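(* Consider the family of catenaries $C_{0,a}$, $a>0$, in the hyperbolic plane $\mathbb{H}^2_{\{u,v\}}$, generating the minimal catenoids $\mathcal{C}_{0,a}$ in $\mathbb{H}^3$. - Let $\mathcal{S}\subset\,]0,\infty[$ be an open interval on which $E_0<0$ (hence the catenoid $\mathcal{C}_{0,a}$ is stable for all $a\in\mathcal{S}$). For $a\in\mathcal{S}$, the catenaries $C_{0,a}$ locally foliate the hyperbolic plane $\mathbb{H}^2_{\{u,v\}}$. - Let $\mathcal{U}\subset\,]0,\infty[$ be an open interval on which $E_0>0$ (hence the catenoid $\mathcal{C}_{0,a}$ has index $1$ for all $a\in\mathcal{U}$). For $a\neq b$ in $\mathcal{U}$, the catenaries $C_{0,a}$ and $C_{0,b}$ intersect exactly at two points. Furthermore, the family $\{C_{0,a}\}_{a\in\mathcal{U}}$ has an envelope, and the points at which $\mathcal{C}_{0,a}$ touches the envelope correspond to the maximal weakly stable domain $\mathcal{D}_{0,z(a)}$, i.e. they are the points with parameter $s=\pm z(a)$, which bound $\mathcal{D}_{0,z(a)}$.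
   Context: $\mathbb{H}^2_{\{u,v\}}$ is the hyperbolic plane in Fermi coordinates $(u,v)\in\mathbb{R}^2$ with metric $du^2+\cosh^2(u)\,dv^2$. For $a>0$, let $y_0(a,s)\ge a$ be defined by $\cosh(2y_0(a,s))=\cosh(2a)\cosh(2s)$, let $$J_0(a,t)=\frac{\sinh(2a)}{(\cosh(2a)\cosh(2t)+1)(\cosh(2a)\cosh(2t)-1)^{1/2}},\qquad \Lambda_0(a,s)=\sqrt2\int_0^sJ_0(a,t)\,dt.$$ The catenary $C_{0,a}$ is the curve $s\in\mathbb{R}\mapsto(u,v)=(y_0(a,s),\Lambda_0(a,s))$. In the half-space model $\{x_3>0\}$ of $\mathbb{H}^3$, with metric $x_3^{-2}(dx_1^2+dx_2^2+dx_3^2)$, the minimal catenoid $\mathcal{C}_{0,a}$ is parametrized by $Y_0(a,s,\theta)=(e^{\Lambda_0}\tanh(y_0)\cos\theta,\ e^{\Lambda_0}\tanh(y_0)\sin\theta,\ e^{\Lambda_0}/\cosh(y_0))$. Put $E_0(a)=\int_0^\infty\frac{\partial J_0}{\partial a}(a,t)\,dt$. ''Locally foliate'' means that the curves are the leaves of a foliation of an open subset of the plane. The envelope of a family of curves $s\mapsto\Phi(a,s)$ is the set of points $\Phi(a,s)$ at which $\partial\Phi/\partial a$ and $\partial\Phi/\partial s$ are linearly dependent. For $a$ with $E_0(a)>0$, $z(a)$ is the unique positive zero of $s\mapsto e_0(a,s)=\cosh(y_0)\big(\partial_s\Lambda_0\,\partial_ay_0-\partial_a\Lambda_0\,\partial_sy_0\big)$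 and $\mathcal{D}_{0,z(a)}=Y_0(a,]-z(a),z(a)[,[0,2\pi])$. Stability refers to the Jacobi operator $J_M=-\Delta-(\mathrm{Ric}(N,N)+|A|^2)$ ($\Delta$ the non-positive Laplacian of the induced metric): an open domain $D$ is stable (resp. weakly stable) if $\int_M fJ_M(f)\,d\mu_M>0$ (resp. $\ge0$) for all nonzero $f\in C_0^\infty(D)$, its index is the maximal dimension of a subspace of $C_0^\infty(D)$ on which this form is negative definite, and it is maximal weakly stable if it is weakly stable and no strictly larger open domain is. *)

(* Defs.v *)
From Stdlib Require Import Reals Lra List.
From Coquelicot Require Import Coquelicot.
Open Scope R_scope.

(** * Functions of two real variables *)

(* Partial derivatives: index 0 is the first variable, any other index the
   second one. *)
Definition pd2 (i : nat) (f : R -> R -> R) (x y : R) : R :=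
  match i with
  | O => Derive (fun t => f t y) x
  | _ => Derive (fun t => f x t) y
  end.

(* [f] is C^n on the (open) set [U]. *)
Fixpoint Cn2 (n : nat) (U : R * R -> Prop) (f : R -> R -> R) : Prop :=
  match n with
  | O => forall x y, U (x, y) -> continuity_2d_pt f x y
  | S m =>
      (forall x y, U (x, y) ->
         ex_derive (fun t => f t y) x /\ ex_derive (fun t => f x t) y) /\
      Cn2 m U (pd2 0 f) /\ Cn2 m U (pd2 1 f)
  end.

Definition smooth2 (U : R * R -> Prop) (f : R -> R -> R) : Prop :=
  forall n, Cn2 n U f.

(** * One-parameter families of plane curves [s |-> Phi a s] *)

Definition on_curve (Phi : R -> R -> R * R) (a : R) (p : R * R) : Prop :=
  exists s, Phi a s = p.

Definition unit_box (p : R * R) : Prop :=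
  (-1 < fst p < 1) /\ (-1 < snd p < 1).

(* [(x, y)] is a smooth diffeomorphism of the open set [U] onto the unit box,
   with inverse [(X, Y)]. *)
Definition plane_chart (U : R * R -> Prop) (x y X Y : R -> R -> R) : Prop :=
  open U /\ smooth2 U x /\ smooth2 U y /\
  smooth2 unit_box X /\ smooth2 unit_box Y /\
  (forall p q, U (p, q) ->
     unit_box (x p q, y p q) /\
     X (x p q) (y p q) = p /\ Y (x p q) (y p q) = q) /\
  (forall s t, unit_box (s, t) ->
     U (X s t, Y s t) /\
     x (X s t) (Y s t) = s /\ y (X s t) (Y s t) = t).

(* The curves [Phi a], [a] in [A], are the leaves of a foliation of the open
   set [W]: they partition [W], and near each point of [W] there is a chart in
   which the connected components of the trace of each leaf are plaques
   [y = constant].  The latter amounts to: the trace is a union of plaques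
   [y = t], [t] in [T], where [T] contains no nondegenerate interval. *)
Definition foliation (W : R * R -> Prop) (A : R -> Prop)
    (Phi : R -> R -> R * R) : Prop :=
  open W /\
  (forall a s, A a -> continuous (Phi a) s) /\
  (forall p, W p <-> exists a, A a /\ on_curve Phi a p) /\
  (forall a b p, A a -> A b -> on_curve Phi a p -> on_curve Phi b p -> a = b) /\
  (forall p, W p ->
     exists (U : R * R -> Prop) (x y X Y : R -> R -> R),
       plane_chart U x y X Y /\ U p /\ (forall q, U q -> W q) /\
       forall a, A a ->
         exists T : R -> Prop,
           (forall q1 q2, U (q1, q2) ->
              (on_curve Phi a (q1, q2) <-> T (y q1 q2))) /\
           (forall t1 t2, t1 < t2 -> exists t, t1 < t < t2 /\ ~ T t)).

Definition locally_foliate (A : R -> Prop) (Phi : R -> R -> R * R) : Prop :=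
  exists W, foliation W A Phi.

Definition lin_dep (v w : R * R) : Prop :=
  exists al be : R,
    (al <> 0 \/ be <> 0) /\
    al * fst v + be * fst w = 0 /\ al * snd v + be * snd w = 0.

(* [d_curve 0 Phi] is dPhi/da and [d_curve 1 Phi] is dPhi/ds. *)
Definition d_curve (i : nat) (Phi : R -> R -> R * R) (a s : R) : R * R :=
  (pd2 i (fun b t => fst (Phi b t)) a s, pd2 i (fun b t => snd (Phi b t)) a s).

Definition characteristic (Phi : R -> R -> R * R) (a s : R) : Prop :=
  lin_dep (d_curve 0 Phi a s) (d_curve 1 Phi a s).

Definition envelope (A : R -> Prop) (Phi : R -> R -> R * R) (p : R * R) : Prop :=
  exists a s, A a /\ characteristic Phi a s /\ Phi a s = p.

(* The curve of parameter [a] touches the envelope at [p]: it passes through a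
   point [p = Phi b t] of the envelope and is tangent to it there, the tangent
   direction of the envelope at [Phi b t] being that of the curve [Phi b]. *)
Definition touches_envelope (A : R -> Prop) (Phi : R -> R -> R * R)
    (a : R) (p : R * R) : Prop :=
  exists s, Phi a s = p /\
  exists b t, A b /\ characteristic Phi b t /\ Phi b t = p /\
    lin_dep (d_curve 1 Phi a s) (d_curve 1 Phi b t).

(** * Riemannian metrics on (open subsets of) R^3, in coordinates *)

Definition R3 : Type := (R * R * R)%type.

(* The coordinates x_1, x_2, x_3 have indices 0, 1, 2. *)
Definition coord (i : nat) (p : R3) : R :=
  match i with
  | O => fst (fst p)
  | S O => snd (fst p)
  | _ => snd p
  end.

Definition shift (i : nat) (h : R) (p : R3) : R3 :=
  match i with
  | O => (fst (fst p) + h, snd (fst p), snd p)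
  | S O => (fst (fst p), snd (fst p) + h, snd p)
  | _ => (fst (fst p), snd (fst p), snd p + h)
  end.

Definition pd3 (i : nat) (F : R3 -> R) (p : R3) : R :=
  Derive (fun h => F (shift i h p)) 0.

Definition sum2 (F : nat -> R) : R := F 0%nat + F 1%nat.
Definition sum3 (F : nat -> R) : R := F 0%nat + F 1%nat + F 2%nat.

(* [christoffel G Ginv k i j p] is Gamma^k_ij. *)
Definition christoffel (G Ginv : nat -> nat -> R3 -> R) (k i j : nat) (p : R3) : R :=
  / 2 * sum3 (fun l => Ginv k l p *
                (pd3 i (G l j) p + pd3 j (G l i) p - pd3 l (G i j) p)).

(* Sign convention: the round sphere has positive Ricci curvature. *)
Definition ricci (G Ginv : nat -> nat -> R3 -> R) (i j : nat) (p : R3) : R :=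
  let Gam := christoffel G Ginv in
  sum3 (fun k =>
    pd3 k (Gam k i j) p - pd3 j (Gam k i k) p +
    sum3 (fun l => Gam k k l p * Gam l i j p - Gam k j l p * Gam l i k p)).

(** * The half-space model of H^3 *)

Definition hyp (i j : nat) (p : R3) : R :=
  if Nat.eqb i j then / coord 2 p ^ 2 else 0.

(* The inverse matrix of [hyp]. *)
Definition hyp_inv (i j : nat) (p : R3) : R :=
  if Nat.eqb i j then coord 2 p ^ 2 else 0.

Definition bilin (B : nat -> nat -> R3 -> R) (p : R3) (v w : nat -> R) : R :=
  sum3 (fun i => sum3 (fun j => B i j p * v i * w j)).

(** * Parametrized surfaces in H^3 *)

Section Surface.

Variable Y : R -> R -> R3.

Definition tangent (i : nat) (s t : R) (k : nat) : R :=
  pd2 i (fun x y => coord k (Y x y)) s t.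

Definition first_form (i j : nat) (s t : R) : R :=
  bilin hyp (Y s t) (tangent i s t) (tangent j s t).

Definition det_first_form (s t : R) : R :=
  first_form 0 0 s t * first_form 1 1 s t - first_form 0 1 s t * first_form 1 0 s t.

Definition first_form_inv (i j : nat) (s t : R) : R :=
  (if Nat.eqb i j then first_form (1 - i) (1 - j) s t else - first_form i j s t)
    / det_first_form s t.

(* The metric being conformal to the Euclidean one, the Euclidean cross product
   of the tangent vectors is normal to the surface for [hyp] as well. *)
Definition cross (v w : nat -> R) (k : nat) : R :=
  match k with
  | O => v 1%nat * w 2%nat - v 2%nat * w 1%nat
  | S O => v 2%nat * w 0%nat - v 0%nat * w 2%nat
  | _ => v 0%nat * w 1%nat - v 1%nat * w 0%nat
  end.

Definition unit_normal (s t : R) (k : nat) : R :=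
  let nu := cross (tangent 0 s t) (tangent 1 s t) in
  nu k / sqrt (bilin hyp (Y s t) nu nu).

(* Covariant derivative in H^3, in the direction of the [i]-th tangent vector,
   of the [j]-th one. *)
Definition cov_tangent (i j : nat) (s t : R) (k : nat) : R :=
  pd2 i (fun x y => tangent j x y k) s t +
  sum3 (fun l => sum3 (fun m =>
    christoffel hyp hyp_inv k l m (Y s t) * tangent i s t l * tangent j s t m)).

Definition second_form (i j : nat) (s t : R) : R :=
  bilin hyp (Y s t) (cov_tangent i j s t) (unit_normal s t).

Definition norm2_A (s t : R) : R :=
  sum2 (fun i => sum2 (fun j => sum2 (fun k => sum2 (fun l =>
    first_form_inv i k s t * first_form_inv j l s t *
    second_form i j s t * second_form k l s t)))).

Definition ric_NN (s t : R) : R :=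
  bilin (ricci hyp hyp_inv) (Y s t) (unit_normal s t) (unit_normal s t).

Definition laplacian (phi : R -> R -> R) (s t : R) : R :=
  / sqrt (det_first_form s t) *
  sum2 (fun i =>
    pd2 i (fun x y => sqrt (det_first_form x y) *
             sum2 (fun j => first_form_inv i j x y * pd2 j phi x y)) s t).

Definition jacobi (phi : R -> R -> R) (s t : R) : R :=
  - laplacian phi s t - (ric_NN s t + norm2_A s t) * phi s t.

(* From here on, [Y] is meant to be 2pi-periodic in its second variable and to
   be a diffeomorphism of the cylinder R x R/2piZ onto an embedded surface; a
   function [f] on the surface is represented by a function on R^3 of which only
   the values on the surface matter. *)

Definition surface (p : R3) : Prop := exists s t, Y s t = p.

Definition jacobi_form (f : R3 -> R) : R :=
  let phi := fun s t => f (Y s t) in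
  RInt_gen
    (fun s => RInt (fun t => phi s t * jacobi phi s t * sqrt (det_first_form s t))
                0 (2 * PI))
    (Rbar_locally m_infty) (Rbar_locally p_infty).

Definition connected_set (D : R3 -> Prop) : Prop :=
  forall O1 O2 : R3 -> Prop, open O1 -> open O2 ->
    (forall p, D p -> O1 p \/ O2 p) ->
    (exists p, D p /\ O1 p) -> (exists p, D p /\ O2 p) ->
    exists p, D p /\ O1 p /\ O2 p.

(* Open connected subsets of the surface, for the topology induced by R^3. *)
Definition open_domain (D : R3 -> Prop) : Prop :=
  (exists O : R3 -> Prop, open O /\ forall p, D p <-> surface p /\ O p) /\
  connected_set D.

(* C_0^oo(D): smooth functions on the surface whose support is contained in a
   compact subset of [D]. *)
Definition test_function (D : R3 -> Prop) (f : R3 -> R) : Prop :=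
  smooth2 (fun _ => True) (fun s t => f (Y s t)) /\
  exists K : R3 -> Prop,
    closed K /\ (exists B, forall p i, K p -> Rabs (coord i p) <= B) /\
    (forall p, K p -> D p) /\
    (forall p, surface p -> ~ K p -> f p = 0).

Definition stable (D : R3 -> Prop) : Prop :=
  forall f, test_function D f -> (exists p, surface p /\ f p <> 0) ->
    0 < jacobi_form f.

Definition weakly_stable (D : R3 -> Prop) : Prop :=
  forall f, test_function D f -> (exists p, surface p /\ f p <> 0) ->
    0 <= jacobi_form f.

Definition maximal_weakly_stable (D : R3 -> Prop) : Prop :=
  open_domain D /\ weakly_stable D /\
  forall D', open_domain D' -> (forall p, D p -> D' p) ->
    (exists p, D' p /\ ~ D p) -> ~ weakly_stable D'.

(* The form is negative definite on the span of [f 0], ..., [f (n-1)], and these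
   functions are linearly independent (the form vanishes at 0). *)
Definition negative_subspace (D : R3 -> Prop) (n : nat) : Prop :=
  exists f : nat -> R3 -> R,
    (forall i, (i < n)%nat -> test_function D (f i)) /\
    forall c : nat -> R, (exists i, (i < n)%nat /\ c i <> 0) ->
      jacobi_form
        (fun p => fold_right Rplus 0 (map (fun i => c i * f i p) (seq 0 n))) < 0.

Definition has_index (D : R3 -> Prop) (n : nat) : Prop :=
  negative_subspace D n /\ forall m, negative_subspace D m -> (m <= n)%nat.

Definition boundary_in_surface (D : R3 -> Prop) (p : R3) : Prop :=
  surface p /\
  forall O : R3 -> Prop, open O -> O p ->
    (exists q, O q /\ D q) /\ (exists q, O q /\ surface q /\ ~ D q).

End Surface.

(** * Catenaries and catenoids *)

Definition arccosh (x : R) : R := ln (x + sqrt (x ^ 2 - 1)).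

(* See [y0_spec] below. *)
Definition y0 (a s : R) : R := / 2 * arccosh (cosh (2 * a) * cosh (2 * s)).

Definition J0 (a t : R) : R :=
  sinh (2 * a) /
  ((cosh (2 * a) * cosh (2 * t) + 1) * sqrt (cosh (2 * a) * cosh (2 * t) - 1)).

Definition Lambda0 (a s : R) : R := sqrt 2 * RInt (fun t => J0 a t) 0 s.

Definition E0 (a : R) : R :=
  RInt_gen (fun t => pd2 0 J0 a t) (at_point 0) (Rbar_locally p_infty).

Definition e0 (a s : R) : R :=
  cosh (y0 a s) *
  (pd2 1 Lambda0 a s * pd2 0 y0 a s - pd2 0 Lambda0 a s * pd2 1 y0 a s).

Definition catenary (a s : R) : R * R := (y0 a s, Lambda0 a s).

(* The point of the half-space obtained from the point with Fermi coordinates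
   [(u, v)] in the half-plane x_2 = 0 by the rotation of angle [theta] about the
   x_3-axis. *)
Definition revolve (p : R * R) (theta : R) : R3 :=
  let (u, v) := p in
  (exp v * tanh u * cos theta, exp v * tanh u * sin theta, exp v / cosh u).

Definition catenoid (a s theta : R) : R3 := revolve (catenary a s) theta.

Definition catenoid_domain (a z : R) (p : R3) : Prop :=
  exists s theta, - z < s < z /\ 0 <= theta <= 2 * PI /\ catenoid a s theta = p.

Definition Rbar_open_interval (l r : Rbar) (a : R) : Prop :=
  Rbar_lt l a /\ Rbar_lt a r.

Lemma cosh_ge_1 (x : R) : 1 <= cosh x.
Proof.
  unfold cosh.
  assert (H : exp x * exp (- x) = 1) by (rewrite <- exp_plus, Rplus_opp_r; apply exp_0).
  pose proof (exp_pos x); pose proof (exp_pos (- x)).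
  assert (0 <= (exp x - exp (- x)) ^ 2) by apply pow2_ge_0.
  nra.
Qed.

Lemma cosh_arccosh (x : R) : 1 <= x -> cosh (arccosh x) = x.
Proof.
  intros Hx; unfold cosh, arccosh.
  assert (Hs : sqrt (x ^ 2 - 1) * sqrt (x ^ 2 - 1) = x ^ 2 - 1) by (apply sqrt_sqrt; nra).
  pose proof (sqrt_pos (x ^ 2 - 1)).
  rewrite exp_Ropp, exp_ln by lra.
  apply Rmult_eq_reg_r with (2 * (x + sqrt (x ^ 2 - 1))); [ field_simplify; nra | lra ].
Qed.

Lemma arccosh_cosh (x : R) : 0 <= x -> arccosh (cosh x) = x.
Proof.
  intros Hx; unfold arccosh.
  assert (H1 : exp x * exp (- x) = 1) by (rewrite <- exp_plus, Rplus_opp_r; apply exp_0).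
  assert (Hm : exp (- x) <= exp x).
  { destruct Hx as [Hx | <-]; [ left; apply exp_increasing; lra | rewrite Ropp_0; lra ]. }
  replace (cosh x ^ 2 - 1) with (sinh x * sinh x) by (unfold cosh, sinh; nra).
  rewrite sqrt_square by (unfold sinh; lra).
  replace (cosh x + sinh x) with (exp x) by (unfold cosh, sinh; lra).
  apply ln_exp.
Qed.

Lemma arccosh_le (x y : R) : 1 <= x -> x <= y -> arccosh x <= arccosh y.
Proof.
  intros Hx Hxy; unfold arccosh.
  pose proof (sqrt_pos (x ^ 2 - 1)).
  apply ln_le; [ lra | ].
  apply Rplus_le_compat; [ exact Hxy | apply sqrt_le_1_alt; nra ].
Qed.

Lemma y0_spec (a s : R) : 0 < a ->
  a <= y0 a s /\ cosh (2 * y0 a s) = cosh (2 * a) * cosh (2 * s).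
Proof.
  intros Ha.
  pose proof (cosh_ge_1 (2 * a)); pose proof (cosh_ge_1 (2 * s)).
  unfold y0; split.
  - assert (arccosh (cosh (2 * a)) <= arccosh (cosh (2 * a) * cosh (2 * s))).
    { apply arccosh_le; nra. }
    rewrite arccosh_cosh in H1 by lra; lra.
  - replace (2 * (/ 2 * arccosh (cosh (2 * a) * cosh (2 * s))))
      with (arccosh (cosh (2 * a) * cosh (2 * s))) by field.
    apply cosh_arccosh; nra.
Qed.

(* Main.v *)
Require Import Defs.
From Stdlib Require Import Reals Lra Lia List Classical ClassicalEpsilon FunctionalExtensionality.
From Stdlib Require Znat.
From Coquelicot Require Import Coquelicot.
Open Scope R_scope.
Set Bullet Behavior "Strict Subproofs".

(** Everything is governed by one Jacobi field. The catenary is parametrized by arc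
    length, so that the catenoid carries the metric [ds^2 + f^2 dtheta^2] with
    [f = sinh y0], and its Jacobi operator on radial functions is
    [L h = - ((f h')' + (|A|^2 - 2) f h) / f] (lemma [jacobi_catenoid]). Two solutions of
    [L h = 0] are explicit up to a primitive: [v0 = cosh y0 * y0'], which comes from the
    translations along the axis and vanishes at [s = 0] only, and [e0], which comes from the
    variation of [a]. By the constancy of the Wronskian the quotient [ratio = e0 / v0] is
    strictly decreasing for [s > 0], and its limit at infinity is [- sqrt 2 * E0 a]
    ([ratio_decr], [E0_ratio]). Hence [e0 > 0] everywhere if [E0 a < 0], and [e0] has exactly
    one positive zero [z] if [E0 a > 0] ([e0_pos_stable], [e0_zero]).

    Stability. After integration by parts the Jacobi form of a test function is a
    first-order energy ([jacobi_form_energy]). A positive solution, or supersolution, of the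
    Jacobi equation on the support makes the energy nonnegative by completing squares
    ([picone]). With the solution [e0] this gives stability when [E0 a < 0] and weak
    stability of the domain [|s| < z] when [E0 a > 0]. The index is at most one because the
    energy is nonnegative on the functions of zero mean over the neck
    ([energy_zero_mean]): the radial part is compared with [v0 + k e0] on each half, and the part
    of zero mean along the circles with the supersolution [1 / f], after Wirtinger's
    inequality. Conversely, let a domain contain [|s| < z] and a boundary point: adding to a
    cut-off of [e0] a small bump at this point decreases the energy to first order, since
    [e0' z < 0] ([perturbed_energy_neg], [negative_test]). This gives index one, and
    maximality among connected domains, which cannot leave [|s| < z] without meeting its
    boundary.

    Plane curves. The determinant of [dPhi/da] and [dPhi/ds] is [e0 / cosh y0] up to sign, which
    yields the characteristic points, and Clairaut's relation shows that a tangent line at a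
    point determines the catenary, which yields the points of contact with the
    envelope. For the mutual position of the curves, let [rise c u] be the height at which the
    catenary [c] reaches the distance [u] from the axis: its derivative in [c] is [- ratio]
    ([rise_derive_c]). In the stable case it is therefore decreasing in [c] and the curves are
    disjoint; as moreover [e0 > 0], the map [(a, s) -> Phi a s] can be inverted by two
    applications of the implicit function theorem for one unknown, first along a curve and
    then across the family, which gives the charts of the foliation ([chart_exists]). In the
    unstable case the gap between two curves is positive at first, strictly decreasing in [u]
    by Clairaut's relation, and negative for large [u] since [ratio] is then negative,
    uniformly for [c] in a compact interval: it has a single zero, hence two symmetric points
    of intersection ([two_points]). *)

(** * Calculus of smooth functions of two variables *)

Lemma open_locally_2d (U : R * R -> Prop) x y :
  open U -> U (x, y) -> locally_2d (fun u v => U (u, v)) x y.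
Proof.
  intros HU Hxy. apply locally_2d_locally.
  apply filter_imp with (2 := HU _ Hxy). intros [u v]; auto.
Qed.

Lemma locally_2d_open (U : R * R -> Prop) :
  (forall x y, U (x, y) -> locally_2d (fun u v => U (u, v)) x y) -> open U.
Proof.
  intros H [x y] Hxy. specialize (H x y Hxy). apply locally_2d_locally in H.
  apply filter_imp with (2 := H). intros [u v]; auto.
Qed.

Lemma Cn2_ext n U f g :
  open U -> (forall x y, U (x, y) -> f x y = g x y) -> Cn2 n U f -> Cn2 n U g.
Proof.
  intros HU. revert f g. induction n as [|n IH]; intros f g Hfg Hf; simpl in *.
  - intros x y Hxy. apply continuity_2d_pt_ext_loc with f; [|auto].
    destruct (open_locally_2d U x y HU Hxy) as [d Hd].
    exists d. intros u v Hu Hv. apply Hfg. auto.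
  - destruct Hf as [H1 [H2 H3]].
    assert (L : forall x y, U (x, y) ->
       locally x (fun t => f t y = g t y) /\ locally y (fun t => f x t = g x t)).
    { intros x y Hxy. pose proof (open_locally_2d U x y HU Hxy) as HL. split.
      - apply filter_imp with (2 := locally_2d_1d_const_y _ _ _ HL). auto.
      - apply filter_imp with (2 := locally_2d_1d_const_x _ _ _ HL). auto. }
    split; [|split].
    + intros x y Hxy. destruct (H1 x y Hxy), (L x y Hxy). split.
      * apply ex_derive_ext_loc with (fun t => f t y); auto.
      * apply ex_derive_ext_loc with (fun t => f x t); auto.
    + apply IH with (2 := H2). intros x y Hxy. apply Derive_ext_loc, L, Hxy.
    + apply IH with (2 := H3). intros x y Hxy. apply Derive_ext_loc, L, Hxy.
Qed.

(** Derivatives are given by formulas on [U] only, whereas [Cn2] speaks of [Derive]; this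
    is how every order is reached from the previous one. *)
Lemma Cn2_S_intro n U f f1 f2 :
  open U ->
  (forall x y, U (x, y) -> is_derive (fun t => f t y) x (f1 x y)) ->
  (forall x y, U (x, y) -> is_derive (fun t => f x t) y (f2 x y)) ->
  Cn2 n U f1 -> Cn2 n U f2 -> Cn2 (S n) U f.
Proof.
  intros HU D1 D2 H1 H2. simpl. split; [|split].
  - intros x y Hxy. split; eexists; [apply D1 | apply D2]; exact Hxy.
  - apply Cn2_ext with f1; auto. intros x y Hxy. symmetry.
    apply is_derive_unique, D1, Hxy.
  - apply Cn2_ext with f2; auto. intros x y Hxy. symmetry.
    apply is_derive_unique, D2, Hxy.
Qed.

Lemma Cn2_S_derive n U f :
  Cn2 (S n) U f ->
  (forall x y, U (x, y) -> is_derive (fun t => f t y) x (pd2 0 f x y)) /\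
  (forall x y, U (x, y) -> is_derive (fun t => f x t) y (pd2 1 f x y)).
Proof.
  intros [H _]. split; intros x y Hxy; apply Derive_correct, H, Hxy.
Qed.

Lemma Cn2_1_differentiable U f x y :
  open U -> Cn2 1 U f -> U (x, y) ->
  differentiable_pt_lim f x y (pd2 0 f x y) (pd2 1 f x y).
Proof.
  intros HU Hf Hxy. destruct (Cn2_S_derive _ _ _ Hf) as [D1 D2].
  destruct Hf as [_ [C1 _]].
  apply filterdiff_differentiable_pt_lim.
  apply (is_derive_filterdiff f x y (pd2 0 f) (pd2 1 f x y)).
  - apply filter_imp with (2 := HU _ Hxy). intros [u v] Huv. apply D1, Huv.
  - apply D2, Hxy.
  - specialize (C1 x y Hxy). apply continuity_2d_pt_filterlim in C1. exact C1.
Qed.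

Lemma Cn2_pred n U f : open U -> Cn2 (S n) U f -> Cn2 n U f.
Proof.
  intros HU. revert f. induction n as [|n IH]; intros f Hf.
  - intros x y Hxy. apply differentiable_continuity_pt.
    exists (pd2 0 f x y), (pd2 1 f x y). apply Cn2_1_differentiable with U; auto.
  - destruct Hf as [H1 [H2 H3]]. split; [exact H1|]. split; apply IH; assumption.
Qed.

Lemma Cn2_continuity n U f x y :
  open U -> Cn2 n U f -> U (x, y) -> continuity_2d_pt f x y.
Proof.
  intros HU. induction n as [|n IH]; intros Hf Hxy; [apply Hf, Hxy|].
  apply IH; auto. apply Cn2_pred; auto.
Qed.

Lemma Cn2_const n U c : open U -> Cn2 n U (fun _ _ => c).
Proof.
  intros HU. revert c. induction n as [|n IH]; intros c.
  - intros x y _. apply continuity_2d_pt_const.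
  - apply Cn2_S_intro with (fun _ _ => 0) (fun _ _ => 0); auto;
      intros; apply is_derive_Reals, derivable_pt_lim_const.
Qed.

Lemma Cn2_fst n U : open U -> Cn2 n U (fun x _ => x).
Proof.
  intros HU. destruct n as [|n].
  - intros x y _. apply continuity_2d_pt_id1.
  - apply Cn2_S_intro with (fun _ _ => 1) (fun _ _ => 0); auto.
    + intros. apply (is_derive_id (K := R_AbsRing)).
    + intros. apply (is_derive_const (K := R_AbsRing) (V := R_NormedModule)).
    + apply Cn2_const, HU.
    + apply Cn2_const, HU.
Qed.

Lemma Cn2_snd n U : open U -> Cn2 n U (fun _ y => y).
Proof.
  intros HU. destruct n as [|n].
  - intros x y _. apply continuity_2d_pt_id2.
  - apply Cn2_S_intro with (fun _ _ => 0) (fun _ _ => 1); auto.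
    + intros. apply (is_derive_const (K := R_AbsRing) (V := R_NormedModule)).
    + intros. apply (is_derive_id (K := R_AbsRing)).
    + apply Cn2_const, HU.
    + apply Cn2_const, HU.
Qed.

Lemma Cn2_plus n U f g :
  open U -> Cn2 n U f -> Cn2 n U g -> Cn2 n U (fun x y => f x y + g x y).
Proof.
  intros HU. revert f g. induction n as [|n IH]; intros f g Hf Hg.
  - intros x y Hxy. apply continuity_2d_pt_plus; auto.
  - destruct (Cn2_S_derive _ _ _ Hf), (Cn2_S_derive _ _ _ Hg).
    destruct Hf as [_ [? ?]], Hg as [_ [? ?]].
    apply Cn2_S_intro with (fun x y => pd2 0 f x y + pd2 0 g x y)
      (fun x y => pd2 1 f x y + pd2 1 g x y); auto.
    + intros. apply (is_derive_plus (fun t => f t y)); auto.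
    + intros. apply (is_derive_plus (fun t => f x t)); auto.
Qed.

Lemma Cn2_mult n U f g :
  open U -> Cn2 n U f -> Cn2 n U g -> Cn2 n U (fun x y => f x y * g x y).
Proof.
  intros HU. revert f g. induction n as [|n IH]; intros f g Hf Hg.
  - intros x y Hxy. apply continuity_2d_pt_mult; auto.
  - destruct (Cn2_S_derive _ _ _ Hf), (Cn2_S_derive _ _ _ Hg).
    pose proof (Cn2_pred _ _ _ HU Hf). pose proof (Cn2_pred _ _ _ HU Hg).
    destruct Hf as [_ [? ?]], Hg as [_ [? ?]].
    apply Cn2_S_intro with (fun x y => pd2 0 f x y * g x y + f x y * pd2 0 g x y)
      (fun x y => pd2 1 f x y * g x y + f x y * pd2 1 g x y);
      auto using Cn2_plus.
    + intros. apply (is_derive_mult (fun t => f t y) (fun t => g t y)); [auto|auto|intros; apply Rmult_comm].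
    + intros. apply (is_derive_mult (fun t => f x t) (fun t => g x t)); [auto|auto|intros; apply Rmult_comm].
Qed.

Lemma Cn2_opp n U f : open U -> Cn2 n U f -> Cn2 n U (fun x y => - f x y).
Proof.
  intros HU Hf. apply Cn2_ext with (fun x y => (-1) * f x y); auto.
  - intros; ring.
  - apply Cn2_mult; auto. apply Cn2_const, HU.
Qed.

Lemma Cn2_minus n U f g :
  open U -> Cn2 n U f -> Cn2 n U g -> Cn2 n U (fun x y => f x y - g x y).
Proof. intros. apply Cn2_plus; auto. apply Cn2_opp; auto. Qed.

(** When the derivative of each [g i] is a combination of two members of the family,
    the order of differentiability can be raised for all members at once. This covers
    [exp], the pair [cos], [sin], and the flat functions used for cut-offs. *)
Lemma Cn2_comp1 (I : Type) (g : I -> R -> R) (dom : R -> Prop) n U f :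
  open U ->
  (forall i x, dom x -> continuity_pt (g i) x) ->
  (forall i, exists j k a b, forall x, dom x ->
     is_derive (g i) x (a * g j x + b * g k x)) ->
  (forall x y, U (x, y) -> dom (f x y)) ->
  Cn2 n U f -> forall i, Cn2 n U (fun x y => g i (f x y)).
Proof.
  intros HU Hc Hd Hdom. induction n as [|n IH]; intros Hf i.
  - intros x y Hxy. apply continuity_1d_2d_pt_comp; auto.
  - destruct (Cn2_S_derive _ _ _ Hf) as [D1 D2].
    pose proof (Cn2_pred _ _ _ HU Hf) as Hf'. destruct Hf as [_ [F1 F2]].
    destruct (Hd i) as [j [k [a [b Hg]]]].
    assert (HG : Cn2 n U (fun x y => a * g j (f x y) + b * g k (f x y))).
    { apply Cn2_plus; auto; apply Cn2_mult; auto; apply Cn2_const; auto. }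
    apply Cn2_S_intro with
      (fun x y => pd2 0 f x y * (a * g j (f x y) + b * g k (f x y)))
      (fun x y => pd2 1 f x y * (a * g j (f x y) + b * g k (f x y)));
      auto using Cn2_mult.
    + intros x y Hxy. apply (is_derive_comp (g i) (fun t => f t y)); auto.
    + intros x y Hxy. apply (is_derive_comp (g i) (fun t => f x t)); auto.
Qed.

(** For [/ f], [sqrt f] and [ln f] the derivative is an algebraic expression in the
    partial derivatives of [f] and the function itself, so that the order of
    differentiability goes up by one at each step. *)
Lemma Cn2_inv n U f :
  open U -> (forall x y, U (x, y) -> f x y <> 0) ->
  Cn2 n U f -> Cn2 n U (fun x y => / f x y).
Proof.
  intros HU Hnz. induction n as [|n IH]; intros Hf.
  - intros x y Hxy. apply continuity_2d_pt_inv; auto.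
  - destruct (Cn2_S_derive _ _ _ Hf) as [D1 D2].
    pose proof (Cn2_pred _ _ _ HU Hf) as Hf'. destruct Hf as [_ [F1 F2]].
    apply Cn2_S_intro with (fun x y => - pd2 0 f x y * (/ f x y * / f x y))
      (fun x y => - pd2 1 f x y * (/ f x y * / f x y));
      auto using Cn2_mult, Cn2_opp.
    + intros x y Hxy.
      replace (- pd2 0 f x y * (/ f x y * / f x y)) with (- pd2 0 f x y / f x y ^ 2)
        by (field; auto).
      apply (is_derive_inv (fun t => f t y)); auto.
    + intros x y Hxy.
      replace (- pd2 1 f x y * (/ f x y * / f x y)) with (- pd2 1 f x y / f x y ^ 2)
        by (field; auto).
      apply (is_derive_inv (fun t => f x t)); auto.
Qed.

Lemma Cn2_div n U f g :
  open U -> (forall x y, U (x, y) -> g x y <> 0) ->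
  Cn2 n U f -> Cn2 n U g -> Cn2 n U (fun x y => f x y / g x y).
Proof. intros. apply Cn2_mult; auto. apply Cn2_inv; auto. Qed.

Lemma Cn2_sqrt n U f :
  open U -> (forall x y, U (x, y) -> 0 < f x y) ->
  Cn2 n U f -> Cn2 n U (fun x y => sqrt (f x y)).
Proof.
  intros HU Hpos. induction n as [|n IH]; intros Hf.
  - intros x y Hxy. apply (continuity_1d_2d_pt_comp sqrt); [|apply Hf, Hxy].
    apply continuity_pt_sqrt. specialize (Hpos x y Hxy); lra.
  - destruct (Cn2_S_derive _ _ _ Hf) as [D1 D2].
    pose proof (Cn2_pred _ _ _ HU Hf) as Hf'. destruct Hf as [_ [F1 F2]].
    assert (Hs : Cn2 n U (fun x y => 2 * sqrt (f x y))).
    { apply Cn2_mult; auto. apply Cn2_const, HU. }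
    assert (Hs0 : forall x y, U (x, y) -> 2 * sqrt (f x y) <> 0).
    { intros x y Hxy. pose proof (sqrt_lt_R0 _ (Hpos x y Hxy)). lra. }
    apply Cn2_S_intro with (fun x y => pd2 0 f x y / (2 * sqrt (f x y)))
      (fun x y => pd2 1 f x y / (2 * sqrt (f x y))); auto using Cn2_div.
    + intros x y Hxy. apply (is_derive_sqrt (fun t => f t y)); auto.
    + intros x y Hxy. apply (is_derive_sqrt (fun t => f x t)); auto.
Qed.

Lemma Cn2_ln n U f :
  open U -> (forall x y, U (x, y) -> 0 < f x y) ->
  Cn2 n U f -> Cn2 n U (fun x y => ln (f x y)).
Proof.
  intros HU Hpos Hf.
  assert (Hnz : forall x y, U (x, y) -> f x y <> 0).
  { intros x y Hxy. specialize (Hpos x y Hxy). lra. }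
  destruct n as [|n].
  - intros x y Hxy. apply (continuity_1d_2d_pt_comp ln); [|apply Hf, Hxy].
    apply derivable_continuous_pt. eexists. apply derivable_pt_lim_ln; auto.
  - destruct (Cn2_S_derive _ _ _ Hf) as [D1 D2].
    pose proof (Cn2_pred _ _ _ HU Hf) as Hf'. destruct Hf as [_ [F1 F2]].
    apply Cn2_S_intro with (fun x y => pd2 0 f x y / f x y)
      (fun x y => pd2 1 f x y / f x y); auto using Cn2_div.
    + intros x y Hxy. apply (is_derive_comp ln (fun t => f t y)); auto.
      apply is_derive_Reals, derivable_pt_lim_ln; auto.
    + intros x y Hxy. apply (is_derive_comp ln (fun t => f x t)); auto.
      apply is_derive_Reals, derivable_pt_lim_ln; auto.
Qed.

Lemma Cn2_exp n U f :
  open U -> Cn2 n U f -> Cn2 n U (fun x y => exp (f x y)).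
Proof.
  intros HU Hf.
  apply (Cn2_comp1 unit (fun _ => exp) (fun _ => True) n U f); auto using tt.
  - intros _ x _. apply derivable_continuous_pt, derivable_pt_exp.
  - intros _. exists tt, tt, 1, 0. intros x _.
    replace (1 * exp x + 0 * exp x) with (exp x) by ring.
    apply is_derive_exp.
Qed.

Lemma Cn2_trig n U f :
  open U -> Cn2 n U f ->
  Cn2 n U (fun x y => cos (f x y)) /\ Cn2 n U (fun x y => sin (f x y)).
Proof.
  intros HU Hf.
  assert (H : forall b : bool, Cn2 n U (fun x y => (if b then cos else sin) (f x y))).
  { apply (Cn2_comp1 bool (fun b : bool => if b then cos else sin) (fun _ => True)); auto.
    - intros [|] x _; [apply continuity_cos | apply continuity_sin].
    - intros [|].
      + exists false, false, (-1), 0. intros x _.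
        replace (-1 * sin x + 0 * sin x) with (- sin x) by ring. apply is_derive_cos.
      + exists true, true, 1, 0. intros x _.
        replace (1 * cos x + 0 * cos x) with (cos x) by ring. apply is_derive_sin. }
  split; [apply (H true) | apply (H false)].
Qed.

Lemma is_derive_comp2 U (f : R -> R -> R) (g h : R -> R) x dg dh :
  open U -> Cn2 1 U f -> U (g x, h x) -> is_derive g x dg -> is_derive h x dh ->
  is_derive (fun t => f (g t) (h t)) x
    (pd2 0 f (g x) (h x) * dg + pd2 1 f (g x) (h x) * dh).
Proof.
  intros HU Hf Hx Hg Hh. apply is_derive_Reals, derivable_pt_lim_comp_2d.
  - apply Cn2_1_differentiable with U; auto.
  - apply is_derive_Reals, Hg.
  - apply is_derive_Reals, Hh.
Qed.

Lemma continuity_2d_pt_comp2 (f g h : R -> R -> R) x y :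
  continuity_2d_pt f (g x y) (h x y) -> continuity_2d_pt g x y ->
  continuity_2d_pt h x y -> continuity_2d_pt (fun u v => f (g u v) (h u v)) x y.
Proof.
  intros Hf Hg Hh eps. destruct (Hf eps) as [d Hd].
  destruct (Hg d) as [d1 H1], (Hh d) as [d2 H2].
  assert (Hm : 0 < Rmin d1 d2) by (apply Rmin_pos; apply cond_pos).
  exists (mkposreal _ Hm). simpl. intros u v Hu Hv.
  pose proof (Rmin_l d1 d2); pose proof (Rmin_r d1 d2).
  apply Hd; [apply H1 | apply H2]; lra.
Qed.

Lemma Cn2_comp2 n U V f g h :
  open U -> open V -> (forall x y, U (x, y) -> V (g x y, h x y)) ->
  Cn2 n V f -> Cn2 n U g -> Cn2 n U h -> Cn2 n U (fun x y => f (g x y) (h x y)).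
Proof.
  intros HU HV HUV. revert f. induction n as [|n IH]; intros f Hf Hg Hh.
  - intros x y Hxy. apply continuity_2d_pt_comp2; auto.
  - assert (Hf1 : Cn2 1 V f).
    { clear - Hf HV. revert f Hf. induction n as [|m IHm]; intros f Hf; [exact Hf|].
      apply IHm, Cn2_pred; auto. }
    destruct (Cn2_S_derive _ _ _ Hg), (Cn2_S_derive _ _ _ Hh).
    pose proof (Cn2_pred _ _ _ HU Hg). pose proof (Cn2_pred _ _ _ HU Hh).
    destruct Hf as [_ [F1 F2]], Hg as [_ [G1 G2]], Hh as [_ [H11 H12]].
    apply Cn2_S_intro with
      (fun x y => pd2 0 f (g x y) (h x y) * pd2 0 g x y
                  + pd2 1 f (g x y) (h x y) * pd2 0 h x y)
      (fun x y => pd2 0 f (g x y) (h x y) * pd2 1 g x y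
                  + pd2 1 f (g x y) (h x y) * pd2 1 h x y); auto.
    + intros x y Hxy.
      apply (is_derive_comp2 V f (fun t => g t y) (fun t => h t y)); auto.
    + intros x y Hxy. apply (is_derive_comp2 V f (g x) (h x)); auto.
    + apply Cn2_plus; auto; apply Cn2_mult; auto.
    + apply Cn2_plus; auto; apply Cn2_mult; auto.
Qed.

Lemma smooth2_continuity U f x y :
  open U -> smooth2 U f -> U (x, y) -> continuity_2d_pt f x y.
Proof. intros HU Hf. apply (Cn2_continuity 0); auto. Qed.

Lemma smooth2_pd2 U f i : smooth2 U f -> smooth2 U (pd2 i f).
Proof. intros Hf n. destruct (Hf (S n)) as [_ [H0 H1]]. destruct i; auto. Qed.

Lemma smooth2_derive U f :
  smooth2 U f ->
  (forall x y, U (x, y) -> is_derive (fun t => f t y) x (pd2 0 f x y)) /\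
  (forall x y, U (x, y) -> is_derive (fun t => f x t) y (pd2 1 f x y)).
Proof. intros Hf. apply (Cn2_S_derive 0), Hf. Qed.

(** ** Primitives depending on a parameter *)

Lemma continuity_2d_pt_fst f x y :
  continuity_2d_pt f x y -> continuity_pt (fun t => f t y) x.
Proof.
  intros H. apply continuity_pt_filterlim. intros P [eps HP].
  destruct (H eps) as [d Hd]. exists d. intros u Hu. apply HP, Hd; [exact Hu|].
  rewrite Rminus_eq_0, Rabs_R0. apply cond_pos.
Qed.

Lemma continuity_2d_pt_snd f x y :
  continuity_2d_pt f x y -> continuity_pt (fun t => f x t) y.
Proof.
  intros H. apply continuity_pt_filterlim. intros P [eps HP].
  destruct (H eps) as [d Hd]. exists d. intros u Hu. apply HP, Hd; [|exact Hu].
  rewrite Rminus_eq_0, Rabs_R0. apply cond_pos.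
Qed.

Lemma ex_RInt_cont f a b : (forall t, continuity_pt f t) -> ex_RInt f a b.
Proof.
  intros H. apply (ex_RInt_continuous (V := R_CompleteNormedModule)).
  intros z _. apply continuity_pt_filterlim, H.
Qed.

Lemma RInt_param_small f x s0 eps :
  (forall t, continuity_2d_pt f x t) -> 0 < eps ->
  exists d : posreal, forall u, Rabs (u - x) < d ->
    forall t, Rmin 0 s0 <= t <= Rmax 0 s0 -> Rabs (f u t - f x t) <= eps.
Proof.
  intros Hf He.
  destruct (uniform_continuity_2d_1d' f (Rmin 0 s0) (Rmax 0 s0) x
              (fun t _ => Hf t) (mkposreal eps He)) as [d Hd].
  exists d. intros u Hu t Ht. simpl in Hd. left.
  apply Rabs_lt_between in Hu. pose proof (cond_pos d).
  apply Hd; try assumption; try lra.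
  rewrite Rminus_eq_0, Rabs_R0. assumption.
Qed.

(** The integrand is defined on [A x R], which contains the whole path from 0 to [s]:
    uniform continuity on a compact segment controls the change of parameter, and the
    continuity of a primitive the change of endpoint. *)
Lemma continuity_2d_pt_RInt (A : R -> Prop) f x s :
  open A -> (forall u t, A u -> continuity_2d_pt f u t) -> A x ->
  continuity_2d_pt (fun u v => RInt (f u) 0 v) x s.
Proof.
  intros HA Hf Hx eps.
  assert (Hint : forall u a b, A u -> ex_RInt (f u) a b).
  { intros u a b Hu. apply ex_RInt_cont. intros t. apply continuity_2d_pt_snd.
    apply Hf, Hu. }
  assert (Hcont : continuous (fun v => RInt (f x) 0 v) s).
  { apply (continuous_RInt_1 (f x) 0 s (fun v => RInt (f x) 0 v)).
    exists (mkposreal 1 Rlt_0_1). intros v _.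
    apply (RInt_correct (f x) 0 v), Hint, Hx. }
  set (m := Rmax (Rabs (s - 1)) (Rabs (s + 1)) + 1).
  assert (Hm : 1 <= m) by (unfold m; pose proof (Rmax_l (Rabs (s - 1)) (Rabs (s + 1)));
    pose proof (Rabs_pos (s-1)); lra).
  assert (He2 : 0 < eps / 2 / m) by (repeat apply Rdiv_lt_0_compat; try apply cond_pos; lra).
  destruct (RInt_param_small f x (- m) (eps / 2 / m) (fun t => Hf x t Hx) He2) as [d1 Hd1].
  destruct (RInt_param_small f x m (eps / 2 / m) (fun t => Hf x t Hx) He2) as [d2 Hd2].
  destruct (HA x Hx) as [d3 Hd3].
  assert (He : 0 < eps / 2) by (pose proof (cond_pos eps); lra).
  destruct (proj1 (filterlim_locally _ _) Hcont (mkposreal _ He)) as [d4 Hd4].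
  assert (Hd : 0 < Rmin (Rmin d1 d2) (Rmin d3 (Rmin d4 1))).
  { repeat apply Rmin_pos; try apply cond_pos. lra. }
  exists (mkposreal _ Hd). simpl. intros u v Hu Hv.
  pose proof (Rmin_l (Rmin d1 d2) (Rmin d3 (Rmin d4 1))).
  pose proof (Rmin_r (Rmin d1 d2) (Rmin d3 (Rmin d4 1))).
  pose proof (Rmin_l d1 d2). pose proof (Rmin_r d1 d2).
  pose proof (Rmin_l d3 (Rmin d4 1)). pose proof (Rmin_r d3 (Rmin d4 1)).
  pose proof (Rmin_l d4 1). pose proof (Rmin_r d4 1).
  assert (HAu : A u) by (apply Hd3; change (Rabs (u - x) < d3); lra).
  assert (Hv4 : Rabs (RInt (f x) 0 v - RInt (f x) 0 s) < eps / 2).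
  { apply (Hd4 v). change (Rabs (v - s) < d4). lra. }
  assert (Hvm : Rabs v <= m).
  { unfold m. assert (Hv1 : Rabs (v - s) < 1) by lra. clear - Hv1. revert Hv1. unfold Rabs, Rmax; repeat destruct Rle_dec; repeat destruct Rcase_abs; lra. }
  assert (H5' : Rabs (RInt (f u) 0 v - RInt (f x) 0 v) <= eps / 2).
  { replace (RInt (f u) 0 v - RInt (f x) 0 v)
      with (RInt (fun t => f u t - f x t) 0 v)
      by (apply (RInt_minus (f u) (f x)); apply Hint; assumption).
    apply Rle_trans with (Rabs v * (eps / 2 / m)).
    - destruct (Rle_dec 0 v) as [Hv0|Hv0].
      + replace (Rabs v) with (v - 0) by (rewrite Rabs_right; lra).
        apply abs_RInt_le_const; [lra| |].
        * apply (ex_RInt_minus (f u) (f x)); apply Hint; assumption.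
        * intros t Ht. apply Hd2; [lra|]. rewrite Rabs_right in Hvm by lra.
          rewrite Rmin_left, Rmax_right; lra.
      + rewrite <- (opp_RInt_swap (fun t => f u t - f x t) v 0).
        2:{ apply (ex_RInt_minus (f u) (f x)); apply Hint; assumption. }
        change (Rabs (- RInt (fun t => f u t - f x t) v 0) <= Rabs v * (eps / 2 / m)).
        rewrite Rabs_Ropp. replace (Rabs v) with (0 - v) by (rewrite Rabs_left; lra).
        apply abs_RInt_le_const; [lra| |].
        * apply (ex_RInt_minus (f u) (f x)); apply Hint; assumption.
        * intros t Ht. apply Hd1; [lra|]. rewrite Rabs_left in Hvm by lra.
          rewrite Rmin_right, Rmax_left; lra.
    - apply Rle_trans with (m * (eps / 2 / m)).
      + apply Rmult_le_compat_r; lra.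
      + right; field; lra. }
  replace (RInt (f u) 0 v - RInt (f x) 0 s) with
    ((RInt (f u) 0 v - RInt (f x) 0 v) + (RInt (f x) 0 v - RInt (f x) 0 s)) by ring.
  apply Rle_lt_trans with (1 := Rabs_triang _ _). lra.
Qed.

Lemma open_strip (A : R -> Prop) : open A -> open (fun p : R * R => A (fst p)).
Proof.
  intros HA. apply locally_2d_open. intros x y Hx. simpl in *.
  destruct (HA x Hx) as [d Hd]. exists d. intros u v Hu _. apply Hd, Hu.
Qed.

Lemma is_derive_RInt_strip (A : R -> Prop) f x s :
  open A -> Cn2 1 (fun p => A (fst p)) f -> A x ->
  is_derive (fun u => RInt (f u) 0 s) x (RInt (pd2 0 f x) 0 s).
Proof.
  intros HA Hf Hx. pose proof (open_strip A HA) as HO.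
  destruct (Cn2_S_derive _ _ _ Hf) as [D1 _].
  apply (is_derive_RInt_param f 0 s x).
  - apply filter_imp with (2 := HA x Hx). intros u Hu t _. eexists.
    apply (D1 u t Hu).
  - intros t _. destruct Hf as [_ [H _]]. apply H, Hx.
  - apply filter_imp with (2 := HA x Hx). intros u Hu.
    apply ex_RInt_cont. intros t. apply (continuity_2d_pt_snd f).
    apply (Cn2_continuity 1 _ f u t HO Hf Hu).
Qed.

Lemma Cn2_RInt (A : R -> Prop) n f :
  open A -> smooth2 (fun p => A (fst p)) f ->
  Cn2 n (fun p => A (fst p)) (fun u v => RInt (f u) 0 v).
Proof.
  intros HA. pose proof (open_strip A HA) as HO.
  revert f. induction n as [|n IH]; intros f Hf.
  - intros x s Hx. apply (continuity_2d_pt_RInt A); auto.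
    intros u t Hu. apply smooth2_continuity with (fun p => A (fst p)); auto.
  - apply Cn2_S_intro with (fun u v => RInt (pd2 0 f u) 0 v) f; auto.
    + intros x s Hx. apply (is_derive_RInt_strip A); auto.
    + intros x s Hx.
      assert (Hc : forall t, continuity_pt (f x) t).
      { intros t. apply continuity_2d_pt_snd, smooth2_continuity with (fun p => A (fst p)); auto. }
      apply (is_derive_RInt (f x) (RInt (f x) 0) 0 s).
      * apply filter_forall. intros v. apply (RInt_correct (f x) 0 v).
        apply ex_RInt_cont, Hc.
      * apply continuity_pt_filterlim, Hc.
    + apply IH, (smooth2_pd2 _ _ 0), Hf.
Qed.

(** ** Implicit functions *)

(** As [phi] vanishes at [t0], only the value of [psi] there enters; in the implicit
    function theorem [psi] is the inverse of a derivative at an unknown intermediate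
    point. *)
Lemma is_derive_factor (g phi psi : R -> R) t0 d :
  locally t0 (fun t => g t = g t0 + phi t * psi t) ->
  phi t0 = 0 -> is_derive phi t0 d -> continuity_pt psi t0 ->
  is_derive g t0 (d * psi t0).
Proof.
  intros Hg H0 Hphi Hpsi. apply is_derive_Reals. apply is_derive_Reals in Hphi.
  intros eps Heps.
  destruct (continuity_2d_pt_mult _ _ d (psi t0) (continuity_2d_pt_id1 _ _)
             (continuity_2d_pt_id2 _ _) (mkposreal eps Heps)) as [k Hk].
  destruct (Hphi k (cond_pos k)) as [d1 Hd1].
  apply continuity_pt_filterlim in Hpsi.
  destruct (proj1 (filterlim_locally _ _) Hpsi k) as [d2 Hd2].
  destruct Hg as [d3 Hd3].
  assert (Hd : 0 < Rmin d1 (Rmin d2 d3)) by (repeat apply Rmin_pos; apply cond_pos).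
  exists (mkposreal _ Hd). simpl. intros h Hh Hhd.
  pose proof (Rmin_l d1 (Rmin d2 d3)). pose proof (Rmin_r d1 (Rmin d2 d3)).
  pose proof (Rmin_l d2 d3). pose proof (Rmin_r d2 d3).
  assert (Hb : Rabs (t0 + h - t0) = Rabs h) by (f_equal; ring).
  rewrite (Hd3 (t0 + h)) by (change (Rabs (t0 + h - t0) < d3); lra).
  specialize (Hd1 h Hh ltac:(lra)). rewrite H0, Rminus_0_r in Hd1.
  assert (A2 : Rabs (psi (t0 + h) - psi t0) < k).
  { apply (Hd2 (t0 + h)). change (Rabs (t0 + h - t0) < d2). lra. }
  replace ((g t0 + phi (t0 + h) * psi (t0 + h) - g t0) / h)
    with (phi (t0 + h) / h * psi (t0 + h)) by (field; auto).
  apply (Hk _ _ Hd1 A2).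
Qed.

(** The equation [F (G u v) v = u] differentiates to
    [dG/du = 1 / F_1] and [dG/dv = - F_2 / F_1]; these formulas give one more
    derivative to [G] than they use, hence smoothness by induction. *)
Section Implicit.

Variables (V W : R * R -> Prop) (F G : R -> R -> R).
Hypothesis HV : open V.
Hypothesis HW : open W.
Hypothesis HF : smooth2 V F.
Hypothesis HF1 : forall x y, V (x, y) -> 0 < pd2 0 F x y.
Hypothesis Hconv : forall x1 x2 x y, V (x1, y) -> V (x2, y) -> x1 <= x <= x2 -> V (x, y).
Hypothesis HG : forall u v, W (u, v) -> V (G u v, v) /\ F (G u v) v = u.

Lemma implicit_incr x1 x2 y : V (x1, y) -> V (x2, y) -> x1 < x2 -> F x1 y < F x2 y.
Proof.
  intros H1 H2 H12. destruct (smooth2_derive _ _ HF) as [D1 _].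
  destruct (MVT_gen (fun t => F t y) x1 x2 (fun t => pd2 0 F t y)) as [c [Hc Heq]].
  - intros t Ht. rewrite Rmin_left, Rmax_right in Ht by lra. apply D1.
    apply Hconv with x1 x2; auto; lra.
  - intros t Ht. rewrite Rmin_left, Rmax_right in Ht by lra.
    apply (continuity_2d_pt_fst F), smooth2_continuity with V; auto.
    apply Hconv with x1 x2; auto; lra.
  - rewrite Rmin_left, Rmax_right in Hc by lra.
    assert (0 < pd2 0 F c y) by (apply HF1, Hconv with x1 x2; auto; lra).
    assert (0 < pd2 0 F c y * (x2 - x1)) by (apply Rmult_lt_0_compat; lra). lra.
Qed.

Lemma implicit_continuity u0 v0 : W (u0, v0) -> continuity_2d_pt G u0 v0.
Proof.
  intros H0 eps. destruct (HG u0 v0 H0) as [HV0 HF0]. set (x0 := G u0 v0) in *.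
  destruct (open_locally_2d _ _ _ HV HV0) as [d1 Hd1].
  set (e := Rmin (eps / 2) (d1 / 2)).
  assert (He : 0 < e) by (apply Rmin_pos; apply is_pos_div_2).
  assert (He1 : e < eps) by (unfold e; pose proof (Rmin_l (eps/2) (d1/2));
    pose proof (cond_pos eps); lra).
  assert (He2 : e < d1) by (unfold e; pose proof (Rmin_r (eps/2) (d1/2));
    pose proof (cond_pos d1); lra).
  assert (Vn : forall v, Rabs (v - v0) < d1 -> V (x0 - e, v) /\ V (x0 + e, v)).
  { intros v Hv. split; apply Hd1; auto.
    - replace (x0 - e - x0) with (- e) by ring. rewrite Rabs_Ropp, Rabs_right; lra.
    - replace (x0 + e - x0) with e by ring. rewrite Rabs_right; lra. }
  assert (Hz : Rabs (v0 - v0) < d1) by (rewrite Rminus_eq_0, Rabs_R0; apply cond_pos).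
  destruct (Vn v0 Hz) as [Vm Vp].
  assert (Lm : F (x0 - e) v0 < u0) by (rewrite <- HF0; apply implicit_incr; auto; lra).
  assert (Lp : u0 < F (x0 + e) v0) by (rewrite <- HF0; apply implicit_incr; auto; lra).
  set (k := Rmin ((u0 - F (x0 - e) v0) / 2) ((F (x0 + e) v0 - u0) / 2)).
  assert (Hk : 0 < k) by (unfold k; apply Rmin_pos; lra).
  assert (Hk1 : k <= (u0 - F (x0 - e) v0) / 2) by apply Rmin_l.
  assert (Hk2 : k <= (F (x0 + e) v0 - u0) / 2) by apply Rmin_r.
  destruct (smooth2_continuity V F _ _ HV HF Vm (mkposreal k Hk)) as [d2 Hd2].
  destruct (smooth2_continuity V F _ _ HV HF Vp (mkposreal k Hk)) as [d3 Hd3].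
  destruct (open_locally_2d _ _ _ HW H0) as [d4 Hd4].
  assert (Hd : 0 < Rmin (Rmin d1 k) (Rmin d2 (Rmin d3 d4))).
  { repeat apply Rmin_pos; try apply cond_pos; lra. }
  exists (mkposreal _ Hd). simpl. intros u v Hu Hv.
  pose proof (Rmin_l (Rmin d1 k) (Rmin d2 (Rmin d3 d4))).
  pose proof (Rmin_r (Rmin d1 k) (Rmin d2 (Rmin d3 d4))).
  pose proof (Rmin_l d1 k). pose proof (Rmin_r d1 k).
  pose proof (Rmin_l d2 (Rmin d3 d4)). pose proof (Rmin_r d2 (Rmin d3 d4)).
  pose proof (Rmin_l d3 d4). pose proof (Rmin_r d3 d4).
  assert (Huv : W (u, v)) by (apply Hd4; lra).
  destruct (HG u v Huv) as [HVu HFu].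
  destruct (Vn v) as [Wm Wp]; [lra|].
  assert (Z : forall x, Rabs (x - x) < d2) by (intros; rewrite Rminus_eq_0, Rabs_R0; apply cond_pos).
  assert (Z3 : forall x, Rabs (x - x) < d3) by (intros; rewrite Rminus_eq_0, Rabs_R0; apply cond_pos).
  assert (A2 := Hd2 (x0 - e) v (Z _) ltac:(lra)). simpl in A2.
  assert (A3 := Hd3 (x0 + e) v (Z3 _) ltac:(lra)). simpl in A3.
  assert (Hu' : Rabs (u - u0) < k) by lra.
  apply Rabs_lt_between in A2, A3, Hu'.
  apply Rabs_lt_between'. split.
  - destruct (Rlt_le_dec (x0 - e) (G u v)) as [L|L]; [lra|exfalso].
    destruct L as [L|L].
    + pose proof (implicit_incr _ _ _ HVu Wm L). lra.
    + rewrite L in HFu. lra.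
  - destruct (Rlt_le_dec (G u v) (x0 + e)) as [L|L]; [lra|exfalso].
    destruct L as [L|L].
    + pose proof (implicit_incr _ _ _ Wp HVu L). lra.
    + rewrite <- L in HFu. lra.
Qed.

(* The mean value theorem in the first variable turns the increment of [F]
   between two solutions into a difference quotient of [G]. *)
Lemma implicit_quotient u v x y :
  V (x, y) -> W (u, v) -> V (x, v) ->
  exists c, Rabs (c - x) <= Rabs (G u v - x) /\ V (c, v) /\
    u - F x v = pd2 0 F c v * (G u v - x).
Proof.
  intros H0 Huv Hxv. destruct (HG u v Huv) as [HVu HFu].
  destruct (smooth2_derive _ _ HF) as [D1 _].
  assert (Hin : forall t, Rmin x (G u v) <= t <= Rmax x (G u v) -> V (t, v)).
  { intros t Ht. destruct (Rle_dec x (G u v)).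
    - rewrite Rmin_left, Rmax_right in Ht by lra. apply Hconv with x (G u v); auto.
    - rewrite Rmin_right, Rmax_left in Ht by lra. apply Hconv with (G u v) x; auto. }
  destruct (MVT_gen (fun t => F t v) x (G u v) (fun t => pd2 0 F t v)) as [c [Hc Heq]].
  - intros t Ht. apply D1, Hin. lra.
  - intros t Ht. apply (continuity_2d_pt_fst F), smooth2_continuity with V; auto.
  - exists c. split; [|split; [apply Hin, Hc|rewrite <- HFu at 1; exact Heq]].
    destruct (Rle_dec x (G u v)).
    + rewrite Rmin_left, Rmax_right in Hc by lra. rewrite !Rabs_right; lra.
    + rewrite Rmin_right, Rmax_left in Hc by lra. rewrite !Rabs_left1; lra.
Qed.

(** Both partial derivatives of [G] are instances, with one of [gu], [gv] constant. The
    intermediate point [c t] of the mean value theorem tends to [x0] as [t -> t0]. *)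
Lemma implicit_derive_along (gu gv : R -> R) t0 du dv :
  is_derive gu t0 du -> is_derive gv t0 dv -> W (gu t0, gv t0) ->
  is_derive (fun t => G (gu t) (gv t)) t0
    ((du - pd2 1 F (G (gu t0) (gv t0)) (gv t0) * dv)
       * / pd2 0 F (G (gu t0) (gv t0)) (gv t0)).
Proof.
  intros Hu Hv H0. destruct (HG _ _ H0) as [HV0 HF0].
  set (x0 := G (gu t0) (gv t0)) in *.
  assert (Cu : continuity_pt gu t0).
  { apply continuity_pt_filterlim, (ex_derive_continuous gu). eexists; apply Hu. }
  assert (Cv : continuity_pt gv t0).
  { apply continuity_pt_filterlim, (ex_derive_continuous gv). eexists; apply Hv. }
  assert (CG : continuity_pt (fun t => G (gu t) (gv t)) t0).
  { apply (continuity_2d_pt_fst (fun t _ => G (gu t) (gv t)) t0 0).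
    apply continuity_2d_pt_comp2; [apply implicit_continuity, H0| |].
    - apply (continuity_1d_2d_pt_comp gu (fun t _ => t)); auto using continuity_2d_pt_id1.
    - apply (continuity_1d_2d_pt_comp gv (fun t _ => t)); auto using continuity_2d_pt_id1. }
  set (P := fun t c => Rabs (c - x0) <= Rabs (G (gu t) (gv t) - x0) /\ V (c, gv t) /\
     gu t - F x0 (gv t) = pd2 0 F c (gv t) * (G (gu t) (gv t) - x0)).
  set (c := fun t => epsilon (inhabits 0) (P t)).
  assert (Lc : locally t0 (fun t => P t (c t))).
  { assert (L1 : locally t0 (fun t => W (gu t, gv t))).
    { destruct (open_locally_2d _ _ _ HW H0) as [d Hd].
      apply continuity_pt_filterlim in Cu, Cv.
      pose proof (proj1 (filterlim_locally _ _) Cu d) as L1.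
      pose proof (proj1 (filterlim_locally _ _) Cv d) as L2.
      generalize (filter_and _ _ L1 L2). apply filter_imp. intros t [A B].
      apply Hd; assumption. }
    assert (L2 : locally t0 (fun t => V (x0, gv t))).
    { destruct (open_locally_2d _ _ _ HV HV0) as [d Hd].
      apply continuity_pt_filterlim in Cv.
      pose proof (proj1 (filterlim_locally _ _) Cv d) as L2.
      revert L2. apply filter_imp. intros t B. apply Hd; [|assumption].
      rewrite Rminus_eq_0, Rabs_R0. apply cond_pos. }
    generalize (filter_and _ _ L1 L2). apply filter_imp. intros t [A B].
    apply epsilon_spec. apply (implicit_quotient _ _ x0 (gv t0)); auto. }
  assert (Hc0 : c t0 = x0).
  { pose proof (locally_singleton _ _ Lc) as [A _]. fold x0 in A.
    rewrite Rminus_eq_0, Rabs_R0 in A.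
    pose proof (Rabs_pos (c t0 - x0)).
    destruct (Req_dec (c t0 - x0) 0) as [E|E]; [lra|].
    apply Rabs_no_R0 in E. lra. }
  assert (Cc : continuity_pt c t0).
  { apply continuity_pt_filterlim, filterlim_locally. intros eps.
    apply continuity_pt_filterlim in CG.
    pose proof (proj1 (filterlim_locally _ _) CG eps) as L.
    generalize (filter_and _ _ L Lc). apply filter_imp. intros t [A [B _]].
    rewrite Hc0. change (Rabs (G (gu t) (gv t) - x0) < eps) in A.
    change (Rabs (c t - x0) < eps). lra. }
  assert (Hpsi : (fun t => / pd2 0 F (c t) (gv t)) t0 = / pd2 0 F x0 (gv t0))
    by (cbv beta; rewrite Hc0; reflexivity).
  rewrite <- Hpsi.
  apply (is_derive_factor (fun t => G (gu t) (gv t)) (fun t => gu t - F x0 (gv t))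
           (fun t => / pd2 0 F (c t) (gv t)) t0).
  - revert Lc. apply filter_imp. intros t [_ [B C]]. rewrite C. fold x0.
    specialize (HF1 _ _ B). field. lra.
  - lra.
  - destruct (smooth2_derive _ _ HF) as [_ D2].
    apply (is_derive_minus gu (fun t => F x0 (gv t))); auto.
    rewrite Rmult_comm. apply (is_derive_comp (F x0) gv); auto.
  - apply (continuity_pt_inv (fun t => pd2 0 F (c t) (gv t))).
    + apply (continuity_2d_pt_fst (fun t _ => pd2 0 F (c t) (gv t)) t0 0).
      apply continuity_2d_pt_comp2.
      * rewrite Hc0. apply smooth2_continuity with V; auto. apply (smooth2_pd2 _ _ 0), HF.
      * apply (continuity_1d_2d_pt_comp c (fun t _ => t)); auto using continuity_2d_pt_id1.
      * apply (continuity_1d_2d_pt_comp gv (fun t _ => t)); auto using continuity_2d_pt_id1.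
    + rewrite Hc0. specialize (HF1 _ _ HV0). lra.
Qed.

Lemma implicit_smooth : smooth2 W G.
Proof.
  intros n. induction n as [|n IH].
  - intros u v Huv. apply implicit_continuity, Huv.
  - assert (HFG : forall i, Cn2 n W (fun u v => pd2 i F (G u v) v)).
    { intros i. apply (Cn2_comp2 n W V (pd2 i F) G (fun _ v => v)); auto.
      - intros u v Huv. apply HG, Huv.
      - apply smooth2_pd2, HF.
      - apply Cn2_snd, HW. }
    assert (Hinv : Cn2 n W (fun u v => / pd2 0 F (G u v) v)).
    { apply Cn2_inv; auto. intros u v Huv. specialize (HF1 _ _ (proj1 (HG _ _ Huv))). lra. }
    apply Cn2_S_intro with (fun u v => / pd2 0 F (G u v) v)
      (fun u v => - pd2 1 F (G u v) v * / pd2 0 F (G u v) v);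
      auto using Cn2_mult, Cn2_opp.
    + intros u v Huv.
      replace (/ pd2 0 F (G u v) v) with
        ((1 - pd2 1 F (G u v) v * 0) * / pd2 0 F (G u v) v) by ring.
      apply (implicit_derive_along (fun t => t) (fun _ => v)); auto.
      * apply (is_derive_id (K := R_AbsRing)).
      * apply (is_derive_const (K := R_AbsRing) (V := R_NormedModule)).
    + intros u v Huv.
      replace (- pd2 1 F (G u v) v) with (0 - pd2 1 F (G u v) v * 1) by ring.
      apply (implicit_derive_along (fun _ => u) (fun t => t)); auto.
      * apply (is_derive_const (K := R_AbsRing) (V := R_NormedModule)).
      * apply (is_derive_id (K := R_AbsRing)).
Qed.

End Implicit.

(** ** Flat functions, for cut-offs *)

(** The functions [x^-m exp (-1/x)], extended by 0, are stable under
    differentiation. *)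
Definition flat (m : nat) (x : R) : R :=
  if Rlt_dec 0 x then exp (- / x) * / x ^ m else 0.

Lemma flat_pos m x : 0 < x -> 0 < flat m x.
Proof.
  intros Hx. unfold flat. destruct Rlt_dec; [|lra].
  apply Rmult_lt_0_compat; [apply exp_pos | apply Rinv_0_lt_compat, pow_lt, Hx].
Qed.

Lemma flat_neg m x : x <= 0 -> flat m x = 0.
Proof. intros Hx. unfold flat. destruct Rlt_dec; [lra|reflexivity]. Qed.

Lemma flat_nonneg m x : 0 <= flat m x.
Proof.
  destruct (Rlt_le_dec 0 x); [left; apply flat_pos | rewrite flat_neg]; lra.
Qed.

Lemma exp_pow x n : exp (x * INR n) = exp x ^ n.
Proof.
  induction n as [|n IH]; [simpl; rewrite Rmult_0_r; apply exp_0|].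
  rewrite S_INR, Rmult_plus_distr_l, Rmult_1_r, exp_plus, IH. simpl. ring.
Qed.

Lemma pow_le_exp n u : 0 <= u -> (u / INR (S n)) ^ S n <= exp u.
Proof.
  intros Hu. assert (Hn : 0 < INR (S n)) by (apply lt_0_INR; lia).
  apply Rle_trans with (exp (u / INR (S n)) ^ S n).
  - apply pow_incr. split.
    + apply Rmult_le_pos; [lra|]. left. apply Rinv_0_lt_compat, Hn.
    + pose proof (exp_ineq1_le (u / INR (S n))). lra.
  - right. rewrite <- exp_pow. f_equal. field. lra.
Qed.

(** [exp (1/x) >= (1 / (n x))^n] with [n = m + 1] beats the power [x^m]; this gives the
    differentiability of [flat m] at 0. *)
Lemma flat_bound m x : 0 < x -> flat m x <= INR (S m) ^ S m * x.
Proof.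
  intros Hx. unfold flat. destruct Rlt_dec; [|lra].
  pose proof (pow_lt x m Hx) as Hm. pose proof (pow_lt x (S m) Hx) as HSm.
  assert (Hn : 0 < INR (S m)) by (apply lt_0_INR; lia).
  pose proof (pow_lt (INR (S m)) (S m) Hn) as HN.
  assert (Hix : 0 < / x) by (apply Rinv_0_lt_compat, Hx).
  assert (H := pow_le_exp m (/ x) (Rlt_le _ _ Hix)).
  assert (H1 : (/ x / INR (S m)) ^ S m = / (INR (S m) ^ S m * x ^ S m)).
  { rewrite <- Rpow_mult_distr, <- pow_inv. f_equal. field. lra. }
  rewrite H1 in H. rewrite exp_Ropp.
  apply Rle_trans with (INR (S m) ^ S m * x ^ S m * / x ^ m).
  - apply Rmult_le_compat_r; [left; apply Rinv_0_lt_compat, Hm|].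
    rewrite <- (Rinv_inv (INR (S m) ^ S m * x ^ S m)).
    apply Rinv_le_contravar; [|exact H].
    apply Rinv_0_lt_compat, Rmult_lt_0_compat; assumption.
  - right. simpl (x ^ S m). field. lra.
Qed.

Lemma flat_derive m x :
  is_derive (flat m) x (- INR m * flat (S m) x + 1 * flat (S (S m)) x).
Proof.
  destruct (Rtotal_order x 0) as [Hx|[Hx|Hx]].
  - rewrite !flat_neg by lra.
    apply is_derive_ext_loc with (fun _ => 0).
    + exists (mkposreal (- x) ltac:(lra)). simpl. intros y Hy.
      change (Rabs (y - x) < - x) in Hy. apply Rabs_lt_between in Hy.
      rewrite flat_neg; [reflexivity|lra].
    + replace (- INR m * 0 + 1 * 0) with 0 by ring.
      apply (is_derive_const (K := R_AbsRing) (V := R_NormedModule)).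
  - subst x. rewrite !flat_neg by lra.
    replace (- INR m * 0 + 1 * 0) with 0 by ring.
    apply is_derive_Reals. intros eps Heps.
    set (K := INR (S (S m)) ^ S (S m)).
    assert (HK : 0 < K) by (apply pow_lt, lt_0_INR; lia).
    assert (Hd : 0 < eps / K) by (apply Rdiv_lt_0_compat; auto).
    exists (mkposreal _ Hd). simpl. intros h Hh Hhd.
    rewrite Rplus_0_l, (flat_neg m 0), !Rminus_0_r by lra.
    destruct (Rlt_le_dec 0 h) as [H|H].
    + replace (flat m h / h) with (flat (S m) h).
      2:{ unfold flat. destruct Rlt_dec; [|lra]. pose proof (pow_lt h m H).
          simpl. field. lra. }
      rewrite Rabs_right by (apply Rle_ge, flat_nonneg).
      apply Rle_lt_trans with (1 := flat_bound (S m) h H). fold K.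
      rewrite Rabs_right in Hhd by lra.
      apply Rmult_lt_reg_r with (/ K); [apply Rinv_0_lt_compat, HK|].
      replace (K * h * / K) with h by (field; lra). exact Hhd.
    + rewrite flat_neg by exact H. unfold Rdiv. rewrite Rmult_0_l, Rabs_R0. exact Heps.
  - pose proof (pow_lt x m Hx) as Hm.
    apply is_derive_ext_loc with (fun t => exp (- / t) * / t ^ m).
    + exists (mkposreal x Hx). simpl. intros y Hy.
      change (Rabs (y - x) < x) in Hy. apply Rabs_lt_between in Hy.
      unfold flat. destruct Rlt_dec; [reflexivity|lra].
    + unfold flat. destruct Rlt_dec as [_|]; [|lra].
      auto_derive.
      * split; [lra|split; [|exact I]]. lra.
      * destruct m as [|m]; [simpl; field; lra|].
        simpl (Init.Nat.pred (S m)).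
        replace (x ^ S (S m)) with (x * x * x ^ m) by (simpl; ring).
        replace (x ^ S (S (S m))) with (x * x * x * x ^ m) by (simpl; ring).
        replace (x ^ S m) with (x * x ^ m) by (simpl; ring).
        assert (x ^ m <> 0) by (apply pow_nonzero; lra).
        field. split; lra.
Qed.

Lemma flat_continuity m x : continuity_pt (flat m) x.
Proof.
  apply continuity_pt_filterlim, (ex_derive_continuous (flat m)).
  eexists. apply flat_derive.
Qed.

Lemma Cn2_flat m n U f : open U -> Cn2 n U f -> Cn2 n U (fun x y => flat m (f x y)).
Proof.
  intros HU Hf.
  apply (Cn2_comp1 nat flat (fun _ => True) n U f); auto using flat_continuity.
  intros i. exists (S i), (S (S i)), (- INR i), 1. intros x _. apply flat_derive.
Qed.

Lemma flat0_derive x : is_derive (flat 0) x (flat 2 x).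
Proof.
  replace (flat 2 x) with (- INR 0 * flat 1 x + 1 * flat 2 x) by (simpl; ring).
  apply flat_derive.
Qed.

Lemma flat0_lt_1 x : flat 0 x < 1.
Proof.
  unfold flat. destruct Rlt_dec as [H|H]; [|lra].
  simpl. rewrite Rinv_1, Rmult_1_r, <- exp_0. apply exp_increasing.
  pose proof (Rinv_0_lt_compat x H). lra.
Qed.

Lemma exp_ge_quadratic r : 0 <= r -> 1 + r + r ^ 2 / 2 <= exp r.
Proof.
  intros Hr.
  destruct (MVT_gen (fun t => exp t - (1 + t + t ^ 2 / 2)) 0 r (fun t => exp t - (1 + t)))
    as [c [Hc Heq]].
  - intros t _. auto_derive; [exact I|field].
  - intros t _. apply continuity_pt_filterlim,
      (ex_derive_continuous (fun t => exp t - (1 + t + t ^ 2 / 2))).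
    auto_derive. exact I.
  - rewrite exp_0 in Heq. pose proof (exp_ineq1_le c).
    assert (0 <= (exp c - (1 + c)) * (r - 0)) by (apply Rmult_le_pos; lra). lra.
Qed.

(* These two bounds make the cut-offs [flat 0 (x - 1)], rescaled, converge to the
   indicator of [0, +oo) at the rate needed below. *)
Lemma flat0_defect x : 0 <= x -> x * (1 - flat 0 (x - 1)) <= 2.
Proof.
  intros Hx. pose proof (flat_nonneg 0 (x - 1)).
  pose proof (Rmult_le_pos _ _ Hx H).
  destruct (Rle_lt_dec x 2) as [H2|H2]; [lra|].
  unfold flat. destruct Rlt_dec as [_|]; [|lra]. simpl. rewrite Rinv_1, Rmult_1_r.
  pose proof (exp_ineq1_le (- / (x - 1))).
  apply Rle_trans with (x * / (x - 1)).
  - apply Rmult_le_compat_l; lra.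
  - apply Rmult_le_reg_r with (x - 1); [lra|].
    rewrite Rmult_assoc, Rinv_l by lra. lra.
Qed.

Lemma flat2_decay x : 0 <= x -> x ^ 2 * flat 2 (x - 1) <= 2.
Proof.
  intros Hx. unfold flat. destruct Rlt_dec as [H|H]; [|lra].
  set (r := / (x - 1)). assert (Hr : 0 < r) by (apply Rinv_0_lt_compat, H).
  pose proof (exp_ge_quadratic r (Rlt_le _ _ Hr)).
  rewrite exp_Ropp. pose proof (exp_pos r).
  replace (x ^ 2 * (/ exp r * / (x - 1) ^ 2)) with ((1 + r) ^ 2 / exp r)
    by (replace x with (1 + / r) by (unfold r; rewrite Rinv_inv; ring);
        replace (1 + / r - 1) with (/ r) by ring; field; lra).
  apply Rmult_le_reg_r with (exp r); [assumption|].
  unfold Rdiv. rewrite Rmult_assoc, Rinv_l by lra. nra.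
Qed.

(** * Elementary facts of one-variable analysis *)

Ltac pos :=
  repeat match goal with
  | |- 0 < _ * _ => apply Rmult_lt_0_compat
  | |- 0 < _ / _ => apply Rdiv_lt_0_compat
  | |- 0 < / _ => apply Rinv_0_lt_compat
  | |- 0 < _ ^ _ => apply pow_lt
  end; try lra.

Lemma is_derive_cont (f : R -> R) x l : is_derive f x l -> continuity_pt f x.
Proof.
  intros H. apply continuity_pt_filterlim, (ex_derive_continuous f). eexists; apply H.
Qed.

Ltac as_R := match goal with |- @eq _ ?x ?y => change (@eq R x y) end.
Ltac rring := as_R; ring.

Lemma is_derive_eq (f : R -> R) (x l l' : R) : is_derive f x l -> l = l' -> is_derive f x l'.
Proof. intros H <-. exact H. Qed.

Lemma is_derive_scal_r (f : R -> R) x l k :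
  is_derive f x l -> is_derive (fun t => f t * k) x (l * k).
Proof.
  intros H. rewrite Rmult_comm.
  apply is_derive_ext with (fun t => k * f t); [intros; apply Rmult_comm|].
  apply (is_derive_scal f), H.
Qed.

Lemma RInt_derive (f df : R -> R) a b :
  (forall x, is_derive f x (df x)) -> (forall x, continuity_pt df x) ->
  RInt df a b = f b - f a.
Proof.
  intros H1 H2. apply is_RInt_unique. apply (is_RInt_derive f df).
  - intros x _. apply H1.
  - intros x _. apply continuity_pt_filterlim, H2.
Qed.

Lemma RInt_ext_all (f g : R -> R) a b :
  (forall x, f x = g x) -> RInt f a b = RInt g a b.
Proof. intros H. apply RInt_ext. intros x _. apply H. Qed.

Lemma RInt_const_R (c a b : R) : RInt (fun _ => c) a b = (b - a) * c.
Proof. apply (RInt_const a b c). Qed.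

Lemma RInt_plus_c f g a b :
  (forall t, continuity_pt f t) -> (forall t, continuity_pt g t) ->
  RInt (fun x => f x + g x) a b = RInt f a b + RInt g a b.
Proof. intros Hf Hg. apply (RInt_plus f g); apply ex_RInt_cont; assumption. Qed.

Lemma RInt_minus_c f g a b :
  (forall t, continuity_pt f t) -> (forall t, continuity_pt g t) ->
  RInt (fun x => f x - g x) a b = RInt f a b - RInt g a b.
Proof. intros Hf Hg. apply (RInt_minus f g); apply ex_RInt_cont; assumption. Qed.

Lemma RInt_scal_c f k a b :
  (forall t, continuity_pt f t) -> RInt (fun x => k * f x) a b = k * RInt f a b.
Proof. intros Hf. apply (RInt_scal f a b k), ex_RInt_cont, Hf. Qed.

Lemma RInt_chasles_c f a b c :
  (forall t, continuity_pt f t) -> RInt f a b + RInt f b c = RInt f a c.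
Proof. intros Hf. apply (RInt_Chasles f a b c); apply ex_RInt_cont, Hf. Qed.

Lemma RInt_nonneg f a b :
  a <= b -> (forall t, continuity_pt f t) -> (forall t, a <= t <= b -> 0 <= f t) ->
  0 <= RInt f a b.
Proof.
  intros Hab Hc Hf. apply RInt_ge_0; auto using ex_RInt_cont.
  intros t Ht. apply Hf. lra.
Qed.

Lemma RInt_monotone f g a b :
  a <= b -> (forall t, continuity_pt f t) -> (forall t, continuity_pt g t) ->
  (forall t, a <= t <= b -> f t <= g t) -> RInt f a b <= RInt g a b.
Proof.
  intros Hab Hf Hg H. apply RInt_le; auto using ex_RInt_cont.
  intros t Ht. apply H. lra.
Qed.

(** The primitive is nondecreasing with equal values at both ends, hence constant; the
    endpoints are then reached by continuity. *)
Lemma RInt_zero_nonneg f a b :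
  a < b -> (forall t, continuity_pt f t) -> (forall t, a <= t <= b -> 0 <= f t) ->
  RInt f a b = 0 -> forall t, a <= t <= b -> f t = 0.
Proof.
  intros Hab Hc Hf H0.
  assert (Hder : forall x, is_derive (RInt f a) x (f x)).
  { intros x. apply (is_derive_RInt f (RInt f a) a x).
    - apply filter_forall. intros v. apply (RInt_correct f a v), ex_RInt_cont, Hc.
    - apply continuity_pt_filterlim, Hc. }
  assert (Hz : forall x, a <= x <= b -> RInt f a x = 0).
  { intros x Hx. pose proof (RInt_Chasles f a x b (ex_RInt_cont _ _ _ Hc) (ex_RInt_cont _ _ _ Hc)) as E.
    change (RInt f a x + RInt f x b = RInt f a b) in E.
    assert (0 <= RInt f a x) by (apply RInt_nonneg; auto; [lra|intros; apply Hf; lra]).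
    assert (0 <= RInt f x b) by (apply RInt_nonneg; auto; [lra|intros; apply Hf; lra]). lra. }
  assert (Hin : forall t, a < t < b -> f t = 0).
  { intros t Ht. rewrite <- (is_derive_unique _ _ _ (Hder t)).
    rewrite (Derive_ext_loc _ (fun _ => 0)); [apply Derive_const|].
    assert (Hp : 0 < Rmin (t - a) (b - t)) by (apply Rmin_pos; lra).
    exists (mkposreal _ Hp). simpl. intros y Hy. change (Rabs (y - t) < Rmin (t - a) (b - t)) in Hy.
    pose proof (Rmin_l (t - a) (b - t)). pose proof (Rmin_r (t - a) (b - t)).
    apply Rabs_lt_between in Hy. apply Hz. lra. }
  intros t Ht. destruct (Req_dec (f t) 0) as [E|E]; [exact E|exfalso].
  destruct (proj1 (filterlim_locally _ _) (proj1 (continuity_pt_filterlim _ _) (Hc t))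
              (mkposreal _ (Rabs_pos_lt _ E))) as [d Hd]. simpl in Hd.
  set (h := Rmin (d / 2) ((b - a) / 4)).
  assert (0 < h) by (apply Rmin_pos; [apply is_pos_div_2|lra]).
  assert (h <= d / 2) by apply Rmin_l. assert (h <= (b - a) / 4) by apply Rmin_r.
  pose proof (cond_pos d).
  assert (exists u, a < u < b /\ Rabs (u - t) < d) as [u [Hu Hu2]].
  { destruct (Rle_dec t ((a + b) / 2)).
    - exists (t + h). split; [lra|]. rewrite Rabs_right; lra.
    - exists (t - h). split; [lra|]. rewrite Rabs_left; lra. }
  specialize (Hd u Hu2). rewrite (Hin u Hu) in Hd.
  change (Rabs (0 - f t) < Rabs (f t)) in Hd.
  replace (0 - f t) with (- f t) in Hd by ring. rewrite Rabs_Ropp in Hd. lra.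
Qed.

Lemma derive_zero_const (f : R -> R) a b :
  (forall x, a <= x <= b -> is_derive f x 0) -> a <= b -> f a = f b.
Proof.
  intros H Hab. destruct (MVT_gen f a b (fun _ => 0)) as [c [_ E]].
  - intros x Hx. rewrite Rmin_left, Rmax_right in Hx by lra. apply H; lra.
  - intros x Hx. rewrite Rmin_left, Rmax_right in Hx by lra. eapply is_derive_cont, H; lra.
  - lra.
Qed.

Lemma MVT_open (f df : R -> R) a b :
  a < b -> (forall x, a < x < b -> is_derive f x (df x)) ->
  (forall x, a <= x <= b -> continuity_pt f x) ->
  exists c, a < c < b /\ f b - f a = df c * (b - a).
Proof.
  intros Hab Hd Hc.
  assert (pr : forall c, a < c < b -> derivable_pt f c).
  { intros c Hin. exists (df c). apply is_derive_Reals, Hd, Hin. }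
  destruct (MVT f id a b pr (fun c _ => derivable_pt_id c) Hab Hc
             (fun c _ => derivable_continuous_pt _ _ (derivable_pt_id c))) as [c [P E]].
  exists c. split; [exact P|]. rewrite derive_pt_id in E. unfold id in E.
  rewrite Derive_Reals in E. rewrite (is_derive_unique _ _ _ (Hd c P)) in E. lra.
Qed.

Lemma derive_neg_decr (f df : R -> R) a b :
  a < b -> (forall x, a < x < b -> is_derive f x (df x)) ->
  (forall x, a < x < b -> df x < 0) ->
  (forall x, a <= x <= b -> continuity_pt f x) -> f b < f a.
Proof.
  intros Hab Hd Hn Hc. destruct (MVT_open f df a b Hab Hd Hc) as [c [Hin E]].
  specialize (Hn c Hin). nra.
Qed.

Lemma derive_pos_incr (f df : R -> R) a b :
  a < b -> (forall x, a < x < b -> is_derive f x (df x)) ->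
  (forall x, a < x < b -> 0 < df x) ->
  (forall x, a <= x <= b -> continuity_pt f x) -> f a < f b.
Proof.
  intros Hab Hd Hn Hc. destruct (MVT_open f df a b Hab Hd Hc) as [c [Hin E]].
  specialize (Hn c Hin). nra.
Qed.

Lemma IVT_signed f a b :
  a <= b -> (forall x, a <= x <= b -> continuity_pt f x) -> f a * f b <= 0 ->
  exists c, a <= c <= b /\ f c = 0.
Proof.
  intros Hab Hc Hs.
  (* composed with the retraction onto [a, b], f becomes continuous everywhere *)
  set (cl := fun x => Rmax a (Rmin b x)).
  assert (Hcl : forall x, a <= cl x <= b).
  { intros x. unfold cl. split; [apply Rmax_l|]. apply Rmax_lub; [lra|apply Rmin_l]. }
  assert (Hid : forall x, a <= x <= b -> cl x = x).
  { intros x Hx. unfold cl. rewrite Rmin_right, Rmax_right; lra. }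
  assert (HC : continuity (fun x => f (cl x))).
  { intros x. apply (continuity_pt_comp cl f); [|apply Hc, Hcl].
    apply continuity_pt_filterlim, filterlim_locally. intros eps. exists eps.
    intros y Hy. change (Rabs (y - x) < eps) in Hy. change (Rabs (cl y - cl x) < eps).
    apply Rle_lt_trans with (2 := Hy). unfold cl, Rmax, Rmin.
    repeat destruct Rle_dec; unfold Rabs; repeat destruct Rcase_abs; lra. }
  destruct (IVT_cor (fun x => f (cl x)) a b HC Hab) as [c [Hin E]].
  - rewrite !Hid by lra. exact Hs.
  - exists c. rewrite Hid in E by exact Hin. auto.
Qed.

(** Induction along a compact interval; it replaces both its compactness and its
    connectedness below. *)
Lemma interval_induction (P : R -> Prop) a b :
  a <= b -> P a ->
  (forall x, a <= x <= b -> exists d : posreal, forall y z,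
     x - d < y <= x -> a <= y -> P y -> y <= z < x + d -> z <= b -> P z) ->
  P b.
Proof.
  intros Hab Ha Hstep.
  set (E := fun x => a <= x <= b /\ P x).
  destruct (completeness E) as [m [Hub Hlub]].
  - exists b. intros x [Hx _]. lra.
  - exists a. split; [lra|exact Ha].
  - assert (Hm : a <= m <= b).
    { split; [apply Hub; split; [lra|exact Ha]|]. apply Hlub. intros x [Hx _]. lra. }
    destruct (Hstep m Hm) as [d Hd]. pose proof (cond_pos d).
    assert (exists y, m - d < y <= m /\ a <= y /\ P y) as [y [Hy1 [Hy2 Hy3]]].
    { apply NNPP. intros N.
      assert (m <= m - d); [|lra]. apply Hlub. intros x [Hx Px].
      destruct (Rle_lt_dec x (m - d)); [assumption|exfalso].
      apply N. exists x. repeat split; try lra; auto. apply Hub. split; auto. }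
    destruct (Rle_lt_dec b m) as [L|L].
    + replace b with m by lra. apply (Hd y m); auto; lra.
    + exfalso. set (z := Rmin b (m + d / 2)).
      assert (m < z) by (unfold z; apply Rmin_glb_lt; lra).
      assert (z <= b) by apply Rmin_l. assert (z <= m + d / 2) by apply Rmin_r.
      assert (z <= m); [|lra]. apply Hub. split; [lra|].
      apply (Hd y z); auto; lra.
Qed.

(** * Hyperbolic functions *)

Lemma is_derive_cosh x : is_derive cosh x (sinh x).
Proof. apply is_derive_Reals, derivable_pt_lim_cosh. Qed.

Lemma is_derive_sinh x : is_derive sinh x (cosh x).
Proof. apply is_derive_Reals, derivable_pt_lim_sinh. Qed.

Lemma cosh2_sinh2 x : cosh x ^ 2 = 1 + sinh x ^ 2.
Proof.
  assert (H : exp x * exp (- x) = 1) by (rewrite <- exp_plus, Rplus_opp_r; apply exp_0).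
  unfold cosh, sinh. nra.
Qed.

Lemma cosh_double x : cosh (2 * x) = 2 * sinh x ^ 2 + 1.
Proof.
  assert (H : exp x * exp (- x) = 1) by (rewrite <- exp_plus, Rplus_opp_r; apply exp_0).
  unfold cosh, sinh. replace (2 * x) with (x + x) by ring.
  replace (- (x + x)) with (- x + - x) by ring. rewrite !exp_plus. nra.
Qed.

Lemma sinh_double x : sinh (2 * x) = 2 * sinh x * cosh x.
Proof.
  unfold cosh, sinh. replace (2 * x) with (x + x) by ring.
  replace (- (x + x)) with (- x + - x) by ring. rewrite !exp_plus. field.
Qed.

Lemma sinh_pos x : 0 < x -> 0 < sinh x.
Proof.
  intros Hx. unfold sinh. assert (exp (- x) < exp x) by (apply exp_increasing; lra). lra.
Qed.

Lemma cosh_opp x : cosh (- x) = cosh x.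
Proof. unfold cosh. rewrite Ropp_involutive. field. Qed.

Lemma sinh_opp x : sinh (- x) = - sinh x.
Proof. unfold sinh. rewrite Ropp_involutive. field. Qed.

Lemma sinh_incr x y : x < y -> sinh x < sinh y.
Proof.
  intros H. apply (derive_pos_incr sinh cosh); [exact H| | |].
  - intros t _. apply is_derive_sinh.
  - intros t _. pose proof (cosh_ge_1 t). lra.
  - intros t _. eapply is_derive_cont, is_derive_sinh.
Qed.

Lemma sinh_le x y : x <= y -> sinh x <= sinh y.
Proof. intros [H| ->]; [left; apply sinh_incr, H|lra]. Qed.

Lemma cosh_quadratic x : 1 + x ^ 2 / 2 <= cosh x.
Proof.
  assert (H : forall t, 0 <= t -> 1 + t ^ 2 / 2 <= cosh t).
  { intros t Ht. destruct (MVT_gen (fun t => cosh t - (1 + t ^ 2 / 2)) 0 t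
      (fun t => sinh t - t)) as [c [Hc E]].
    - intros u _. apply (is_derive_minus cosh (fun t => 1 + t ^ 2 / 2)); [apply is_derive_cosh|].
      auto_derive; [exact I|field].
    - intros u _. apply (continuity_pt_minus cosh (fun t => 1 + t ^ 2 / 2)).
      + eapply is_derive_cont, is_derive_cosh.
      + apply (is_derive_cont _ _ u). auto_derive; [exact I|field].
    - rewrite Rmin_left, Rmax_right in Hc by lra. rewrite cosh_0 in E.
      destruct (MVT_gen (fun t => sinh t - t) 0 c (fun t => cosh t - 1)) as [d [Hd E2]].
      + intros u _. apply (is_derive_minus sinh (fun t => t)); [apply is_derive_sinh|].
        apply (is_derive_id (K := R_AbsRing)).
      + intros u _. apply (continuity_pt_minus sinh (fun t => t)).
        * eapply is_derive_cont, is_derive_sinh.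
        * apply continuity_pt_id.
      + rewrite sinh_0 in E2. pose proof (cosh_ge_1 d).
        assert (0 <= (cosh d - 1) * (c - 0)) by (apply Rmult_le_pos; lra).
        assert (0 <= (sinh c - c) * (t - 0)) by (apply Rmult_le_pos; lra). lra. }
  destruct (Rle_dec 0 x); [apply H; assumption|].
  rewrite <- cosh_opp. replace (x ^ 2) with ((- x) ^ 2) by ring. apply H; lra.
Qed.

Lemma is_derive_arccosh x : 1 < x -> is_derive arccosh x (/ sqrt (x ^ 2 - 1)).
Proof.
  intros Hx. unfold arccosh.
  assert (H : 0 < x ^ 2 - 1) by nra. pose proof (sqrt_lt_R0 _ H).
  auto_derive.
  - replace (x * (x * 1) + - (1)) with (x ^ 2 - 1) by ring. repeat split; lra.
  - replace (x * (x * 1) + - (1)) with (x ^ 2 - 1) by ring. field. lra.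
Qed.

Lemma Cn2_cosh n U f : open U -> Cn2 n U f -> Cn2 n U (fun x y => cosh (f x y)).
Proof.
  intros HU Hf. unfold cosh. apply Cn2_div; auto.
  - apply Cn2_plus; auto using Cn2_exp, Cn2_opp.
  - apply Cn2_const, HU.
Qed.

Lemma Cn2_sinh n U f : open U -> Cn2 n U f -> Cn2 n U (fun x y => sinh (f x y)).
Proof.
  intros HU Hf. unfold sinh. apply Cn2_div; auto.
  - apply Cn2_minus; auto using Cn2_exp, Cn2_opp.
  - apply Cn2_const, HU.
Qed.

(** * The profile curves *)

Definition half_plane (p : R * R) : Prop := 0 < fst p.

Lemma open_half_plane : open half_plane.
Proof. apply (open_strip (fun x => 0 < x)). apply open_gt. Qed.

Lemma sinh_2a_pos a : 0 < a -> 0 < sinh (2 * a).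
Proof. intros. apply sinh_pos. lra. Qed.

Lemma cosh_2a_gt a : 0 < a -> 1 < cosh (2 * a).
Proof.
  intros Ha. pose proof (sinh_2a_pos a Ha). pose proof (cosh2_sinh2 (2 * a)).
  pose proof (cosh_ge_1 (2 * a)). nra.
Qed.

Lemma cosh_prod_gt a s : 0 < a -> 1 < cosh (2 * a) * cosh (2 * s).
Proof. intros Ha. pose proof (cosh_2a_gt a Ha). pose proof (cosh_ge_1 (2 * s)). nra. Qed.

Lemma Cn2_cosh_prod n : Cn2 n half_plane (fun a s => cosh (2 * a) * cosh (2 * s)).
Proof.
  pose proof open_half_plane as HO.
  apply Cn2_mult; auto; apply Cn2_cosh; auto; apply Cn2_mult; auto using Cn2_const.
  - apply Cn2_fst, HO.
  - apply Cn2_snd, HO.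
Qed.

Lemma y0_smooth : smooth2 half_plane y0.
Proof.
  intros n. pose proof open_half_plane as HO. pose proof (Cn2_cosh_prod n) as HP.
  unfold y0, arccosh.
  assert (Hs : Cn2 n half_plane (fun a s => sqrt ((cosh (2 * a) * cosh (2 * s)) ^ 2 - 1))).
  { apply Cn2_sqrt; auto.
    - intros a s Ha. pose proof (cosh_prod_gt a s Ha). nra.
    - apply Cn2_minus; auto using Cn2_const. simpl. apply Cn2_mult; auto.
      apply Cn2_mult; auto using Cn2_const. }
  apply Cn2_mult; auto using Cn2_const. apply Cn2_ln; auto using Cn2_plus.
  intros a s Ha. pose proof (cosh_prod_gt a s Ha).
  pose proof (sqrt_pos ((cosh (2 * a) * cosh (2 * s)) ^ 2 - 1)). lra.
Qed.

Lemma J0_smooth : smooth2 half_plane J0.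
Proof.
  intros n. pose proof open_half_plane as HO. pose proof (Cn2_cosh_prod n) as HP.
  unfold J0. apply Cn2_div; auto.
  - intros a s Ha. pose proof (cosh_prod_gt a s Ha).
    apply Rmult_integral_contrapositive. split; [lra|].
    apply Rgt_not_eq, sqrt_lt_R0. lra.
  - apply Cn2_sinh; auto. apply Cn2_mult; auto using Cn2_const, Cn2_fst.
  - apply Cn2_mult; auto using Cn2_plus, Cn2_const.
    apply Cn2_sqrt; auto using Cn2_minus, Cn2_const.
    intros a s Ha. pose proof (cosh_prod_gt a s Ha). lra.
Qed.

Lemma Lambda0_smooth : smooth2 half_plane Lambda0.
Proof.
  intros n. pose proof open_half_plane as HO. unfold Lambda0.
  apply Cn2_mult; auto using Cn2_const.
  apply (Cn2_RInt (fun x => 0 < x)); [apply open_gt|apply J0_smooth].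
Qed.

Lemma e0_smooth : smooth2 half_plane e0.
Proof.
  intros n. pose proof open_half_plane as HO. unfold e0.
  apply Cn2_mult; [exact HO|apply Cn2_cosh; [exact HO|apply y0_smooth]|].
  apply Cn2_minus; [exact HO| |]; apply Cn2_mult; auto;
    apply smooth2_pd2; auto using y0_smooth, Lambda0_smooth.
Qed.

Lemma Lambda0_derive_a a s : 0 < a ->
  is_derive (fun b => Lambda0 b s) a (sqrt 2 * RInt (pd2 0 J0 a) 0 s).
Proof.
  intros Ha. unfold Lambda0.
  apply (is_derive_scal (fun b => RInt (fun t => J0 b t) 0 s)).
  apply (is_derive_RInt_strip (fun x => 0 < x)); [apply open_gt|apply J0_smooth|exact Ha].
Qed.

(** [slope a s] and [speed a s] are the components of the velocity of the
    catenary, which is parametrized by arc length. *)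
Definition slope (a s : R) : R :=
  cosh (2 * a) * sinh (2 * s) / (2 * sinh (y0 a s) * cosh (y0 a s)).
Definition speed (a s : R) : R :=
  sinh (2 * a) / (2 * cosh (y0 a s) ^ 2 * sinh (y0 a s)).
Definition y0_a (a s : R) : R :=
  sinh (2 * a) / cosh (2 * a) * (2 * sinh (y0 a s) ^ 2 + 1)
    / (2 * sinh (y0 a s) * cosh (y0 a s)).
Definition speed_a (a s : R) : R :=
  speed a s * (2 * cosh (2 * a) / sinh (2 * a)
    - sinh (2 * a) / cosh (2 * a) * (2 * sinh (y0 a s) ^ 2 + 1)
       * (/ cosh (y0 a s) ^ 2 + / (2 * sinh (y0 a s) ^ 2))).

Section Profile.

Variable a : R.
Hypothesis Ha : 0 < a.

Lemma y0_ge s : a <= y0 a s.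
Proof. apply y0_spec, Ha. Qed.

Lemma y0_pos s : 0 < y0 a s.
Proof. pose proof (y0_ge s). lra. Qed.

Lemma sinh_y0_pos s : 0 < sinh (y0 a s).
Proof. apply sinh_pos, y0_pos. Qed.

Lemma cosh_pos_1 x : 0 < cosh x.
Proof. pose proof (cosh_ge_1 x). lra. Qed.

(** In this form the defining relation of [y0] turns the functions attached to the
    catenary into algebraic expressions in
    [sinh (y0 a s)], [cosh (y0 a s)] and [slope]. *)
Lemma sinh_y0_sqr s : 2 * sinh (y0 a s) ^ 2 + 1 = cosh (2 * a) * cosh (2 * s).
Proof. rewrite <- cosh_double. apply y0_spec, Ha. Qed.

Lemma speed_pos s : 0 < speed a s.
Proof.
  unfold speed. pose proof (sinh_2a_pos a Ha). pose proof (sinh_y0_pos s).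
  pose proof (cosh_pos_1 (y0 a s)).
  apply Rdiv_lt_0_compat; [assumption|]. apply Rmult_lt_0_compat; nra.
Qed.

(** Clairaut's relation; its constant determines [a]. *)
Lemma speed_clairaut s :
  2 * speed a s * cosh (y0 a s) ^ 2 * sinh (y0 a s) = sinh (2 * a).
Proof.
  unfold speed. pose proof (sinh_y0_pos s). pose proof (cosh_pos_1 (y0 a s)).
  field. lra.
Qed.

Lemma profile_arclength s :
  slope a s ^ 2 + cosh (y0 a s) ^ 2 * speed a s ^ 2 = 1.
Proof.
  unfold slope, speed. pose proof (sinh_y0_pos s). pose proof (cosh_pos_1 (y0 a s)).
  pose proof (sinh_y0_sqr s). pose proof (cosh2_sinh2 (y0 a s)) as E1.
  pose proof (cosh2_sinh2 (2 * a)) as E2. pose proof (cosh2_sinh2 (2 * s)) as E3.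
  set (C := cosh (2 * a)) in *. set (S := sinh (2 * a)) in *.
  set (c := cosh (2 * s)) in *. set (sg := sinh (2 * s)) in *.
  set (ch := cosh (y0 a s)) in *. set (sh := sinh (y0 a s)) in *.
  apply Rmult_eq_reg_r with (4 * sh ^ 2 * ch ^ 2).
  2:{ apply Rgt_not_eq. assert (0 < sh ^ 2) by nra. nra. }
  transitivity ((C * sg) ^ 2 + S ^ 2).
  - field. lra.
  - replace ((C * sg) ^ 2) with ((C * c) ^ 2 - C ^ 2)
      by (replace ((C * sg) ^ 2) with (C ^ 2 * sg ^ 2) by ring;
          replace (sg ^ 2) with (c ^ 2 - 1) by lra; ring).
    rewrite <- H1. replace (S ^ 2) with (C ^ 2 - 1) by lra. rewrite E1. ring.
Qed.

Lemma sqrt_cosh_prod s :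
  sqrt (cosh (2 * a) * cosh (2 * s) - 1) = sqrt 2 * sinh (y0 a s).
Proof.
  rewrite <- sinh_y0_sqr. pose proof (sinh_y0_pos s).
  replace (2 * sinh (y0 a s) ^ 2 + 1 - 1) with (2 * (sinh (y0 a s)) ^ 2) by ring.
  rewrite sqrt_mult by nra. rewrite sqrt_pow2 by lra. reflexivity.
Qed.

Lemma J0_speed s : sqrt 2 * J0 a s = speed a s.
Proof.
  unfold J0, speed. rewrite sqrt_cosh_prod, <- sinh_y0_sqr.
  pose proof (cosh2_sinh2 (y0 a s)).
  replace (2 * sinh (y0 a s) ^ 2 + 1 + 1) with (2 * cosh (y0 a s) ^ 2) by lra.
  pose proof (sinh_y0_pos s). pose proof (cosh_pos_1 (y0 a s)).
  assert (0 < sqrt 2) by (apply sqrt_lt_R0; lra). field. lra.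
Qed.

Lemma sinh_2y0 s : sqrt ((cosh (2 * a) * cosh (2 * s)) ^ 2 - 1)
                   = 2 * sinh (y0 a s) * cosh (y0 a s).
Proof.
  pose proof (sinh_y0_pos s). pose proof (cosh_pos_1 (y0 a s)).
  rewrite <- sinh_y0_sqr, <- (cosh_double (y0 a s)), cosh2_sinh2.
  replace (1 + sinh (2 * y0 a s) ^ 2 - 1) with (sinh (2 * y0 a s) ^ 2) by ring.
  rewrite <- sinh_double. apply sqrt_pow2. rewrite sinh_double. nra.
Qed.

Lemma y0_derive s : is_derive (y0 a) s (slope a s).
Proof.
  pose proof (sinh_y0_pos s). pose proof (cosh_pos_1 (y0 a s)).
  unfold y0 at 1.
  replace (slope a s) with (/ 2 * ((cosh (2 * a) * (2 * sinh (2 * s)))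
     * / sqrt ((cosh (2 * a) * cosh (2 * s)) ^ 2 - 1))).
  2:{ rewrite sinh_2y0. unfold slope. field. lra. }
  apply (is_derive_scal (fun t => arccosh (cosh (2 * a) * cosh (2 * t)))).
  apply (is_derive_comp arccosh (fun t => cosh (2 * a) * cosh (2 * t))).
  - apply is_derive_arccosh, cosh_prod_gt, Ha.
  - apply (is_derive_scal (fun t => cosh (2 * t))).
    apply (is_derive_comp cosh (fun t => 2 * t)); [apply is_derive_cosh|].
    auto_derive; [exact I|ring].
Qed.

Lemma y0_derive_a s : is_derive (fun b => y0 b s) a (y0_a a s).
Proof.
  pose proof (sinh_y0_pos s). pose proof (cosh_pos_1 (y0 a s)).
  pose proof (cosh_pos_1 (2 * a)).
  unfold y0.
  replace (y0_a a s) with (/ 2 * (((2 * sinh (2 * a)) * cosh (2 * s))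
     * / sqrt ((cosh (2 * a) * cosh (2 * s)) ^ 2 - 1))).
  2:{ rewrite sinh_2y0. unfold y0_a. rewrite sinh_y0_sqr. field. lra. }
  apply (is_derive_scal (fun b => arccosh (cosh (2 * b) * cosh (2 * s)))).
  apply (is_derive_comp arccosh (fun b => cosh (2 * b) * cosh (2 * s))).
  - apply is_derive_arccosh, cosh_prod_gt, Ha.
  - apply (is_derive_scal_r (fun b => cosh (2 * b))).
    apply (is_derive_comp cosh (fun t => 2 * t)); [apply is_derive_cosh|].
    auto_derive; [exact I|ring].
Qed.

Lemma Lambda0_derive s : is_derive (Lambda0 a) s (speed a s).
Proof.
  rewrite <- J0_speed. unfold Lambda0.
  assert (Hc : forall t, continuity_pt (J0 a) t).
  { intros t. apply continuity_2d_pt_snd, smooth2_continuity with half_plane;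
      auto using open_half_plane, J0_smooth. }
  apply (is_derive_scal (fun t => RInt (J0 a) 0 t)).
  apply (is_derive_RInt (J0 a) (RInt (J0 a) 0) 0 s).
  - apply filter_forall. intros v. apply (RInt_correct (J0 a) 0 v), ex_RInt_cont, Hc.
  - apply continuity_pt_filterlim, Hc.
Qed.

Lemma cosh_y0_derive s : is_derive (fun t => cosh (y0 a t)) s (sinh (y0 a s) * slope a s).
Proof.
  rewrite Rmult_comm.
  apply (is_derive_comp cosh (y0 a)); [apply is_derive_cosh|apply y0_derive].
Qed.

Lemma sinh_y0_derive s : is_derive (fun t => sinh (y0 a t)) s (cosh (y0 a s) * slope a s).
Proof.
  rewrite Rmult_comm.
  apply (is_derive_comp sinh (y0 a)); [apply is_derive_sinh|apply y0_derive].
Qed.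

Lemma speed_derive s : is_derive (speed a) s
  (- speed a s * slope a s * (2 * sinh (y0 a s) / cosh (y0 a s)
                              + cosh (y0 a s) / sinh (y0 a s))).
Proof.
  pose proof (sinh_y0_pos s). pose proof (cosh_pos_1 (y0 a s)).
  unfold speed at 1. 
  auto_derive.
  - assert (ex_derive (fun x => y0 a x) s) by (eexists; apply y0_derive).
    repeat split; auto. apply Rgt_not_eq; unfold Rgt. pos.
  - rewrite (is_derive_unique (fun t : R => y0 a t) s _ (y0_derive s)).
    unfold speed. field. lra.
Qed.

Lemma slope_derive s : is_derive (slope a) s
  (speed a s ^ 2 * cosh (y0 a s) / sinh (y0 a s)
     * (cosh (y0 a s) ^ 2 + sinh (y0 a s) ^ 2)).
Proof.
  pose proof (sinh_y0_pos s). pose proof (cosh_pos_1 (y0 a s)).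
  pose proof (profile_arclength s) as E. pose proof (sinh_y0_sqr s) as E1.
  pose proof (cosh2_sinh2 (y0 a s)) as E2.
  assert (D : is_derive (slope a) s
    ((2 * (cosh (2 * a) * cosh (2 * s)) - slope a s * 2 * slope a s
        * (cosh (y0 a s) ^ 2 + sinh (y0 a s) ^ 2)) / (2 * sinh (y0 a s) * cosh (y0 a s)))).
  { unfold slope at 1. auto_derive.
    - assert (ex_derive (fun x => y0 a x) s) by (eexists; apply y0_derive).
      repeat split; auto. apply Rgt_not_eq; unfold Rgt. pos.
    - rewrite (is_derive_unique (fun t : R => y0 a t) s _ (y0_derive s)).
      unfold slope. field. lra. }
  replace (speed a s ^ 2 * cosh (y0 a s) / sinh (y0 a s)
     * (cosh (y0 a s) ^ 2 + sinh (y0 a s) ^ 2)) with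
   ((2 * (cosh (2 * a) * cosh (2 * s)) - slope a s * 2 * slope a s
        * (cosh (y0 a s) ^ 2 + sinh (y0 a s) ^ 2)) / (2 * sinh (y0 a s) * cosh (y0 a s)));
   [exact D|].
  rewrite <- E1.
  replace (slope a s * 2 * slope a s) with (2 - 2 * cosh (y0 a s) ^ 2 * speed a s ^ 2) by lra.
  rewrite E2. field_simplify_eq; [|lra].
  replace (cosh (y0 a s) ^ 3) with (cosh (y0 a s) * cosh (y0 a s) ^ 2) by ring.
  try rewrite E2. ring.
Qed.

End Profile.

(** * Jacobi fields *)

(** [|A|^2 + Ric (N, N)] on the catenoid. *)
Definition potential (a s : R) : R :=
  2 * (cosh (y0 a s) ^ 2 * speed a s / sinh (y0 a s)) ^ 2 - 2.

(** The normal component of the Killing field of the translations along the axis. *)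
Definition v0 (a s : R) : R := cosh (y0 a s) * slope a s.
Definition v0_s (a s : R) : R :=
  sinh (y0 a s) * slope a s ^ 2
  + speed a s ^ 2 * cosh (y0 a s) ^ 2 / sinh (y0 a s)
      * (cosh (y0 a s) ^ 2 + sinh (y0 a s) ^ 2).
Definition Lambda0_a (a s : R) : R := pd2 0 Lambda0 a s.
Definition e0_s (a s : R) : R :=
  - (sinh (2 * a) ^ 2 / (2 * cosh (2 * a))) * slope a s
     * (cosh (y0 a s) / sinh (y0 a s) ^ 3 + sinh (y0 a s) / cosh (y0 a s) ^ 3)
  - v0 a s * speed_a a s - v0_s a s * Lambda0_a a s.

Section JacobiFields.

Variable a : R.
Hypothesis Ha : 0 < a.

Lemma speed_derive_a s : is_derive (fun b => speed b s) a (speed_a a s).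
Proof.
  pose proof (sinh_y0_pos a Ha s). pose proof (cosh_pos_1 (y0 a s)).
  pose proof (cosh_pos_1 (2 * a)). pose proof (sinh_2a_pos a Ha).
  unfold speed at 1. auto_derive.
  - assert (ex_derive (fun x => y0 x s) a) by (eexists; apply y0_derive_a, Ha).
    repeat split; auto. apply Rgt_not_eq; unfold Rgt. pos.
  - rewrite (is_derive_unique (fun t : R => y0 t s) a _ (y0_derive_a a Ha s)).
    unfold speed_a, speed, y0_a. field. lra.
Qed.

Lemma Lambda0_a_RInt s : Lambda0_a a s = sqrt 2 * RInt (pd2 0 J0 a) 0 s.
Proof. apply is_derive_unique, Lambda0_derive_a, Ha. Qed.

Lemma pd2_0_J0 s : sqrt 2 * pd2 0 J0 a s = speed_a a s.
Proof.
  rewrite <- (is_derive_unique _ _ _ (speed_derive_a s)). unfold pd2.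
  rewrite <- Derive_scal. apply Derive_ext_loc.
  exists (mkposreal a Ha). simpl. intros b Hb. change (Rabs (b - a) < a) in Hb.
  apply Rabs_lt_between in Hb. apply J0_speed. lra.
Qed.

Lemma pd2_0_J0_cont t : continuity_pt (pd2 0 J0 a) t.
Proof.
  apply continuity_2d_pt_snd, smooth2_continuity with half_plane;
    auto using open_half_plane. apply (smooth2_pd2 _ _ 0), J0_smooth.
Qed.

Lemma Lambda0_a_derive s : is_derive (Lambda0_a a) s (speed_a a s).
Proof.
  rewrite <- pd2_0_J0.
  apply is_derive_ext with (fun t => sqrt 2 * RInt (pd2 0 J0 a) 0 t).
  { intros t. symmetry. apply Lambda0_a_RInt. }
  apply (is_derive_scal (fun t => RInt (pd2 0 J0 a) 0 t)).
  apply (is_derive_RInt (pd2 0 J0 a) (RInt (pd2 0 J0 a) 0) 0 s).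
  - apply filter_forall. intros v. apply (RInt_correct (pd2 0 J0 a) 0 v), ex_RInt_cont.
    apply pd2_0_J0_cont.
  - apply continuity_pt_filterlim, pd2_0_J0_cont.
Qed.

(** Only the second term is transcendental, and it is [v0] times a primitive. The
    Jacobi equation of [e0] thereby becomes an identity between rational functions. *)
Lemma e0_decomp s : e0 a s =
  sinh (2 * a) ^ 2 / (4 * cosh (2 * a))
    * (/ sinh (y0 a s) ^ 2 + / cosh (y0 a s) ^ 2)
  - v0 a s * Lambda0_a a s.
Proof.
  pose proof (sinh_y0_pos a Ha s). pose proof (cosh_pos_1 (y0 a s)).
  pose proof (cosh_pos_1 (2 * a)).
  unfold e0. change (pd2 1 Lambda0 a s) with (Derive (Lambda0 a) s).
  change (pd2 0 Lambda0 a s) with (Lambda0_a a s).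
  change (pd2 1 y0 a s) with (Derive (y0 a) s).
  change (pd2 0 y0 a s) with (Derive (fun b => y0 b s) a).
  rewrite (is_derive_unique _ _ _ (Lambda0_derive a Ha s)),
    (is_derive_unique _ _ _ (y0_derive a Ha s)),
    (is_derive_unique (fun b : R => y0 b s) a _ (y0_derive_a a Ha s)).
  pose proof (cosh2_sinh2 (y0 a s)) as E.
  unfold v0, y0_a, speed. 
  replace (2 * sinh (y0 a s) ^ 2 + 1) with (cosh (y0 a s) ^ 2 + sinh (y0 a s) ^ 2) by lra.
  field. lra.
Qed.

Lemma v0_derive s : is_derive (v0 a) s (v0_s a s).
Proof.
  pose proof (sinh_y0_pos a Ha s). pose proof (cosh_pos_1 (y0 a s)).
  replace (v0_s a s) with (sinh (y0 a s) * slope a s * slope a s + cosh (y0 a s)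
    * (speed a s ^ 2 * cosh (y0 a s) / sinh (y0 a s)
     * (cosh (y0 a s) ^ 2 + sinh (y0 a s) ^ 2))) by (unfold v0_s; field; lra).
  apply (is_derive_mult (fun t => cosh (y0 a t)) (slope a)).
  - apply cosh_y0_derive, Ha.
  - apply slope_derive, Ha.
  - intros; apply Rmult_comm.
Qed.

End JacobiFields.

Ltac derive_profile a Ha s :=
  assert (ex_derive (fun x => y0 a x) s) by (eexists; apply y0_derive, Ha);
  assert (ex_derive (fun x => slope a x) s) by (eexists; apply slope_derive, Ha);
  assert (ex_derive (fun x => speed a x) s) by (eexists; apply speed_derive, Ha);
  assert (ex_derive (fun x => Lambda0 a x) s) by (eexists; apply Lambda0_derive, Ha);
  assert (ex_derive (fun x => Lambda0_a a x) s) by (eexists; apply Lambda0_a_derive, Ha);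
  auto_derive;
  [ repeat split; auto; apply Rgt_not_eq; unfold Rgt; pos
  | rewrite ?(is_derive_unique (fun t : R => y0 a t) s _ (y0_derive a Ha s)),
      ?(is_derive_unique (fun t : R => slope a t) s _ (slope_derive a Ha s)),
      ?(is_derive_unique (fun t : R => speed a t) s _ (speed_derive a Ha s)),
      ?(is_derive_unique (fun t : R => Lambda0 a t) s _ (Lambda0_derive a Ha s)),
      ?(is_derive_unique (fun t : R => Lambda0_a a t) s _ (Lambda0_a_derive a Ha s)) ].

Section JacobiEquation.

Variable a : R.
Hypothesis Ha : 0 < a.

Lemma e0_derive s : is_derive (e0 a) s (e0_s a s).
Proof.
  pose proof (sinh_y0_pos a Ha s). pose proof (cosh_pos_1 (y0 a s)).
  pose proof (cosh_pos_1 (2 * a)).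
  eapply is_derive_ext; [intros t; symmetry; apply (e0_decomp a Ha)|].
  unfold v0. derive_profile a Ha s. unfold e0_s, v0, v0_s. field. lra.
Qed.

(** Killing fields induce solutions of the Jacobi equation
    [(f h')' + (|A|^2 + Ric) f h = 0], where [f = sinh y0] is the radius of the parallel
    circles. Here and below this is checked modulo the relations between [slope],
    [speed] and the hyperbolic functions. *)
Lemma v0_jacobi s :
  is_derive (fun t => sinh (y0 a t) * v0_s a t) s
    (- potential a s * sinh (y0 a s) * v0 a s).
Proof.
  pose proof (sinh_y0_pos a Ha s). pose proof (cosh_pos_1 (y0 a s)).
  unfold v0_s. derive_profile a Ha s. unfold potential, v0.
  pose proof (profile_arclength a Ha s) as E1. pose proof (cosh2_sinh2 (y0 a s)) as E2.
  assert (E3 : slope a s ^ 2 = 1 - cosh (y0 a s) ^ 2 * speed a s ^ 2) by lra.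
  field_simplify_eq; [|lra]. ring [E3 E2].
Qed.

(** Two solutions of a Sturm-Liouville equation have a constant Wronskian; it is
    evaluated here from the explicit formulas. *)
Lemma wronskian s :
  sinh (y0 a s) * (e0_s a s * v0 a s - e0 a s * v0_s a s) = - cosh (2 * a).
Proof.
  pose proof (sinh_y0_pos a Ha s). pose proof (cosh_pos_1 (y0 a s)).
  pose proof (cosh_pos_1 (2 * a)). pose proof (sinh_2a_pos a Ha).
  rewrite (e0_decomp a Ha). unfold e0_s, v0_s, v0, speed_a.
  pose proof (cosh2_sinh2 (2 * a)) as E4. pose proof (speed_clairaut a Ha s) as E5.
  pose proof (profile_arclength a Ha s) as E1.
  pose proof (cosh2_sinh2 (y0 a s)) as E2.
  set (p := slope a s) in *. set (q := speed a s) in *.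
  set (ch := cosh (y0 a s)) in *. set (sh := sinh (y0 a s)) in *.
  set (C := cosh (2 * a)) in *. rewrite <- E5 in *. clear E5.
  assert (0 < q) by (apply speed_pos, Ha).
  assert (E3 : p ^ 2 = 1 - ch ^ 2 * q ^ 2) by lra.
  field_simplify_eq; [|repeat split; lra]. ring [E3 E2 E4].
Qed.

(** The variation of the family of catenoids is a Jacobi field too. *)
Lemma e0_jacobi s :
  is_derive (fun t => sinh (y0 a t) * e0_s a t) s
    (- potential a s * sinh (y0 a s) * e0 a s).
Proof.
  pose proof (sinh_y0_pos a Ha s). pose proof (cosh_pos_1 (y0 a s)).
  pose proof (cosh_pos_1 (2 * a)). pose proof (sinh_2a_pos a Ha).
  rewrite (e0_decomp a Ha). unfold e0_s, v0_s, v0, speed_a. derive_profile a Ha s.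
  unfold potential, speed_a.
  pose proof (cosh2_sinh2 (2 * a)) as E4. pose proof (speed_clairaut a Ha s) as E5.
  pose proof (profile_arclength a Ha s) as E1. pose proof (cosh2_sinh2 (y0 a s)) as E2.
  assert (0 < speed a s) by (apply speed_pos, Ha).
  set (p := slope a s) in *. set (q := speed a s) in *.
  set (L := Lambda0_a a s) in *.
  set (ch := cosh (y0 a s)) in *. set (sh := sinh (y0 a s)) in *.
  set (C := cosh (2 * a)) in *. rewrite <- E5 in *. clear E5.
  assert (E3 : p ^ 2 = 1 - ch ^ 2 * q ^ 2) by lra.
  field_simplify_eq; [|repeat split; lra]. ring [E3 E2 E4].
Qed.

End JacobiEquation.

(** * Zeros of the Jacobi field [e0] *)

Lemma Lambda0_0 a : Lambda0 a 0 = 0.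
Proof. unfold Lambda0. rewrite RInt_point. apply Rmult_0_r. Qed.

Lemma y0_even a s : y0 a (- s) = y0 a s.
Proof. unfold y0. rewrite Ropp_mult_distr_r_reverse, cosh_opp. reflexivity. Qed.

Section Zeros.

Variable a : R.
Hypothesis Ha : 0 < a.

Lemma slope_odd s : slope a (- s) = - slope a s.
Proof.
  pose proof (sinh_y0_pos a Ha s). pose proof (cosh_pos_1 (y0 a s)).
  unfold slope. rewrite y0_even, Ropp_mult_distr_r_reverse, sinh_opp. field. lra.
Qed.

Lemma speed_even s : speed a (- s) = speed a s.
Proof. unfold speed. rewrite y0_even. reflexivity. Qed.

Lemma Lambda0_odd s : Lambda0 a (- s) = - Lambda0 a s.
Proof.
  assert (D : forall x, is_derive (fun t => Lambda0 a t + Lambda0 a (- t)) x 0).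
  { intros x. replace 0 with (speed a x + -1 * speed a (- x)) by (rewrite speed_even; ring).
    apply (is_derive_plus (Lambda0 a) (fun t => Lambda0 a (- t))).
    - apply Lambda0_derive, Ha.
    - apply (is_derive_comp (Lambda0 a) Ropp); [apply Lambda0_derive, Ha|].
      auto_derive; [exact I|ring]. }
  assert (E : Lambda0 a s + Lambda0 a (- s) = Lambda0 a 0 + Lambda0 a (- 0)).
  { destruct (Rle_dec 0 s).
    - symmetry. apply (derive_zero_const (fun t => Lambda0 a t + Lambda0 a (- t)) 0 s); auto.
    - apply (derive_zero_const (fun t => Lambda0 a t + Lambda0 a (- t)) s 0); auto. lra. }
  rewrite Ropp_0, Lambda0_0 in E. lra.
Qed.

Lemma slope_pos s : 0 < s -> 0 < slope a s.
Proof.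
  intros Hs. pose proof (sinh_y0_pos a Ha s). pose proof (cosh_pos_1 (y0 a s)).
  pose proof (cosh_pos_1 (2 * a)). assert (0 < sinh (2 * s)) by (apply sinh_pos; lra).
  unfold slope. pos.
Qed.

Lemma v0_pos s : 0 < s -> 0 < v0 a s.
Proof.
  intros Hs. pose proof (slope_pos s Hs). pose proof (cosh_pos_1 (y0 a s)).
  unfold v0. pos.
Qed.

Lemma slope_incr s t : s < t -> slope a s < slope a t.
Proof.
  intros Hst. eapply derive_pos_incr; [exact Hst| | |].
  - intros x _. apply slope_derive, Ha.
  - intros x _. cbv beta. pose proof (sinh_y0_pos a Ha x). pose proof (cosh_pos_1 (y0 a x)).
    pose proof (speed_pos a Ha x).
    assert (0 < cosh (y0 a x) ^ 2 + sinh (y0 a x) ^ 2) by nra. pos.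
  - intros x _. eapply is_derive_cont, slope_derive, Ha.
Qed.

Lemma Lambda0_incr s t : s < t -> Lambda0 a s < Lambda0 a t.
Proof.
  intros Hst. eapply derive_pos_incr; [exact Hst| | |].
  - intros x _. apply Lambda0_derive, Ha.
  - intros x _. apply speed_pos, Ha.
  - intros x _. eapply is_derive_cont, Lambda0_derive, Ha.
Qed.

Lemma Lambda0_inj s t : Lambda0 a s = Lambda0 a t -> s = t.
Proof.
  intros E. destruct (Rtotal_order s t) as [H|[H|H]]; [|exact H|];
    apply Lambda0_incr in H; lra.
Qed.

Lemma Lambda0_lt_iff s t : Lambda0 a s < Lambda0 a t <-> s < t.
Proof.
  split; [|apply Lambda0_incr]. intros H.
  destruct (Rtotal_order s t) as [L|[L|L]]; [exact L|subst; lra|].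
  apply Lambda0_incr in L. lra.
Qed.

Lemma Lambda0_pos s : 0 < s -> 0 < Lambda0 a s.
Proof. intros H. rewrite <- (Lambda0_0 a). apply Lambda0_incr, H. Qed.

Lemma sinh_y0_ge s : s ^ 2 <= sinh (y0 a s) ^ 2.
Proof.
  pose proof (sinh_y0_sqr a Ha s). pose proof (cosh_quadratic (2 * s)).
  pose proof (cosh_ge_1 (2 * a)). nra.
Qed.

(** Comparison with the derivative of [atan]: [Lambda0 a] is bounded. *)
Lemma speed_bound s : speed a s <= sinh (2 * a) / (2 * sinh a) * / (1 + s ^ 2).
Proof.
  pose proof (sinh_y0_ge s). pose proof (cosh2_sinh2 (y0 a s)).
  pose proof (sinh_le _ _ (y0_ge a Ha s)). pose proof (sinh_pos a Ha).
  pose proof (sinh_2a_pos a Ha).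
  pose proof (pow2_ge_0 s).
  replace (sinh (2 * a) / (2 * sinh a) * / (1 + s ^ 2)) with
    (sinh (2 * a) * / (2 * (1 + s ^ 2) * sinh a)) by (field; lra).
  unfold speed, Rdiv. apply Rmult_le_compat_l; [lra|]. apply Rinv_le_contravar; [pos|].
  apply Rmult_le_compat; nra.
Qed.

Lemma Lambda0_bound s : 0 <= s -> Lambda0 a s <= sinh (2 * a) / (2 * sinh a) * 2.
Proof.
  intros Hs. set (K := sinh (2 * a) / (2 * sinh a)).
  pose proof (sinh_pos a Ha). pose proof (sinh_2a_pos a Ha).
  assert (HK : 0 < K) by (unfold K; pos).
  assert (E : Lambda0 a s <= K * atan s).
  { destruct (MVT_gen (fun t => K * atan t - Lambda0 a t) 0 s
      (fun t => K * / (1 + t ^ 2) - speed a t)) as [c [Hc E]].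
    - intros x _. apply (is_derive_minus (fun t => K * atan t) (Lambda0 a)).
      + apply (is_derive_scal atan). apply is_derive_Reals, derivable_pt_lim_atan.
      + apply Lambda0_derive, Ha.
    - intros x _. apply (continuity_pt_minus (fun t => K * atan t) (Lambda0 a)).
      + apply (continuity_pt_scal atan). apply derivable_continuous_pt, derivable_pt_atan.
      + eapply is_derive_cont, Lambda0_derive, Ha.
    - rewrite Lambda0_0, atan_0 in E. pose proof (speed_bound c). fold K in H1.
      assert (0 <= (K * / (1 + c ^ 2) - speed a c) * (s - 0)) by (apply Rmult_le_pos; lra).
      lra. }
  pose proof (atan_bound s). pose proof PI_4. nra.
Qed.

(** In the formula for [speed_a] the negative term is dropped; an upper bound
    suffices, because [ratio] is decreasing and only needs a lower bound. *)
Lemma Lambda0_a_bound s : 0 <= s ->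
  Lambda0_a a s <= 2 * cosh (2 * a) / sinh (2 * a) * Lambda0 a s.
Proof.
  intros Hs. set (K := 2 * cosh (2 * a) / sinh (2 * a)).
  destruct (MVT_gen (fun t => K * Lambda0 a t - Lambda0_a a t) 0 s
      (fun t => K * speed a t - speed_a a t)) as [c [Hc E]].
  - intros x _. apply (is_derive_minus (fun t => K * Lambda0 a t) (Lambda0_a a)).
    + apply (is_derive_scal (Lambda0 a)), Lambda0_derive, Ha.
    + apply Lambda0_a_derive, Ha.
  - intros x _. apply (continuity_pt_minus (fun t => K * Lambda0 a t) (Lambda0_a a)).
    + apply (continuity_pt_scal (Lambda0 a)). eapply is_derive_cont, Lambda0_derive, Ha.
    + eapply is_derive_cont, Lambda0_a_derive, Ha.
  - assert (Lambda0_a a 0 = 0).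
    { rewrite Lambda0_a_RInt by exact Ha. rewrite RInt_point. apply Rmult_0_r. }
    rewrite Lambda0_0, H in E.
    assert (0 <= K * speed a c - speed_a a c).
    { unfold speed_a. fold K. pose proof (sinh_y0_pos a Ha c). pose proof (cosh_pos_1 (y0 a c)).
      pose proof (cosh_pos_1 (2 * a)). pose proof (sinh_2a_pos a Ha).
      assert (0 < speed a c) by (apply speed_pos, Ha).
      set (X := sinh (2 * a) / cosh (2 * a) * (2 * sinh (y0 a c) ^ 2 + 1) *
        (/ cosh (y0 a c) ^ 2 + / (2 * sinh (y0 a c) ^ 2))).
      assert (0 < X).
      { unfold X. apply Rmult_lt_0_compat; [apply Rmult_lt_0_compat; [pos|nra]|].
        apply Rplus_lt_0_compat; pos. }
      replace (K * speed a c - speed a c * (K - X)) with (speed a c * X) by ring. nra. }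
    assert (0 <= (K * speed a c - speed_a a c) * (s - 0)) by (apply Rmult_le_pos; lra).
    lra.
Qed.

Lemma e0_expr s : e0 a s =
  cosh (y0 a s) * (speed a s * y0_a a s - Lambda0_a a s * slope a s).
Proof.
  unfold e0. change (pd2 1 Lambda0 a s) with (Derive (Lambda0 a) s).
  change (pd2 1 y0 a s) with (Derive (y0 a) s).
  change (pd2 0 y0 a s) with (Derive (fun b => y0 b s) a).
  rewrite (is_derive_unique _ _ _ (Lambda0_derive a Ha s)),
    (is_derive_unique _ _ _ (y0_derive a Ha s)),
    (is_derive_unique (fun b : R => y0 b s) a _ (y0_derive_a a Ha s)). reflexivity.
Qed.

Lemma Lambda0_a_odd s : Lambda0_a a (- s) = - Lambda0_a a s.
Proof.
  assert (D : forall x, is_derive (fun t => Lambda0_a a t + Lambda0_a a (- t)) x 0).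
  { intros x. replace 0 with (speed_a a x + -1 * speed_a a (- x))
      by (unfold speed_a; rewrite speed_even, y0_even; ring).
    apply (is_derive_plus (Lambda0_a a) (fun t => Lambda0_a a (- t))).
    - apply Lambda0_a_derive, Ha.
    - apply (is_derive_comp (Lambda0_a a) Ropp); [apply Lambda0_a_derive, Ha|].
      auto_derive; [exact I|ring]. }
  assert (E : Lambda0_a a s + Lambda0_a a (- s) = Lambda0_a a 0 + Lambda0_a a (- 0)).
  { destruct (Rle_dec 0 s).
    - symmetry. apply (derive_zero_const (fun t => Lambda0_a a t + Lambda0_a a (- t)) 0 s); auto.
    - apply (derive_zero_const (fun t => Lambda0_a a t + Lambda0_a a (- t)) s 0); auto. lra. }
  assert (Lambda0_a a 0 = 0).
  { rewrite Lambda0_a_RInt by exact Ha. rewrite RInt_point. apply Rmult_0_r. }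
  rewrite Ropp_0 in E. lra.
Qed.

Lemma e0_even s : e0 a (- s) = e0 a s.
Proof.
  rewrite !e0_expr. unfold y0_a.
  rewrite Lambda0_a_odd, slope_odd, speed_even, y0_even. ring.
Qed.

Lemma v0_odd s : v0 a (- s) = - v0 a s.
Proof. unfold v0. rewrite slope_odd, y0_even. ring. Qed.

Lemma y0_a_pos s : 0 < y0_a a s.
Proof.
  pose proof (sinh_y0_pos a Ha s). pose proof (cosh_pos_1 (y0 a s)).
  pose proof (cosh_pos_1 (2 * a)). pose proof (sinh_2a_pos a Ha).
  unfold y0_a. assert (0 < 2 * sinh (y0 a s) ^ 2 + 1) by nra. pos.
Qed.

Lemma e0_0_pos : 0 < e0 a 0.
Proof.
  rewrite e0_expr. assert (slope a 0 = 0) as ->.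
  { unfold slope. rewrite Rmult_0_r, sinh_0. unfold Rdiv. ring. }
  pose proof (cosh_pos_1 (y0 a 0)). pose proof (speed_pos a Ha 0). pose proof (y0_a_pos 0).
  rewrite Rmult_0_r, Rminus_0_r. pos.
Qed.

(** The ratio of the two Jacobi fields decreases by the constancy of their
    Wronskian; its limit at infinity is computed by [E0]. *)
Definition ratio (s : R) : R := e0 a s / v0 a s.

Lemma ratio_derive s : 0 < s ->
  is_derive ratio s (- cosh (2 * a) / (sinh (y0 a s) * v0 a s ^ 2)).
Proof.
  intros Hs. pose proof (v0_pos s Hs). pose proof (sinh_y0_pos a Ha s).
  replace (- cosh (2 * a) / (sinh (y0 a s) * v0 a s ^ 2)) with
    ((e0_s a s * v0 a s - e0 a s * v0_s a s) / v0 a s ^ 2).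
  2:{ rewrite <- (wronskian a Ha s). field. lra. }
  apply (is_derive_div (e0 a) (v0 a)).
  - apply e0_derive, Ha.
  - apply v0_derive, Ha.
  - lra.
Qed.

Lemma ratio_decr s t : 0 < s -> s < t -> ratio t < ratio s.
Proof.
  intros Hs Hst. eapply derive_neg_decr; [exact Hst| | |].
  - intros x Hx. apply ratio_derive. lra.
  - intros x Hx. cbv beta. pose proof (v0_pos x ltac:(lra)). pose proof (sinh_y0_pos a Ha x).
    pose proof (cosh_pos_1 (2 * a)).
    assert (0 < cosh (2 * a) / (sinh (y0 a x) * v0 a x ^ 2)) by pos.
    unfold Rdiv in *. lra.
  - intros x Hx. eapply is_derive_cont, ratio_derive. lra.
Qed.

Lemma ratio_expr s : 0 < s -> ratio s = speed a s * y0_a a s / slope a s - Lambda0_a a s.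
Proof.
  intros Hs. unfold ratio, v0. rewrite e0_expr. pose proof (slope_pos s Hs).
  pose proof (cosh_pos_1 (y0 a s)). field. lra.
Qed.

Lemma e0_ratio s : 0 < s -> e0 a s = v0 a s * ratio s.
Proof. intros Hs. unfold ratio. pose proof (v0_pos s Hs). field. lra. Qed.

Lemma ratio_bounded_below : exists m, forall s, 0 < s -> m <= ratio s.
Proof.
  pose proof (cosh_pos_1 (2 * a)). pose proof (sinh_2a_pos a Ha).
  set (K := 2 * cosh (2 * a) / sinh (2 * a)).
  assert (0 < K) by (unfold K; pos).
  exists (- (K * (sinh (2 * a) / (2 * sinh a) * 2))). intros s Hs.
  rewrite ratio_expr by exact Hs. pose proof (Lambda0_a_bound s ltac:(lra)). fold K in H2.
  pose proof (Lambda0_bound s ltac:(lra)).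
  assert (0 < speed a s * y0_a a s / slope a s).
  { pose proof (speed_pos a Ha s). pose proof (y0_a_pos s). pose proof (slope_pos s Hs). pos. }
  assert (K * Lambda0 a s <= K * (sinh (2 * a) / (2 * sinh a) * 2)).
  { apply Rmult_le_compat_l; lra. }
  lra.
Qed.

Lemma ratio_limit : exists L, (forall s, 0 < s -> L < ratio s) /\
  forall eps, 0 < eps -> exists s0, 0 < s0 /\ forall s, s0 <= s -> ratio s < L + eps.
Proof.
  destruct ratio_bounded_below as [m Hm].
  destruct (completeness (fun x => exists s, 0 < s /\ x = - ratio s)) as [M [Hub Hlub]].
  - exists (- m). intros x [s [Hs ->]]. specialize (Hm s Hs). lra.
  - exists (- ratio 1), 1. split; [lra|reflexivity].
  - exists (- M). split.
    + intros s Hs. assert (- ratio (s + 1) <= M) by (apply Hub; exists (s + 1); split; [lra|auto]).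
      pose proof (ratio_decr s (s + 1) Hs ltac:(lra)). lra.
    + intros eps He. apply NNPP. intros N.
      assert (M <= M - eps); [|lra]. apply Hlub. intros x [s [Hs ->]].
      apply Rnot_lt_le. intros C. apply N. exists s. split; [exact Hs|].
      intros t [Ht| ->]; [pose proof (ratio_decr s t Hs Ht)|]; lra.
Qed.

Lemma speed_y0_a_bound s : 0 < s ->
  speed a s * y0_a a s <= sinh (2 * a) ^ 2 / (2 * cosh (2 * a)) * / s ^ 2.
Proof.
  intros Hs. pose proof (sinh_y0_pos a Ha s). pose proof (cosh_ge_1 (y0 a s)).
  pose proof (cosh_pos_1 (2 * a)). pose proof (sinh_2a_pos a Ha).
  pose proof (cosh2_sinh2 (y0 a s)). pose proof (sinh_y0_ge s).
  assert (0 < s ^ 2) by nra.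
  assert (0 < sinh (2 * a) ^ 2 / (2 * cosh (2 * a))) by pos.
  replace (speed a s * y0_a a s) with (sinh (2 * a) ^ 2 / (2 * cosh (2 * a)) *
    ((2 * sinh (y0 a s) ^ 2 + 1) / (2 * cosh (y0 a s) ^ 3 * sinh (y0 a s) ^ 2)))
    by (unfold speed, y0_a; field; lra).
  apply Rmult_le_compat_l; [lra|].
  apply Rle_trans with (/ sinh (y0 a s) ^ 2); [|apply Rinv_le_contravar; lra].
  apply Rmult_le_reg_r with (2 * cosh (y0 a s) ^ 3 * sinh (y0 a s) ^ 2); [pos|].
  replace ((2 * sinh (y0 a s) ^ 2 + 1) / (2 * cosh (y0 a s) ^ 3 * sinh (y0 a s) ^ 2) *
    (2 * cosh (y0 a s) ^ 3 * sinh (y0 a s) ^ 2)) with (2 * sinh (y0 a s) ^ 2 + 1)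
    by (field; lra).
  replace (/ sinh (y0 a s) ^ 2 * (2 * cosh (y0 a s) ^ 3 * sinh (y0 a s) ^ 2)) with
    (2 * cosh (y0 a s) ^ 3) by (field; lra).
  replace (cosh (y0 a s) ^ 3) with (cosh (y0 a s) * cosh (y0 a s) ^ 2) by ring.
  rewrite H3. nra.
Qed.

Lemma is_RInt_gen_half_line f l :
  (forall t, continuity_pt f t) ->
  (forall eps, 0 < eps -> exists s0, forall s, s0 <= s -> Rabs (RInt f 0 s - l) < eps) ->
  is_RInt_gen f (at_point 0) (Rbar_locally p_infty) l.
Proof.
  intros Hc Hl P [eps HP].
  destruct (Hl eps (cond_pos eps)) as [s0 Hs0].
  apply (Filter_prod _ _ _ (fun x => x = 0) (fun x => s0 < x)).
  - reflexivity.
  - exists s0. auto.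
  - intros x y -> Hy. simpl. exists (RInt f 0 y). split.
    + apply (RInt_correct f 0 y), ex_RInt_cont, Hc.
    + apply HP. apply (Hs0 y). lra.
Qed.

(** Since [speed * y0_a / slope] tends to 0, the limit of [ratio] is that of
    [- Lambda0_a], that is [- sqrt 2 * E0 a]. The improper integral [E0] converges because
    [ratio] is monotone and bounded below. *)
Lemma E0_ratio : exists L, E0 a = - L / sqrt 2 /\ (forall s, 0 < s -> L < ratio s) /\
  forall eps, 0 < eps -> exists s0, 0 < s0 /\ forall s, s0 <= s -> ratio s < L + eps.
Proof.
  destruct ratio_limit as [L [HL1 HL2]]. exists L. split; [|split; assumption].
  assert (S2 : 0 < sqrt 2) by (apply sqrt_lt_R0; lra).
  unfold E0. apply is_RInt_gen_unique. apply is_RInt_gen_half_line.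
  - intros t. apply (pd2_0_J0_cont a Ha t).
  - intros eps He.
    destruct (HL2 (sqrt 2 * eps / 2)) as [s0 [Hs0 H0]]; [pos|].
    set (K := sinh (2 * a) ^ 2 / (2 * cosh (2 * a)) / slope a 1).
    pose proof (cosh_pos_1 (2 * a)). pose proof (sinh_2a_pos a Ha).
    pose proof (slope_pos 1 ltac:(lra)) as Hsl.
    assert (HK : 0 < K) by (unfold K; pos).
    set (e := sqrt 2 * eps / 2). assert (Hepos : 0 < e) by (unfold e; pos).
    exists (Rmax (Rmax s0 2) (K / e + 2)). intros s Hs.
    pose proof (Rmax_l (Rmax s0 2) (K / e + 2)). pose proof (Rmax_r (Rmax s0 2) (K / e + 2)).
    pose proof (Rmax_l s0 2). pose proof (Rmax_r s0 2).
    specialize (H0 s ltac:(lra)). specialize (HL1 s ltac:(lra)).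
    rewrite ratio_expr in H0, HL1 by lra.
    assert (B : 0 <= speed a s * y0_a a s / slope a s < e).
    { pose proof (speed_pos a Ha s). pose proof (y0_a_pos s).
      pose proof (slope_incr 1 s ltac:(lra)).
      split; [left; pos|].
      apply Rle_lt_trans with (K * / s ^ 2).
      - unfold K. replace (sinh (2 * a) ^ 2 / (2 * cosh (2 * a)) / slope a 1 * / s ^ 2)
          with (sinh (2 * a) ^ 2 / (2 * cosh (2 * a)) * / s ^ 2 * / slope a 1)
          by (field; lra).
        apply Rmult_le_compat; try (left; pos; fail).
        + apply speed_y0_a_bound. lra.
        + apply Rinv_le_contravar; lra.
      - assert (Hks : K / e < s) by lra.
        assert (K < s * e).
        { apply Rmult_lt_reg_r with (/ e); [pos|].
          replace (s * e * / e) with s by (field; lra). exact Hks. }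
        apply Rmult_lt_reg_r with (s ^ 2); [pos|].
        rewrite Rmult_assoc, Rinv_l by (apply Rgt_not_eq; unfold Rgt; pos). nra. }
    rewrite (Lambda0_a_RInt a Ha) in H0, HL1.
    change (fun t : R => pd2 0 J0 a t) with (pd2 0 J0 a).
    set (I := RInt (pd2 0 J0 a) 0 s) in *.
    assert (HI : Rabs (sqrt 2 * I - (- L)) < 2 * e).
    { fold e in H0. apply Rabs_def1; lra. }
    replace (I - - L / sqrt 2) with (/ sqrt 2 * (sqrt 2 * I - - L)) by (field; lra).
    rewrite Rabs_mult, Rabs_right by (apply Rle_ge; left; pos).
    apply Rmult_lt_reg_l with (sqrt 2); [lra|].
    rewrite <- Rmult_assoc, Rinv_r, Rmult_1_l by lra. unfold e in HI. lra.
Qed.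

(** A decreasing function with positive limit is positive. *)
Lemma e0_pos_stable : E0 a < 0 -> forall s, 0 < e0 a s.
Proof.
  intros HE. destruct E0_ratio as [L [EL [HL _]]].
  assert (S2 : 0 < sqrt 2) by (apply sqrt_lt_R0; lra).
  assert (0 < L).
  { rewrite EL in HE. apply Rmult_lt_reg_r with (/ sqrt 2); [pos|].
    unfold Rdiv in HE. lra. }
  assert (Hp : forall s, 0 < s -> 0 < e0 a s).
  { intros s Hs. rewrite e0_ratio by exact Hs. pose proof (v0_pos s Hs).
    specialize (HL s Hs). assert (0 < ratio s) by lra. pos. }
  intros s. destruct (Rtotal_order s 0) as [H1|[->|H1]].
  - rewrite <- e0_even. apply Hp. lra.
  - apply e0_0_pos.
  - apply Hp, H1.
Qed.

Lemma ratio_eventually_neg : 0 < E0 a ->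
  exists s0, 0 < s0 /\ forall s, s0 <= s -> ratio s < 0.
Proof.
  intros HE. destruct E0_ratio as [L [EL [_ HL]]].
  assert (S2 : 0 < sqrt 2) by (apply sqrt_lt_R0; lra).
  assert (L < 0).
  { rewrite EL in HE. apply Ropp_lt_cancel. rewrite Ropp_0.
    apply Rmult_lt_reg_r with (/ sqrt 2); [pos|]. unfold Rdiv in HE. lra. }
  destruct (HL (- L)) as [s0 [Hs0 H0]]; [lra|]. exists s0. split; [exact Hs0|].
  intros s Hs. specialize (H0 s Hs). lra.
Qed.

(** [ratio] decreases to a negative limit, while [e0 a 0 > 0]. *)
Lemma e0_zero : 0 < E0 a ->
  exists z, 0 < z /\ e0 a z = 0 /\ (forall s, Rabs s < z -> 0 < e0 a s) /\
    (forall s, z < Rabs s -> e0 a s < 0).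
Proof.
  intros HE. destruct (ratio_eventually_neg HE) as [s1 [Hs1 Hn]].
  assert (N1 : e0 a s1 < 0).
  { rewrite e0_ratio by exact Hs1. specialize (Hn s1 ltac:(lra)).
    pose proof (v0_pos s1 Hs1). nra. }
  destruct (IVT_signed (e0 a) 0 s1) as [z [Hz E]]; [lra| |pose proof e0_0_pos; nra|].
  { intros x _. eapply is_derive_cont, e0_derive, Ha. }
  assert (Hz0 : 0 < z).
  { destruct (proj1 Hz) as [H|H]; [exact H|]. subst z. pose proof e0_0_pos. lra. }
  assert (Rz : ratio z = 0) by (unfold ratio; rewrite E; unfold Rdiv; ring).
  assert (HA : forall s, e0 a s = e0 a (Rabs s)).
  { intros s. unfold Rabs. destruct Rcase_abs; [rewrite e0_even|]; reflexivity. }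
  exists z. repeat split; auto.
  - intros s Hs. rewrite HA. destruct (Rabs_pos s) as [P|P].
    + rewrite e0_ratio by exact P. pose proof (ratio_decr _ _ P Hs). pose proof (v0_pos _ P).
      rewrite Rz in H. pos.
    + rewrite <- P. apply e0_0_pos.
  - intros s Hs. rewrite HA. rewrite e0_ratio by lra.
    pose proof (ratio_decr _ _ Hz0 Hs). pose proof (v0_pos (Rabs s) ltac:(lra)).
    rewrite Rz in H. nra.
Qed.

Lemma e0_s_neg z : 0 < z -> e0 a z = 0 -> e0_s a z < 0.
Proof.
  intros Hz E. pose proof (wronskian a Ha z) as W. rewrite E in W.
  pose proof (v0_pos z Hz). pose proof (sinh_y0_pos a Ha z). pose proof (cosh_pos_1 (2 * a)).
  apply Rnot_le_lt. intros N.
  assert (0 <= sinh (y0 a z) * (e0_s a z * v0 a z)).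
  { apply Rmult_le_pos; [lra|]. apply Rmult_le_pos; lra. }
  lra.
Qed.

(** [v0] alone vanishes at 0; a small multiple of [e0], positive there, repairs this without
    spoiling the sign elsewhere, because [ratio] is bounded below. *)
Lemma half_line_positive : exists k, 0 < k /\ forall s, 0 <= s -> 0 < v0 a s + k * e0 a s.
Proof.
  destruct ratio_bounded_below as [m Hm].
  set (k := / (Rabs m + 1)). pose proof (Rabs_pos m).
  assert (Hk : 0 < k) by (unfold k; pos). exists k. split; [exact Hk|].
  intros s [Hs|Hs].
  - rewrite e0_ratio by exact Hs. specialize (Hm s Hs). pose proof (v0_pos s Hs).
    replace (v0 a s + k * (v0 a s * ratio s)) with (v0 a s * (1 + k * ratio s)) by ring.
    apply Rmult_lt_0_compat; [assumption|].
    assert (- Rabs m <= m) by (unfold Rabs; destruct Rcase_abs; lra).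
    assert (k * - Rabs m <= k * ratio s) by (apply Rmult_le_compat_l; lra).
    assert (k * (Rabs m + 1) = 1) by (unfold k; field; lra). nra.
  - subst s. assert (v0 a 0 = 0) as ->.
    { unfold v0, slope. rewrite Rmult_0_r, sinh_0. unfold Rdiv. ring. }
    pose proof e0_0_pos. rewrite Rplus_0_l. pos.
Qed.

End Zeros.

(** * The Jacobi operator of the catenoid *)

(** ** Curvature of the half-space *)

Definition kron (i j : nat) : R := if Nat.eqb i j then 1 else 0.

Lemma pd3_hyp k i j p : (k < 3)%nat -> coord 2 p <> 0 ->
  pd3 k (hyp i j) p = kron i j * kron k 2 * (-2 / coord 2 p ^ 3).
Proof.
  intros Hk Hp. destruct p as [[x y] z]. simpl in Hp. unfold pd3, hyp, kron.
  destruct (Nat.eqb i j).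
  - destruct k as [|[|[|k]]]; try lia; simpl.
    + rewrite Derive_const. ring.
    + rewrite Derive_const. ring.
    + apply is_derive_unique. auto_derive.
      * rewrite Rplus_0_r. repeat split; auto.
      * rewrite Rplus_0_r. field. lra.
  - rewrite Derive_const. ring.
Qed.

Definition hyp_christoffel (k i j : nat) (p : R3) : R :=
  (kron i j * kron k 2 - kron i k * kron j 2 - kron j k * kron i 2) / coord 2 p.

Lemma christoffel_hyp k i j p : (k < 3)%nat -> (i < 3)%nat -> (j < 3)%nat ->
  coord 2 p <> 0 -> christoffel hyp hyp_inv k i j p = hyp_christoffel k i j p.
Proof.
  intros Hk Hi Hj Hp. unfold christoffel, sum3.
  rewrite !pd3_hyp by (assumption || lia). unfold hyp_inv, hyp_christoffel, kron.
  destruct k as [|[|[|k]]]; try lia; destruct i as [|[|[|i]]]; try lia;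
    destruct j as [|[|[|j]]]; try lia; cbn [Nat.eqb]; field; exact Hp.
Qed.

Lemma coord_shift_2 l h p : coord 2 (shift l h p) =
  if Nat.eqb l 0 then coord 2 p else if Nat.eqb l 1 then coord 2 p else coord 2 p + h.
Proof. destruct l as [|[|l]]; reflexivity. Qed.

Lemma pd3_christoffel_hyp l k i j p :
  (l < 3)%nat -> (k < 3)%nat -> (i < 3)%nat -> (j < 3)%nat -> coord 2 p <> 0 ->
  pd3 l (christoffel hyp hyp_inv k i j) p =
  - kron l 2 * (kron i j * kron k 2 - kron i k * kron j 2 - kron j k * kron i 2)
    / coord 2 p ^ 2.
Proof.
  intros Hl Hk Hi Hj Hp. unfold pd3.
  rewrite (Derive_ext_loc _ (fun h => hyp_christoffel k i j (shift l h p))).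
  - unfold hyp_christoffel.
    set (c := kron i j * kron k 2 - kron i k * kron j 2 - kron j k * kron i 2).
    destruct l as [|[|[|l]]]; try lia; unfold kron; cbn [Nat.eqb].
    + rewrite (Derive_ext _ (fun _ => c / coord 2 p)) by reflexivity.
      rewrite Derive_const. unfold Rdiv; ring.
    + rewrite (Derive_ext _ (fun _ => c / coord 2 p)) by reflexivity.
      rewrite Derive_const. unfold Rdiv; ring.
    + rewrite (Derive_ext _ (fun h => c / (coord 2 p + h))) by reflexivity.
      apply is_derive_unique. change (coord 2 p) with (snd p) in *.
      auto_derive; rewrite Rplus_0_r; [auto|field; auto].
  - assert (H : 0 < Rabs (coord 2 p)) by (apply Rabs_pos_lt, Hp).
    exists (mkposreal _ H). simpl. intros h Hh. change (Rabs (h - 0) < Rabs (coord 2 p)) in Hh.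
    rewrite Rminus_0_r in Hh.
    apply christoffel_hyp; auto. rewrite coord_shift_2.
    destruct (Nat.eqb l 0); [exact Hp|]. destruct (Nat.eqb l 1); [exact Hp|].
    intros E. replace h with (- coord 2 p) in Hh by lra. rewrite Rabs_Ropp in Hh. lra.
Qed.

(** Constant sectional curvature -1. *)
Lemma ricci_hyp i j p : (i < 3)%nat -> (j < 3)%nat -> coord 2 p <> 0 ->
  ricci hyp hyp_inv i j p = -2 * hyp i j p.
Proof.
  intros Hi Hj Hp. unfold ricci, sum3.
  rewrite !pd3_christoffel_hyp by (assumption || lia).
  rewrite !christoffel_hyp by (assumption || lia).
  unfold hyp_christoffel, hyp, kron.
  destruct i as [|[|[|i]]]; try lia; destruct j as [|[|[|j]]]; try lia; cbn [Nat.eqb];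
    field; exact Hp.
Qed.

(** ** Fundamental forms *)

Section Geometry.

Variable a : R.
Hypothesis Ha : 0 < a.

Local Notation Y := (catenoid a).

(** The profile of the surface in cylindrical coordinates: distance to the [x_3]-axis and
    third coordinate. *)
Definition radial (s : R) : R := exp (Lambda0 a s) * tanh (y0 a s).
Definition height (s : R) : R := exp (Lambda0 a s) / cosh (y0 a s).
Definition radial_s (s : R) : R :=
  height s * (speed a s * sinh (y0 a s) + slope a s / cosh (y0 a s)).
Definition height_s (s : R) : R :=
  height s * (speed a s - slope a s * sinh (y0 a s) / cosh (y0 a s)).

Lemma coord_catenoid s t : Y s t = (radial s * cos t, radial s * sin t, height s).
Proof. reflexivity. Qed.

Lemma height_pos s : 0 < height s.
Proof. unfold height. pose proof (cosh_pos_1 (y0 a s)). pose proof (exp_pos (Lambda0 a s)). pos. Qed.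

Lemma radial_height s : radial s = height s * sinh (y0 a s).
Proof. unfold radial, height, tanh. pose proof (cosh_pos_1 (y0 a s)). field. lra. Qed.

Lemma height_derive s : is_derive height s (height_s s).
Proof.
  pose proof (cosh_pos_1 (y0 a s)). unfold height, height_s. derive_profile a Ha s.
  unfold height. field. lra.
Qed.

Lemma radial_derive s : is_derive radial s (radial_s s).
Proof.
  pose proof (cosh_pos_1 (y0 a s)). pose proof (cosh2_sinh2 (y0 a s)) as E.
  eapply is_derive_ext; [intros t; symmetry; apply radial_height|].
  replace (radial_s s) with (height_s s * sinh (y0 a s) + height s * (cosh (y0 a s) * slope a s)).
  - apply (is_derive_mult height (fun t => sinh (y0 a t))).
    + apply height_derive.
    + apply sinh_y0_derive, Ha.
    + intros; apply Rmult_comm.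
  - unfold radial_s, height_s. field_simplify_eq; [|lra]. rewrite E. ring.
Qed.

Lemma tangent_0 s t k : tangent Y 0 s t k =
  match k with O => radial_s s * cos t | S O => radial_s s * sin t | _ => height_s s end.
Proof.
  unfold tangent, pd2. apply is_derive_unique.
  destruct k as [|[|k]]; simpl.
  - apply (is_derive_scal_r radial), radial_derive.
  - apply (is_derive_scal_r radial), radial_derive.
  - apply height_derive.
Qed.

Lemma tangent_1 s t k : tangent Y 1 s t k =
  match k with O => - radial s * sin t | S O => radial s * cos t | _ => 0 end.
Proof.
  unfold tangent, pd2.
  destruct k as [|[|k]]; simpl; apply is_derive_unique.
  - change (exp (Lambda0 a s) * tanh (y0 a s)) with (radial s).
    auto_derive; [exact I|ring].
  - change (exp (Lambda0 a s) * tanh (y0 a s)) with (radial s).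
    auto_derive; [exact I|ring].
  - apply (is_derive_const (K := R_AbsRing) (V := R_NormedModule)).
Qed.

Lemma bilin_hyp p v w : coord 2 p <> 0 ->
  bilin hyp p v w = (v 0%nat * w 0%nat + v 1%nat * w 1%nat + v 2%nat * w 2%nat) / coord 2 p ^ 2.
Proof. intros Hp. unfold bilin, sum3, hyp. cbn [Nat.eqb]. field. exact Hp. Qed.

Lemma height_neq s : height s <> 0.
Proof. pose proof (height_pos s). lra. Qed.

Lemma cos2_sin2 t : cos t ^ 2 = 1 - sin t ^ 2.
Proof. pose proof (sin2_cos2 t). unfold Rsqr in *. nra. Qed.

(** Arc length again, now for the half-space metric. *)
Lemma velocity_norm s : radial_s s ^ 2 + height_s s ^ 2 = height s ^ 2.
Proof.
  unfold radial_s, height_s. pose proof (cosh_pos_1 (y0 a s)).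
  pose proof (cosh2_sinh2 (y0 a s)) as E. pose proof (profile_arclength a Ha s) as E1.
  assert (E3 : slope a s ^ 2 = 1 - cosh (y0 a s) ^ 2 * speed a s ^ 2) by lra.
  field_simplify_eq; [|lra]. ring [E E3].
Qed.

Lemma first_form_catenoid i j s t : (i < 2)%nat -> (j < 2)%nat ->
  first_form Y i j s t =
  if Nat.eqb i j then (if Nat.eqb i 0 then 1 else sinh (y0 a s) ^ 2) else 0.
Proof.
  intros Hi Hj. unfold first_form.
  rewrite bilin_hyp by (rewrite coord_catenoid; apply height_neq).
  pose proof (height_neq s). pose proof (cos2_sin2 t) as E.
  destruct i as [|[|i]]; try lia; destruct j as [|[|j]]; try lia;
    rewrite ?tangent_0, ?tangent_1; simpl;
    change (exp (Lambda0 a s) / cosh (y0 a s)) with (height s).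
  - apply Rmult_eq_reg_r with (height s ^ 2); [|apply pow_nonzero; auto].
    rewrite Rmult_1_l.
    transitivity (radial_s s ^ 2 * (cos t ^ 2 + sin t ^ 2) + height_s s ^ 2).
    + field. auto.
    + rewrite E, <- velocity_norm. ring.
  - field. auto.
  - field. auto.
  - rewrite !radial_height.
    apply Rmult_eq_reg_r with (height s ^ 2); [|apply pow_nonzero; auto].
    transitivity ((height s * sinh (y0 a s)) ^ 2 * (cos t ^ 2 + sin t ^ 2)).
    + field. auto.
    + rewrite E. ring.
Qed.

Lemma det_first_form_catenoid s t : det_first_form Y s t = sinh (y0 a s) ^ 2.
Proof.
  unfold det_first_form. rewrite !first_form_catenoid by lia. cbn [Nat.eqb]. ring.
Qed.

Lemma sqrt_det_catenoid s t : sqrt (det_first_form Y s t) = sinh (y0 a s).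
Proof.
  rewrite det_first_form_catenoid. apply sqrt_pow2. pose proof (sinh_y0_pos a Ha s). lra.
Qed.

Lemma first_form_inv_catenoid i j s t : (i < 2)%nat -> (j < 2)%nat ->
  first_form_inv Y i j s t =
  if Nat.eqb i j then (if Nat.eqb i 0 then 1 else / sinh (y0 a s) ^ 2) else 0.
Proof.
  intros Hi Hj. unfold first_form_inv. rewrite det_first_form_catenoid.
  pose proof (sinh_y0_pos a Ha s).
  destruct i as [|[|i]]; try lia; destruct j as [|[|j]]; try lia; cbn [Nat.eqb Nat.sub];
    rewrite first_form_catenoid by lia; cbn [Nat.eqb]; field; lra.
Qed.

Lemma unit_normal_catenoid s t k : unit_normal Y s t k =
  match k with O => - height_s s * cos t | S O => - height_s s * sin t | _ => radial_s s end.
Proof.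
  unfold unit_normal.
  assert (H : sqrt (bilin hyp (Y s t) (cross (tangent Y 0 s t) (tangent Y 1 s t))
     (cross (tangent Y 0 s t) (tangent Y 1 s t))) = radial s).
  { rewrite bilin_hyp by (rewrite coord_catenoid; apply height_neq).
    unfold cross. rewrite !tangent_0, !tangent_1. rewrite coord_catenoid. cbn [coord fst snd].
    pose proof (height_neq s). pose proof (cos2_sin2 t) as E.
    pose proof (velocity_norm s) as E1.
    transitivity (sqrt (radial s ^ 2)); [|apply sqrt_pow2].
    2:{ rewrite radial_height. pose proof (height_pos s). pose proof (sinh_y0_pos a Ha s).
        left; pos. }
    f_equal. apply Rmult_eq_reg_r with (height s ^ 2); [|apply pow_nonzero; auto].
    transitivity (radial s ^ 2 * (height_s s ^ 2 * (cos t ^ 2 + sin t ^ 2)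
      + radial_s s ^ 2 * (cos t ^ 2 + sin t ^ 2) ^ 2)).
    - field. auto.
    - rewrite E, <- E1. ring. }
  rewrite H.
  assert (radial s <> 0).
  { rewrite radial_height. pose proof (height_pos s). pose proof (sinh_y0_pos a Ha s).
    apply Rgt_not_eq; unfold Rgt; pos. }
  pose proof (cos2_sin2 t) as E.
  destruct k as [|[|k]]; unfold cross; rewrite !tangent_0, !tangent_1; field_simplify_eq; auto;
    ring [E].
Qed.

Lemma ric_NN_catenoid s t : ric_NN Y s t = -2.
Proof.
  unfold ric_NN, bilin, sum3.
  rewrite !ricci_hyp by (try lia; rewrite coord_catenoid; apply height_neq).
  rewrite !unit_normal_catenoid. unfold hyp. cbn [Nat.eqb]. rewrite coord_catenoid.
  cbn [coord fst snd]. pose proof (height_neq s). pose proof (cos2_sin2 t) as E.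
  pose proof (velocity_norm s) as E1.
  apply Rmult_eq_reg_r with (height s ^ 2); [|apply pow_nonzero; auto].
  transitivity (-2 * (height_s s ^ 2 * (cos t ^ 2 + sin t ^ 2) + radial_s s ^ 2)).
  - field. auto.
  - rewrite E, <- E1. ring.
Qed.

Definition radial_ss (s : R) : R :=
  height_s s * (speed a s * sinh (y0 a s) + slope a s / cosh (y0 a s)) +
  height s * (- speed a s * slope a s * (2 * sinh (y0 a s) / cosh (y0 a s)
                              + cosh (y0 a s) / sinh (y0 a s)) * sinh (y0 a s)
    + speed a s * cosh (y0 a s) * slope a s
    + speed a s ^ 2 / sinh (y0 a s) * (cosh (y0 a s) ^ 2 + sinh (y0 a s) ^ 2)
    - slope a s ^ 2 * sinh (y0 a s) / cosh (y0 a s) ^ 2).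
Definition height_ss (s : R) : R :=
  height_s s * (speed a s - slope a s * sinh (y0 a s) / cosh (y0 a s)) +
  height s * (- speed a s * slope a s * (2 * sinh (y0 a s) / cosh (y0 a s)
                              + cosh (y0 a s) / sinh (y0 a s))
    - speed a s ^ 2 * (cosh (y0 a s) ^ 2 + sinh (y0 a s) ^ 2)
    - slope a s ^ 2 * (cosh (y0 a s) ^ 2 - sinh (y0 a s) ^ 2) / cosh (y0 a s) ^ 2).

Lemma radial_s_derive s : is_derive radial_s s (radial_ss s).
Proof.
  pose proof (cosh_pos_1 (y0 a s)). pose proof (sinh_y0_pos a Ha s).
  assert (ex_derive (fun x => height x) s) by (eexists; apply height_derive).
  unfold radial_s. derive_profile a Ha s.
  rewrite (is_derive_unique (fun t : R => height t) s _ (height_derive s)).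
  unfold radial_ss. field. lra.
Qed.

Lemma height_s_derive s : is_derive height_s s (height_ss s).
Proof.
  pose proof (cosh_pos_1 (y0 a s)). pose proof (sinh_y0_pos a Ha s).
  assert (ex_derive (fun x => height x) s) by (eexists; apply height_derive).
  unfold height_s. derive_profile a Ha s.
  rewrite (is_derive_unique (fun t : R => height t) s _ (height_derive s)).
  unfold height_ss. field. lra.
Qed.

Lemma pd2_tangent i j s t k : (i < 2)%nat -> (j < 2)%nat ->
  pd2 i (fun x y => tangent Y j x y k) s t =
  match i, j, k with
  | O, O, O => radial_ss s * cos t
  | O, O, S O => radial_ss s * sin t
  | O, O, _ => height_ss s
  | O, _, O => - radial_s s * sin t
  | O, _, S O => radial_s s * cos t
  | O, _, _ => 0
  | _, O, O => - radial_s s * sin t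
  | _, O, S O => radial_s s * cos t
  | _, O, _ => 0
  | _, _, O => - radial s * cos t
  | _, _, S O => - radial s * sin t
  | _, _, _ => 0
  end.
Proof.
  intros Hi Hj.
  assert (D1 : forall c, is_derive (fun x => radial_s x * c) s (radial_ss s * c)).
  { intros c. apply (is_derive_scal_r radial_s), radial_s_derive. }
  assert (D2 : forall c, is_derive (fun x => radial x * c) s (radial_s s * c)).
  { intros c. apply (is_derive_scal_r radial), radial_derive. }
  destruct i as [|[|i]]; try lia; destruct j as [|[|j]]; try lia; unfold pd2;
    apply is_derive_unique.
  - apply is_derive_ext with (fun x => match k with
      | O => radial_s x * cos t | S O => radial_s x * sin t | _ => height_s x end).
    { intros x. rewrite tangent_0. reflexivity. }
    destruct k as [|[|k]]; auto. apply height_s_derive.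
  - apply is_derive_ext with (fun x => match k with
      | O => - radial x * sin t | S O => radial x * cos t | _ => 0 end).
    { intros x. rewrite tangent_1. reflexivity. }
    destruct k as [|[|k]]; auto.
    + apply is_derive_ext with (fun x => radial x * - sin t); [intros; simpl; ring|].
      replace (- radial_s s * sin t) with (radial_s s * - sin t) by ring. auto.
    + apply (is_derive_const (K := R_AbsRing) (V := R_NormedModule)).
  - apply is_derive_ext with (fun y => match k with
      | O => radial_s s * cos y | S O => radial_s s * sin y | _ => height_s s end).
    { intros x. rewrite tangent_0. reflexivity. }
    destruct k as [|[|k]]; (auto_derive; [exact I|ring]).
  - apply is_derive_ext with (fun y => match k with
      | O => - radial s * sin y | S O => radial s * cos y | _ => 0 end).
    { intros x. rewrite tangent_1. reflexivity. }
    destruct k as [|[|k]]; (auto_derive; [exact I|ring]).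
Qed.

Definition curvature (s : R) : R := cosh (y0 a s) ^ 2 * speed a s / sinh (y0 a s).

(* The principal curvatures are opposite: the catenoid is minimal. *)
Lemma second_form_catenoid i j s t : (i < 2)%nat -> (j < 2)%nat ->
  second_form Y i j s t =
  if Nat.eqb i j then (if Nat.eqb i 0 then - curvature s
                       else sinh (y0 a s) ^ 2 * curvature s) else 0.
Proof.
  intros Hi Hj. unfold second_form.
  assert (Hh : coord 2 (Y s t) = height s) by reflexivity.
  assert (Hn : coord 2 (Y s t) <> 0) by (rewrite Hh; apply height_neq).
  rewrite bilin_hyp by exact Hn. unfold cov_tangent, sum3.
  rewrite !unit_normal_catenoid, !pd2_tangent by lia.
  rewrite !christoffel_hyp by (exact Hn || lia). unfold hyp_christoffel, kron.
  cbn [Nat.eqb]. rewrite Hh.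
  pose proof (cos2_sin2 t) as E.
  pose proof (cosh_pos_1 (y0 a s)). pose proof (sinh_y0_pos a Ha s).
  pose proof (cosh2_sinh2 (y0 a s)) as E2. pose proof (profile_arclength a Ha s) as E1.
  assert (E3 : slope a s ^ 2 = 1 - cosh (y0 a s) ^ 2 * speed a s ^ 2) by lra.
  pose proof (height_neq s).
  destruct i as [|[|i]]; try lia; destruct j as [|[|j]]; try lia; cbn [Nat.eqb];
    rewrite ?tangent_0, ?tangent_1; unfold curvature.
  - transitivity (((cos t ^ 2 + sin t ^ 2) *
        (- height_s s * (radial_ss s - 2 * radial_s s * height_s s / height s)
         + radial_s s * radial_s s ^ 2 / height s)
      + radial_s s * (height_ss s - height_s s ^ 2 / height s)) / height s ^ 2).
    { field. auto. }
    rewrite E. unfold radial_ss, height_ss, radial_s, height_s. 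
    field_simplify_eq; [|lra]. ring [E3 E2].
  - field. auto.
  - field. auto.
  - transitivity (((cos t ^ 2 + sin t ^ 2) *
        (radial s * height_s s + radial_s s * radial s ^ 2 / height s)) / height s ^ 2).
    { field. auto. }
    rewrite E, radial_height. unfold radial_s, height_s.
    field_simplify_eq; [|lra]. ring [E3 E2].
Qed.

Lemma norm2_A_catenoid s t : norm2_A Y s t = 2 * curvature s ^ 2.
Proof.
  pose proof (sinh_y0_pos a Ha s).
  unfold norm2_A, sum2. rewrite !first_form_inv_catenoid by lia.
  rewrite !second_form_catenoid by lia. cbn [Nat.eqb]. field. lra.
Qed.

(** The induced metric is [ds^2 + f^2 dtheta^2] with [f = sinh y0]. *)
Lemma jacobi_catenoid phi s t :
  jacobi Y phi s t =
  - (Derive (fun x => sinh (y0 a x) * pd2 0 phi x t) s / sinh (y0 a s)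
     + pd2 1 (pd2 1 phi) s t / sinh (y0 a s) ^ 2)
  - potential a s * phi s t.
Proof.
  unfold jacobi, laplacian.
  rewrite ric_NN_catenoid, norm2_A_catenoid, sqrt_det_catenoid. unfold sum2.
  pose proof (sinh_y0_pos a Ha s).
  assert (E0' : pd2 0 (fun x y => sqrt (det_first_form Y x y) *
      (first_form_inv Y 0 0 x y * pd2 0 phi x y + first_form_inv Y 0 1 x y * pd2 1 phi x y)) s t
     = Derive (fun x => sinh (y0 a x) * pd2 0 phi x t) s).
  { apply Derive_ext. intros x. rewrite sqrt_det_catenoid, !first_form_inv_catenoid by lia.
    cbn [Nat.eqb]. ring. }
  assert (E1 : pd2 1 (fun x y => sqrt (det_first_form Y x y) *
      (first_form_inv Y 1 0 x y * pd2 0 phi x y + first_form_inv Y 1 1 x y * pd2 1 phi x y)) s t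
     = / sinh (y0 a s) * pd2 1 (pd2 1 phi) s t).
  { change (pd2 1 (pd2 1 phi) s t) with (Derive (pd2 1 phi s) t). rewrite <- Derive_scal.
    apply Derive_ext. intros y. rewrite sqrt_det_catenoid, !first_form_inv_catenoid by lia.
    cbn [Nat.eqb]. field. lra. }
  rewrite E0', E1. unfold potential. unfold curvature. field. lra.
Qed.

End Geometry.

(** * Lower bounds for quadratic forms *)

Lemma ex_RInt_on f a b : a <= b -> (forall x, a <= x <= b -> continuity_pt f x) -> ex_RInt f a b.
Proof.
  intros Hab H. apply (ex_RInt_continuous (V := R_CompleteNormedModule)).
  intros z Hz. rewrite Rmin_left, Rmax_right in Hz by lra. apply continuity_pt_filterlim, H, Hz.
Qed.

Lemma continuity_pt_div' f g x :
  continuity_pt f x -> continuity_pt g x -> g x <> 0 -> continuity_pt (fun t => f t / g t) x.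
Proof. intros Hf Hg Hz. exact (continuity_pt_div f g x Hf Hg Hz). Qed.

Lemma continuity_pt_mult' f g x :
  continuity_pt f x -> continuity_pt g x -> continuity_pt (fun t => f t * g t) x.
Proof. intros Hf Hg. exact (continuity_pt_mult f g x Hf Hg). Qed.

Lemma continuity_pt_plus' f g x :
  continuity_pt f x -> continuity_pt g x -> continuity_pt (fun t => f t + g t) x.
Proof. intros Hf Hg. exact (continuity_pt_plus f g x Hf Hg). Qed.

Lemma continuity_pt_minus' f g x :
  continuity_pt f x -> continuity_pt g x -> continuity_pt (fun t => f t - g t) x.
Proof. intros Hf Hg. exact (continuity_pt_minus f g x Hf Hg). Qed.

Lemma continuity_pt_pow' f n x :
  continuity_pt f x -> continuity_pt (fun t => f t ^ n) x.
Proof.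
  intros Hf. induction n as [|n IH].
  - apply continuity_pt_const. intros u v; reflexivity.
  - exact (continuity_pt_mult f (fun t => f t ^ n) x Hf IH).
Qed.

Lemma continuity_pt_cst' (c x : R) : continuity_pt (fun _ => c) x.
Proof. apply continuity_pt_const. intros u v; reflexivity. Qed.

Ltac cont := repeat match goal with
  | H : ?P |- ?P => exact H
  | |- continuity_pt (fun _ => ?c) _ => apply continuity_pt_cst'
  | |- continuity_pt (fun t => @?f t / @?g t) _ => apply (continuity_pt_div' f g)
  | |- continuity_pt (fun t => @?f t * @?g t) _ => apply (continuity_pt_mult' f g)
  | |- continuity_pt (fun t => @?f t + @?g t) _ => apply (continuity_pt_plus' f g)
  | |- continuity_pt (fun t => @?f t - @?g t) _ => apply (continuity_pt_minus' f g)
  | |- continuity_pt (fun t => @?f t ^ ?n) _ => apply (continuity_pt_pow' f n)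
  end.

(** Picone's identity. [M], [B], [N] stand for the integrals of [u^2], [u u'],
    [u'^2] along the fibres; a positive supersolution [h] of [(f h')' + Q f h = 0]
    bounds the energy from below by completing squares. *)
Lemma picone (f Q h h1 k M B N : R -> R) (al be : R) :
  al <= be ->
  (forall s, al <= s <= be ->
     is_derive h s (h1 s) /\ is_derive (fun x => f x * h1 x) s (k s) /\
     k s <= - Q s * f s * h s /\ 0 < h s /\ is_derive M s (2 * B s) /\ 0 <= M s) ->
  (forall s, al <= s <= be ->
     continuity_pt f s /\ continuity_pt Q s /\ continuity_pt h1 s /\ continuity_pt k s /\
     continuity_pt B s /\ continuity_pt N s) ->
  RInt (fun s => f s * (N s - 2 * (h1 s / h s) * B s + (h1 s / h s) ^ 2 * M s)) al be
  + (f be * (h1 be / h be) * M be - f al * (h1 al / h al) * M al)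
  <= RInt (fun s => f s * N s - Q s * f s * M s) al be.
Proof.
  intros Hab HD HC.
  assert (HC' : forall s, al <= s <= be -> continuity_pt h s /\ continuity_pt M s).
  { intros s Hs. destruct (HD s Hs) as [D1 [_ [_ [_ [D2 _]]]]].
    split; eapply is_derive_cont; eassumption. }
  set (D := fun s => f s * (N s - 2 * (h1 s / h s) * B s + (h1 s / h s) ^ 2 * M s)).
  set (W := fun s => f s * (h1 s / h s) * M s).
  set (W' := fun s => (k s / h s - f s * (h1 s / h s) ^ 2) * M s + 2 * f s * (h1 s / h s) * B s).
  assert (CD : forall s, al <= s <= be -> continuity_pt D s).
  { intros s Hs. destruct (HD s Hs) as [_ [_ [_ [D2 _]]]].
    destruct (HC s Hs) as [? [? [? [? [? ?]]]]], (HC' s Hs). unfold D. cont; lra. }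
  assert (CW : forall s, al <= s <= be -> continuity_pt W' s).
  { intros s Hs. destruct (HD s Hs) as [_ [_ [_ [D2 _]]]].
    destruct (HC s Hs) as [? [? [? [? [? ?]]]]], (HC' s Hs). unfold W'. cont; lra. }
  assert (IW : is_RInt W' al be (W be - W al)).
  { apply (is_RInt_derive W W').
    - intros s Hs. rewrite Rmin_left, Rmax_right in Hs by lra.
      destruct (HD s Hs) as [D1 [D2 [_ [D3 [D4 _]]]]].
      apply is_derive_ext with (fun x => (f x * h1 x) / h x * M x).
      { intros x. unfold W. change (f x * h1 x / h x * M x = f x * (h1 x / h x) * M x).
        unfold Rdiv. ring. }
      replace (W' s) with ((k s * h s - f s * h1 s * h1 s) / h s ^ 2 * M s
        + (f s * h1 s) / h s * (2 * B s)) by (unfold W'; field; lra).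
      apply (is_derive_mult (fun x => f x * h1 x / h x) M); [|exact D4|intros; apply Rmult_comm].
      apply (is_derive_div (fun x => f x * h1 x) h); auto. lra.
    - intros s Hs. rewrite Rmin_left, Rmax_right in Hs by lra.
      apply continuity_pt_filterlim, CW, Hs. }
  change (f be * (h1 be / h be) * M be - f al * (h1 al / h al) * M al) with (W be - W al).
  rewrite <- (is_RInt_unique _ _ _ _ IW).
  assert (ED : ex_RInt D al be) by (apply ex_RInt_on; auto).
  assert (EW : ex_RInt W' al be) by (eexists; apply IW).
  change (RInt (fun s => f s * (N s - 2 * (h1 s / h s) * B s + (h1 s / h s) ^ 2 * M s)) al be)
    with (RInt D al be).
  change (RInt D al be + RInt W' al be) with (plus (RInt D al be) (RInt W' al be)).
  rewrite <- (RInt_plus (V := R_CompleteNormedModule)) by assumption.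
  apply RInt_le; auto.
  - apply (ex_RInt_plus (V := R_NormedModule)); assumption.
  - apply ex_RInt_on; auto. intros s Hs.
    destruct (HC s Hs) as [? [? [? [? [? ?]]]]], (HC' s Hs). cont.
  - intros s Hs. destruct (HD s ltac:(lra)) as [_ [_ [D1 [D2 [_ D3]]]]].
    change (D s + W' s <= f s * N s - Q s * f s * M s). unfold D, W'.
    assert (k s / h s <= - Q s * f s).
    { apply Rmult_le_reg_r with (h s); [lra|]. unfold Rdiv.
      rewrite Rmult_assoc, Rinv_l by lra. lra. }
    assert (k s / h s * M s <= - Q s * f s * M s) by (apply Rmult_le_compat_r; assumption).
    lra.
Qed.

Lemma picone_nonneg (f Q h h1 k M B N : R -> R) (al be : R) :
  al <= be ->
  (forall s, al <= s <= be ->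
     is_derive h s (h1 s) /\ is_derive (fun x => f x * h1 x) s (k s) /\
     k s <= - Q s * f s * h s /\ 0 < h s /\ is_derive M s (2 * B s) /\ 0 <= M s) ->
  (forall s, al <= s <= be ->
     continuity_pt f s /\ continuity_pt Q s /\ continuity_pt h1 s /\ continuity_pt k s /\
     continuity_pt B s /\ continuity_pt N s) ->
  (forall s b, al <= s <= be -> 0 <= f s /\ 0 <= N s - 2 * b * B s + b ^ 2 * M s) ->
  M al = 0 -> M be = 0 ->
  0 <= RInt (fun s => f s * N s - Q s * f s * M s) al be.
Proof.
  intros Hab HD HC HN H0 H1. eapply Rle_trans; [|apply (picone f Q h h1 k M B N); eauto].
  rewrite H0, H1, !Rmult_0_r, Rminus_0_r, Rplus_0_r.
  apply RInt_ge_0; auto.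
  - apply ex_RInt_on; auto. intros s Hs.
    destruct (HD s Hs) as [D1 [_ [_ [D2 [D3 _]]]]].
    destruct (HC s Hs) as [? [? [? [? [? ?]]]]].
    assert (continuity_pt h s) by (eapply is_derive_cont; eassumption).
    assert (continuity_pt M s) by (eapply is_derive_cont; eassumption).
    cont; lra.
  - intros s Hs. destruct (HN s (h1 s / h s) ltac:(lra)). apply Rmult_le_pos; assumption.
Qed.

Lemma is_derive_sqr (u : R -> R) x l : is_derive u x l -> is_derive (fun t => u t ^ 2) x (2 * (u x * l)).
Proof.
  intros H. replace (2 * (u x * l)) with (INR 2 * l * u x ^ 1) by (simpl; ring).
  apply (is_derive_pow u 2 x l), H.
Qed.

(** ** Wirtinger's inequality *)

(** Picone's identity with [h x = cos (k (x - x0 - PI/2))], positive on the whole interval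
    because [k < 1]. *)
Lemma wirtinger_dirichlet (u du : R -> R) x0 k :
  0 < k < 1 -> (forall x, is_derive u x (du x)) -> (forall x, continuity_pt du x) ->
  u x0 = 0 -> u (x0 + PI) = 0 ->
  k ^ 2 * RInt (fun x => u x ^ 2) x0 (x0 + PI) <= RInt (fun x => du x ^ 2) x0 (x0 + PI).
Proof.
  intros Hk Hu Hdu H0 H1. pose proof PI_RGT_0 as HPI.
  assert (Cu : forall x, continuity_pt u x) by (intros x; eapply is_derive_cont, Hu).
  set (th := fun x => k * (x - x0 - PI / 2)).
  assert (Dth : forall x, is_derive th x k).
  { intros x. unfold th. auto_derive; [exact I|ring]. }
  assert (Cth : forall x, continuity_pt th x) by (intros x; eapply is_derive_cont, Dth).
  assert (Csin : forall x, continuity_pt (fun x => sin (th x)) x).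
  { intros x. apply (continuity_pt_comp th sin); [apply Cth|apply continuity_sin]. }
  assert (Ccos : forall x, continuity_pt (fun x => cos (th x)) x).
  { intros x. apply (continuity_pt_comp th cos); [apply Cth|apply continuity_cos]. }
  pose proof (picone_nonneg (fun _ => 1) (fun _ => k ^ 2) (fun x => cos (th x))
    (fun x => - k * sin (th x)) (fun x => - k ^ 2 * cos (th x))
    (fun x => u x ^ 2) (fun x => u x * du x) (fun x => du x ^ 2) x0 (x0 + PI)) as P.
  assert (E : RInt (fun s => 1 * du s ^ 2 - k ^ 2 * 1 * u s ^ 2) x0 (x0 + PI) =
    RInt (fun x => du x ^ 2) x0 (x0 + PI) - k ^ 2 * RInt (fun x => u x ^ 2) x0 (x0 + PI)).
  { rewrite (RInt_ext_all _ (fun s => du s ^ 2 - k ^ 2 * u s ^ 2)) by (intros; ring).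
    rewrite RInt_minus_c, RInt_scal_c; [reflexivity| | |]; intros x; cont; auto. }
  cbv beta in P. rewrite E in P. clear E.
  assert (0 <= RInt (fun x => du x ^ 2) x0 (x0 + PI)
    - k ^ 2 * RInt (fun x => u x ^ 2) x0 (x0 + PI)); [apply P|lra].
  - lra.
  - intros s Hs.
    assert (0 < cos (th s)) by (apply cos_gt_0; unfold th; nra).
    refine (conj _ (conj _ (conj _ (conj _ (conj _ _))))); try lra.
    + replace (- k * sin (th s)) with (k * - sin (th s)) by ring.
      apply (is_derive_comp cos th); [apply is_derive_cos|apply Dth].
    + replace (- k ^ 2 * cos (th s)) with (1 * (- k * (k * cos (th s)))) by ring.
      apply (is_derive_scal (fun x => - k * sin (th x))).
      apply (is_derive_scal (fun x => sin (th x))).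
      apply (is_derive_comp sin th); [apply is_derive_sin|apply Dth].
    + apply is_derive_sqr, Hu.
    + apply pow2_ge_0.
  - intros s Hs. repeat split; cont; auto.
  - intros s b Hs. split; [lra|].
    replace (du s ^ 2 - 2 * b * (u s * du s) + b ^ 2 * u s ^ 2) with ((du s - b * u s) ^ 2) by ring.
    apply pow2_ge_0.
  - rewrite H0. ring.
  - rewrite H1. ring.
Qed.

Lemma le_of_lt_1 (A B : R) : (forall k, 0 < k < 1 -> k ^ 2 * A <= B) -> A <= B.
Proof.
  intros H. destruct (Rle_dec A 0) as [HA|HA].
  - specialize (H (/ 2) ltac:(lra)). destruct (Rle_dec A B); [assumption|]. nra.
  - apply Rnot_lt_le. intros L. 
    pose proof (H (/ 2) ltac:(lra)).
    set (e := (A - B) / (2 * A)).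
    assert (0 < e) by (unfold e; pos). assert (e * (2 * A) = A - B) by (unfold e; field; lra).
    assert (e < 1) by nra.
    specialize (H (1 - e) ltac:(lra)). nra.
Qed.

Lemma RInt_periodic (g : R -> R) T x :
  (forall t, continuity_pt g t) -> (forall t, g (t + T) = g t) ->
  RInt g x (x + T) = RInt g 0 T.
Proof.
  intros Hc Hp.
  assert (Hd : forall y, is_derive (RInt g 0) y (g y)).
  { intros y. apply (is_derive_RInt g (RInt g 0) 0 y).
    - apply filter_forall. intros v. apply (RInt_correct g 0 v), ex_RInt_cont, Hc.
    - apply continuity_pt_filterlim, Hc. }
  assert (D : forall y, is_derive (fun y => RInt g 0 (y + T) - RInt g 0 y) y 0).
  { intros y. apply is_derive_eq with (1 * g (y + T) - g y); [|rewrite Hp; ring].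
    apply (is_derive_minus (fun y => RInt g 0 (y + T)) (RInt g 0)); [|apply Hd].
    apply (is_derive_comp (RInt g 0) (fun y => y + T)); [apply Hd|].
    auto_derive; [exact I|ring]. }
  assert (E : RInt g 0 (x + T) - RInt g 0 x = RInt g 0 (0 + T) - RInt g 0 0).
  { destruct (Rle_dec 0 x).
    - symmetry. apply (derive_zero_const (fun y => RInt g 0 (y + T) - RInt g 0 y)); auto.
    - apply (derive_zero_const (fun y => RInt g 0 (y + T) - RInt g 0 y)); auto. lra. }
  rewrite RInt_point, Rplus_0_l in E. change (zero : R) with 0 in E.
  pose proof (RInt_chasles_c g 0 x (x + T) Hc). lra.
Qed.

Lemma RInt_shift_sqr (g : R -> R) m a b :
  (forall t, continuity_pt g t) ->
  RInt (fun x => (g x - m) ^ 2) a b =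
  RInt (fun x => g x ^ 2) a b - 2 * m * RInt g a b + m ^ 2 * (b - a).
Proof.
  intros Hc.
  transitivity (RInt (fun x => g x ^ 2 - 2 * m * g x + m ^ 2) a b).
  { apply RInt_ext_all. intros; ring. }
  rewrite RInt_plus_c, RInt_minus_c, RInt_scal_c; try (intros t; cont; auto; fail).
  rewrite RInt_const_R. rring.
Qed.

(** The variance is nonnegative. *)
Lemma RInt_jensen (g : R -> R) :
  (forall t, continuity_pt g t) ->
  RInt g 0 (2 * PI) ^ 2 / (2 * PI) <= RInt (fun x => g x ^ 2) 0 (2 * PI).
Proof.
  intros Hc. pose proof PI_RGT_0.
  set (m := RInt g 0 (2 * PI) / (2 * PI)).
  assert (0 <= RInt (fun x => (g x - m) ^ 2) 0 (2 * PI)).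
  { apply RInt_nonneg; [lra| |intros; apply pow2_ge_0].
    intros t. cont; auto. }
  rewrite RInt_shift_sqr in H0 by exact Hc.
  replace (RInt g 0 (2 * PI) ^ 2 / (2 * PI)) with (2 * m * RInt g 0 (2 * PI) - m ^ 2 * (2 * PI - 0))
    by (unfold m; field; lra). lra.
Qed.

(** A periodic function takes the same value at two opposite points; on the two
    half-circles they bound, the inequality with fixed endpoints applies. *)
Lemma wirtinger (g dg : R -> R) :
  (forall x, is_derive g x (dg x)) -> (forall x, continuity_pt dg x) ->
  (forall x, g (x + 2 * PI) = g x) -> (forall x, dg (x + 2 * PI) = dg x) ->
  RInt (fun x => g x ^ 2) 0 (2 * PI) - RInt g 0 (2 * PI) ^ 2 / (2 * PI)
  <= RInt (fun x => dg x ^ 2) 0 (2 * PI).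
Proof.
  intros Hg Hdg Hp Hdp. pose proof PI_RGT_0.
  assert (Cg : forall x, continuity_pt g x) by (intros x; eapply is_derive_cont, Hg).
  destruct (IVT_signed (fun x => g (x + PI) - g x) 0 PI) as [x0 [_ E]].
  - lra.
  - intros x _. apply continuity_pt_minus'; [|apply Cg].
    apply (continuity_pt_comp (fun x => x + PI) g); [|apply Cg]. cont. apply continuity_pt_id.
  - replace (PI + PI) with (0 + 2 * PI) by ring. rewrite Hp, Rplus_0_l.
    pose proof (pow2_ge_0 (g PI - g 0)). nra.
  - cbv beta in E. set (m := g x0). set (u := fun x => g x - m).
    assert (Hu : forall x, is_derive u x (dg x)).
    { intros x. replace (dg x) with (dg x - 0) by ring.
      apply (is_derive_minus g (fun _ => m)); [apply Hg|].
      apply (is_derive_const (K := R_AbsRing) (V := R_NormedModule)). }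
    assert (Cu2 : forall x, continuity_pt (fun x => u x ^ 2) x).
    { intros x. unfold u. cont; auto. }
    assert (Cd2 : forall x, continuity_pt (fun x => dg x ^ 2) x).
    { intros x. cont; auto. }
    assert (K : RInt (fun x => u x ^ 2) x0 (x0 + 2 * PI)
                <= RInt (fun x => dg x ^ 2) x0 (x0 + 2 * PI)).
    { apply le_of_lt_1. intros k Hk.
      rewrite <- (RInt_chasles_c (fun x => u x ^ 2) x0 (x0 + PI) (x0 + 2 * PI)) by auto.
      rewrite <- (RInt_chasles_c (fun x => dg x ^ 2) x0 (x0 + PI) (x0 + 2 * PI)) by auto.
      replace (x0 + 2 * PI) with (x0 + PI + PI) by ring.
      rewrite Rmult_plus_distr_l. apply Rplus_le_compat.
      - apply wirtinger_dirichlet; auto; unfold u, m; lra.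
      - assert (x0 + PI + PI = x0 + 2 * PI) as E2 by ring.
        apply wirtinger_dirichlet; auto; unfold u, m; rewrite ?E2, ?Hp; lra. }
    rewrite !RInt_periodic in K; auto.
    2:{ intros t. cbv beta. rewrite Hdp. reflexivity. }
    2:{ intros t. unfold u. rewrite Hp. reflexivity. }
    unfold u in K. rewrite RInt_shift_sqr in K by exact Cg.
    set (G := RInt g 0 (2 * PI)) in *.
    assert (0 <= 2 * PI * (m - G / (2 * PI)) ^ 2) by (apply Rmult_le_pos; [lra|apply pow2_ge_0]).
    replace (2 * PI * (m - G / (2 * PI)) ^ 2) with
      (m ^ 2 * (2 * PI - 0) - 2 * m * G + G ^ 2 / (2 * PI)) in H0 by (field; lra).
    lra.
Qed.

(** * The energy of a test function *)

Definition everywhere : R * R -> Prop := fun _ => True.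

Lemma open_everywhere : open everywhere.
Proof. apply open_true. Qed.

Lemma smooth2_mult f g :
  smooth2 everywhere f -> smooth2 everywhere g -> smooth2 everywhere (fun x y => f x y * g x y).
Proof. intros Hf Hg n. apply Cn2_mult; auto using open_everywhere. Qed.

Lemma smooth2_plus f g :
  smooth2 everywhere f -> smooth2 everywhere g -> smooth2 everywhere (fun x y => f x y + g x y).
Proof. intros Hf Hg n. apply Cn2_plus; auto using open_everywhere. Qed.

Lemma smooth2_const c : smooth2 everywhere (fun _ _ => c).
Proof. intros n. apply Cn2_const, open_everywhere. Qed.

Lemma smooth2_sqr f : smooth2 everywhere f -> smooth2 everywhere (fun x y => f x y ^ 2).
Proof. intros Hf. simpl. auto using smooth2_mult, smooth2_const. Qed.

Lemma smooth2_cont2 f s t : smooth2 everywhere f -> continuity_pt (f s) t.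
Proof.
  intros Hf. apply continuity_2d_pt_snd, smooth2_continuity with everywhere;
    auto using open_everywhere. exact I.
Qed.

(** The parallel circles are parametrized by [0, 2 PI]; their radius is left out of the
    integral. *)
Definition circ (g : R -> R -> R) (s : R) : R := RInt (g s) 0 (2 * PI).

Lemma circ_derive g s : smooth2 everywhere g -> is_derive (circ g) s (circ (pd2 0 g) s).
Proof.
  intros Hg. unfold circ.
  assert (Hd : forall u, is_derive (fun u => RInt (g u) 0 (2 * PI)) u
                 (RInt (pd2 0 g u) 0 (2 * PI))); [|apply Hd].
  intros u. apply (is_derive_RInt_strip (fun _ => True)); [apply open_true|apply Hg|exact I].
Qed.

Lemma circ_cont g s : smooth2 everywhere g -> continuity_pt (circ g) s.
Proof. intros Hg. eapply is_derive_cont, circ_derive, Hg. Qed.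

Lemma circ_plus f g s : smooth2 everywhere f -> smooth2 everywhere g ->
  circ (fun x y => f x y + g x y) s = circ f s + circ g s.
Proof. intros Hf Hg. apply RInt_plus_c; intros t; apply smooth2_cont2; assumption. Qed.

Lemma circ_scal f k s : smooth2 everywhere f ->
  circ (fun x y => k * f x y) s = k * circ f s.
Proof. intros Hf. apply RInt_scal_c; intros t; apply smooth2_cont2; assumption. Qed.

Lemma circ_ext f g s : (forall t, f s t = g s t) -> circ f s = circ g s.
Proof. intros H. apply RInt_ext_all, H. Qed.

Lemma circ_sqr_nonneg g s : smooth2 everywhere g -> 0 <= circ (fun x y => g x y ^ 2) s.
Proof.
  intros Hg. pose proof PI_RGT_0. apply RInt_nonneg; [lra| |intros; apply pow2_ge_0].
  intros t. apply (smooth2_cont2 (fun x y => g x y ^ 2)), smooth2_sqr, Hg.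
Qed.

(** Test functions read in the coordinates [s], [theta]. *)
Definition periodic_compact (phi : R -> R -> R) (S0 : R) : Prop :=
  smooth2 everywhere phi /\ (forall s t, phi s (t + 2 * PI) = phi s t) /\
  0 < S0 /\ (forall s t, S0 <= Rabs s -> phi s t = 0).

Definition energy (a : R) (phi : R -> R -> R) (s : R) : R :=
  sinh (y0 a s) * circ (fun x y => pd2 0 phi x y ^ 2) s
  + circ (fun x y => pd2 1 phi x y ^ 2) s / sinh (y0 a s)
  - potential a s * sinh (y0 a s) * circ (fun x y => phi x y ^ 2) s.

Lemma RInt_vanish (f : R -> R) a b :
  (forall t, Rmin a b < t < Rmax a b -> f t = 0) -> RInt f a b = 0.
Proof.
  intros H. transitivity (RInt (fun _ => 0) a b); [apply RInt_ext, H|].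
  rewrite RInt_const_R. rring.
Qed.

Lemma RInt_gen_compact (g : R -> R) S0 :
  0 < S0 -> (forall s, continuity_pt g s) -> (forall s, S0 <= Rabs s -> g s = 0) ->
  RInt_gen g (Rbar_locally m_infty) (Rbar_locally p_infty) = RInt g (- S0) S0.
Proof.
  intros HS Hc H0. apply is_RInt_gen_unique. intros P [eps HP].
  apply (Filter_prod _ _ _ (fun x => x < - S0) (fun x => S0 < x)).
  - exists (- S0). auto.
  - exists S0. auto.
  - intros x y Hx Hy. simpl. exists (RInt g x y). split.
    + apply (RInt_correct g x y), ex_RInt_cont, Hc.
    + apply HP. replace (RInt g x y) with (RInt g (- S0) S0); [apply ball_center|].
      pose proof (RInt_chasles_c g x (- S0) y Hc) as C1.
      pose proof (RInt_chasles_c g (- S0) S0 y Hc) as C2.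
      rewrite (RInt_vanish g x (- S0)) in C1.
      2:{ intros t Ht. apply H0. rewrite Rmin_left, Rmax_right in Ht by lra.
          rewrite Rabs_left; lra. }
      rewrite (RInt_vanish g S0 y) in C2.
      2:{ intros t Ht. apply H0. rewrite Rmin_left, Rmax_right in Ht by lra.
          rewrite Rabs_right; lra. }
      rewrite Rplus_0_l in C1. rewrite Rplus_0_r in C2. rewrite <- C1. exact C2.
Qed.

Section Energy.

Variable a : R.
Hypothesis Ha : 0 < a.

Lemma sinh_y0_cont s : continuity_pt (fun s => sinh (y0 a s)) s.
Proof. eapply is_derive_cont, sinh_y0_derive, Ha. Qed.
Lemma cosh_y0_cont s : continuity_pt (fun s => cosh (y0 a s)) s.
Proof. eapply is_derive_cont, cosh_y0_derive, Ha. Qed.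
Lemma slope_cont s : continuity_pt (slope a) s.
Proof. eapply is_derive_cont, slope_derive, Ha. Qed.
Lemma speed_cont s : continuity_pt (speed a) s.
Proof. eapply is_derive_cont, speed_derive, Ha. Qed.
Lemma sinh_y0_neq s : sinh (y0 a s) <> 0.
Proof. pose proof (sinh_y0_pos a Ha s). lra. Qed.
Lemma potential_cont s : continuity_pt (potential a) s.
Proof.
  unfold potential. cont; auto using sinh_y0_cont, cosh_y0_cont, speed_cont, sinh_y0_neq.
Qed.

Variables (phi : R -> R -> R) (S0 : R).
Hypothesis Hphi : periodic_compact phi S0.

Lemma phi_smooth : smooth2 everywhere phi.
Proof. apply Hphi. Qed.

Lemma energy_cont s : continuity_pt (energy a phi) s.
Proof.
  unfold energy. cont; auto using sinh_y0_cont, sinh_y0_neq, potential_cont;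
    apply circ_cont; apply smooth2_sqr; auto using smooth2_pd2, phi_smooth.
Qed.

Lemma pd2_1_periodic s t : pd2 1 phi s (t + 2 * PI) = pd2 1 phi s t.
Proof.
  destruct Hphi as [_ [Hp _]]. destruct (smooth2_derive _ _ phi_smooth) as [_ D].
  pose proof (D s (t + 2 * PI) I) as D1.
  assert (D2 : is_derive (fun u => phi s (u + 2 * PI)) t (1 * pd2 1 phi s (t + 2 * PI))).
  { apply (is_derive_comp (phi s) (fun u => u + 2 * PI)); [exact D1|].
    auto_derive; [exact I|ring]. }
  rewrite Rmult_1_l in D2. symmetry. apply is_derive_unique.
  apply is_derive_ext with (2 := D2). intros u. apply Hp.
Qed.

Lemma circ_by_parts s :
  circ (fun x y => phi x y * pd2 1 (pd2 1 phi) x y) s = - circ (fun x y => pd2 1 phi x y ^ 2) s.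
Proof.
  pose proof (smooth2_pd2 _ _ 1 phi_smooth) as H1. pose proof (smooth2_pd2 _ _ 1 H1) as H11.
  assert (E : circ (fun x y => pd2 1 phi x y ^ 2 + phi x y * pd2 1 (pd2 1 phi) x y) s = 0).
  { unfold circ. rewrite (RInt_derive (fun y => phi s y * pd2 1 phi s y)
      (fun y => pd2 1 phi s y ^ 2 + phi s y * pd2 1 (pd2 1 phi) s y)).
    - destruct Hphi as [_ [Hp _]].
      pose proof (Hp s 0) as E1. pose proof (pd2_1_periodic s 0) as E2.
      rewrite Rplus_0_l in E1, E2. rewrite E1, E2. ring.
    - intros y. destruct (smooth2_derive _ _ phi_smooth) as [_ D].
      destruct (smooth2_derive _ _ H1) as [_ D1].
      apply is_derive_eq with (pd2 1 phi s y * pd2 1 phi s y + phi s y * pd2 1 (pd2 1 phi) s y);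
        [|ring].
      apply (is_derive_mult (phi s) (pd2 1 phi s)); [apply D, I|apply D1, I|intros; apply Rmult_comm].
    - intros y. apply (smooth2_cont2 (fun x y => pd2 1 phi x y ^ 2 + phi x y * pd2 1 (pd2 1 phi) x y)).
      auto using smooth2_plus, smooth2_sqr, smooth2_mult, phi_smooth. }
  rewrite circ_plus in E; auto using smooth2_sqr, smooth2_mult, phi_smooth. lra.
Qed.

Lemma circ_sqr_derive s :
  is_derive (circ (fun x y => phi x y ^ 2)) s (2 * circ (fun x y => phi x y * pd2 0 phi x y) s).
Proof.
  rewrite <- circ_scal by auto using smooth2_mult, smooth2_pd2, phi_smooth.
  erewrite circ_ext; [apply circ_derive, smooth2_sqr, phi_smooth|].
  intros t. symmetry. apply is_derive_unique. destruct (smooth2_derive _ _ phi_smooth) as [D _].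
  apply (is_derive_sqr (fun x => phi x t)), D, I.
Qed.

Lemma circ_mixed_derive s :
  is_derive (circ (fun x y => phi x y * pd2 0 phi x y)) s
    (circ (fun x y => pd2 0 phi x y ^ 2) s + circ (fun x y => phi x y * pd2 0 (pd2 0 phi) x y) s).
Proof.
  pose proof (smooth2_pd2 _ _ 0 phi_smooth) as H1. pose proof (smooth2_pd2 _ _ 0 H1) as H11.
  rewrite <- circ_plus by auto using smooth2_mult, smooth2_sqr, phi_smooth.
  erewrite circ_ext; [apply circ_derive; auto using smooth2_mult, phi_smooth|].
  intros t. symmetry. apply is_derive_unique. destruct (smooth2_derive _ _ phi_smooth) as [D _].
  destruct (smooth2_derive _ _ H1) as [D1 _].
  apply is_derive_eq with (pd2 0 phi s t * pd2 0 phi s t + phi s t * pd2 0 (pd2 0 phi) s t);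
    [|ring].
  apply (is_derive_mult (fun x => phi x t) (fun x => pd2 0 phi x t));
    [apply D, I|apply D1, I|intros; apply Rmult_comm].
Qed.

(** The second term of the right-hand side is the derivative of [f * circ (phi phi_s)]:
    it integrates to 0 over a compact support. *)
Lemma jacobi_density s :
  RInt (fun t => phi s t * jacobi (catenoid a) phi s t * sqrt (det_first_form (catenoid a) s t))
    0 (2 * PI) =
  energy a phi s
  - (cosh (y0 a s) * slope a s * circ (fun x y => phi x y * pd2 0 phi x y) s
     + sinh (y0 a s) * (circ (fun x y => pd2 0 phi x y ^ 2) s
                        + circ (fun x y => phi x y * pd2 0 (pd2 0 phi) x y) s)).
Proof.
  pose proof (smooth2_pd2 _ _ 0 phi_smooth) as H0. pose proof (smooth2_pd2 _ _ 0 H0) as H00.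
  pose proof (smooth2_pd2 _ _ 1 phi_smooth) as H1. pose proof (smooth2_pd2 _ _ 1 H1) as H11.
  set (f := sinh (y0 a s)). set (f1 := cosh (y0 a s) * slope a s). set (q := potential a s).
  assert (Hf : f <> 0) by apply sinh_y0_neq.
  transitivity (circ (fun x y => ((- f1) * (phi x y * pd2 0 phi x y)
      + (- f) * (phi x y * pd2 0 (pd2 0 phi) x y))
      + ((- / f) * (phi x y * pd2 1 (pd2 1 phi) x y) + (- q * f) * phi x y ^ 2)) s).
  { apply RInt_ext_all. intros t. rewrite sqrt_det_catenoid, jacobi_catenoid by exact Ha.
    replace (Derive (fun x => sinh (y0 a x) * pd2 0 phi x t) s)
      with (f1 * pd2 0 phi s t + f * pd2 0 (pd2 0 phi) s t).
    2:{ symmetry. apply is_derive_unique. destruct (smooth2_derive _ _ H0) as [D _].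
        apply (is_derive_mult (fun x => sinh (y0 a x)) (fun x => pd2 0 phi x t));
          [apply sinh_y0_derive, Ha|apply D, I|intros; apply Rmult_comm]. }
    fold f q. field. exact Hf. }
  assert (S1 : smooth2 everywhere (fun x y => phi x y * pd2 0 phi x y)) by auto using smooth2_mult, phi_smooth.
  assert (S2 : smooth2 everywhere (fun x y => phi x y * pd2 0 (pd2 0 phi) x y)) by auto using smooth2_mult, phi_smooth.
  assert (S3 : smooth2 everywhere (fun x y => phi x y * pd2 1 (pd2 1 phi) x y)) by auto using smooth2_mult, phi_smooth.
  assert (S4 : smooth2 everywhere (fun x y => phi x y ^ 2)) by auto using smooth2_sqr, phi_smooth.
  rewrite !circ_plus, !circ_scal; auto using smooth2_plus, smooth2_mult, smooth2_const.
  rewrite circ_by_parts. unfold energy. fold f q. fold f1. as_R. field. exact Hf.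
Qed.

Lemma support_zero s : S0 <= Rabs s -> phi s = fun _ => 0.
Proof.
  intros H. apply functional_extensionality. intros t. apply Hphi, H.
Qed.

(** Integration by parts turns the Jacobi form into the first-order energy. *)
Lemma jacobi_integral :
  RInt_gen (fun s => RInt (fun t => phi s t * jacobi (catenoid a) phi s t
                             * sqrt (det_first_form (catenoid a) s t)) 0 (2 * PI))
    (Rbar_locally m_infty) (Rbar_locally p_infty) = RInt (energy a phi) (- S0) S0.
Proof.
  pose proof (smooth2_pd2 _ _ 0 phi_smooth) as H0. pose proof (smooth2_pd2 _ _ 0 H0) as H00.
  set (B := circ (fun x y => phi x y * pd2 0 phi x y)).
  set (W := fun s => cosh (y0 a s) * slope a s * B s
     + sinh (y0 a s) * (circ (fun x y => pd2 0 phi x y ^ 2) s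
                        + circ (fun x y => phi x y * pd2 0 (pd2 0 phi) x y) s)).
  assert (CW : forall s, continuity_pt W s).
  { intros s. unfold W, B. cont; auto using cosh_y0_cont, sinh_y0_cont, slope_cont;
      apply circ_cont; auto using smooth2_mult, smooth2_sqr, phi_smooth. }
  assert (DW : forall s, is_derive (fun s => sinh (y0 a s) * B s) s (W s)).
  { intros s. apply (is_derive_mult (fun s => sinh (y0 a s)) B);
      [apply sinh_y0_derive, Ha|apply circ_mixed_derive|intros; apply Rmult_comm]. }
  replace (fun s => RInt (fun t => phi s t * jacobi (catenoid a) phi s t
      * sqrt (det_first_form (catenoid a) s t)) 0 (2 * PI))
    with (fun s => energy a phi s - W s)
    by (apply functional_extensionality; intros s; symmetry; apply jacobi_density).
  destruct Hphi as [_ [_ [HS _]]].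
  assert (HB : forall s, S0 <= Rabs s -> B s = 0).
  { intros s Hr. unfold B, circ. apply RInt_vanish. intros t _. rewrite (support_zero s Hr). ring. }
  rewrite (RInt_gen_compact _ S0 HS).
  - rewrite RInt_minus_c by auto using energy_cont.
    rewrite (RInt_derive (fun s => sinh (y0 a s) * B s) W) by auto.
    rewrite (HB S0), (HB (- S0)) by (unfold Rabs; destruct Rcase_abs; lra). rring.
  - intros s. cont; auto using energy_cont.
  - intros s Hr. transitivity (RInt (fun t => phi s t * jacobi (catenoid a) phi s t
      * sqrt (det_first_form (catenoid a) s t)) 0 (2 * PI));
      [symmetry; apply jacobi_density|]. apply RInt_vanish.
    intros t _. rewrite (support_zero s Hr). ring.
Qed.

End Energy.

Lemma jacobi_form_energy a f S0 : 0 < a ->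
  periodic_compact (fun s t => f (catenoid a s t)) S0 ->
  jacobi_form (catenoid a) f = RInt (energy a (fun s t => f (catenoid a s t))) (- S0) S0.
Proof. intros Ha H. apply (jacobi_integral a Ha _ _ H). Qed.

(** * Signs of the energy *)

Section Signs.

Variable a : R.
Hypothesis Ha : 0 < a.
Variables (phi : R -> R -> R) (S0 : R).
Hypothesis Hphi : periodic_compact phi S0.

Local Notation f := (fun s => sinh (y0 a s)).
Local Notation M := (circ (fun x y => phi x y ^ 2)).
Local Notation B := (circ (fun x y => phi x y * pd2 0 phi x y)).
Local Notation N := (circ (fun x y => pd2 0 phi x y ^ 2)).
Local Notation P := (circ (fun x y => pd2 1 phi x y ^ 2)).

Lemma test_smooth : smooth2 everywhere phi.
Proof. exact (phi_smooth phi S0 Hphi). Qed.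

Lemma circ_square s b :
  circ (fun x y => (pd2 0 phi x y - b * phi x y) ^ 2) s = N s - 2 * b * B s + b ^ 2 * M s.
Proof.
  pose proof (smooth2_pd2 _ _ 0 test_smooth) as H0.
  transitivity (circ (fun x y => pd2 0 phi x y ^ 2 +
    ((- 2 * b) * (phi x y * pd2 0 phi x y) + b ^ 2 * phi x y ^ 2)) s).
  { apply circ_ext. intros t. ring. }
  rewrite !circ_plus, !circ_scal;
    auto 10 using test_smooth, smooth2_plus, smooth2_mult, smooth2_const, smooth2_sqr.
  ring.
Qed.

Lemma square_smooth b : smooth2 everywhere (fun x y => pd2 0 phi x y - b * phi x y).
Proof.
  intros n. pose proof (smooth2_pd2 _ _ 0 test_smooth) as H0. pose proof open_everywhere. pose proof test_smooth.
  apply Cn2_minus; auto. apply Cn2_mult; auto using Cn2_const.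
Qed.

Lemma circ_conts : (forall s, continuity_pt M s) /\ (forall s, continuity_pt B s) /\
  (forall s, continuity_pt N s) /\ (forall s, continuity_pt P s).
Proof.
  pose proof (smooth2_pd2 _ _ 0 test_smooth) as H0. pose proof (smooth2_pd2 _ _ 1 test_smooth) as H1.
  repeat apply conj; intros s; apply circ_cont; auto using test_smooth, smooth2_sqr, smooth2_mult.
Qed.

Lemma boundary_zero s : S0 <= Rabs s -> M s = 0.
Proof.
  intros H. unfold circ. apply RInt_vanish. intros t _.
  destruct Hphi as [_ [_ [_ Hz]]]. rewrite Hz by exact H. ring.
Qed.

Lemma boundary_zero_ends : M S0 = 0 /\ M (- S0) = 0.
Proof.
  destruct Hphi as [_ [_ [HS _]]].
  split; apply boundary_zero; unfold Rabs; destruct Rcase_abs; lra.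
Qed.

Lemma energy_split :
  RInt (energy a phi) (- S0) S0 =
  RInt (fun s => f s * N s - potential a s * f s * M s) (- S0) S0
  + RInt (fun s => P s / f s) (- S0) S0.
Proof.
  destruct circ_conts as [CM [CB [CN CP]]].
  rewrite <- RInt_plus_c.
  - apply RInt_ext_all. intros s. unfold energy. ring.
  - intros s. cont; auto using potential_cont, sinh_y0_cont.
  - intros s. cont; auto using sinh_y0_cont, sinh_y0_neq.
Qed.

Lemma angular_nonneg : 0 <= RInt (fun s => P s / f s) (- S0) S0.
Proof.
  destruct circ_conts as [CM [CB [CN CP]]]. destruct Hphi as [_ [_ [HS _]]].
  apply RInt_nonneg; [lra| |].
  - intros s. cont; auto using sinh_y0_cont, sinh_y0_neq.
  - intros s _. apply Rmult_le_pos.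
    + apply circ_sqr_nonneg, smooth2_pd2, test_smooth.
    + left. pose proof (sinh_y0_pos a Ha s). pos.
Qed.

Lemma e0_cont s : continuity_pt (e0 a) s.
Proof. eapply is_derive_cont, e0_derive, Ha. Qed.

Lemma e0_s_cont s : continuity_pt (e0_s a) s.
Proof.
  assert (C : continuity_pt (fun t => (sinh (y0 a t) * e0_s a t) / sinh (y0 a t)) s).
  { apply continuity_pt_div'; auto using sinh_y0_cont, sinh_y0_neq.
    eapply is_derive_cont, e0_jacobi, Ha. }
  revert C. apply continuity_pt_ext. intros t. pose proof (sinh_y0_neq a Ha t). field. auto.
Qed.

(** [e0] is a positive solution of the Jacobi equation on the support, and the angular
    derivative only contributes nonnegatively. *)
Lemma energy_picone :
  (forall s, - S0 <= s <= S0 -> 0 < e0 a s) ->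
  RInt (fun s => f s * circ (fun x y => (pd2 0 phi x y - e0_s a s / e0 a s * phi x y) ^ 2) s)
    (- S0) S0 <= RInt (energy a phi) (- S0) S0.
Proof.
  intros He. destruct circ_conts as [CM [CB [CN CP]]]. destruct boundary_zero_ends as [E1 E2].
  assert (HS : 0 < S0) by apply Hphi.
  rewrite energy_split. pose proof angular_nonneg as HP.
  pose proof (picone f (potential a) (e0 a) (e0_s a)
    (fun s => - potential a s * sinh (y0 a s) * e0 a s) M B N (- S0) S0) as K.
  rewrite E1, E2, !Rmult_0_r, Rminus_0_r, Rplus_0_r in K.
  eapply Rle_trans; [|apply Rplus_le_compat_l, HP]. rewrite Rplus_0_r.
  eapply Rle_trans; [|apply K].
  - right. apply RInt_ext_all. intros s. rewrite circ_square. reflexivity.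
  - lra.
  - intros s Hs. refine (conj _ (conj _ (conj _ (conj _ (conj _ _))))).
    + apply e0_derive, Ha.
    + apply e0_jacobi, Ha.
    + lra.
    + apply He, Hs.
    + apply (circ_sqr_derive _ _ Hphi).
    + apply circ_sqr_nonneg, test_smooth.
  - intros s Hs. repeat apply conj; auto using sinh_y0_cont, potential_cont, e0_s_cont.
    apply continuity_pt_ext with (fun s => -1 * potential a s * sinh (y0 a s) * e0 a s).
    { intros t. ring. }
    cont; auto using sinh_y0_cont, potential_cont, e0_cont.
Qed.

Lemma energy_weakly_stable :
  (forall s, - S0 <= s <= S0 -> 0 < e0 a s) -> 0 <= RInt (energy a phi) (- S0) S0.
Proof.
  intros He. eapply Rle_trans; [|apply energy_picone, He].
  assert (HS : 0 < S0) by apply Hphi. destruct circ_conts as [CM [CB [CN CP]]].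
  apply RInt_ge_0; [lra| |].
  - apply ex_RInt_on; [lra|]. intros s Hs.
    apply continuity_pt_ext with (fun s => f s *
      (N s - 2 * (e0_s a s / e0 a s) * B s + (e0_s a s / e0 a s) ^ 2 * M s)).
    { intros t. rewrite circ_square. reflexivity. }
    specialize (He s Hs). cont; auto using sinh_y0_cont, e0_s_cont, e0_cont; lra.
  - intros s _. apply Rmult_le_pos.
    + left. apply sinh_y0_pos, Ha.
    + apply circ_sqr_nonneg, square_smooth.
Qed.

(** Equality would force [phi / e0] to be constant along the meridians, hence zero. *)
Lemma energy_stable s0 t0 :
  (forall s, 0 < e0 a s) -> 0 <= t0 <= 2 * PI -> phi s0 t0 <> 0 ->
  0 < RInt (energy a phi) (- S0) S0.
Proof.
  intros He Ht0 Hnz. pose proof PI_RGT_0.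
  apply Rnot_le_lt. intros Hle. apply Hnz.
  assert (HS : 0 < S0) by apply Hphi. destruct circ_conts as [CM [CB [CN CP]]].
  set (D := fun s => f s * circ (fun x y => (pd2 0 phi x y - e0_s a s / e0 a s * phi x y) ^ 2) s).
  assert (CD : forall s, continuity_pt D s).
  { intros s. apply continuity_pt_ext with (fun s => f s *
      (N s - 2 * (e0_s a s / e0 a s) * B s + (e0_s a s / e0 a s) ^ 2 * M s)).
    { intros t. unfold D. rewrite circ_square. reflexivity. }
    specialize (He s). cont; auto using sinh_y0_cont, e0_s_cont, e0_cont; lra. }
  assert (PD : forall s, 0 <= D s).
  { intros s. apply Rmult_le_pos; [left; apply sinh_y0_pos, Ha|].
    apply circ_sqr_nonneg, square_smooth. }
  pose proof (energy_picone (fun s _ => He s)) as K. fold D in K.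
  assert (ZD : RInt D (- S0) S0 = 0).
  { apply Rle_antisym; [lra|]. apply RInt_nonneg; auto. lra. }
  assert (Z : forall s, - S0 <= s <= S0 -> pd2 0 phi s t0 - e0_s a s / e0 a s * phi s t0 = 0).
  { intros s Hs. pose proof (RInt_zero_nonneg D (- S0) S0 ltac:(lra) CD (fun t _ => PD t) ZD s Hs) as E.
    unfold D in E. apply Rmult_integral in E. destruct E as [E|E].
    - pose proof (sinh_y0_pos a Ha s). lra.
    - set (g := fun x y => (pd2 0 phi x y - e0_s a s / e0 a s * phi x y) ^ 2) in E.
      assert (Hg : smooth2 everywhere g) by apply smooth2_sqr, square_smooth.
      assert (E3 : g s t0 = 0).
      { apply (RInt_zero_nonneg (g s) 0 (2 * PI)); auto; [lra| |].
        - intros t. apply smooth2_cont2, Hg.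
        - intros t _. apply pow2_ge_0. }
      unfold g in E3. apply Rsqr_0_uniq. unfold Rsqr. lra. }
  assert (Hq : forall s, - S0 <= s <= S0 -> is_derive (fun s => phi s t0 / e0 a s) s 0).
  { intros s Hs. destruct (smooth2_derive _ _ test_smooth) as [D1 _]. specialize (He s).
    apply is_derive_eq with ((pd2 0 phi s t0 * e0 a s - phi s t0 * e0_s a s) / e0 a s ^ 2).
    - apply (is_derive_div (fun s => phi s t0) (e0 a)); [apply D1, I|apply e0_derive, Ha|lra].
    - specialize (Z s Hs). replace (pd2 0 phi s t0) with (e0_s a s / e0 a s * phi s t0) by lra.
      field. lra. }
  destruct Hphi as [_ [_ [_ Hz]]].
  destruct (Rle_lt_dec S0 (Rabs s0)) as [L|L]; [apply Hz, L|].
  apply Rabs_lt_between in L.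
  assert (E : phi s0 t0 / e0 a s0 = phi S0 t0 / e0 a S0).
  { apply (derive_zero_const (fun s => phi s t0 / e0 a s)); [|lra]. intros s Hs. apply Hq. lra. }
  rewrite (Hz S0) in E by (rewrite Rabs_right; lra). specialize (He s0).
  replace (phi s0 t0) with (phi s0 t0 / e0 a s0 * e0 a s0) by (field; lra).
  rewrite E. unfold Rdiv. ring.
Qed.

(** ** The index is at most one *)

(** If the mean of [phi] over the neck vanishes, the energy is nonnegative. The mean
    value of [phi] along the circles vanishes at [s = 0], and the two half-catenoids
    are stable for such functions; for functions of zero mean along each circle,
    Wirtinger's inequality adds [1 / f^2] to the operator, for which [1 / f] is a
    supersolution. *)

Let mean (s : R) : R := circ phi s / (2 * PI).
Let mean_s (s : R) : R := circ (pd2 0 phi) s / (2 * PI).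

Lemma mean_derive s : is_derive mean s (mean_s s).
Proof. apply (is_derive_scal_r (circ phi)), circ_derive, test_smooth. Qed.

Lemma mean_jensen s b : 2 * PI * (mean_s s - b * mean s) ^ 2 <= N s - 2 * b * B s + b ^ 2 * M s.
Proof.
  pose proof PI_RGT_0. pose proof (smooth2_pd2 _ _ 0 test_smooth) as H0.
  rewrite <- circ_square.
  pose proof (RInt_jensen (fun t => pd2 0 phi s t - b * phi s t)) as J.
  assert (E : RInt (fun t => pd2 0 phi s t - b * phi s t) 0 (2 * PI) = 2 * PI * (mean_s s - b * mean s)).
  { rewrite RInt_minus_c, RInt_scal_c.
    - unfold mean, mean_s, circ. change (fun t => phi s t) with (phi s).
      as_R. field. lra.
    - intros t. apply (smooth2_cont2 phi), test_smooth.
    - intros t. apply (smooth2_cont2 (pd2 0 phi)), H0.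
    - intros t. apply (smooth2_cont2 (fun x y => b * phi x y)).
      apply smooth2_mult; [apply smooth2_const|apply test_smooth]. }
  rewrite E in J.
  replace ((2 * PI * (mean_s s - b * mean s)) ^ 2 / (2 * PI)) with (2 * PI * (mean_s s - b * mean s) ^ 2) in J
    by (field; lra).
  apply J. intros t. apply (smooth2_cont2 (fun x y => pd2 0 phi x y - b * phi x y)), square_smooth.
Qed.

Lemma mean_jensen0 s : 2 * PI * mean s ^ 2 <= M s.
Proof.
  pose proof PI_RGT_0.
  pose proof (RInt_jensen (phi s)) as J.
  replace (2 * PI * mean s ^ 2) with (RInt (phi s) 0 (2 * PI) ^ 2 / (2 * PI))
    by (unfold mean, circ; field; lra).
  apply J. intros t. apply smooth2_cont2, test_smooth.
Qed.

Lemma mean_wirtinger s : M s - 2 * PI * mean s ^ 2 <= P s.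
Proof.
  pose proof PI_RGT_0. destruct Hphi as [_ [Hp _]].
  pose proof (smooth2_pd2 _ _ 1 test_smooth) as H1.
  replace (2 * PI * mean s ^ 2) with (RInt (phi s) 0 (2 * PI) ^ 2 / (2 * PI))
    by (unfold mean, circ; field; lra).
  destruct (smooth2_derive _ _ test_smooth) as [_ D].
  apply (wirtinger (phi s) (pd2 1 phi s)).
  - intros x. apply D, I.
  - intros x. apply smooth2_cont2, H1.
  - apply Hp.
  - intros x. apply (pd2_1_periodic phi S0 Hphi).
Qed.

Lemma mean_conts : (forall s, continuity_pt mean s) /\ (forall s, continuity_pt mean_s s).
Proof.
  split; intros s.
  - eapply is_derive_cont, mean_derive.
  - unfold mean_s. cont; [|pose proof PI_RGT_0; lra]. apply (circ_cont (pd2 0 phi)), smooth2_pd2, test_smooth.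
Qed.

Lemma mean_boundary s : S0 <= Rabs s -> mean s = 0.
Proof.
  intros H. unfold mean, circ. rewrite RInt_vanish; [unfold Rdiv; ring|].
  intros t _. destruct Hphi as [_ [_ [_ Hz]]]. apply Hz, H.
Qed.

Lemma v0_cont s : continuity_pt (v0 a) s.
Proof. eapply is_derive_cont, v0_derive, Ha. Qed.

Lemma v0_s_cont s : continuity_pt (v0_s a) s.
Proof.
  unfold v0_s. cont; auto using sinh_y0_cont, cosh_y0_cont, slope_cont, speed_cont, sinh_y0_neq.
Qed.

(* The half-catenoids: [c = 1] on the right, [c = -1] on the left. *)
Lemma mean_half c al be :
  al <= be -> (forall s, al <= s <= be -> 0 <= c * s) -> (c = 1 \/ c = -1) ->
  mean al = 0 -> mean be = 0 ->
  0 <= RInt (fun s => f s * (2 * PI * mean_s s ^ 2) - potential a s * f s * (2 * PI * mean s ^ 2)) al be.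
Proof.
  intros Hab Hc Hc1 E1 E2. pose proof PI_RGT_0. destruct mean_conts as [C1 C2].
  destruct (half_line_positive a Ha) as [k [Hk Hpos]].
  assert (Hh : forall s, al <= s <= be -> 0 < c * v0 a s + k * e0 a s).
  { intros s Hs. specialize (Hc s Hs). destruct Hc1 as [-> | ->].
    - rewrite Rmult_1_l. apply Hpos. lra.
    - rewrite <- (Ropp_involutive s), (v0_odd a Ha), (e0_even a Ha).
      replace (-1 * - v0 a (- s)) with (v0 a (- s)) by ring. apply Hpos. lra. }
  apply (picone_nonneg f (potential a) (fun s => c * v0 a s + k * e0 a s)
    (fun s => c * v0_s a s + k * e0_s a s)
    (fun s => c * (-1 * potential a s * sinh (y0 a s) * v0 a s)
              + k * (-1 * potential a s * sinh (y0 a s) * e0 a s))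
    (fun s => 2 * PI * mean s ^ 2) (fun s => 2 * PI * (mean s * mean_s s))
    (fun s => 2 * PI * mean_s s ^ 2) al be Hab).
  - intros s Hs. refine (conj _ (conj _ (conj _ (conj _ (conj _ _))))).
    + apply (is_derive_plus (fun s => c * v0 a s) (fun s => k * e0 a s)).
      * apply (is_derive_scal (v0 a)), v0_derive, Ha.
      * apply (is_derive_scal (e0 a)), e0_derive, Ha.
    + apply is_derive_ext with (fun s => c * (sinh (y0 a s) * v0_s a s)
                                          + k * (sinh (y0 a s) * e0_s a s)).
      { intros t. rring. }
      apply is_derive_eq with (c * (- potential a s * sinh (y0 a s) * v0 a s)
              + k * (- potential a s * sinh (y0 a s) * e0 a s)); [|ring].
      apply (is_derive_plus (fun s => c * (sinh (y0 a s) * v0_s a s))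
        (fun s => k * (sinh (y0 a s) * e0_s a s))).
      * apply (is_derive_scal (fun s => sinh (y0 a s) * v0_s a s)), v0_jacobi, Ha.
      * apply (is_derive_scal (fun s => sinh (y0 a s) * e0_s a s)), e0_jacobi, Ha.
    + right. ring.
    + apply Hh, Hs.
    + apply is_derive_eq with (2 * PI * (2 * (mean s * mean_s s))); [|ring].
      apply (is_derive_scal (fun s => mean s ^ 2)), is_derive_sqr, mean_derive.
    + pose proof (pow2_ge_0 (mean s)). nra.
  - intros s Hs. repeat apply conj; cont;
      auto using sinh_y0_cont, potential_cont, e0_s_cont, v0_s_cont, v0_cont, e0_cont.
  - intros s b Hs. split; [left; apply sinh_y0_pos, Ha|].
    replace (2 * PI * mean_s s ^ 2 - 2 * b * (2 * PI * (mean s * mean_s s)) + b ^ 2 * (2 * PI * mean s ^ 2))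
      with (2 * PI * (mean_s s - b * mean s) ^ 2) by ring.
    pose proof (pow2_ge_0 (mean_s s - b * mean s)). nra.
  - rewrite E1. ring.
  - rewrite E2. ring.
Qed.

(** The supersolution is [1 / f]: the operator augmented by [1 / f^2] maps it to
    [-2], by the arc-length relation. *)
Lemma zero_mean_part :
  0 <= RInt (fun s => f s * (N s - 2 * PI * mean_s s ^ 2)
    - (potential a s - / f s ^ 2) * f s * (M s - 2 * PI * mean s ^ 2)) (- S0) S0.
Proof.
  pose proof PI_RGT_0. destruct mean_conts as [C1 C2].
  destruct circ_conts as [CM [CB [CN CP]]]. destruct boundary_zero_ends as [E1 E2].
  assert (HS : 0 < S0) by apply Hphi.
  assert (Hf : forall s, 0 < sinh (y0 a s)) by apply (sinh_y0_pos a Ha).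
  assert (CI : forall s, continuity_pt (fun s => potential a s - / f s ^ 2) s).
  { intros s. apply continuity_pt_ext with (fun s => potential a s - 1 / f s ^ 2).
    { intros t. field. apply sinh_y0_neq, Ha. }
    cont; auto using potential_cont, sinh_y0_cont. apply pow_nonzero, sinh_y0_neq, Ha. }
  apply (picone_nonneg f (fun s => potential a s - / f s ^ 2) (fun s => / f s)
    (fun s => - (cosh (y0 a s) * slope a s) / f s ^ 2)
    (fun s => slope a s ^ 2 / f s ^ 2
              - speed a s ^ 2 * cosh (y0 a s) ^ 2 / f s ^ 2 * (cosh (y0 a s) ^ 2 + f s ^ 2))
    (fun s => M s - 2 * PI * mean s ^ 2) (fun s => B s - 2 * PI * (mean s * mean_s s))
    (fun s => N s - 2 * PI * mean_s s ^ 2)); [lra| | | | |].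
  - intros s Hs. specialize (Hf s). refine (conj _ (conj _ (conj _ (conj _ (conj _ _))))).
    + apply (is_derive_inv f); [apply sinh_y0_derive, Ha|lra].
    + apply is_derive_ext with (fun s => -1 * (v0 a s / sinh (y0 a s))).
      { intros t. unfold v0. as_R. field. apply sinh_y0_neq, Ha. }
      pose proof (cosh2_sinh2 (y0 a s)) as E3.
      apply is_derive_eq with (-1 * ((v0_s a s * sinh (y0 a s)
         - v0 a s * (cosh (y0 a s) * slope a s)) / sinh (y0 a s) ^ 2)).
      2:{ unfold v0, v0_s. field_simplify_eq; [|lra]. ring [E3]. }
      apply (is_derive_scal (fun s => v0 a s / sinh (y0 a s))).
      apply (is_derive_div (v0 a) (fun s => sinh (y0 a s)));
        [apply v0_derive, Ha|apply sinh_y0_derive, Ha|lra].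
    + unfold potential. pose proof (cosh2_sinh2 (y0 a s)) as E3.
      pose proof (profile_arclength a Ha s) as E4.
      assert (E5 : slope a s ^ 2 = 1 - cosh (y0 a s) ^ 2 * speed a s ^ 2) by lra.
      rewrite E5.
      match goal with |- ?l <= ?r => assert (r - l = 2); [|lra] end.
      field_simplify_eq; [|lra]. ring [E3].
    + pos.
    + apply is_derive_eq with (2 * B s - 2 * PI * (2 * (mean s * mean_s s))); [|ring].
      apply (is_derive_minus M (fun s => 2 * PI * mean s ^ 2)).
      * apply (circ_sqr_derive _ _ Hphi).
      * apply (is_derive_scal (fun s => mean s ^ 2)), is_derive_sqr, mean_derive.
    + pose proof (mean_jensen0 s). lra.
  - intros s Hs. specialize (Hf s).
    assert (f s ^ 2 <> 0) by (apply pow_nonzero; lra).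
    repeat apply conj; auto.
    + apply sinh_y0_cont, Ha.
    + apply continuity_pt_ext with (fun s => (-1 * (cosh (y0 a s) * slope a s)) / sinh (y0 a s) ^ 2).
      { intros t. field. apply sinh_y0_neq, Ha. }
      cont; auto using sinh_y0_cont, cosh_y0_cont, slope_cont.
    + cont; auto using sinh_y0_cont, cosh_y0_cont, slope_cont, speed_cont.
    + cont; auto.
    + cont; auto.
  - intros s b Hs. split; [left; apply Hf|].
    pose proof (mean_jensen s b). 
    replace (2 * PI * (mean_s s - b * mean s) ^ 2) with (2 * PI * mean_s s ^ 2 - 2 * b * (2 * PI * (mean s * mean_s s))
      + b ^ 2 * (2 * PI * mean s ^ 2)) in H0 by ring. lra.
  - rewrite E2, mean_boundary; [ring|]. unfold Rabs; destruct Rcase_abs; lra.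
  - rewrite E1, mean_boundary; [ring|]. unfold Rabs; destruct Rcase_abs; lra.
Qed.

Lemma energy_zero_mean : circ phi 0 = 0 -> 0 <= RInt (energy a phi) (- S0) S0.
Proof.
  intros H0. pose proof PI_RGT_0. destruct mean_conts as [C1 C2].
  destruct circ_conts as [CM [CB [CN CP]]].
  assert (HS : 0 < S0) by apply Hphi.
  assert (Hf : forall s, 0 < sinh (y0 a s)) by apply (sinh_y0_pos a Ha).
  assert (M0 : mean 0 = 0) by (unfold mean; rewrite H0; unfold Rdiv; ring).
  set (G1 := fun s => f s * (2 * PI * mean_s s ^ 2) - potential a s * f s * (2 * PI * mean s ^ 2)).
  set (G2 := fun s => f s * (N s - 2 * PI * mean_s s ^ 2)
    - (potential a s - / f s ^ 2) * f s * (M s - 2 * PI * mean s ^ 2)).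
  set (G3 := fun s => (P s - (M s - 2 * PI * mean s ^ 2)) / f s).
  assert (CG1 : forall s, continuity_pt G1 s).
  { intros s. unfold G1. cont; auto using sinh_y0_cont, potential_cont. }
  assert (CG2 : forall s, continuity_pt G2 s).
  { intros s. apply continuity_pt_ext with (fun s => f s * (N s - 2 * PI * mean_s s ^ 2)
    - (potential a s - 1 / f s ^ 2) * f s * (M s - 2 * PI * mean s ^ 2)).
    { intros t. unfold G2. field. apply sinh_y0_neq, Ha. }
    cont; auto using sinh_y0_cont, potential_cont. apply pow_nonzero, sinh_y0_neq, Ha. }
  assert (CG3 : forall s, continuity_pt G3 s).
  { intros s. unfold G3. cont; auto using sinh_y0_cont, sinh_y0_neq. }
  assert (E : RInt (energy a phi) (- S0) S0 =
    RInt G1 (- S0) S0 + (RInt G2 (- S0) S0 + RInt G3 (- S0) S0)).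
  { rewrite <- (RInt_plus_c G2 G3), <- RInt_plus_c; auto.
    - apply RInt_ext_all. intros s. unfold energy, G1, G2, G3. specialize (Hf s). field. lra.
    - intros s. cont; auto. }
  rewrite E. repeat apply Rplus_le_le_0_compat.
  - rewrite <- (RInt_chasles_c G1 (- S0) 0 S0) by auto. apply Rplus_le_le_0_compat.
    + apply (mean_half (-1)); auto; try lra; [intros; lra|].
      apply mean_boundary. unfold Rabs; destruct Rcase_abs; lra.
    + apply (mean_half 1); auto; try lra; [intros; lra|].
      apply mean_boundary. unfold Rabs; destruct Rcase_abs; lra.
  - apply zero_mean_part.
  - apply RInt_nonneg; auto; [lra|]. intros s _. unfold G3. apply Rmult_le_pos.
    + pose proof (mean_wirtinger s). lra.
    + left. specialize (Hf s). pos.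
Qed.

End Signs.

(** * Compact sets of space *)

Definition bounded3 (K : R3 -> Prop) : Prop :=
  exists B, forall p i, K p -> Rabs (coord i p) <= B.

Lemma open_ball3 (O : R3 -> Prop) p : open O -> O p ->
  exists d : posreal, forall q, (forall i, Rabs (coord i q - coord i p) < d) -> O q.
Proof.
  intros HO Hp. destruct (HO p Hp) as [d Hd]. exists d. intros [[x y] z] H. apply Hd.
  destruct p as [[x0 y0] z0].
  repeat split; [apply (H 0%nat)|apply (H 1%nat)|apply (H 2%nat)].
Qed.

Lemma ball3_open (O : R3 -> Prop) :
  (forall p, O p -> exists d : posreal, forall q, (forall i, Rabs (coord i q - coord i p) < d) -> O q) ->
  open O.
Proof.
  intros H p Hp. destruct (H p Hp) as [d Hd]. exists d. intros [[x y] z] Hb.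
  destruct p as [[x0 y0] z0]. destruct Hb as [[H0 H1] H2].
  apply Hd. intros [|[|i]]; [apply H0|apply H1|apply H2].
Qed.

Definition continuous3 (g : R3 -> R) : Prop :=
  forall p eps, 0 < eps -> exists d : posreal, forall q,
    (forall i, Rabs (coord i q - coord i p) < d) -> Rabs (g q - g p) < eps.

Lemma closed_ball3 (K : R3 -> Prop) p : closed K -> ~ K p ->
  exists d : posreal, forall q, (forall i, Rabs (coord i q - coord i p) < d) -> ~ K q.
Proof.
  intros HK Hp. apply (open_ball3 (fun q => ~ K q)); [|exact Hp]. apply open_not, HK.
Qed.

(** Choose around each point of a box a radius on which either [g] stays above half its
    value, or [K] is avoided; compactness of the box makes the radius uniform. *)
Lemma compact_lower_bound (K : R3 -> Prop) (g : R3 -> R) :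
  closed K -> bounded3 K -> continuous3 g -> (forall p, K p -> 0 < g p) ->
  exists d, 0 < d /\ forall p, K p -> d <= g p.
Proof.
  intros HK [B HB] Hg Hpos.
  set (pt := fun t : Compactness.Tn 3 R => ((fst t, fst (snd t)), fst (snd (snd t))) : R3).
  set (Q := fun t (d : posreal) => (K (pt t) -> d <= g (pt t) / 2) /\
    forall q, (forall i, Rabs (coord i q - coord i (pt t)) < d) ->
      (K (pt t) -> g (pt t) / 2 < g q) /\ (~ K (pt t) -> ~ K q)).
  assert (HQ : forall t, exists d, Q t d).
  { intros t. destruct (classic (K (pt t))) as [Hk|Hk].
    - specialize (Hpos _ Hk). destruct (Hg (pt t) (g (pt t) / 2)) as [d Hd]; [lra|].
      assert (H0 : 0 < Rmin d (g (pt t) / 2)) by (apply Rmin_pos; [apply cond_pos|lra]).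
      exists (mkposreal _ H0). split; simpl.
      + intros _. apply Rmin_r.
      + intros q Hq. split; [|tauto]. intros _.
        assert (L : Rabs (g q - g (pt t)) < g (pt t) / 2).
        { apply Hd. intros i. pose proof (Rmin_l d (g (pt t) / 2)). specialize (Hq i). lra. }
        apply Rabs_lt_between in L. lra.
    - destruct (closed_ball3 K (pt t) HK Hk) as [d Hd]. exists d. split; [tauto|].
      intros q Hq. split; [tauto|]. intros _. apply Hd, Hq. }
  set (delta := fun t => epsilon (inhabits (mkposreal 1 Rlt_0_1)) (Q t)).
  assert (Hdelta : forall t, Q t (delta t)) by (intros t; apply epsilon_spec, HQ).
  destruct (compactness_value 3 (- B, (- B, (- B, tt))) (B, (B, (B, tt))) delta) as [d Hd].
  exists d. split; [apply cond_pos|]. intros [[x y] z] Hk.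
  apply Rnot_lt_le. intros L.
  apply (Hd (x, (y, (z, tt)))).
  - pose proof (HB _ 0%nat Hk) as H0. pose proof (HB _ 1%nat Hk) as H1.
    pose proof (HB _ 2%nat Hk) as H2. simpl in *.
    apply Rabs_le_between in H0, H1, H2. repeat split; lra.
  - intros [t [_ [Hc Hdt]]]. destruct (Hdelta t) as [H1 H2].
    assert (Hx : forall i, Rabs (coord i (x, y, z) - coord i (pt t)) < delta t).
    { revert Hc. generalize (pos (delta t)). intros r.
      destruct t as [t1 [t2 [t3 []]]]. simpl. intros Hc [|[|i]]; apply Hc. }
    destruct (H2 (x, y, z) Hx) as [H3 H4].
    destruct (classic (K (pt t))) as [C|C].
    + specialize (H1 C). specialize (H3 C). lra.
    + apply (H4 C), Hk.
Qed.

Lemma continuous3_coord i : continuous3 (coord i).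
Proof.
  intros p eps He. exists (mkposreal eps He). intros q Hq. apply Hq.
Qed.

Lemma continuous3_comp2 (h : R -> R -> R) (g1 g2 : R3 -> R) :
  (forall x y, continuity_2d_pt h x y) -> continuous3 g1 -> continuous3 g2 ->
  continuous3 (fun p => h (g1 p) (g2 p)).
Proof.
  intros Hh H1 H2 p eps He. destruct (Hh (g1 p) (g2 p) (mkposreal eps He)) as [d Hd].
  destruct (H1 p d (cond_pos d)) as [d1 Hd1]. destruct (H2 p d (cond_pos d)) as [d2 Hd2].
  assert (H0 : 0 < Rmin d1 d2) by (apply Rmin_pos; apply cond_pos).
  exists (mkposreal _ H0). simpl. intros q Hq.
  pose proof (Rmin_l d1 d2). pose proof (Rmin_r d1 d2).
  apply Hd; [apply Hd1|apply Hd2]; intros i; specialize (Hq i); lra.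
Qed.

Lemma continuous3_plus g1 g2 :
  continuous3 g1 -> continuous3 g2 -> continuous3 (fun p => g1 p + g2 p).
Proof.
  apply (continuous3_comp2 Rplus). intros x y.
  apply continuity_2d_pt_plus; [apply continuity_2d_pt_id1|apply continuity_2d_pt_id2].
Qed.

Lemma continuous3_mult g1 g2 :
  continuous3 g1 -> continuous3 g2 -> continuous3 (fun p => g1 p * g2 p).
Proof.
  apply (continuous3_comp2 Rmult). intros x y.
  apply continuity_2d_pt_mult; [apply continuity_2d_pt_id1|apply continuity_2d_pt_id2].
Qed.

Lemma continuous3_minus g1 g2 :
  continuous3 g1 -> continuous3 g2 -> continuous3 (fun p => g1 p - g2 p).
Proof.
  apply (continuous3_comp2 Rminus). intros x y.
  apply continuity_2d_pt_minus; [apply continuity_2d_pt_id1|apply continuity_2d_pt_id2].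
Qed.

Lemma continuous3_const c : continuous3 (fun _ => c).
Proof.
  intros p eps He. exists (mkposreal 1 Rlt_0_1). intros q _.
  rewrite Rminus_eq_0, Rabs_R0. exact He.
Qed.

Lemma open_pos3 g : continuous3 g -> open (fun p => 0 < g p).
Proof.
  intros Hg. apply ball3_open. intros p Hp. destruct (Hg p (g p) Hp) as [d Hd].
  exists d. intros q Hq. specialize (Hd q Hq). apply Rabs_lt_between in Hd. lra.
Qed.

Lemma closed_nonneg3 g : continuous3 g -> closed (fun p => 0 <= g p).
Proof.
  intros Hg p Hp. apply Rnot_lt_le. intros L. apply Hp.
  assert (HO : open (fun p => 0 < 0 - g p)).
  { apply open_pos3. apply continuous3_minus; auto using continuous3_const. }
  apply filter_imp with (2 := HO p ltac:(lra)). intros q Hq. lra.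
Qed.

(** Supports of test functions will be given as images of rectangles. *)

Definition rect_image (Y : R -> R -> R3) (s1 s2 t1 t2 : R) (p : R3) : Prop :=
  exists s t, s1 <= s <= s2 /\ t1 <= t <= t2 /\ Y s t = p.

Definition continuous_surface (Y : R -> R -> R3) : Prop :=
  forall i s t, continuity_2d_pt (fun x y => coord i (Y x y)) s t.

Lemma surface_neighbourhood Y (O : R3 -> Prop) s t :
  continuous_surface Y -> open O -> O (Y s t) ->
  exists d, 0 < d /\ forall x y, Rabs (x - s) < d -> Rabs (y - t) < d -> O (Y x y).
Proof.
  intros HY HO Hp. destruct (open_ball3 O _ HO Hp) as [e He].
  destruct (HY 0%nat s t e) as [d0 H0]. destruct (HY 1%nat s t e) as [d1 H1].
  destruct (HY 2%nat s t e) as [d2 H2].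
  exists (Rmin d0 (Rmin d1 d2)). split; [repeat apply Rmin_pos; apply cond_pos|].
  intros x y Hx Hy.
  pose proof (Rmin_l d0 (Rmin d1 d2)). pose proof (Rmin_r d0 (Rmin d1 d2)).
  pose proof (Rmin_l d1 d2). pose proof (Rmin_r d1 d2).
  apply He. intros [|[|i]]; [apply H0|apply H1|apply H2]; lra.
Qed.

Lemma rect_closed_bounded s1 s2 t1 t2 :
  let K := fun p : R3 => (0 <= coord 0 p - s1 /\ 0 <= s2 - coord 0 p) /\
    (0 <= coord 1 p - t1 /\ 0 <= t2 - coord 1 p) /\
    (0 <= coord 2 p /\ 0 <= 0 - coord 2 p) in
  closed K /\ bounded3 K.
Proof.
  intros K. split.
  - repeat apply closed_and; apply closed_nonneg3;
      auto using continuous3_minus, continuous3_const, continuous3_coord.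
  - exists (Rabs s1 + Rabs s2 + Rabs t1 + Rabs t2). intros p i [H1 [H2 H3]].
    assert (forall x l r, 0 <= x - l -> 0 <= r - x -> Rabs x <= Rabs l + Rabs r).
    { intros x l r. unfold Rabs. repeat destruct Rcase_abs; lra. }
    pose proof (Rabs_pos s1). pose proof (Rabs_pos s2).
    pose proof (Rabs_pos t1). pose proof (Rabs_pos t2).
    destruct i as [|[|i]].
    + pose proof (H (coord 0 p) s1 s2). lra.
    + pose proof (H (coord 1 p) t1 t2). lra.
    + change (coord (S (S i)) p) with (coord 2 p). replace (coord 2 p) with 0 by lra.
      rewrite Rabs_R0. lra.
Qed.

(** The distance to a point outside the image is bounded below on the rectangle. *)
Lemma rect_image_closed Y s1 s2 t1 t2 :
  continuous_surface Y -> closed (rect_image Y s1 s2 t1 t2).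
Proof.
  intros HY p Hp. apply NNPP. intros Hn. apply Hp.
  destruct (rect_closed_bounded s1 s2 t1 t2) as [CK BK].
  set (g := fun q : R3 => (coord 0 (Y (coord 0 q) (coord 1 q)) - coord 0 p) ^ 2
    + (coord 1 (Y (coord 0 q) (coord 1 q)) - coord 1 p) ^ 2
    + (coord 2 (Y (coord 0 q) (coord 1 q)) - coord 2 p) ^ 2).
  assert (Cg : continuous3 g).
  { assert (H : forall i, continuous3 (fun q => (coord i (Y (coord 0 q) (coord 1 q)) - coord i p) ^ 2)).
    { intros i. simpl.
      assert (C : continuous3 (fun q => coord i (Y (coord 0 q) (coord 1 q)) - coord i p)).
      { apply continuous3_minus; [|apply continuous3_const].
        apply (continuous3_comp2 (fun x y => coord i (Y x y)));
          auto using continuous3_coord. }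
      auto using continuous3_mult, continuous3_const. }
    apply continuous3_plus; [apply continuous3_plus|]; apply H. }
  destruct (compact_lower_bound _ g CK BK Cg) as [d [Hd0 Hd]].
  - intros q [H0 [H1 _]]. apply Rnot_le_lt. intros L. apply Hn.
    exists (coord 0 q), (coord 1 q). split; [lra|split; [lra|]].
    unfold g in L.
    pose proof (pow2_ge_0 (coord 0 (Y (coord 0 q) (coord 1 q)) - coord 0 p)) as P0.
    pose proof (pow2_ge_0 (coord 1 (Y (coord 0 q) (coord 1 q)) - coord 1 p)) as P1.
    pose proof (pow2_ge_0 (coord 2 (Y (coord 0 q) (coord 1 q)) - coord 2 p)) as P2.
    assert (Z : forall x y : R, (x - y) ^ 2 = 0 -> x = y).
    { intros x y E. assert (x - y = 0); [|lra]. apply Rsqr_0_uniq. unfold Rsqr. lra. }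
    destruct (Y (coord 0 q) (coord 1 q)) as [[x y] z]. destruct p as [[x' y'] z'].
    simpl coord in *. rewrite (Z x x'), (Z y y'), (Z z z') by lra. reflexivity.
  - set (r := Rmin 1 (d / 4)).
    assert (Hr : 0 < r) by (apply Rmin_pos; lra).
    assert (r <= 1) by apply Rmin_l. assert (r <= d / 4) by apply Rmin_r.
    exists (mkposreal r Hr). intros q Hb [s [t [Hs [Ht E]]]].
    specialize (Hd (s, t, 0)). unfold g in Hd. simpl coord in Hd. rewrite E in Hd.
    assert (HH : forall i, (coord i q - coord i p) ^ 2 <= r * r).
    { intros i. assert (A : Rabs (coord i q - coord i p) < r).
      { destruct q as [[x y] z], p as [[x' y'] z']. destruct Hb as [[B0 B1] B2].
        destruct i as [|[|i]]; [apply B0|apply B1|apply B2]. }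
      rewrite <- Rsqr_pow2, Rsqr_abs. unfold Rsqr. pose proof (Rabs_pos (coord i q - coord i p)).
      apply Rmult_le_compat; lra. }
    pose proof (HH 0%nat) as A0. pose proof (HH 1%nat) as A1. pose proof (HH 2%nat) as A2.
    simpl coord in A0, A1, A2.
    assert (r * r <= d / 4) by nra.
    assert (d <= (fst (fst q) - fst (fst p)) ^ 2 + (snd (fst q) - snd (fst p)) ^ 2 + (snd q - snd p) ^ 2).
    { apply Hd. repeat split; lra. }
    lra.
Qed.

Lemma rect_image_bounded Y s1 s2 t1 t2 :
  continuous_surface Y -> bounded3 (rect_image Y s1 s2 t1 t2).
Proof.
  intros HY. destruct (rect_closed_bounded s1 s2 t1 t2) as [CK BK].
  (* 1 / (1 + |Y|^2) has a positive minimum *)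
  set (n2 := fun q : R3 => coord 0 (Y (coord 0 q) (coord 1 q)) ^ 2
    + coord 1 (Y (coord 0 q) (coord 1 q)) ^ 2 + coord 2 (Y (coord 0 q) (coord 1 q)) ^ 2 + 1).
  assert (P : forall q, 1 <= n2 q).
  { intros q. unfold n2. pose proof (pow2_ge_0 (coord 0 (Y (coord 0 q) (coord 1 q)))).
    pose proof (pow2_ge_0 (coord 1 (Y (coord 0 q) (coord 1 q)))).
    pose proof (pow2_ge_0 (coord 2 (Y (coord 0 q) (coord 1 q)))). lra. }
  assert (Cn : continuous3 n2).
  { assert (H : forall i, continuous3 (fun q => coord i (Y (coord 0 q) (coord 1 q)) ^ 2)).
    { intros i. simpl.
      assert (C : continuous3 (fun q => coord i (Y (coord 0 q) (coord 1 q)))).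
      { apply (continuous3_comp2 (fun x y => coord i (Y x y)));
          auto using continuous3_coord. }
      auto using continuous3_mult, continuous3_const. }
    unfold n2. auto using continuous3_plus, continuous3_const. }
  assert (Cg : continuous3 (fun q => / n2 q)).
  { intros q eps He. 
    destruct (continuity_2d_pt_inv (fun u _ => u) (n2 q) 0 (continuity_2d_pt_id1 _ _)
      ltac:(specialize (P q); lra) (mkposreal eps He)) as [d Hd].
    destruct (Cn q d (cond_pos d)) as [d' Hd']. exists d'. intros q' Hq'.
    apply (Hd (n2 q') 0); [apply Hd', Hq'|]. rewrite Rminus_eq_0, Rabs_R0. apply cond_pos. }
  destruct (compact_lower_bound _ _ CK BK Cg) as [d [Hd0 Hd]].
  { intros q _. specialize (P q). pos. }
  exists (/ d + 1). intros p i [s [t [Hs [Ht E]]]].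
  assert (L : d <= / n2 (s, t, 0)).
  { apply (Hd (s, t, 0)). simpl. repeat split; lra. }
  pose proof (P (s, t, 0)) as P0.
  assert (L2 : n2 (s, t, 0) <= / d).
  { rewrite <- (Rinv_inv (n2 (s, t, 0))). apply Rinv_le_contravar; assumption. }
  unfold n2 in L2. simpl coord in L2. rewrite E in L2. rewrite <- E in L2 at 1.
  assert (X : forall x, x ^ 2 <= / d -> Rabs x <= / d + 1).
  { intros x Hx. assert (0 < / d) by pos. unfold Rabs. destruct Rcase_abs; nra. }
  pose proof (pow2_ge_0 (fst (fst p))). pose proof (pow2_ge_0 (snd (fst p))).
  pose proof (pow2_ge_0 (snd p)). rewrite E in L2.
  apply X. destruct i as [|[|i]]; simpl coord; lra.
Qed.

Lemma closed_union3 (K1 K2 : R3 -> Prop) : closed K1 -> closed K2 -> closed (fun p => K1 p \/ K2 p).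
Proof.
  intros H1 H2 p Hp. apply NNPP. intros Hn. apply Hp.
  assert (L1 : locally p (fun q => ~ K1 q)) by (apply (open_not _ H1); tauto).
  assert (L2 : locally p (fun q => ~ K2 q)) by (apply (open_not _ H2); tauto).
  generalize (filter_and _ _ L1 L2). apply filter_imp. tauto.
Qed.

Lemma bounded_union3 K1 K2 : bounded3 K1 -> bounded3 K2 -> bounded3 (fun p => K1 p \/ K2 p).
Proof.
  intros [B1 H1] [B2 H2]. exists (Rmax B1 B2). intros p i [H|H].
  - eapply Rle_trans; [apply H1, H|apply Rmax_l].
  - eapply Rle_trans; [apply H2, H|apply Rmax_r].
Qed.

(** * Domains of the catenoid *)

Lemma angle_mod t : exists t', 0 <= t' <= 2 * PI /\ cos t' = cos t /\ sin t' = sin t.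
Proof.
  pose proof PI_RGT_0.
  set (k := Int_part (t / (2 * PI))). destruct (base_Int_part (t / (2 * PI))) as [H1 H2].
  fold k in H1, H2.
  assert (E : t = t / (2 * PI) * (2 * PI)) by (field; lra).
  exists (t - IZR k * (2 * PI)). split; [nra|].
  assert (P : forall n x, cos (x + INR n * (2 * PI)) = cos x /\ sin (x + INR n * (2 * PI)) = sin x).
  { intros n x. replace (x + INR n * (2 * PI)) with (x + 2 * INR n * PI) by ring.
    split; [apply cos_period|apply sin_period]. }
  destruct (Z.le_gt_cases 0 k) as [L|L].
  - destruct (P (Z.to_nat k) (t - IZR k * (2 * PI))) as [P1 P2].
    rewrite INR_IZR_INZ, Znat.Z2Nat.id in P1, P2 by exact L.
    replace (t - IZR k * (2 * PI) + IZR k * (2 * PI)) with t in P1, P2 by ring. auto.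
  - destruct (P (Z.to_nat (- k)) t) as [P1 P2].
    rewrite INR_IZR_INZ, Znat.Z2Nat.id, opp_IZR in P1, P2 by lia.
    replace (t + - IZR k * (2 * PI)) with (t - IZR k * (2 * PI)) in P1, P2 by ring. auto.
Qed.

Definition norm2 (p : R3) : R :=
  coord 0 p * coord 0 p + coord 1 p * coord 1 p + coord 2 p * coord 2 p.

Lemma norm2_continuous : continuous3 norm2.
Proof.
  unfold norm2. repeat apply (continuous3_plus (fun _ => _));
    apply continuous3_mult; apply continuous3_coord.
Qed.

Section Topology.

Variable a : R.
Hypothesis Ha : 0 < a.

Local Notation Y := (catenoid a).

(** The Euclidean norm depends on [s] only and increases with it: it serves as a global
    coordinate to recover [s] from a point of the surface. *)
Lemma norm2_catenoid s t : norm2 (Y s t) = exp (Lambda0 a s) ^ 2.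
Proof.
  unfold norm2. rewrite coord_catenoid. simpl coord. rewrite radial_height. unfold height.
  pose proof (cosh_pos_1 (y0 a s)). pose proof (cosh2_sinh2 (y0 a s)) as E.
  pose proof (cos2_sin2 t) as E2. field_simplify_eq; [|lra]. ring [E E2].
Qed.

Lemma exp_lt_iff x y : exp x ^ 2 < exp y ^ 2 <-> x < y.
Proof.
  rewrite <- !(exp_pow _ 2). split; intros H.
  - apply exp_lt_inv in H. simpl in H. lra.
  - apply exp_increasing. simpl. lra.
Qed.

Lemma norm2_lt s1 t1 s2 t2 : norm2 (Y s1 t1) < norm2 (Y s2 t2) <-> s1 < s2.
Proof. rewrite !norm2_catenoid, exp_lt_iff. apply Lambda0_lt_iff, Ha. Qed.

Lemma catenoid_inj s t s' t' : Y s t = Y s' t' -> s = s' /\ cos t = cos t' /\ sin t = sin t'.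
Proof.
  intros E.
  assert (Es : s = s').
  { destruct (Rtotal_order s s') as [H|[H|H]]; [|exact H|];
      apply (norm2_lt s t s' t') in H || apply (norm2_lt s' t' s t) in H; rewrite E in H; lra. }
  split; [exact Es|]. subst s'. rewrite !coord_catenoid in E. injection E as E1 E2.
  assert (Hr : radial a s <> 0).
  { rewrite radial_height. pose proof (height_pos a s).
    pose proof (sinh_y0_pos a Ha s). apply Rgt_not_eq; unfold Rgt; pos. }
  split; apply Rmult_eq_reg_l with (radial a s); assumption.
Qed.

Lemma catenoid_angle s t t' : cos t = cos t' -> sin t = sin t' -> Y s t = Y s t'.
Proof. intros E1 E2. rewrite !coord_catenoid, E1, E2. reflexivity. Qed.

Lemma catenoid_continuous : continuous_surface Y.
Proof.
  assert (C1 : forall (f : R -> R) (s t : R), continuity_pt f s -> continuity_2d_pt (fun x _ => f x) s t).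
  { intros f s t Hf. apply (continuity_1d_2d_pt_comp f (fun x _ => x));
      auto using continuity_2d_pt_id1. }
  assert (C2 : forall (f : R -> R) (s t : R), continuity_pt f t -> continuity_2d_pt (fun _ y => f y) s t).
  { intros f s t Hf. apply (continuity_1d_2d_pt_comp f (fun _ y => y));
      auto using continuity_2d_pt_id2. }
  assert (Cr : forall s, continuity_pt (radial a) s).
  { intros s. eapply is_derive_cont, radial_derive, Ha. }
  assert (Ch : forall s, continuity_pt (height a) s).
  { intros s. eapply is_derive_cont, height_derive, Ha. }
  intros i s t. destruct i as [|[|i]].
  - apply (continuity_2d_pt_mult (fun x _ => radial a x) (fun _ y => cos y)).
    + apply C1, Cr.
    + apply C2, continuity_cos.
  - apply (continuity_2d_pt_mult (fun x _ => radial a x) (fun _ y => sin y)).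
    + apply C1, Cr.
    + apply C2, continuity_sin.
  - apply (C1 (height a)), Ch.
Qed.

Lemma catenoid_domain_iff z s t : catenoid_domain a z (Y s t) <-> - z < s < z.
Proof.
  split.
  - intros [s' [t' [Hs [_ E]]]]. apply catenoid_inj in E. destruct E as [-> _]. exact Hs.
  - intros Hs. destruct (angle_mod t) as [t' [Ht [Ec Es]]]. exists s, t'.
    split; [exact Hs|split; [exact Ht|]]. apply catenoid_angle; assumption.
Qed.

Lemma catenoid_domain_surface z p : catenoid_domain a z p -> surface Y p.
Proof. intros [s [t [_ [_ E]]]]. exists s, t. exact E. Qed.

(** On the surface these open sets are [|s| < z] and [|s| > z]. *)
Definition inside (z : R) (p : R3) : Prop :=
  0 < norm2 (Y z 0) - norm2 p /\ 0 < norm2 p - norm2 (Y (- z) 0).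
Definition outside (z : R) (p : R3) : Prop :=
  0 < norm2 p - norm2 (Y z 0) \/ 0 < norm2 (Y (- z) 0) - norm2 p.

Lemma inside_open z : open (inside z).
Proof.
  apply open_and; apply open_pos3; apply continuous3_minus;
    auto using norm2_continuous, continuous3_const.
Qed.

Lemma outside_open z : open (outside z).
Proof.
  apply open_or; apply open_pos3; apply continuous3_minus;
    auto using norm2_continuous, continuous3_const.
Qed.

Lemma inside_iff z s t : inside z (Y s t) <-> - z < s < z.
Proof.
  unfold inside. pose proof (norm2_lt s t z 0). pose proof (norm2_lt (- z) 0 s t).
  rewrite !Rlt_0_minus. tauto.
Qed.

Lemma outside_iff z s t : outside z (Y s t) <-> (z < s \/ s < - z).
Proof.
  unfold outside. pose proof (norm2_lt z 0 s t). pose proof (norm2_lt s t (- z) 0).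
  rewrite !Rlt_0_minus. tauto.
Qed.

(** Two points of the strip are joined by the image of a segment of the parameter plane. *)
Lemma strip_connected (D : R3 -> Prop) z :
  (forall s t, - z < s < z -> D (Y s t)) ->
  (forall p, D p -> exists s t, - z < s < z /\ Y s t = p) -> connected_set D.
Proof.
  intros HD1 HD2 O1 O2 HO1 HO2 Hcov [p1 [D1 P1]] [p2 [D2 P2]].
  destruct (HD2 _ D1) as [s1 [t1 [Hs1 E1]]]. destruct (HD2 _ D2) as [s2 [t2 [Hs2 E2]]].
  apply NNPP. intros Hn.
  set (g := fun x => Y (s1 + x * (s2 - s1)) (t1 + x * (t2 - t1))).
  assert (Dg : forall x, 0 <= x <= 1 -> D (g x)).
  { intros x Hx. apply HD1. destruct (Rle_lt_dec s1 s2); nra. }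
  assert (Lg : forall (O : R3 -> Prop) x, open O -> O (g x) ->
    exists d : posreal, forall y, Rabs (y - x) < d -> O (g y)).
  { intros O x HO Ox. destruct (surface_neighbourhood _ _ _ _ catenoid_continuous HO Ox) as [d [Hd0 Hd]].
    set (m := Rabs (s2 - s1) + Rabs (t2 - t1) + 1).
    pose proof (Rabs_pos (s2 - s1)). pose proof (Rabs_pos (t2 - t1)).
    assert (Hm : 0 < d / m) by (unfold m; pos).
    exists (mkposreal _ Hm). simpl. intros y Hy.
    assert (L : Rabs (y - x) * m < d).
    { apply Rmult_lt_reg_r with (/ m); [unfold m; pos|].
      rewrite Rmult_assoc, Rinv_r, Rmult_1_r by (unfold m; lra). exact Hy. }
    pose proof (Rabs_pos (y - x)).
    apply Hd.
    - replace (s1 + y * (s2 - s1) - (s1 + x * (s2 - s1))) with ((y - x) * (s2 - s1)) by ring.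
      rewrite Rabs_mult. unfold m in L. nra.
    - replace (t1 + y * (t2 - t1) - (t1 + x * (t2 - t1))) with ((y - x) * (t2 - t1)) by ring.
      rewrite Rabs_mult. unfold m in L. nra. }
  assert (B : O1 (g 1)).
  { apply (interval_induction (fun x => O1 (g x)) 0 1); [lra| |].
    - unfold g. rewrite !Rmult_0_l, !Rplus_0_r, E1. exact P1.
    - intros x Hx. destruct (Hcov _ (Dg x Hx)) as [Ox|Ox].
      + destruct (Lg _ x HO1 Ox) as [d Hd]. exists d. intros y w Hy Hy0 _ Hw Hw1.
        apply Hd. unfold Rabs. destruct Rcase_abs; lra.
      + destruct (Lg _ x HO2 Ox) as [d Hd]. exists d. intros y w Hy Hy0 Py Hw Hw1. exfalso.
        apply Hn. exists (g y). split; [apply Dg; lra|split; [exact Py|]].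
        apply Hd. unfold Rabs. destruct Rcase_abs; lra. }
  apply Hn. exists (g 1). split; [apply Dg; lra|split; [exact B|]].
  unfold g. replace (s1 + 1 * (s2 - s1)) with s2 by ring.
  replace (t1 + 1 * (t2 - t1)) with t2 by ring. rewrite E2. exact P2.
Qed.

Lemma catenoid_domain_open z : open_domain Y (catenoid_domain a z).
Proof.
  split.
  - exists (inside z). split; [apply inside_open|]. intros p. split.
    + intros Hp. pose proof (catenoid_domain_surface z p Hp) as [s [t <-]].
      split; [exists s, t; reflexivity|].
      apply inside_iff. apply catenoid_domain_iff in Hp. exact Hp.
    + intros [[s [t <-]] Hi]. apply inside_iff in Hi. apply catenoid_domain_iff, Hi.
  - apply strip_connected with z.
    + intros s t Hs. apply catenoid_domain_iff, Hs.
    + intros p [s [t [Hs [_ E]]]]. exists s, t. split; assumption.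
Qed.

(** Otherwise [inside z] and [outside z] would disconnect [D]. *)
Lemma boundary_crossing z (D : R3 -> Prop) : 0 < z ->
  (forall p, D p -> surface Y p) -> connected_set D ->
  (forall p, catenoid_domain a z p -> D p) -> (exists p, D p /\ ~ catenoid_domain a z p) ->
  exists s t, (s = z \/ s = - z) /\ D (Y s t).
Proof.
  intros Hz HS HC Hsub [p0 [Dp0 Np0]]. apply NNPP. intros Hn.
  assert (Hcov : forall p, D p -> inside z p \/ outside z p).
  { intros p Hp. destruct (HS p Hp) as [s [t <-]]. rewrite inside_iff, outside_iff.
    destruct (Rtotal_order s z) as [H|[H|H]]; [|exfalso; apply Hn; exists s, t; auto|auto].
    destruct (Rtotal_order s (- z)) as [H'|[H'|H']]; [auto|exfalso; apply Hn; exists s, t; auto|auto]. }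
  destruct (HC (inside z) (outside z) (inside_open z) (outside_open z) Hcov) as [p [Hp [H1 H2]]].
  - exists (Y 0 0). split; [apply Hsub, catenoid_domain_iff; lra|apply inside_iff; lra].
  - exists p0. split; [exact Dp0|]. destruct (Hcov p0 Dp0) as [H|H]; [|exact H].
    exfalso. apply Np0. destruct (HS p0 Dp0) as [s [t <-]]. apply inside_iff in H.
    apply catenoid_domain_iff, H.
  - destruct (HS p Hp) as [s [t <-]]. apply inside_iff in H1. apply outside_iff in H2. lra.
Qed.

Lemma catenoid_boundary z p : 0 < z ->
  (boundary_in_surface Y (catenoid_domain a z) p <->
   exists s t, (s = z \/ s = - z) /\ Y s t = p).
Proof.
  intros Hz. split.
  - intros [[s [t <-]] Hb]. exists s, t. split; [|reflexivity].
    apply NNPP. intros Hn.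
    destruct (Rlt_le_dec (Rabs s) z) as [L|L].
    + apply Rabs_lt_between in L.
      destruct (Hb (inside z) (inside_open z)) as [_ [q [Oq [[s' [t' <-]] Nq]]]].
      { apply inside_iff. lra. }
      apply Nq, catenoid_domain_iff, inside_iff with t', Oq.
    + destruct (Hb (outside z) (outside_open z)) as [[q [Oq Dq]] _].
      { apply outside_iff. unfold Rabs in L. destruct Rcase_abs; lra. }
      destruct Dq as [s' [t' [Hs' [_ E]]]]. rewrite <- E in Oq. apply outside_iff in Oq. lra.
  - intros [s [t [Hs <-]]]. split; [exists s, t; reflexivity|].
    intros O HO Op. split.
    + destruct (surface_neighbourhood _ _ _ _ catenoid_continuous HO Op) as [d [Hd0 Hd]].
      set (e := Rmin (d / 2) z). assert (0 < e) by (apply Rmin_pos; lra).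
      assert (e <= d / 2) by apply Rmin_l. assert (e <= z) by apply Rmin_r.
      assert (Zt : Rabs (t - t) < d) by (rewrite Rminus_eq_0, Rabs_R0; lra).
      destruct Hs as [-> | ->].
      * exists (Y (z - e) t). split.
        -- apply Hd; [|exact Zt]. rewrite Rabs_left; lra.
        -- apply catenoid_domain_iff. lra.
      * exists (Y (- z + e) t). split.
        -- apply Hd; [|exact Zt]. rewrite Rabs_right; lra.
        -- apply catenoid_domain_iff. lra.
    + exists (Y s t). split; [exact Op|split; [exists s, t; reflexivity|]].
      rewrite catenoid_domain_iff. lra.
Qed.

(** ** Supports of test functions *)

(** On the compact support [x_3] is bounded below and the norm above, and
    [x_3 = exp Lambda0 / cosh y0] tends to 0 at the ends of the surface when the norm is
    bounded. *)
Lemma test_function_support (D : R3 -> Prop) f :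
  (forall p, D p -> surface Y p) -> test_function Y D f ->
  exists S0, periodic_compact (fun s t => f (Y s t)) S0.
Proof.
  intros HD [Hsm [K [HK [[B HB] [HKD Hz]]]]].
  assert (Hp : forall p, K p -> 0 < coord 2 p).
  { intros p Hp. destruct (HD p (HKD p Hp)) as [s [t <-]]. apply height_pos. }
  destruct (compact_lower_bound K (coord 2) HK) as [d [Hd0 Hd]]; auto.
  { exists B. exact HB. }
  { apply continuous3_coord. }
  set (S0 := 2 * (Rabs B + 1) / d + 1). pose proof (Rabs_pos B).
  assert (HS : 0 < 2 * (Rabs B + 1) / d) by pos.
  exists S0. split; [exact Hsm|split; [|split; [unfold S0; lra|]]].
  - intros s t. f_equal. apply catenoid_angle.
    + replace (t + 2 * PI) with (t + 2 * INR 1 * PI) by (simpl; ring). apply cos_period.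
    + replace (t + 2 * PI) with (t + 2 * INR 1 * PI) by (simpl; ring). apply sin_period.
  - intros s t Hs. apply Hz; [exists s, t; reflexivity|]. intros Hk.
    pose proof (Hd _ Hk) as L. change (d <= height a s) in L.
    assert (N : norm2 (Y s t) <= 4 * (Rabs B + 1) ^ 2).
    { unfold norm2. pose proof (HB _ 0%nat Hk) as B0. pose proof (HB _ 1%nat Hk) as B1.
      pose proof (HB _ 2%nat Hk) as B2.
      assert (Q : forall x, Rabs x <= B -> x * x <= (Rabs B + 1) ^ 2).
      { intros x Hx. pose proof (Rle_abs B). pose proof (Rabs_pos x).
        replace (x * x) with (Rabs x * Rabs x) by (unfold Rabs; destruct Rcase_abs; ring). nra. }
      apply Q in B0, B1, B2. pose proof (pow2_ge_0 (Rabs B + 1)). lra. }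
    rewrite norm2_catenoid in N. pose proof (sinh_y0_ge a Ha s) as G.
    pose proof (cosh2_sinh2 (y0 a s)) as G2. pose proof (cosh_pos_1 (y0 a s)) as G3.
    pose proof (exp_pos (Lambda0 a s)) as G4.
    assert (X : d * cosh (y0 a s) <= exp (Lambda0 a s)).
    { unfold height in L. apply Rmult_le_reg_r with (/ cosh (y0 a s)); [pos|].
      rewrite Rmult_assoc, Rinv_r, Rmult_1_r by lra. exact L. }
    assert (X2 : d * cosh (y0 a s) <= 2 * (Rabs B + 1)).
    { eapply Rle_trans; [exact X|]. apply Rsqr_incr_0; unfold Rsqr; nra. }
    assert (X3 : Rabs s <= cosh (y0 a s)).
    { apply Rsqr_incr_0; [|apply Rabs_pos|lra]. rewrite <- Rsqr_abs. unfold Rsqr. nra. }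
    assert (X4 : d * Rabs s <= 2 * (Rabs B + 1)) by nra.
    assert (X5 : d * S0 <= d * Rabs s) by (apply Rmult_le_compat_l; lra).
    assert (d * S0 = 2 * (Rabs B + 1) + d) by (unfold S0; field; lra). lra.
Qed.

(** A function of the norm that is positive in the domain and vanishes on its boundary is
    bounded below on the support, which therefore stays away from [s = z] and [s = - z]. *)
Lemma domain_support z f : 0 < z -> test_function Y (catenoid_domain a z) f ->
  exists z', z' < z /\ periodic_compact (fun s t => f (Y s t)) z'.
Proof.
  intros Hz Hf. destruct (test_function_support _ f (catenoid_domain_surface z) Hf) as [S0 [Hsm [Hp _]]].
  destruct Hf as [_ [K [HK [HB [HKD H0]]]]].
  set (g := fun p => (norm2 (Y z 0) - norm2 p) * (norm2 p - norm2 (Y (- z) 0))).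
  set (h := fun s => (norm2 (Y z 0) - exp (Lambda0 a s) ^ 2) * (exp (Lambda0 a s) ^ 2 - norm2 (Y (- z) 0))).
  assert (gh : forall s t, g (Y s t) = h s).
  { intros s t. unfold g, h. rewrite (norm2_catenoid s t). reflexivity. }
  destruct (compact_lower_bound K g HK HB) as [d [Hd0 Hd]].
  { unfold g. auto using continuous3_mult, continuous3_minus, norm2_continuous, continuous3_const. }
  { intros p Hk. pose proof (HKD p Hk) as Dp.
    destruct (catenoid_domain_surface z p Dp) as [s [t <-]].
    apply catenoid_domain_iff, (inside_iff z s t) in Dp. destruct Dp. unfold g. pos. }
  assert (Ch : forall s, continuity_pt h s).
  { intros s. assert (C : continuity_pt (fun s => exp (Lambda0 a s)) s).
    { apply (continuity_pt_comp (Lambda0 a) exp).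
      - eapply is_derive_cont, Lambda0_derive, Ha.
      - apply derivable_continuous_pt, derivable_pt_exp. }
    unfold h. cont. }
  assert (Hz1 : h z = 0) by (unfold h; rewrite norm2_catenoid; ring).
  assert (Hz2 : h (- z) = 0) by (unfold h; rewrite (norm2_catenoid (- z) 0); ring).
  destruct (proj1 (filterlim_locally _ _) (proj1 (continuity_pt_filterlim _ _) (Ch z))
              (mkposreal d Hd0)) as [d1 Hd1].
  destruct (proj1 (filterlim_locally _ _) (proj1 (continuity_pt_filterlim _ _) (Ch (- z)))
              (mkposreal d Hd0)) as [d2 Hd2].
  set (e := Rmin (z / 2) (Rmin (d1 / 2) (d2 / 2))).
  assert (He : 0 < e) by (repeat apply Rmin_pos; try apply is_pos_div_2; lra).
  assert (e <= z / 2) by apply Rmin_l.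
  assert (e <= Rmin (d1 / 2) (d2 / 2)) by apply Rmin_r.
  pose proof (Rmin_l (d1 / 2) (d2 / 2)). pose proof (Rmin_r (d1 / 2) (d2 / 2)).
  pose proof (cond_pos d1). pose proof (cond_pos d2).
  exists (z - e). split; [lra|]. split; [exact Hsm|split; [exact Hp|split; [lra|]]].
  intros s t Hs. apply H0; [exists s, t; reflexivity|]. intros Hk.
  pose proof (Hd _ Hk) as L. rewrite gh in L.
  pose proof (HKD _ Hk) as Dp. apply catenoid_domain_iff in Dp.
  destruct (Rle_lt_dec 0 s) as [Hs0|Hs0].
  - rewrite Rabs_right in Hs by lra.
    assert (A : Rabs (h s - h z) < d).
    { apply (Hd1 s). change (Rabs (s - z) < d1). rewrite Rabs_left1; lra. }
    rewrite Hz1, Rminus_0_r in A. pose proof (Rle_abs (h s)). lra.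
  - rewrite Rabs_left in Hs by lra.
    assert (A : Rabs (h s - h (- z)) < d).
    { apply (Hd2 s). change (Rabs (s - - z) < d2). rewrite Rabs_right; lra. }
    rewrite Hz2, Rminus_0_r in A. pose proof (Rle_abs (h s)). lra.
Qed.

(** [s], [cos theta] and [sin theta] are determined by the point of the surface. *)
Lemma function_on_surface (phi : R -> R -> R) :
  (forall s t t', cos t = cos t' -> sin t = sin t' -> phi s t = phi s t') ->
  exists f : R3 -> R, forall s t, f (Y s t) = phi s t.
Proof.
  intros H.
  set (Q := fun p v => forall s t, Y s t = p -> v = phi s t).
  assert (HQ : forall s t, Q (Y s t) (phi s t)).
  { intros s t s' t' E. apply catenoid_inj in E. destruct E as [-> [E1 E2]]. apply H; auto. }
  exists (fun p => epsilon (inhabits 0) (Q p)). intros s t.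
  apply (epsilon_spec (inhabits 0) (Q (Y s t))); [|reflexivity].
  exists (phi s t). apply HQ.
Qed.

End Topology.

(** * Instability beyond the zeros of [e0] *)

Section Unstable.

Variable a : R.
Hypothesis Ha : 0 < a.
Variable z : R.
Hypothesis Hz : 0 < z.
Hypothesis He0 : e0 a z = 0.
Hypothesis Hin : forall s, Rabs s < z -> 0 < e0 a s.

Local Notation f := (fun s => sinh (y0 a s)).
Local Notation q := (potential a).

(** ** The radial cut-off of [e0] *)

Lemma bounded_on (g : R -> R) al be : (forall s, continuity_pt g s) -> al <= be ->
  exists m, 0 < m /\ forall s, al <= s <= be -> Rabs (g s) <= m.
Proof.
  intros Hg Hab.
  destruct (continuity_ab_maj g al be Hab (fun c _ => Hg c)) as [M1 [H1 _]].
  destruct (continuity_ab_min g al be Hab (fun c _ => Hg c)) as [M2 [H2 _]].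
  exists (Rabs (g M1) + Rabs (g M2) + 1).
  pose proof (Rabs_pos (g M1)). pose proof (Rabs_pos (g M2)). split; [lra|].
  intros s Hs. specialize (H1 s Hs). specialize (H2 s Hs). unfold Rabs in *.
  repeat destruct Rcase_abs; lra.
Qed.

Lemma e0_le_quadratic :
  exists m, 0 < m /\ forall s, - z <= s <= z -> 0 <= e0 a s <= m * (z ^ 2 - s ^ 2).
Proof.
  destruct (bounded_on (e0_s a) 0 z) as [m1 [Hm1 Hb]]; [apply e0_s_cont, Ha|lra|].
  exists (m1 / z). split; [pos|].
  assert (Hpos : forall s, 0 <= s <= z -> 0 <= e0 a s <= m1 / z * (z ^ 2 - s ^ 2)).
  { intros s Hs. split.
    - destruct (proj2 Hs) as [L| ->]; [|lra]. left. apply Hin. rewrite Rabs_right; lra.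
    - destruct (MVT_gen (e0 a) s z (e0_s a)) as [c [Hc E]].
      + intros x _. apply e0_derive, Ha.
      + intros x _. apply e0_cont, Ha.
      + rewrite Rmin_left, Rmax_right in Hc by lra.
        specialize (Hb c ltac:(lra)). apply Rabs_le_between in Hb.
        rewrite He0 in E. apply Rle_trans with (m1 * (z - s)); [nra|].
        replace (m1 / z * (z ^ 2 - s ^ 2)) with (m1 * (z - s) * ((z + s) / z)) by (field; lra).
        assert (1 <= (z + s) / z).
        { apply Rmult_le_reg_r with z; [lra|]. unfold Rdiv. rewrite Rmult_assoc, Rinv_l; lra. }
        assert (0 <= m1 * (z - s)) by (apply Rmult_le_pos; lra). nra. }
  intros s Hs. destruct (Rle_lt_dec 0 s); [apply Hpos; lra|].
  rewrite <- (e0_even a Ha). replace (s ^ 2) with ((- s) ^ 2) by ring. apply Hpos. lra.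
Qed.

Section Cutoff.

Variable eta : R.
Hypothesis Heta : 0 < eta.

Definition cutoff (s : R) : R := flat 0 ((z ^ 2 - s ^ 2) / eta - 1).
Definition cutoff_s (s : R) : R := - 2 * s / eta * flat 2 ((z ^ 2 - s ^ 2) / eta - 1).

Lemma cutoff_derive s : is_derive cutoff s (cutoff_s s).
Proof.
  unfold cutoff, cutoff_s.
  apply (is_derive_comp (flat 0) (fun s => (z ^ 2 - s ^ 2) / eta - 1)).
  - apply flat0_derive.
  - auto_derive; [exact I|field; lra].
Qed.

Lemma cutoff_cont s : continuity_pt cutoff s.
Proof. eapply is_derive_cont, cutoff_derive. Qed.

Lemma cutoff_s_cont s : continuity_pt cutoff_s s.
Proof.
  unfold cutoff_s. apply continuity_pt_mult'.
  - apply (is_derive_cont _ _ (- 2 / eta)). auto_derive; [exact I|field; lra].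
  - apply (continuity_pt_comp (fun s => (z ^ 2 - s ^ 2) / eta - 1) (flat 2)).
    + apply (is_derive_cont _ _ (- 2 * s / eta)). auto_derive; [exact I|field; lra].
    + apply flat_continuity.
Qed.

Lemma cutoff_outside s : z ^ 2 - s ^ 2 <= eta -> cutoff s = 0 /\ cutoff_s s = 0.
Proof.
  intros Hs. unfold cutoff, cutoff_s. rewrite !flat_neg; [split; ring| |];
    apply Rmult_le_reg_r with eta; auto; field_simplify; lra.
Qed.

Lemma cutoff_s_sign s : 0 <= - s * cutoff_s s.
Proof.
  unfold cutoff_s. pose proof (flat_nonneg 2 ((z ^ 2 - s ^ 2) / eta - 1)).
  replace (- s * (-2 * s / eta * flat 2 ((z ^ 2 - s ^ 2) / eta - 1))) with
    (2 * s ^ 2 / eta * flat 2 ((z ^ 2 - s ^ 2) / eta - 1)) by (field; lra).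
  apply Rmult_le_pos; [|assumption]. pose proof (pow2_ge_0 s).
  apply Rmult_le_pos; [lra|left; pos].
Qed.

(** [- s * chi'] is nonnegative and [- s * chi' - chi] is a derivative: this bounds the
    total variation of the cut-off uniformly in [eta]. *)
Lemma cutoff_integral : 0 <= RInt (fun s => - s * cutoff_s s) (- z) z <= 2 * z.
Proof.
  assert (C : forall s, continuity_pt (fun s => - s * cutoff_s s) s).
  { intros s. apply continuity_pt_mult'; [|apply cutoff_s_cont].
    apply (is_derive_cont _ _ (-1)). auto_derive; [exact I|ring]. }
  split.
  - apply RInt_nonneg; [lra|exact C|]. intros; apply cutoff_s_sign.
  - assert (E : RInt (fun s => - s * cutoff_s s - cutoff s) (- z) z = 0).
    { rewrite (RInt_derive (fun s => - s * cutoff s) (fun s => - s * cutoff_s s - cutoff s)).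
      - destruct (cutoff_outside z) as [-> _]; [nra|].
        destruct (cutoff_outside (- z)) as [-> _]; [nra|]. rring.
      - intros s. apply is_derive_eq with (-1 * cutoff s + - s * cutoff_s s); [|ring].
        apply (is_derive_mult Ropp cutoff); [|apply cutoff_derive|intros; apply Rmult_comm].
        auto_derive; [exact I|ring].
      - intros s. apply continuity_pt_minus'; [apply C|apply cutoff_cont]. }
    rewrite RInt_minus_c in E by auto using cutoff_cont.
    assert (RInt cutoff (- z) z <= RInt (fun _ => 1) (- z) z).
    { apply RInt_monotone; auto using cutoff_cont; [lra| |].
      - intros; apply continuity_pt_cst'.
      - intros t _. left. apply flat0_lt_1. }
    rewrite RInt_const_R in H. lra.
Qed.

(** With [x = (z^2 - s^2) / eta], both bounds reduce to those on the flat functions. *)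
Lemma cutoff_bounds m s : 0 < m -> - z <= s <= z -> 0 <= e0 a s <= m * (z ^ 2 - s ^ 2) ->
  (cutoff_s s * e0 a s) ^ 2 <= 4 * m ^ 2 * eta * (- s * cutoff_s s) /\
  0 <= (1 - cutoff s) * e0 a s <= 2 * m * eta.
Proof.
  intros Hm Hs He. set (x := (z ^ 2 - s ^ 2) / eta).
  assert (Hx : 0 <= x).
  { unfold x. apply Rmult_le_pos; [nra|left; pos]. }
  assert (Ex : z ^ 2 - s ^ 2 = eta * x) by (unfold x; field; lra).
  rewrite Ex in He. split.
  - pose proof (flat2_decay x Hx) as D. pose proof (cutoff_s_sign s) as Sg.
    pose proof (flat_nonneg 2 (x - 1)) as Fl.
    replace ((cutoff_s s * e0 a s) ^ 2) with
      (e0 a s ^ 2 * flat 2 (x - 1) * (2 / eta) * (- s * cutoff_s s))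
      by (unfold cutoff_s; fold x; field; lra).
    apply Rmult_le_compat_r; [exact Sg|].
    apply Rle_trans with ((m * (eta * x)) ^ 2 * flat 2 (x - 1) * (2 / eta)).
    + apply Rmult_le_compat_r; [left; pos|]. apply Rmult_le_compat_r; [exact Fl|].
      apply pow_incr, He.
    + replace ((m * (eta * x)) ^ 2 * flat 2 (x - 1) * (2 / eta)) with
        (2 * m ^ 2 * eta * (x ^ 2 * flat 2 (x - 1))) by (field; lra).
      assert (0 < 2 * m ^ 2 * eta) by pos. nra.
  - pose proof (flat0_defect x Hx) as D. pose proof (flat0_lt_1 (x - 1)).
    unfold cutoff. fold x. split; [apply Rmult_le_pos; lra|].
    apply Rle_trans with ((1 - flat 0 (x - 1)) * (m * (eta * x))).
    + apply Rmult_le_compat_l; lra.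
    + replace ((1 - flat 0 (x - 1)) * (m * (eta * x))) with
        (m * eta * (x * (1 - flat 0 (x - 1)))) by ring.
      assert (0 < m * eta) by pos. nra.
Qed.

End Cutoff.

(** ** The perturbation *)

Variables (rho rho1 rho2 : R -> R) (S0 : R).
Hypothesis Drho : forall s, is_derive rho s (rho1 s).
Hypothesis Drho1 : forall s, is_derive rho1 s (rho2 s).
Hypothesis Crho2 : forall s, continuity_pt rho2 s.
Hypothesis Hrho : forall s, S0 <= Rabs s -> rho s = 0 /\ rho1 s = 0.
Hypothesis HS : z < S0.
Hypothesis Hrho_pos : 0 < rho z + rho (- z).

Lemma rho_cont s : continuity_pt rho s.
Proof. eapply is_derive_cont, Drho. Qed.
Lemma rho1_cont s : continuity_pt rho1 s.
Proof. eapply is_derive_cont, Drho1. Qed.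

(** The Jacobi operator applied to the radial function [rho], up to sign and the factor
    [f]. *)
Definition jac_rho (s : R) : R :=
  cosh (y0 a s) * slope a s * rho1 s + sinh (y0 a s) * rho2 s + q s * sinh (y0 a s) * rho s.

Lemma jac_rho_cont s : continuity_pt jac_rho s.
Proof.
  unfold jac_rho. cont; auto using cosh_y0_cont, sinh_y0_cont, slope_cont, rho_cont,
    rho1_cont, potential_cont.
Qed.

Lemma f_rho1_derive s : is_derive (fun s => f s * rho1 s) s (jac_rho s - q s * f s * rho s).
Proof.
  apply is_derive_eq with (cosh (y0 a s) * slope a s * rho1 s + sinh (y0 a s) * rho2 s).
  - apply (is_derive_mult f rho1); [apply sinh_y0_derive, Ha|apply Drho1|intros; apply Rmult_comm].
  - unfold jac_rho. ring.
Qed.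

(** Green's formula on [- z, z]; as [e0] vanishes at the endpoints, the boundary term comes
    from [e0']. *)
Lemma green_boundary :
  RInt (fun s => e0 a s * jac_rho s) (- z) z = - f z * e0_s a z * (rho z + rho (- z)).
Proof.
  assert (Eodd : e0_s a (- z) = - e0_s a z).
  { assert (D : is_derive (fun s => e0 a (- s)) z (-1 * e0_s a (- z))).
    { apply (is_derive_comp (e0 a) Ropp); [apply e0_derive, Ha|]. auto_derive; [exact I|ring]. }
    apply is_derive_ext with (g := e0 a) in D; [|intros t; apply e0_even, Ha].
    apply is_derive_unique in D. rewrite (is_derive_unique _ _ _ (e0_derive a Ha z)) in D. lra. }
  rewrite (RInt_derive (fun s => e0 a s * (f s * rho1 s) - (f s * e0_s a s) * rho s)).
  - rewrite (e0_even a Ha z), He0, Eodd, y0_even. rring.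
  - intros s. apply is_derive_eq with
      ((e0_s a s * (f s * rho1 s) + e0 a s * (jac_rho s - q s * f s * rho s))
       - (- q s * sinh (y0 a s) * e0 a s * rho s + f s * e0_s a s * rho1 s)); [|ring].
    apply (is_derive_minus (fun s => e0 a s * (f s * rho1 s)) (fun s => (f s * e0_s a s) * rho s)).
    + apply (is_derive_mult (e0 a) (fun s => f s * rho1 s));
        [apply e0_derive, Ha|apply f_rho1_derive|intros; apply Rmult_comm].
    + apply (is_derive_mult (fun s => f s * e0_s a s) rho);
        [apply e0_jacobi, Ha|apply Drho|intros; apply Rmult_comm].
  - intros s. cont; auto using e0_cont, jac_rho_cont.
Qed.

Lemma RInt_restrict (g : R -> R) : (forall s, continuity_pt g s) ->
  (forall s, z <= Rabs s -> g s = 0) -> RInt g (- S0) S0 = RInt g (- z) z.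
Proof.
  intros Cg Hg.
  pose proof (RInt_chasles_c g (- S0) (- z) S0 Cg) as E1.
  pose proof (RInt_chasles_c g (- z) z S0 Cg) as E2.
  rewrite (RInt_vanish g (- S0) (- z)) in E1.
  2:{ intros t Ht. apply Hg. rewrite Rmin_left, Rmax_right in Ht by lra. rewrite Rabs_left; lra. }
  rewrite (RInt_vanish g z S0) in E2.
  2:{ intros t Ht. apply Hg. rewrite Rmin_left, Rmax_right in Ht by lra. rewrite Rabs_right; lra. }
  rewrite Rplus_0_l in E1. rewrite Rplus_0_r in E2. rewrite <- E1. symmetry. exact E2.
Qed.

Section Fixed_eta.

Variable eta : R.
Hypothesis Heta : 0 < eta.

Local Notation chi := (cutoff eta).
Local Notation chi_s := (cutoff_s eta).
Definition trunc (s : R) : R := cutoff eta s * e0 a s.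
Definition trunc_s (s : R) : R := cutoff_s eta s * e0 a s + cutoff eta s * e0_s a s.

Lemma trunc_derive s : is_derive trunc s (trunc_s s).
Proof.
  apply (is_derive_mult (cutoff eta) (e0 a));
    [apply cutoff_derive, Heta|apply e0_derive, Ha|intros; apply Rmult_comm].
Qed.

Lemma trunc_s_cont s : continuity_pt trunc_s s.
Proof.
  unfold trunc_s. cont; auto using cutoff_s_cont, cutoff_cont, e0_cont, e0_s_cont.
Qed.

Lemma cutoff_far s : z <= Rabs s -> chi s = 0 /\ chi_s s = 0.
Proof.
  intros Hs. apply cutoff_outside; [exact Heta|].
  assert (z ^ 2 <= s ^ 2); [|lra]. replace (s ^ 2) with (Rabs s ^ 2).
  - apply pow_incr. lra.
  - unfold Rabs. destruct Rcase_abs; ring.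
Qed.

(** Since [e0] solves the Jacobi equation, the energy of [chi * e0] is the integral of
    [f (chi' e0)^2], which is of order [eta]. *)
Lemma radial_energy m F : 0 < m -> 0 < F ->
  (forall s, - z <= s <= z -> 0 <= e0 a s <= m * (z ^ 2 - s ^ 2)) ->
  (forall s, - z <= s <= z -> Rabs (f s) <= F) ->
  RInt (fun s => f s * trunc_s s ^ 2 - q s * f s * trunc s ^ 2) (- S0) S0
  <= 8 * F * m ^ 2 * z * eta.
Proof.
  intros Hm HF He Hf.
  assert (C0 := cutoff_cont eta Heta). assert (C1 := cutoff_s_cont eta Heta).
  assert (CE := e0_cont a Ha). assert (CE1 := e0_s_cont a Ha). assert (Cf := sinh_y0_cont a Ha).
  assert (Cq := potential_cont a Ha).
  set (W := fun s => 2 * chi s * chi_s s * e0 a s * (f s * e0_s a s)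
    + chi s ^ 2 * (e0_s a s * (f s * e0_s a s) - q s * f s * e0 a s ^ 2)).
  assert (CW : forall s, continuity_pt W s) by (intros s; unfold W; cont; auto).
  assert (IW : RInt W (- S0) S0 = 0).
  { rewrite (RInt_derive (fun s => chi s ^ 2 * (e0 a s * (f s * e0_s a s))) W); auto.
    - destruct (cutoff_far S0) as [-> _]; [rewrite Rabs_right; lra|].
      destruct (cutoff_far (- S0)) as [-> _]; [rewrite Rabs_left; lra|]. rring.
    - intros s. apply is_derive_eq with (2 * (chi s * chi_s s) * (e0 a s * (f s * e0_s a s))
        + chi s ^ 2 * (e0_s a s * (f s * e0_s a s) + e0 a s * (- q s * sinh (y0 a s) * e0 a s)));
        [|unfold W; ring].
      apply (is_derive_mult (fun s => chi s ^ 2) (fun s => e0 a s * (f s * e0_s a s)));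
        [apply is_derive_sqr, cutoff_derive, Heta| |intros; apply Rmult_comm].
      apply (is_derive_mult (e0 a) (fun s => f s * e0_s a s));
        [apply e0_derive, Ha|apply e0_jacobi, Ha|intros; apply Rmult_comm]. }
  assert (E : RInt (fun s => f s * trunc_s s ^ 2 - q s * f s * trunc s ^ 2) (- S0) S0
    = RInt (fun s => f s * (chi_s s * e0 a s) ^ 2) (- S0) S0).
  { transitivity (RInt (fun s => f s * (chi_s s * e0 a s) ^ 2 + W s) (- S0) S0).
    - apply RInt_ext_all. intros s. unfold W, trunc, trunc_s. ring.
    - rewrite RInt_plus_c, IW; auto; [rring|]. intros s; cont; auto. }
  apply Rle_trans with (1 := Req_le _ _ E). rewrite RInt_restrict.
  - apply Rle_trans with (RInt (fun s => F * (4 * m ^ 2 * eta) * (- s * chi_s s)) (- z) z).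
    + apply RInt_monotone; [lra| | |].
      * intros s; cont; auto.
      * intros s; cont; auto. apply continuity_pt_opp, continuity_pt_id.
      * intros s Hs. destruct (cutoff_bounds eta Heta m s Hm Hs (He s Hs)) as [B _].
        specialize (Hf s Hs). pose proof (Rle_abs (f s)). pose proof (sinh_y0_pos a Ha s).
        rewrite Rmult_assoc. apply Rmult_le_compat; [lra|apply pow2_ge_0|lra|exact B].
    + rewrite RInt_scal_c.
      * destruct (cutoff_integral eta Heta) as [_ B].
        replace (8 * F * m ^ 2 * z * eta) with (F * (4 * m ^ 2 * eta) * (2 * z)) by ring.
        apply Rmult_le_compat_l; [left; pos|exact B].
      * intros s; cont; auto. apply continuity_pt_opp, continuity_pt_id.
  - intros s; cont; auto.
  - intros s Hs. destruct (cutoff_far s Hs) as [_ ->]. ring.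
Qed.

(** The polar form of the energy at [chi * e0] and [rho] tends to the boundary term of
    Green's formula, which is negative because [e0' z < 0]. *)
Lemma mixed_energy m G : 0 < m -> 0 < G ->
  (forall s, - z <= s <= z -> 0 <= e0 a s <= m * (z ^ 2 - s ^ 2)) ->
  (forall s, - z <= s <= z -> Rabs (jac_rho s) <= G) ->
  RInt (fun s => f s * (trunc_s s * rho1 s) - q s * f s * (trunc s * rho s)) (- S0) S0
  <= f z * e0_s a z * (rho z + rho (- z)) + 4 * m * G * z * eta.
Proof.
  intros Hm HG He Hg.
  assert (C0 := cutoff_cont eta Heta). assert (CE := e0_cont a Ha).
  assert (CG := jac_rho_cont). assert (Cr := rho_cont). assert (Cr1 := rho1_cont).
  assert (Cf := sinh_y0_cont a Ha). assert (Cq := potential_cont a Ha).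
  assert (CT : forall s, continuity_pt trunc s) by (intros s; eapply is_derive_cont, trunc_derive).
  assert (CT1 := trunc_s_cont).
  set (W := fun s => trunc_s s * (f s * rho1 s) + trunc s * (jac_rho s - q s * f s * rho s)).
  assert (CW : forall s, continuity_pt W s) by (intros s; unfold W; cont; auto).
  assert (IW : RInt W (- S0) S0 = 0).
  { rewrite (RInt_derive (fun s => trunc s * (f s * rho1 s)) W); auto.
    - destruct (Hrho S0) as [_ ->]; [rewrite Rabs_right; lra|].
      destruct (Hrho (- S0)) as [_ ->]; [rewrite Rabs_left; lra|]. rring.
    - intros s. apply (is_derive_mult trunc (fun s => f s * rho1 s));
        [apply trunc_derive|apply f_rho1_derive|intros; apply Rmult_comm]. }
  assert (E : RInt (fun s => f s * (trunc_s s * rho1 s) - q s * f s * (trunc s * rho s)) (- S0) S0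
    = - RInt (fun s => trunc s * jac_rho s) (- S0) S0).
  { transitivity (RInt (fun s => W s - trunc s * jac_rho s) (- S0) S0).
    - apply RInt_ext_all. intros s. unfold W. ring.
    - rewrite RInt_minus_c, IW; auto; [rring|]. intros s; cont; auto. }
  apply Rle_trans with (1 := Req_le _ _ E).
  rewrite (RInt_restrict (fun s => trunc s * jac_rho s)).
  - assert (E2 : RInt (fun s => trunc s * jac_rho s) (- z) z =
      RInt (fun s => e0 a s * jac_rho s) (- z) z
      - RInt (fun s => (1 - chi s) * e0 a s * jac_rho s) (- z) z).
    { rewrite <- RInt_minus_c.
      - apply RInt_ext_all. intros s. unfold trunc. ring.
      - intros s; cont; auto.
      - intros s; cont; auto. }
    rewrite E2, green_boundary.
    assert (B : RInt (fun s => (1 - chi s) * e0 a s * jac_rho s) (- z) z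
      <= RInt (fun _ => 2 * m * eta * G) (- z) z).
    { apply RInt_monotone; [lra| | |].
      - intros s; cont; auto.
      - intros s; cont.
      - intros s Hs. destruct (cutoff_bounds eta Heta m s Hm Hs (He s Hs)) as [_ B].
        specialize (Hg s Hs). pose proof (Rle_abs (jac_rho s)).
        apply Rle_trans with ((1 - chi s) * e0 a s * G).
        + apply Rmult_le_compat_l; lra.
        + apply Rmult_le_compat_r; lra. }
    rewrite RInt_const_R in B.
    replace (4 * m * G * z * eta) with ((z - - z) * (2 * m * eta * G)) by ring. lra.
  - intros s; cont; auto.
  - intros s Hs. unfold trunc. destruct (cutoff_far s Hs) as [-> _]. ring.
Qed.

End Fixed_eta.

(** ** A test function of negative energy *)

Variables (tau tau1 : R -> R).
Hypothesis Ctau : forall t, continuity_pt tau t.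
Hypothesis Ctau1 : forall t, continuity_pt tau1 t.
Hypothesis Dtau : forall t, is_derive tau t (tau1 t).
Hypothesis Htau : 0 < RInt tau 0 (2 * PI).

Definition perturbed (eta eps s t : R) : R := trunc eta s + eps * rho s * tau t.

Lemma RInt_affine_sqr A B :
  RInt (fun t => (A + B * tau t) ^ 2) 0 (2 * PI) =
  2 * PI * A ^ 2 + 2 * (A * B) * RInt tau 0 (2 * PI) + B ^ 2 * RInt (fun t => tau t ^ 2) 0 (2 * PI).
Proof.
  transitivity (RInt (fun t => A ^ 2 + (2 * (A * B) * tau t + B ^ 2 * tau t ^ 2)) 0 (2 * PI)).
  { apply RInt_ext_all. intros t. ring. }
  rewrite RInt_plus_c, RInt_plus_c, !RInt_scal_c, RInt_const_R; try (intros t; cont; auto; fail).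
  rring.
Qed.

Lemma perturbed_energy eta eps s : 0 < eta ->
  energy a (perturbed eta eps) s =
  2 * PI * (f s * trunc_s eta s ^ 2 - q s * f s * trunc eta s ^ 2)
  + 2 * eps * RInt tau 0 (2 * PI)
      * (f s * (trunc_s eta s * rho1 s) - q s * f s * (trunc eta s * rho s))
  + eps ^ 2 * (RInt (fun t => tau t ^ 2) 0 (2 * PI) * (f s * rho1 s ^ 2 - q s * f s * rho s ^ 2)
               + RInt (fun t => tau1 t ^ 2) 0 (2 * PI) * (rho s ^ 2 / f s)).
Proof.
  intros Heta. unfold energy.
  assert (E0' : circ (fun x y => pd2 0 (perturbed eta eps) x y ^ 2) s =
    RInt (fun t => (trunc_s eta s + eps * rho1 s * tau t) ^ 2) 0 (2 * PI)).
  { apply RInt_ext_all. intros t. f_equal. apply is_derive_unique. unfold perturbed.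
    apply (is_derive_plus (trunc eta) (fun s => eps * rho s * tau t)).
    - apply trunc_derive, Heta.
    - apply (is_derive_scal_r (fun s => eps * rho s)). apply (is_derive_scal rho), Drho. }
  assert (E1 : circ (fun x y => pd2 1 (perturbed eta eps) x y ^ 2) s =
    RInt (fun t => (eps * rho s) ^ 2 * tau1 t ^ 2) 0 (2 * PI)).
  { apply RInt_ext_all. intros t. rewrite <- Rpow_mult_distr. f_equal.
    apply is_derive_unique. unfold perturbed.
    apply is_derive_eq with (0 + eps * rho s * tau1 t); [|ring].
    apply (is_derive_plus (fun _ => trunc eta s) (fun t => eps * rho s * tau t)).
    - apply (is_derive_const (K := R_AbsRing) (V := R_NormedModule)).
    - apply (is_derive_scal tau), Dtau. }
  rewrite E0', E1, RInt_scal_c by (intros t; cont; auto).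
  unfold circ, perturbed. rewrite !RInt_affine_sqr.
  pose proof (sinh_y0_pos a Ha s). as_R. field. lra.
Qed.

(** The energy is [O(eta) - 2 eps T b + O(eps^2)] with [T b > 0]: take first [eps], then [eta],
    small. *)
Lemma perturbed_energy_neg :
  exists eta eps, 0 < eta /\ 0 < eps /\ RInt (energy a (perturbed eta eps)) (- S0) S0 < 0.
Proof.
  pose proof PI_RGT_0.
  destruct e0_le_quadratic as [m [Hm He]].
  destruct (bounded_on f (- z) z) as [F [HF Hf]]; [apply (sinh_y0_cont a Ha)|lra|].
  destruct (bounded_on jac_rho (- z) z) as [G [HG Hg]]; [apply jac_rho_cont|lra|].
  set (T := RInt tau 0 (2 * PI)) in *.
  set (b := - (f z * e0_s a z * (rho z + rho (- z)))).
  assert (Hb : 0 < b).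
  { unfold b. pose proof (e0_s_neg a Ha z Hz He0). pose proof (sinh_y0_pos a Ha z).
    replace (- (f z * e0_s a z * (rho z + rho (- z)))) with
      (f z * - e0_s a z * (rho z + rho (- z))) by ring. cbv beta. pos. }
  set (k := fun s => RInt (fun t => tau t ^ 2) 0 (2 * PI) * (f s * rho1 s ^ 2 - q s * f s * rho s ^ 2)
               + RInt (fun t => tau1 t ^ 2) 0 (2 * PI) * (rho s ^ 2 / f s)).
  assert (Cf := sinh_y0_cont a Ha). assert (Cq := potential_cont a Ha).
  assert (Cr := rho_cont). assert (Cr1 := rho1_cont).
  assert (Ck : forall s, continuity_pt k s).
  { intros s. unfold k. cont; auto. apply sinh_y0_neq, Ha. }
  set (K := RInt k (- S0) S0).
  set (eps := T * b / (Rabs K + 1)).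
  pose proof (Rabs_pos K). pose proof (Rle_abs K).
  assert (Heps : 0 < eps) by (unfold eps; pos).
  assert (Keps : eps ^ 2 * K <= eps * (T * b)).
  { assert (eps * (Rabs K + 1) = T * b) by (unfold eps; field; lra).
    replace (eps ^ 2 * K) with (eps * (eps * K)) by ring. apply Rmult_le_compat_l; [lra|].
    assert (eps * K <= eps * (Rabs K + 1)) by (apply Rmult_le_compat_l; lra). lra. }
  set (c := 2 * PI * (8 * F * m ^ 2 * z) + 2 * eps * T * (4 * m * G * z)).
  assert (Hc : 0 < c) by (unfold c; apply Rplus_lt_0_compat; pos).
  set (eta := eps * (T * b) / (2 * c)).
  assert (Heta : 0 < eta) by (unfold eta; pos).
  assert (Ceta : c * eta = eps * (T * b) / 2) by (unfold eta; field; lra).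
  exists eta, eps. split; [exact Heta|split; [exact Heps|]].
  assert (CT : forall s, continuity_pt (trunc eta) s).
  { intros s; eapply is_derive_cont, trunc_derive, Heta. }
  assert (CT1 := trunc_s_cont eta Heta).
  pose proof (radial_energy eta Heta m F Hm HF He Hf) as R0.
  pose proof (mixed_energy eta Heta m G Hm HG He Hg) as R1.
  assert (E : RInt (energy a (perturbed eta eps)) (- S0) S0 =
    2 * PI * RInt (fun s => f s * trunc_s eta s ^ 2 - q s * f s * trunc eta s ^ 2) (- S0) S0
    + 2 * eps * T * RInt (fun s => f s * (trunc_s eta s * rho1 s)
                                   - q s * f s * (trunc eta s * rho s)) (- S0) S0
    + eps ^ 2 * K).
  { unfold K. rewrite <- !RInt_scal_c; try (intros s; cont; auto; fail).
    rewrite <- !RInt_plus_c; try (intros s; cont; auto; fail).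
    apply RInt_ext_all. intros s. apply (perturbed_energy eta eps s Heta). }
  rewrite E.
  assert (2 * PI * RInt (fun s => f s * trunc_s eta s ^ 2 - q s * f s * trunc eta s ^ 2) (- S0) S0
    <= 2 * PI * (8 * F * m ^ 2 * z * eta)) by (apply Rmult_le_compat_l; lra).
  assert (2 * eps * T * RInt (fun s => f s * (trunc_s eta s * rho1 s)
                                   - q s * f s * (trunc eta s * rho s)) (- S0) S0
    <= 2 * eps * T * (- b + 4 * m * G * z * eta)).
  { apply Rmult_le_compat_l; [left; pos|]. unfold b. rewrite Ropp_involutive. exact R1. }
  assert (2 * PI * (8 * F * m ^ 2 * z * eta) + 2 * eps * T * (- b + 4 * m * G * z * eta)
    = c * eta - 2 * (eps * (T * b))) by (unfold c; ring).
  assert (0 < eps * (T * b)) by pos. lra.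
Qed.

End Unstable.

(** * Stability and index of the catenoids *)

Lemma angle_near x d : 0 < d < PI -> cos d < cos x ->
  exists x', Rabs x' <= d /\ cos x' = cos x /\ sin x' = sin x.
Proof.
  intros Hd Hc. destruct (angle_mod x) as [y [Hy [Ec Es]]].
  destruct (Rle_lt_dec y PI) as [L|L].
  - exists y. split; [|split; assumption]. rewrite Rabs_right by lra.
    apply Rnot_lt_le. intros N. assert (cos y < cos d) by (apply cos_decreasing_1; lra). lra.
  - assert (E1 : cos (y - 2 * PI) = cos x).
    { rewrite <- Ec, <- (cos_period (y - 2 * PI) 1). f_equal. simpl. ring. }
    assert (E2 : sin (y - 2 * PI) = sin x).
    { rewrite <- Es, <- (sin_period (y - 2 * PI) 1). f_equal. simpl. ring. }
    exists (y - 2 * PI). split; [|split; assumption].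
    rewrite Rabs_left1 by lra. apply Rnot_lt_le. intros N.
    assert (cos (- (y - 2 * PI)) < cos d) by (apply cos_decreasing_1; lra).
    rewrite cos_neg in H. lra.
Qed.

Lemma e0_smooth_on_surface a : 0 < a -> smooth2 everywhere (fun s _ => e0 a s).
Proof.
  intros Ha n. apply (Cn2_comp2 n everywhere half_plane e0 (fun _ _ => a) (fun s _ => s));
    auto using open_everywhere, open_half_plane, Cn2_const, Cn2_fst.
  apply e0_smooth.
Qed.

Section NegativeTest.

Variable a : R.
Hypothesis Ha : 0 < a.
Variable z : R.
Hypothesis Hz : 0 < z.
Hypothesis He0 : e0 a z = 0.
Hypothesis Hin : forall s, Rabs s < z -> 0 < e0 a s.

Local Notation Y := (catenoid a).

(** Bumps of half-width [d] around [c], on the line and on the circle. *)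
Definition bump (c d s : R) : R := flat 0 (d ^ 2 - (s - c) ^ 2).
Definition bump1 (c d s : R) : R := - 2 * (s - c) * flat 2 (d ^ 2 - (s - c) ^ 2).
Definition bump2 (c d s : R) : R :=
  - 2 * flat 2 (d ^ 2 - (s - c) ^ 2)
  + 4 * (s - c) ^ 2 * (- 2 * flat 3 (d ^ 2 - (s - c) ^ 2) + flat 4 (d ^ 2 - (s - c) ^ 2)).
Definition angular_bump (c d t : R) : R := flat 0 (cos (t - c) - cos d).
Definition angular_bump1 (c d t : R) : R := - sin (t - c) * flat 2 (cos (t - c) - cos d).

Lemma bump_inner_derive c d s : is_derive (fun s => d ^ 2 - (s - c) ^ 2) s (- 2 * (s - c)).
Proof. auto_derive; [exact I|ring]. Qed.

Lemma bump_derive c d s : is_derive (bump c d) s (bump1 c d s).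
Proof.
  apply (is_derive_comp (flat 0) (fun s => d ^ 2 - (s - c) ^ 2));
    [apply flat0_derive|apply bump_inner_derive].
Qed.

Lemma bump1_derive c d s : is_derive (bump1 c d) s (bump2 c d s).
Proof.
  apply is_derive_eq with (- 2 * flat 2 (d ^ 2 - (s - c) ^ 2) + - 2 * (s - c) *
    (- 2 * (s - c) * (- INR 2 * flat 3 (d ^ 2 - (s - c) ^ 2) + 1 * flat 4 (d ^ 2 - (s - c) ^ 2)))).
  2:{ unfold bump2. simpl. ring. }
  apply (is_derive_mult (fun s => - 2 * (s - c)) (fun s => flat 2 (d ^ 2 - (s - c) ^ 2))).
  - auto_derive; [exact I|ring].
  - apply (is_derive_comp (flat 2) (fun s => d ^ 2 - (s - c) ^ 2));
      [apply flat_derive|apply bump_inner_derive].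
  - intros; apply Rmult_comm.
Qed.

Lemma bump2_cont c d s : continuity_pt (bump2 c d) s.
Proof.
  assert (C : forall m, continuity_pt (fun s => flat m (d ^ 2 - (s - c) ^ 2)) s).
  { intros m. apply (continuity_pt_comp (fun s => d ^ 2 - (s - c) ^ 2) (flat m)).
    - eapply is_derive_cont, bump_inner_derive.
    - apply flat_continuity. }
  unfold bump2. cont; auto. apply continuity_pt_id.
Qed.

Lemma angular_bump_derive c d t : is_derive (angular_bump c d) t (angular_bump1 c d t).
Proof.
  apply (is_derive_comp (flat 0) (fun t => cos (t - c) - cos d)); [apply flat0_derive|].
  auto_derive; [exact I|unfold Rminus; ring].
Qed.

Lemma angular_bump1_cont c d t : continuity_pt (angular_bump1 c d) t.
Proof.
  unfold angular_bump1. apply (continuity_pt_mult' (fun t => - sin (t - c))).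
  - apply (is_derive_cont _ _ (- cos (t - c))). auto_derive; [exact I|unfold Rminus; ring].
  - apply (continuity_pt_comp (fun t => cos (t - c) - cos d) (flat 2)).
    + apply (is_derive_cont _ _ (- sin (t - c))). auto_derive; [exact I|unfold Rminus; ring].
    + apply flat_continuity.
Qed.

Lemma angular_bump_integral c d : 0 < d < PI -> 0 < RInt (angular_bump c d) 0 (2 * PI).
Proof.
  intros Hd. pose proof PI_RGT_0.
  assert (C : forall t, continuity_pt (angular_bump c d) t).
  { intros t. eapply is_derive_cont, angular_bump_derive. }
  assert (P : forall t, 0 <= angular_bump c d t) by (intros; apply flat_nonneg).
  destruct (RInt_nonneg (angular_bump c d) 0 (2 * PI)) as [L|L]; auto; [lra|exfalso].
  destruct (angle_mod c) as [c' [Hc' [E1 E2]]].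
  assert (Z : angular_bump c d c' = 0).
  { apply (RInt_zero_nonneg (angular_bump c d) 0 (2 * PI)); auto. lra. }
  unfold angular_bump in Z.
  assert (cos (c' - c) = 1).
  { rewrite cos_minus, E1, E2. pose proof (sin2_cos2 c). unfold Rsqr in H0. lra. }
  assert (cos d < cos 0) by (apply cos_decreasing_1; lra). rewrite cos_0 in H1.
  pose proof (flat_pos 0 (cos (c' - c) - cos d) ltac:(lra)). lra.
Qed.

Lemma perturbed_smooth c d t0 dt eta eps : 0 < eta ->
  smooth2 everywhere (perturbed a z (bump c d) (angular_bump t0 dt) eta eps).
Proof.
  intros Heta n. pose proof open_everywhere as HO. unfold perturbed, trunc, cutoff, bump, angular_bump.
  assert (C : forall k, Cn2 n everywhere (fun _ _ => k)) by (intros; apply Cn2_const, HO).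
  assert (Cs : Cn2 n everywhere (fun s _ => s)) by apply Cn2_fst, HO.
  assert (Ct : Cn2 n everywhere (fun _ t => t)) by apply Cn2_snd, HO.
  apply Cn2_plus; [exact HO| |]; (apply Cn2_mult; [exact HO| |]).
  - apply (Cn2_flat 0 n everywhere (fun s _ => (z ^ 2 - s ^ 2) / eta - 1)); [exact HO|].
    apply Cn2_minus; auto. apply Cn2_div; auto.
    + intros; lra.
    + apply Cn2_minus; auto. simpl. auto using Cn2_mult.
  - apply e0_smooth_on_surface, Ha.
  - apply Cn2_mult; auto.
    apply (Cn2_flat 0 n everywhere (fun s _ => d ^ 2 - (s - c) ^ 2)); [exact HO|].
    apply Cn2_minus; auto. simpl. auto using Cn2_mult, Cn2_minus.
  - apply (Cn2_flat 0 n everywhere (fun _ t => cos (t - t0) - cos dt)); [exact HO|].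
    apply Cn2_minus; auto. apply (Cn2_trig n everywhere (fun _ t => t - t0)); auto using Cn2_minus.
Qed.

(** The support consists of a compact part of the domain and of a small rectangle around
    a boundary point; the perturbation is localized near that point both in [s] and in
    [theta], since [D] need not contain a full neighbourhood of the boundary circle. *)
Lemma negative_test (D O : R3 -> Prop) sb t0 :
  open O -> (forall p, D p <-> surface Y p /\ O p) ->
  (forall p, catenoid_domain a z p -> D p) -> (sb = z \/ sb = - z) -> D (Y sb t0) ->
  exists f, test_function Y D f /\ jacobi_form Y f < 0.
Proof.
  intros HO HD Hsub Hsb Hp. pose proof PI_RGT_0. pose proof PI2_1.
  destruct (surface_neighbourhood Y O sb t0 (catenoid_continuous a Ha) HO) as [r [Hr Hnb]].
  { apply HD, Hp. }
  set (d := Rmin (r / 2) 1).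
  assert (Hd : 0 < d) by (apply Rmin_pos; lra).
  assert (Hd1 : d <= r / 2) by apply Rmin_l. assert (Hd2 : d <= 1) by apply Rmin_r.
  set (rho := bump sb d). set (tau := angular_bump t0 d).
  assert (Hrho0 : forall s, d <= Rabs (s - sb) -> rho s = 0 /\ bump1 sb d s = 0).
  { intros s Hs. assert (d ^ 2 <= (s - sb) ^ 2).
    { replace ((s - sb) ^ 2) with (Rabs (s - sb) ^ 2) by (unfold Rabs; destruct Rcase_abs; ring).
      apply pow_incr. lra. }
    unfold rho, bump, bump1. rewrite !flat_neg by lra. split; ring. }
  assert (Hfar : forall s, z + 2 <= Rabs s -> d <= Rabs (s - sb)).
  { intros s Hs. unfold Rabs in *. repeat destruct Rcase_abs; destruct Hsb; lra. }
  destruct (perturbed_energy_neg a Ha z Hz He0 Hin rho (bump1 sb d) (bump2 sb d) (z + 2))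
    with (tau := tau) (tau1 := angular_bump1 t0 d) as [eta [eps [Heta [Heps Hneg]]]].
  - apply bump_derive.
  - apply bump1_derive.
  - apply bump2_cont.
  - intros s Hs. apply Hrho0, Hfar, Hs.
  - lra.
  - assert (0 < rho sb).
    { apply flat_pos. rewrite Rminus_eq_0. simpl. nra. }
    pose proof (flat_nonneg 0 (d ^ 2 - (z - sb) ^ 2)). pose proof (flat_nonneg 0 (d ^ 2 - (- z - sb) ^ 2)).
    fold (bump sb d z) in H2. fold (bump sb d (- z)) in H3. fold rho in H2, H3.
    destruct Hsb as [E|E]; rewrite E in H1; lra.
  - intros t. eapply is_derive_cont, angular_bump_derive.
  - apply angular_bump1_cont.
  - apply angular_bump_derive.
  - apply angular_bump_integral. lra.
  - set (phi := perturbed a z rho tau eta eps) in *.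
    assert (Hang : forall s t t', cos t = cos t' -> sin t = sin t' -> phi s t = phi s t').
    { intros s t t' E1 E2. unfold phi, perturbed. f_equal. f_equal. unfold tau, angular_bump.
      rewrite !cos_minus, E1, E2. reflexivity. }
    destruct (function_on_surface a Ha phi Hang) as [f Hf].
    assert (Ef : (fun s t => f (Y s t)) = phi).
    { apply functional_extensionality; intros s. apply functional_extensionality; intros t. apply Hf. }
    assert (Hsm : smooth2 everywhere phi) by (apply perturbed_smooth, Heta).
    assert (Hcut : forall s, z - eta / (2 * z) < Rabs s -> cutoff z eta s = 0).
    { intros s Hs. apply (cutoff_outside z eta Heta).
      set (e := eta / (2 * z)) in *. assert (0 < e) by (unfold e; pos).
      assert (Ee : eta = 2 * z * e) by (unfold e; field; lra).
      replace (s ^ 2) with (Rabs s ^ 2) by (unfold Rabs; destruct Rcase_abs; ring).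
      pose proof (Rabs_pos s). destruct (Rle_lt_dec 0 (z - e)); nra. }
    assert (He : 0 < eta / (2 * z)) by pos.
    exists f. split.
    + split; [rewrite Ef; exact Hsm|].
      set (K1 := rect_image Y (- (z - eta / (2 * z))) (z - eta / (2 * z)) 0 (2 * PI)).
      set (K2 := rect_image Y (sb - d) (sb + d) (t0 - d) (t0 + d)).
      exists (fun p => K1 p \/ K2 p).
      split; [apply closed_union3; apply rect_image_closed, catenoid_continuous, Ha|].
      split; [apply bounded_union3; apply rect_image_bounded, catenoid_continuous, Ha|].
      split.
      * intros p [[s [t [Hs [Ht <-]]]]|[s [t [Hs [Ht <-]]]]].
        -- apply Hsub, (catenoid_domain_iff a Ha). lra.
        -- apply HD. split; [exists s, t; reflexivity|].
           apply Hnb; unfold Rabs; destruct Rcase_abs; lra.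
      * intros p [s [t <-]] HK. rewrite Hf. unfold phi, perturbed, trunc.
        assert (Z1 : cutoff z eta s = 0).
        { apply NNPP. intros N. apply HK. left.
          destruct (angle_mod t) as [t' [Ht' [E1 E2]]]. exists s, t'.
          split; [|split; [exact Ht'|apply catenoid_angle; assumption]].
          apply Rabs_le_between. apply Rnot_lt_le. intros L. apply N, Hcut, L. }
        assert (Z2 : rho s * tau t = 0).
        { apply NNPP. intros N. apply HK. right.
          assert (N1 : Rabs (s - sb) <= d).
          { apply Rnot_lt_le. intros L. apply N. destruct (Hrho0 s) as [-> _]; [lra|]. ring. }
          assert (N2 : cos d < cos (t - t0)).
          { apply Rnot_le_lt. intros L. apply N. unfold tau, angular_bump.
            rewrite (flat_neg 0) by lra. ring. }
          destruct (angle_near (t - t0) d ltac:(lra) N2) as [x [Hx [E1 E2]]].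
          apply Rabs_le_between in N1, Hx.
          exists s, (t0 + x). split; [lra|split; [lra|]].
          replace t with (t0 + (t - t0)) by ring.
          apply catenoid_angle; [rewrite !cos_plus|rewrite !sin_plus]; rewrite E1, E2; reflexivity. }
        rewrite Z1. replace (eps * rho s * tau t) with (eps * (rho s * tau t)) by ring.
        rewrite Z2. ring.
    + rewrite (jacobi_form_energy a f (z + 2) Ha); rewrite Ef; [exact Hneg|].
      split; [exact Hsm|split; [|split; [lra|]]].
      * intros s t. apply Hang.
        -- rewrite <- (cos_period t 1). f_equal. simpl. ring.
        -- rewrite <- (sin_period t 1). f_equal. simpl. ring.
      * intros s t Hs. unfold phi, perturbed, trunc.
        rewrite Hcut by lra. destruct (Hrho0 s (Hfar s Hs)) as [-> _]. ring.
Qed.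

End NegativeTest.

Section Stability.

Variable a : R.
Hypothesis Ha : 0 < a.

Local Notation Y := (catenoid a).

Lemma catenoid_stable : E0 a < 0 -> stable Y (surface Y).
Proof.
  intros HE f Hf [p [[s0 [t0 <-]] Hp]].
  destruct (test_function_support a Ha (surface Y) f (fun p H => H) Hf) as [S0 HS].
  rewrite (jacobi_form_energy a f S0 Ha HS).
  destruct (angle_mod t0) as [t1 [Ht1 [E1 E2]]].
  apply (energy_stable a Ha _ S0 HS s0 t1).
  - apply e0_pos_stable; assumption.
  - exact Ht1.
  - rewrite (catenoid_angle a s0 t1 t0 E1 E2). exact Hp.
Qed.

Lemma domain_weakly_stable z : 0 < z -> (forall s, Rabs s < z -> 0 < e0 a s) ->
  weakly_stable Y (catenoid_domain a z).
Proof.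
  intros Hz Hin f Hf _.
  destruct (domain_support a Ha z f Hz Hf) as [z' [Hz' HS]].
  rewrite (jacobi_form_energy a f z' Ha HS).
  apply (energy_weakly_stable a Ha _ z' HS).
  intros s Hs. apply Hin. unfold Rabs. destruct Rcase_abs; lra.
Qed.

(** A larger domain contains a boundary point, hence carries a test function of negative
    energy. *)
Lemma domain_maximal z : 0 < z -> e0 a z = 0 -> (forall s, Rabs s < z -> 0 < e0 a s) ->
  maximal_weakly_stable Y (catenoid_domain a z).
Proof.
  intros Hz E Hin. split; [apply catenoid_domain_open, Ha|split].
  - apply domain_weakly_stable; assumption.
  - intros D' [[O [HO HD]] HC] Hsub Hex Hws.
    destruct (boundary_crossing a Ha z D' Hz) as [s [t [Hs Hp]]]; auto.
    { intros p Hp. apply HD, Hp. }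
    destruct (negative_test a Ha z Hz E Hin D' O s t HO HD Hsub Hs Hp) as [f [Hf Hneg]].
    specialize (Hws f Hf).
    assert (0 <= jacobi_form Y f); [|lra]. apply Hws.
    apply NNPP. intros N.
    assert (Zf : forall s t, f (Y s t) = 0).
    { intros s' t'. apply NNPP. intros C. apply N. exists (Y s' t'). split; [exists s', t'|]; auto. }
    destruct (test_function_support a Ha D' f) as [S0 HS]; auto.
    { intros p Hp'. apply HD, Hp'. }
    rewrite (jacobi_form_energy a f S0 Ha HS) in Hneg.
    assert (Ef : (fun s t => f (Y s t)) = fun _ _ => 0).
    { apply functional_extensionality; intros s'.
      apply functional_extensionality; intros t'. apply Zf. }
    assert (HS0 := HS). rewrite Ef in HS0, Hneg.
    pose proof (energy_zero_mean a Ha (fun _ _ => 0) S0 HS0). 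
    assert (circ (fun _ _ => 0) 0 = 0) by (apply RInt_vanish; auto). 
    specialize (H H0). lra.
Qed.

Lemma test_function_combination (f0 f1 : R3 -> R) c0 c1 :
  test_function Y (surface Y) f0 -> test_function Y (surface Y) f1 ->
  test_function Y (surface Y) (fun p => c0 * f0 p + c1 * f1 p).
Proof.
  intros [S1 [K1 [C1 [B1 [D1 Z1]]]]] [S2 [K2 [C2 [B2 [D2 Z2]]]]]. split.
  - apply (smooth2_plus (fun s t => c0 * f0 (Y s t)) (fun s t => c1 * f1 (Y s t)));
      apply smooth2_mult; auto using smooth2_const.
  - exists (fun p => K1 p \/ K2 p). split; [apply closed_union3; assumption|].
    split; [apply (bounded_union3 K1 K2); assumption|]. split.
    + intros p [H|H]; auto.
    + intros p Hp HK. rewrite Z1, Z2 by tauto. ring.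
Qed.

Lemma jacobi_form_scal f c : test_function Y (surface Y) f ->
  jacobi_form Y (fun p => c * f p) = c ^ 2 * jacobi_form Y f.
Proof.
  intros Hf.
  destruct (test_function_support a Ha (surface Y) f (fun p H => H) Hf) as [S0 HS].
  assert (Hsm : smooth2 everywhere (fun s t => f (Y s t))) by apply HS.
  assert (HS' : periodic_compact (fun s t => c * f (Y s t)) S0).
  { destruct HS as [_ [Hp [H0 Hz]]].
    split; [apply smooth2_mult; auto using smooth2_const|split; [|split; [exact H0|]]].
    - intros s t. rewrite Hp. reflexivity.
    - intros s t Hs. rewrite Hz by exact Hs. ring. }
  rewrite (jacobi_form_energy a _ S0 Ha HS'), (jacobi_form_energy a _ S0 Ha HS).
  set (phi := fun s t => f (Y s t)) in *.
  rewrite <- (RInt_scal_c (energy a phi)) by apply (energy_cont a Ha phi S0 HS).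
  apply RInt_ext_all. intros s.
  pose proof (smooth2_pd2 _ _ 0 Hsm). pose proof (smooth2_pd2 _ _ 1 Hsm).
  assert (E : forall g g' : R -> R -> R, smooth2 everywhere g ->
     (forall t, g' s t = c * g s t) ->
     circ (fun x y => g' x y ^ 2) s = c ^ 2 * circ (fun x y => g x y ^ 2) s).
  { intros g g' Hg Eg. rewrite <- circ_scal by auto using smooth2_sqr.
    apply circ_ext. intros t. rewrite Eg. ring. }
  unfold energy.
  rewrite (E phi (fun s t => c * f (Y s t))), (E (pd2 0 phi) (pd2 0 (fun s t => c * f (Y s t)))),
    (E (pd2 1 phi) (pd2 1 (fun s t => c * f (Y s t)))); auto.
  - pose proof (sinh_y0_pos a Ha s). as_R. field. lra.
  - intros t. apply (Derive_scal (fun y => phi s y)).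
  - intros t. apply (Derive_scal (fun x => phi x t)).
Qed.

(** In a plane of test functions some nonzero one has vanishing mean over the neck. *)
Lemma index_at_most_one m : negative_subspace Y (surface Y) m -> (m <= 1)%nat.
Proof.
  intros [f [Hf Hneg]]. destruct (Nat.le_gt_cases m 1) as [L|L]; [exact L|exfalso].
  destruct m as [|[|m]]; try lia.
  pose proof (Hf 0%nat ltac:(lia)) as F0. pose proof (Hf 1%nat ltac:(lia)) as F1.
  set (A0 := circ (fun s t => f 0%nat (Y s t)) 0). set (A1 := circ (fun s t => f 1%nat (Y s t)) 0).
  assert (exists c0 c1, (c0 <> 0 \/ c1 <> 0) /\ c0 * A0 + c1 * A1 = 0) as [c0 [c1 [Hc EA]]].
  { destruct (Req_dec A1 0) as [E|E].
    - exists 0, 1. split; [right; lra|]. rewrite E. ring.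
    - exists A1, (- A0). split; [left; exact E|]. ring. }
  set (g := fun p => c0 * f 0%nat p + c1 * f 1%nat p).
  assert (Hg : test_function Y (surface Y) g) by (apply test_function_combination; assumption).
  assert (Hpos : 0 <= jacobi_form Y g).
  { destruct (test_function_support a Ha (surface Y) g (fun p H => H) Hg) as [S0 HS].
    rewrite (jacobi_form_energy a g S0 Ha HS).
    apply (energy_zero_mean a Ha _ S0 HS). apply eq_trans with (2 := EA).
    destruct F0 as [S1 _], F1 as [S2 _].
    unfold A0, A1. rewrite <- (circ_scal (fun s t => f 0%nat (Y s t))),
      <- (circ_scal (fun s t => f 1%nat (Y s t))), <- circ_plus;
      try (apply smooth2_mult; auto using smooth2_const; fail); auto. }
  set (c := fun i : nat => match i with 0%nat => c0 | 1%nat => c1 | _ => 0 end).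
  specialize (Hneg c).
  assert (E : (fun p => fold_right Rplus 0 (map (fun i => c i * f i p) (seq 0 (S (S m))))) = g).
  { apply functional_extensionality. intros p. cbn [seq map fold_right].
    assert (Z : forall n k,
      fold_right Rplus 0 (map (fun i => c i * f i p) (seq (S (S k)) n)) = 0).
    { induction n as [|n IH]; intros k; [reflexivity|]. cbn [seq map fold_right].
      rewrite IH. unfold c. ring. }
    rewrite Z. unfold g, c. ring. }
  rewrite E in Hneg.
  assert (jacobi_form Y g < 0); [|lra]. apply Hneg.
  destruct Hc as [Hc|Hc]; [exists 0%nat|exists 1%nat]; (split; [lia|exact Hc]).
Qed.

Lemma catenoid_index_one z : 0 < z -> e0 a z = 0 -> (forall s, Rabs s < z -> 0 < e0 a s) ->
  has_index Y (surface Y) 1.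
Proof.
  intros Hz E Hin. split; [|apply index_at_most_one].
  destruct (negative_test a Ha z Hz E Hin (surface Y) (fun _ => True) z 0) as [f [Hf Hneg]].
  - apply open_true.
  - intros p. tauto.
  - apply catenoid_domain_surface.
  - auto.
  - exists z, 0. reflexivity.
  - exists (fun _ => f). split; [intros; exact Hf|].
    intros c [i [Hi Hc]]. assert (i = 0)%nat by lia. subst i.
    assert (Ef : (fun p => fold_right Rplus 0 (map (fun i => c i * f p) (seq 0 1)))
      = fun p => c 0%nat * f p).
    { apply functional_extensionality. intros p. simpl. ring. }
    rewrite Ef, jacobi_form_scal by exact Hf.
    assert (0 < c 0%nat ^ 2) by (apply pow2_gt_0, Hc). nra.
Qed.

End Stability.

(** * Intersections of catenaries *)

(** The parameter [s >= 0] at which the catenary [c] is at distance [u] from the axis. *)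
Definition arc (c u : R) : R := / 2 * arccosh (cosh (2 * u) / cosh (2 * c)).

Lemma cosh_incr x y : 0 <= x -> x < y -> cosh x < cosh y.
Proof.
  intros Hx Hxy. apply (derive_pos_incr cosh sinh); auto.
  - intros t _. apply is_derive_cosh.
  - intros t Ht. apply sinh_pos. lra.
  - intros t _. eapply is_derive_cont, is_derive_cosh.
Qed.

Lemma cosh_le x y : 0 <= x -> x <= y -> cosh x <= cosh y.
Proof. intros Hx [H| ->]; [left; apply cosh_incr; assumption|lra]. Qed.

Lemma cosh_quotient_ge c u : 0 < c <= u -> 1 <= cosh (2 * u) / cosh (2 * c).
Proof.
  intros Hc. pose proof (cosh_pos_1 (2 * c)).
  apply Rmult_le_reg_r with (cosh (2 * c)); [lra|].
  unfold Rdiv. rewrite Rmult_assoc, Rinv_l, Rmult_1_l, Rmult_1_r by lra.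
  apply cosh_le; lra.
Qed.

Lemma cosh_quotient_gt c u : 0 < c < u -> 1 < cosh (2 * u) / cosh (2 * c).
Proof.
  intros Hc. pose proof (cosh_pos_1 (2 * c)).
  apply Rmult_lt_reg_r with (cosh (2 * c)); [lra|].
  unfold Rdiv. rewrite Rmult_assoc, Rinv_l, Rmult_1_l, Rmult_1_r by lra.
  apply cosh_incr; lra.
Qed.

Lemma cosh_arc c u : 0 < c <= u -> cosh (2 * arc c u) = cosh (2 * u) / cosh (2 * c).
Proof.
  intros Hc. unfold arc. rewrite <- Rmult_assoc, Rinv_r, Rmult_1_l by lra.
  apply cosh_arccosh, cosh_quotient_ge, Hc.
Qed.

Lemma arccosh_1 : arccosh 1 = 0.
Proof. rewrite <- cosh_0, arccosh_cosh; lra. Qed.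

Lemma arc_nonneg c u : 0 < c <= u -> 0 <= arc c u.
Proof.
  intros Hc. unfold arc. pose proof (arccosh_le 1 _ ltac:(lra) (cosh_quotient_ge c u Hc)) as H.
  rewrite arccosh_1 in H. lra.
Qed.

Lemma arc_pos c u : 0 < c < u -> 0 < arc c u.
Proof.
  intros Hc. destruct (arc_nonneg c u ltac:(lra)) as [H|H]; [exact H|exfalso].
  pose proof (cosh_arc c u ltac:(lra)) as E. rewrite <- H, Rmult_0_r, cosh_0 in E.
  pose proof (cosh_quotient_gt c u Hc). lra.
Qed.

Lemma arc_self c : 0 < c -> arc c c = 0.
Proof.
  intros Hc. unfold arc. pose proof (cosh_pos_1 (2 * c)).
  replace (cosh (2 * c) / cosh (2 * c)) with 1 by (field; lra). rewrite arccosh_1. ring.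
Qed.

Lemma y0_arc c u : 0 < c <= u -> y0 c (arc c u) = u.
Proof.
  intros Hc. unfold y0. rewrite cosh_arc by exact Hc. pose proof (cosh_pos_1 (2 * c)).
  replace (cosh (2 * c) * (cosh (2 * u) / cosh (2 * c))) with (cosh (2 * u)) by (field; lra).
  rewrite arccosh_cosh by lra. field.
Qed.

Lemma arc_y0 c s : 0 < c -> arc c (y0 c s) = Rabs s.
Proof.
  intros Hc. unfold arc. destruct (y0_spec c s Hc) as [_ ->]. pose proof (cosh_pos_1 (2 * c)).
  replace (cosh (2 * c) * cosh (2 * s) / cosh (2 * c)) with (cosh (2 * s)) by (field; lra).
  unfold Rabs. destruct Rcase_abs.
  - rewrite <- cosh_opp, arccosh_cosh by lra. field.
  - rewrite arccosh_cosh by lra. field.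
Qed.

Lemma arc_antitone b c u : 0 < b <= c -> c <= u -> arc c u <= arc b u.
Proof.
  intros Hb Hu. unfold arc. apply Rmult_le_compat_l; [lra|].
  apply arccosh_le; [apply cosh_quotient_ge; lra|].
  pose proof (cosh_pos_1 (2 * u)). pose proof (cosh_pos_1 (2 * b)).
  apply Rmult_le_compat_l; [lra|]. apply Rinv_le_contravar; [lra|]. apply cosh_le; lra.
Qed.

Lemma arccosh_cont x : 1 <= x -> continuity_pt arccosh x.
Proof.
  intros Hx. unfold arccosh.
  apply (continuity_pt_comp (fun x => x + sqrt (x ^ 2 - 1)) ln).
  - apply continuity_pt_plus'; [apply continuity_pt_id|].
    apply (continuity_pt_comp (fun x => x ^ 2 - 1) sqrt).
    + cont. apply continuity_pt_id.
    + apply continuity_pt_sqrt. nra.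
  - pose proof (sqrt_pos (x ^ 2 - 1)). apply derivable_continuous_pt. eexists.
    apply derivable_pt_lim_ln. lra.
Qed.

Lemma cosh_2_cont x : continuity_pt (fun t => cosh (2 * t)) x.
Proof.
  apply (continuity_pt_comp (fun t => 2 * t) cosh).
  - apply (is_derive_cont _ _ 2). auto_derive; [exact I|ring].
  - eapply is_derive_cont, is_derive_cosh.
Qed.

Lemma arc_cont_c c u : 0 < c <= u -> continuity_pt (fun c => arc c u) c.
Proof.
  intros Hc. unfold arc.
  apply (continuity_pt_mult' (fun _ => / 2) (fun c => arccosh (cosh (2 * u) / cosh (2 * c))));
    [apply continuity_pt_cst'|].
  apply (continuity_pt_comp (fun c => cosh (2 * u) / cosh (2 * c)) arccosh).
  - cont; [apply cosh_2_cont|]. pose proof (cosh_pos_1 (2 * c)). lra.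
  - apply arccosh_cont, cosh_quotient_ge, Hc.
Qed.

Lemma arc_cont_u c u : 0 < c <= u -> continuity_pt (arc c) u.
Proof.
  intros Hc. unfold arc.
  apply (continuity_pt_mult' (fun _ => / 2) (fun u => arccosh (cosh (2 * u) / cosh (2 * c))));
    [apply continuity_pt_cst'|].
  apply (continuity_pt_comp (fun u => cosh (2 * u) / cosh (2 * c)) arccosh).
  - cont; [apply cosh_2_cont|]. pose proof (cosh_pos_1 (2 * c)). lra.
  - apply arccosh_cont, cosh_quotient_ge, Hc.
Qed.

Lemma sqrt_cosh_sinh x : 0 <= x -> sqrt (cosh x ^ 2 - 1) = sinh x.
Proof.
  intros Hx. rewrite cosh2_sinh2. replace (1 + sinh x ^ 2 - 1) with (sinh x ^ 2) by ring.
  apply sqrt_pow2. destruct Hx as [Hx|Hx]; [left; apply sinh_pos, Hx|].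
  rewrite <- Hx, sinh_0. lra.
Qed.

Lemma arc_derive_c c u : 0 < c < u ->
  is_derive (fun c => arc c u) c (- y0_a c (arc c u) / slope c (arc c u)).
Proof.
  intros Hc. pose proof (cosh_pos_1 (2 * c)). pose proof (cosh_pos_1 (2 * u)).
  pose proof (arc_pos c u Hc) as Hp. pose proof (sinh_pos (2 * arc c u) ltac:(lra)) as Hs.
  pose proof (cosh_arc c u ltac:(lra)) as E.
  pose proof (sinh_y0_sqr c ltac:(lra) (arc c u)) as E2. rewrite E in E2.
  assert (D : is_derive (fun c => cosh (2 * u) / cosh (2 * c)) c
    (cosh (2 * u) * (- (2 * sinh (2 * c)) / cosh (2 * c) ^ 2))).
  { apply (is_derive_scal (fun c => / cosh (2 * c))).
    apply (is_derive_inv (fun c => cosh (2 * c))); [|lra].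
    apply (is_derive_comp cosh (fun t => 2 * t)); [apply is_derive_cosh|].
    auto_derive; [exact I|ring]. }
  apply is_derive_eq with (/ 2 * ((cosh (2 * u) * (- (2 * sinh (2 * c)) / cosh (2 * c) ^ 2))
    * / sqrt ((cosh (2 * u) / cosh (2 * c)) ^ 2 - 1))).
  - unfold arc. apply (is_derive_scal (fun c => arccosh (cosh (2 * u) / cosh (2 * c)))).
    apply (is_derive_comp arccosh (fun c => cosh (2 * u) / cosh (2 * c))); [|exact D].
    apply is_derive_arccosh, cosh_quotient_gt, Hc.
  - rewrite <- E, sqrt_cosh_sinh by lra. unfold y0_a, slope. rewrite E2.
    pose proof (sinh_y0_pos c ltac:(lra) (arc c u)). pose proof (cosh_pos_1 (y0 c (arc c u))).
    field. lra.
Qed.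

Lemma arc_derive_u c u : 0 < c < u -> is_derive (arc c) u (/ slope c (arc c u)).
Proof.
  intros Hc. pose proof (cosh_pos_1 (2 * c)). pose proof (cosh_pos_1 (2 * u)).
  pose proof (arc_pos c u Hc) as Hp. pose proof (sinh_pos (2 * arc c u) ltac:(lra)) as Hs.
  pose proof (cosh_arc c u ltac:(lra)) as E.
  apply is_derive_eq with (/ 2 * ((2 * sinh (2 * u)) / cosh (2 * c)
    * / sqrt ((cosh (2 * u) / cosh (2 * c)) ^ 2 - 1))).
  - unfold arc. apply (is_derive_scal (fun u => arccosh (cosh (2 * u) / cosh (2 * c)))).
    apply (is_derive_comp arccosh (fun u => cosh (2 * u) / cosh (2 * c))).
    + apply is_derive_arccosh, cosh_quotient_gt, Hc.
    + apply (is_derive_scal_r (fun u => cosh (2 * u))).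
      apply (is_derive_comp cosh (fun t => 2 * t)); [apply is_derive_cosh|].
      auto_derive; [exact I|ring].
  - rewrite <- E, sqrt_cosh_sinh by lra. unfold slope. rewrite y0_arc, (sinh_double u) by lra.
    pose proof (sinh_pos u ltac:(lra)). pose proof (cosh_pos_1 u).
    field. repeat split; lra.
Qed.

(** The height at which the catenary [c] reaches the distance [u]. *)
Definition rise (c u : R) : R := Lambda0 c (arc c u).

(** Moving along the family at fixed distance [u] from the axis, the height varies
    with the sign opposite to that of the Jacobi field [e0]. *)
Lemma rise_derive_c c u : 0 < c < u ->
  is_derive (fun c => rise c u) c (- ratio c (arc c u)).
Proof.
  intros Hc. pose proof (arc_pos c u Hc) as Hp. pose proof (slope_pos c ltac:(lra) _ Hp).
  apply is_derive_eq with (pd2 0 Lambda0 c (arc c u) * 1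
    + pd2 1 Lambda0 c (arc c u) * (- y0_a c (arc c u) / slope c (arc c u))).
  - apply (is_derive_comp2 half_plane Lambda0 (fun c => c) (fun c => arc c u)).
    + apply open_half_plane.
    + apply Lambda0_smooth.
    + unfold half_plane. simpl. lra.
    + apply (is_derive_id (K := R_AbsRing)).
    + apply arc_derive_c, Hc.
  - rewrite ratio_expr by lra.
    change (pd2 1 Lambda0 c (arc c u)) with (Derive (Lambda0 c) (arc c u)).
    rewrite (is_derive_unique _ _ _ (Lambda0_derive c ltac:(lra) (arc c u))).
    unfold Lambda0_a. field. lra.
Qed.

Lemma rise_cont_c c u : 0 < c <= u -> continuity_pt (fun c => rise c u) c.
Proof.
  intros Hc. apply (continuity_2d_pt_fst (fun c _ => rise c u) c 0).
  apply (continuity_2d_pt_comp2 Lambda0 (fun c _ => c) (fun c _ => arc c u)).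
  - apply smooth2_continuity with half_plane; auto using open_half_plane, Lambda0_smooth.
    unfold half_plane. simpl. lra.
  - apply continuity_2d_pt_id1.
  - apply (continuity_1d_2d_pt_comp (fun c => arc c u) (fun c _ => c));
      [apply arc_cont_c, Hc|apply continuity_2d_pt_id1].
Qed.

Lemma rise_derive_u c u : 0 < c < u ->
  is_derive (rise c) u (speed c (arc c u) / slope c (arc c u)).
Proof.
  intros Hc. unfold Rdiv. rewrite Rmult_comm.
  apply (is_derive_comp (Lambda0 c) (arc c)); [apply Lambda0_derive; lra|apply arc_derive_u, Hc].
Qed.

Lemma rise_cont_u c u : 0 < c <= u -> continuity_pt (rise c) u.
Proof.
  intros Hc. apply (continuity_pt_comp (arc c) (Lambda0 c)).
  - apply arc_cont_u, Hc.
  - eapply is_derive_cont, Lambda0_derive. lra.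
Qed.

Lemma on_catenary_rise c u v : 0 < c ->
  (on_curve catenary c (u, v) <-> c <= u /\ (v = rise c u \/ v = - rise c u)).
Proof.
  intros Hc. split.
  - intros [s E]. injection E as E1 E2. subst u v.
    split; [apply y0_ge, Hc|]. unfold rise. rewrite arc_y0 by exact Hc.
    unfold Rabs. destruct Rcase_abs; [right|left]; rewrite ?Lambda0_odd by exact Hc; ring.
  - intros [Hu [-> | ->]].
    + exists (arc c u). unfold catenary. rewrite y0_arc by lra. reflexivity.
    + exists (- arc c u). unfold catenary. rewrite y0_even, y0_arc, Lambda0_odd by lra. reflexivity.
Qed.

Lemma rise_nonneg c u : 0 < c <= u -> 0 <= rise c u.
Proof.
  intros Hc. unfold rise. destruct (arc_nonneg c u Hc) as [H|<-].
  - left. apply Lambda0_pos; [lra|exact H].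
  - rewrite Lambda0_0. lra.
Qed.

Lemma rise_pos c u : 0 < c < u -> 0 < rise c u.
Proof. intros Hc. apply Lambda0_pos; [lra|]. apply arc_pos, Hc. Qed.

Lemma rise_self c : 0 < c -> rise c c = 0.
Proof. intros Hc. unfold rise. rewrite arc_self, Lambda0_0; auto. Qed.

(** By symmetry, a common point in the lower half is also compared through [rise]. *)
Lemma common_point_rise a b u v : 0 < a -> 0 < b ->
  on_curve catenary a (u, v) -> on_curve catenary b (u, v) ->
  a <= u /\ b <= u /\ rise a u = rise b u.
Proof.
  intros Ha Hb H1 H2. apply on_catenary_rise in H1, H2; auto.
  destruct H1 as [A1 A2], H2 as [B1 B2]. split; [exact A1|split; [exact B1|]].
  pose proof (rise_nonneg a u ltac:(lra)). pose proof (rise_nonneg b u ltac:(lra)).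
  destruct A2 as [A2|A2], B2 as [B2|B2]; lra.
Qed.

(** ** The stable family *)

(** At fixed [u] the height decreases with the parameter: the curves do not meet. *)
Lemma stable_rise_decr a b u : 0 < a < b -> b <= u ->
  (forall c, a <= c <= b -> E0 c < 0) -> rise b u < rise a u.
Proof.
  intros Hab Hu HE. apply (derive_neg_decr (fun c => rise c u) (fun c => - ratio c (arc c u))); [lra| | |].
  - intros c Hc. apply rise_derive_c. lra.
  - intros c Hc. pose proof (arc_pos c u ltac:(lra)) as Hp.
    pose proof (e0_pos_stable c ltac:(lra) (HE c ltac:(lra)) (arc c u)) as P.
    pose proof (v0_pos c ltac:(lra) _ Hp).
    assert (0 < ratio c (arc c u)) by (unfold ratio; pos). lra.
  - intros c Hc. apply rise_cont_c. lra.
Qed.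

Lemma stable_disjoint a b p : 0 < a -> 0 < b ->
  (forall c, Rmin a b <= c <= Rmax a b -> E0 c < 0) ->
  on_curve catenary a p -> on_curve catenary b p -> a = b.
Proof.
  intros Ha Hb HE H1 H2. destruct p as [u v].
  destruct (common_point_rise a b u v Ha Hb H1 H2) as [Ua [Ub E]].
  destruct (Rtotal_order a b) as [L|[L|L]]; [exfalso|exact L|exfalso].
  - rewrite Rmin_left, Rmax_right in HE by lra.
    pose proof (stable_rise_decr a b u ltac:(lra) Ub HE). lra.
  - rewrite Rmin_right, Rmax_left in HE by lra.
    pose proof (stable_rise_decr b a u ltac:(lra) Ua HE). lra.
Qed.

(** ** The unstable family *)

(** For each [c] the ratio is eventually negative; being decreasing in [s] and continuous
    in [c], it is so uniformly for [c] in a compact interval. *)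
Lemma ratio_neg_uniform a b : 0 < a <= b -> (forall c, a <= c <= b -> 0 < E0 c) ->
  exists s0, 0 < s0 /\ forall c s, a <= c <= b -> s0 <= s -> ratio c s < 0.
Proof.
  intros Hab HE.
  assert (Hloc : forall c0, a <= c0 <= b -> exists (d : posreal) s0, 0 < s0 /\
    forall c s, 0 < c -> Rabs (c - c0) < d -> s0 <= s -> ratio c s < 0).
  { intros c0 Hc0. destruct (ratio_eventually_neg c0 ltac:(lra) (HE c0 Hc0)) as [s0 [Hs0 Hn]].
    specialize (Hn s0 ltac:(lra)).
    assert (N : e0 c0 s0 < 0).
    { rewrite (e0_ratio c0 ltac:(lra)) by exact Hs0. pose proof (v0_pos c0 ltac:(lra) s0 Hs0). nra. }
    assert (C : continuity_2d_pt e0 c0 s0).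
    { apply smooth2_continuity with half_plane; auto using open_half_plane, e0_smooth.
      unfold half_plane. simpl. lra. }
    destruct (C (mkposreal (- e0 c0 s0) ltac:(lra))) as [d Hd]. simpl in Hd.
    exists d, s0. split; [exact Hs0|]. intros c s Hc Hcd Hs.
    assert (N2 : e0 c s0 < 0).
    { specialize (Hd c s0 Hcd). rewrite Rminus_eq_0, Rabs_R0 in Hd.
      specialize (Hd (cond_pos d)). apply Rabs_lt_between in Hd. lra. }
    assert (R0 : ratio c s0 < 0).
    { pose proof (v0_pos c Hc s0 Hs0). rewrite (e0_ratio c Hc) in N2 by exact Hs0. nra. }
    destruct Hs as [Hs|<-]; [|exact R0]. pose proof (ratio_decr c Hc s0 s Hs0 Hs). lra. }
  destruct (interval_induction (fun x => exists s0, 0 < s0 /\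
    forall c s, a <= c <= x -> s0 <= s -> ratio c s < 0) a b) as [s0 [Hs0 H]].
  - lra.
  - destruct (Hloc a ltac:(lra)) as [d [s0 [Hs0 H]]]. exists s0. split; [exact Hs0|].
    intros c s Hc Hs. apply H; [lra| |exact Hs]. pose proof (cond_pos d).
    replace (c - a) with 0 by lra. rewrite Rabs_R0. lra.
  - intros x Hx. destruct (Hloc x Hx) as [d [s0 [Hs0 H]]]. exists d.
    intros y w Hy Hay [s1 [Hs1 H1]] Hw Hwb. exists (Rmax s0 s1).
    pose proof (Rmax_l s0 s1). pose proof (Rmax_r s0 s1). split; [lra|].
    intros c s Hc Hs. destruct (Rle_lt_dec c y) as [L|L].
    + apply H1; lra.
    + apply H; [lra| |lra]. unfold Rabs. destruct Rcase_abs; lra.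
  - exists s0. split; [exact Hs0|]. exact H.
Qed.

(** By Clairaut's relation, at a given distance from the axis the catenary of larger
    parameter is steeper. *)
Lemma rise_gap_decr a b u1 u2 : 0 < a < b -> b <= u1 < u2 ->
  rise a u2 - rise b u2 < rise a u1 - rise b u1.
Proof.
  intros Hab Hu.
  apply (derive_neg_decr (fun u => rise a u - rise b u) (fun u =>
    speed a (arc a u) / slope a (arc a u) - speed b (arc b u) / slope b (arc b u))); [lra| | |].
  - intros u Hx. apply (is_derive_minus (rise a) (rise b)); apply rise_derive_u; lra.
  - intros u Hx.
    pose proof (slope_pos a ltac:(lra) _ (arc_pos a u ltac:(lra))) as Pa.
    pose proof (slope_pos b ltac:(lra) _ (arc_pos b u ltac:(lra))) as Pb.
    pose proof (profile_arclength a ltac:(lra) (arc a u)) as La.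
    pose proof (profile_arclength b ltac:(lra) (arc b u)) as Lb.
    pose proof (speed_pos a ltac:(lra) (arc a u)) as Qa.
    pose proof (speed_pos b ltac:(lra) (arc b u)) as Qb.
    rewrite y0_arc in La, Lb by lra.
    pose proof (sinh_pos u ltac:(lra)). pose proof (cosh_pos_1 u).
    (* larger neck, larger vertical component of the unit tangent *)
    assert (Q : speed a (arc a u) < speed b (arc b u)).
    { unfold speed. rewrite !y0_arc by lra. apply Rmult_lt_compat_r; [pos|].
      apply sinh_incr. lra. }
    set (qa := speed a (arc a u)) in *. set (qb := speed b (arc b u)) in *.
    set (pa := slope a (arc a u)) in *. set (pb := slope b (arc b u)) in *.
    assert (pb < pa).
    { assert (0 < cosh u ^ 2) by pos.
      assert (qa ^ 2 < qb ^ 2) by nra. assert (cosh u ^ 2 * qa ^ 2 < cosh u ^ 2 * qb ^ 2) by nra.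
      nra. }
    assert (qa / pa < qb / pb); [|lra].
    apply Rmult_lt_reg_r with (pa * pb); [pos|].
    replace (qa / pa * (pa * pb)) with (qa * pb) by (field; lra).
    replace (qb / pb * (pa * pb)) with (qb * pa) by (field; lra). nra.
  - intros u Hx. apply continuity_pt_minus'; apply rise_cont_u; lra.
Qed.

(** The gap [rise a - rise b] is positive at [u = b], where the second curve starts,
    strictly decreasing, and negative far away because [rise] increases with the parameter
    there: it has one zero, and the symmetric point is the other intersection. *)
Lemma two_points_ordered a b : 0 < a < b -> (forall c, a <= c <= b -> 0 < E0 c) ->
  exists p q : R * R, p <> q /\
    forall x, (on_curve catenary a x /\ on_curve catenary b x) <-> (x = p \/ x = q).
Proof.
  intros Hab HE. destruct (ratio_neg_uniform a b ltac:(lra) HE) as [s0 [Hs0 Hn]].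
  set (u2 := y0 b s0).
  assert (Hu2 : b < u2).
  { destruct (y0_ge b ltac:(lra) s0) as [L|L]; [exact L|exfalso].
    pose proof (arc_y0 b s0 ltac:(lra)) as E. fold u2 in L, E.
    rewrite <- L, arc_self, Rabs_right in E by lra. lra. }
  assert (D2 : rise a u2 < rise b u2).
  { apply (derive_pos_incr (fun c => rise c u2) (fun c => - ratio c (arc c u2))); [lra| | |].
    - intros c Hc. apply rise_derive_c. lra.
    - intros c Hc. assert (ratio c (arc c u2) < 0); [|lra]. apply Hn; [lra|].
      apply Rle_trans with (arc b u2); [|apply arc_antitone; lra].
      unfold u2. rewrite arc_y0, Rabs_right by lra. lra.
    - intros c Hc. apply rise_cont_c. lra. }
  pose proof (rise_pos a b ltac:(lra)) as D1. pose proof (rise_self b ltac:(lra)) as D0.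
  destruct (IVT_signed (fun u => rise a u - rise b u) b u2) as [u [Hu E]]; [lra| |nra|].
  { intros x Hx. apply continuity_pt_minus'; apply rise_cont_u; lra. }
  cbv beta in E.
  assert (P : 0 < rise a u) by (apply rise_pos; lra).
  exists (u, rise a u), (u, - rise a u). split.
  - intros C. injection C as C. lra.
  - intros [u' v']. split.
    + intros [H1 H2].
      destruct (common_point_rise a b u' v' ltac:(lra) ltac:(lra) H1 H2) as [A1 [B1 E']].
      assert (u' = u).
      { destruct (Rtotal_order u' u) as [L|[L|L]]; [|exact L|].
        - pose proof (rise_gap_decr a b u' u Hab ltac:(lra)). lra.
        - pose proof (rise_gap_decr a b u u' Hab ltac:(lra)). lra. }
      subst u'. apply on_catenary_rise in H1; [|lra].
      destruct H1 as [_ [-> | ->]]; auto.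
    + intros H. assert (v' = rise a u \/ v' = - rise a u).
      { destruct H as [H|H]; injection H as _ H; auto. }
      assert (u' = u) by (destruct H as [H|H]; injection H as H _; exact H). subst u'.
      rewrite !on_catenary_rise by lra. replace (rise b u) with (rise a u) by lra.
      repeat split; auto; lra.
Qed.

Lemma two_points a b : 0 < a -> 0 < b -> a <> b ->
  (forall c, Rmin a b <= c <= Rmax a b -> 0 < E0 c) ->
  exists p q : R * R, p <> q /\
    forall x, (on_curve catenary a x /\ on_curve catenary b x) <-> (x = p \/ x = q).
Proof.
  intros Ha Hb Hne HE. destruct (Rdichotomy _ _ Hne) as [L|L].
  - rewrite Rmin_left, Rmax_right in HE by lra. apply two_points_ordered; [lra|exact HE].
  - rewrite Rmin_right, Rmax_left in HE by lra.
    destruct (two_points_ordered b a ltac:(lra) HE) as [p [q [Hpq H]]].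
    exists p, q. split; [exact Hpq|]. intros x. rewrite <- H. tauto.
Qed.

(** ** The envelope *)

Lemma lin_dep_iff v w : lin_dep v w <-> fst v * snd w - snd v * fst w = 0.
Proof.
  destruct v as [v1 v2], w as [w1 w2]. simpl. split.
  - intros [al [be [H [E1 E2]]]]. simpl in *.
    assert (Z1 : al * (v1 * w2 - v2 * w1) = 0).
    { replace (al * (v1 * w2 - v2 * w1)) with ((al * v1 + be * w1) * w2 - (al * v2 + be * w2) * w1) by ring.
      rewrite E1, E2. ring. }
    assert (Z2 : be * (v1 * w2 - v2 * w1) = 0).
    { replace (be * (v1 * w2 - v2 * w1)) with (v1 * (al * v2 + be * w2) - v2 * (al * v1 + be * w1)) by ring.
      rewrite E1, E2. ring. }
    destruct H as [H|H]; [apply Rmult_integral in Z1|apply Rmult_integral in Z2]; tauto.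
  - intros E. destruct (Req_dec v1 0) as [H1|H1]; [destruct (Req_dec v2 0) as [H2|H2]|].
    + exists 1, 0. simpl. rewrite H1, H2. repeat split; [left; lra|ring|ring].
    + exists w2, (- v2). simpl. repeat split; [right; lra| |]; lra.
    + exists w1, (- v1). simpl. repeat split; [right; lra| |]; lra.
Qed.

Lemma d_curve_0 a s : 0 < a -> d_curve 0 catenary a s = (y0_a a s, Lambda0_a a s).
Proof.
  intros Ha. unfold d_curve. f_equal. apply is_derive_unique, y0_derive_a, Ha.
Qed.

Lemma d_curve_1 a s : 0 < a -> d_curve 1 catenary a s = (slope a s, speed a s).
Proof.
  intros Ha. unfold d_curve. f_equal; apply is_derive_unique.
  - apply y0_derive, Ha.
  - apply Lambda0_derive, Ha.
Qed.

Lemma characteristic_iff a s : 0 < a -> (characteristic catenary a s <-> e0 a s = 0).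
Proof.
  intros Ha. unfold characteristic. rewrite lin_dep_iff, d_curve_0, d_curve_1 by exact Ha.
  simpl. rewrite (e0_expr a Ha). pose proof (cosh_pos_1 (y0 a s)). split; intros E.
  - replace (speed a s * y0_a a s - Lambda0_a a s * slope a s) with 0 by lra. ring.
  - apply Rmult_integral in E. lra.
Qed.

(** The tangent line determines [speed], hence the constant of Clairaut's relation. *)
Lemma tangent_determines a b s t : 0 < a -> 0 < b -> y0 a s = y0 b t ->
  lin_dep (d_curve 1 catenary a s) (d_curve 1 catenary b t) -> a = b.
Proof.
  intros Ha Hb Ey. rewrite lin_dep_iff, !d_curve_1 by assumption. simpl. intros E.
  pose proof (profile_arclength a Ha s) as La. pose proof (profile_arclength b Hb t) as Lb.
  pose proof (speed_pos a Ha s). pose proof (speed_pos b Hb t).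
  pose proof (speed_clairaut a Ha s) as Ca. pose proof (speed_clairaut b Hb t) as Cb.
  rewrite <- Ey in Lb, Cb.
  assert (Eq : speed a s = speed b t).
  { set (pa := slope a s) in *. set (pb := slope b t) in *.
    set (qa := speed a s) in *. set (qb := speed b t) in *.
    assert (E2 : qa ^ 2 = qb ^ 2).
    { assert (X : pa * qb = qa * pb) by lra.
      transitivity (qa ^ 2 * (pb ^ 2 + cosh (y0 a s) ^ 2 * qb ^ 2)); [rewrite Lb; ring|].
      transitivity (qb ^ 2 * (pa ^ 2 + cosh (y0 a s) ^ 2 * qa ^ 2)); [|rewrite La; ring].
      replace (qa ^ 2 * (pb ^ 2 + cosh (y0 a s) ^ 2 * qb ^ 2)) with
        ((qa * pb) ^ 2 + cosh (y0 a s) ^ 2 * qa ^ 2 * qb ^ 2) by ring.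
      rewrite <- X. ring. }
    nra. }
  rewrite Eq, Cb in Ca.
  assert (I : forall x y, x < y -> sinh (2 * x) < sinh (2 * y)) by (intros; apply sinh_incr; lra).
  destruct (Rtotal_order a b) as [L|[L|L]]; [|exact L|]; apply I in L; lra.
Qed.

Lemma touches_envelope_iff (A : R -> Prop) a z p : (forall c, A c -> 0 < c) -> A a ->
  (forall s, characteristic catenary a s <-> (s = z \/ s = - z)) ->
  (touches_envelope A catenary a p <-> (p = catenary a z \/ p = catenary a (- z))).
Proof.
  intros HA Aa Hz. split.
  - intros [s [Es [b [t [Ab [Hc [Et Hl]]]]]]].
    assert (E : catenary a s = catenary b t) by congruence. injection E as E1 E2.
    assert (a = b) by (apply (tangent_determines a b s t); auto). subst b.
    rewrite <- Et. apply Hz in Hc. destruct Hc as [-> | ->]; auto.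
  - intros H. assert (exists s, (s = z \/ s = - z) /\ p = catenary a s) as [s [Hs ->]].
    { destruct H as [-> | ->]; eauto. }
    exists s. split; [reflexivity|]. exists a, s. split; [exact Aa|].
    split; [apply Hz, Hs|split; [reflexivity|]].
    rewrite lin_dep_iff. ring.
Qed.

(** * The local foliation *)

(** [Lambda0 c] is invertible; its inverse is smooth in both variables. *)

Definition reached (p : R * R) : Prop := 0 < snd p /\ exists s, Lambda0 (snd p) s = fst p.
Definition arc_of_height (v c : R) : R := epsilon (inhabits 0) (fun s => Lambda0 c s = v).

Lemma arc_of_height_spec v c : reached (v, c) -> Lambda0 c (arc_of_height v c) = v.
Proof. intros [_ H]. apply (epsilon_spec (inhabits 0) (fun s => Lambda0 c s = v)), H. Qed.

Lemma arc_of_height_Lambda0 c s : 0 < c -> arc_of_height (Lambda0 c s) c = s.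
Proof.
  intros Hc. apply (Lambda0_inj c Hc). apply arc_of_height_spec.
  split; [exact Hc|]. exists s. reflexivity.
Qed.

Lemma Lambda0_cont_a c s : 0 < c -> continuity_pt (fun c => Lambda0 c s) c.
Proof.
  intros Hc. apply (continuity_2d_pt_fst Lambda0).
  apply smooth2_continuity with half_plane; auto using open_half_plane, Lambda0_smooth.
Qed.

Lemma continuity_pt_locally (g : R -> R) x eps : continuity_pt g x -> 0 < eps ->
  exists d : posreal, forall y, Rabs (y - x) < d -> Rabs (g y - g x) < eps.
Proof.
  intros Hg He. destruct (proj1 (filterlim_locally _ _) (proj1 (continuity_pt_filterlim _ _) Hg)
    (mkposreal eps He)) as [d Hd].
  exists d. intros y Hy. apply (Hd y), Hy.
Qed.

Lemma reached_open : open reached.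
Proof.
  apply locally_2d_open. intros v c [Hc [s Hs]]. simpl in Hc, Hs.
  pose proof (Lambda0_incr c Hc (s - 1) s ltac:(lra)).
  pose proof (Lambda0_incr c Hc s (s + 1) ltac:(lra)).
  set (e := Rmin (v - Lambda0 c (s - 1)) (Lambda0 c (s + 1) - v) / 2).
  pose proof (Rmin_l (v - Lambda0 c (s - 1)) (Lambda0 c (s + 1) - v)).
  pose proof (Rmin_r (v - Lambda0 c (s - 1)) (Lambda0 c (s + 1) - v)).
  assert (He : 0 < e) by (unfold e; apply Rdiv_lt_0_compat; [apply Rmin_pos|]; lra).
  destruct (continuity_pt_locally _ _ e (Lambda0_cont_a c (s - 1) Hc) He) as [d1 Hd1].
  destruct (continuity_pt_locally _ _ e (Lambda0_cont_a c (s + 1) Hc) He) as [d2 Hd2].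
  assert (Hd : 0 < Rmin (Rmin d1 d2) (Rmin e (c / 2))).
  { repeat apply Rmin_pos; try apply cond_pos; lra. }
  exists (mkposreal _ Hd). simpl. intros v' c' Hv Hc'.
  pose proof (Rmin_l (Rmin d1 d2) (Rmin e (c / 2))). pose proof (Rmin_r (Rmin d1 d2) (Rmin e (c / 2))).
  pose proof (Rmin_l d1 d2). pose proof (Rmin_r d1 d2).
  pose proof (Rmin_l e (c / 2)). pose proof (Rmin_r e (c / 2)).
  specialize (Hd1 c' ltac:(lra)). specialize (Hd2 c' ltac:(lra)).
  assert (Hc2 : Rabs (c' - c) < c / 2) by lra. assert (Hv2 : Rabs (v' - v) < e) by lra.
  apply Rabs_lt_between in Hd1, Hd2, Hc2, Hv2.
  unfold reached. simpl. assert (Hc0 : 0 < c') by lra. split; [exact Hc0|].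
  destruct (IVT_signed (fun s => Lambda0 c' s - v') (s - 1) (s + 1)) as [x [_ E]].
  - lra.
  - intros x _. apply continuity_pt_minus'; [|apply continuity_pt_cst'].
    eapply is_derive_cont, Lambda0_derive, Hc0.
  - unfold e in *. nra.
  - exists x. cbv beta in E. lra.
Qed.

Definition swapped_half_plane (p : R * R) : Prop := 0 < snd p.

Lemma open_swapped_half_plane : open swapped_half_plane.
Proof.
  apply locally_2d_open. intros x y Hy. unfold swapped_half_plane in *. simpl in *.
  exists (mkposreal y Hy). simpl. intros u v _ Hv. apply Rabs_lt_between in Hv. lra.
Qed.

Lemma Lambda0_swap_smooth : smooth2 swapped_half_plane (fun s c => Lambda0 c s).
Proof.
  intros n. pose proof open_swapped_half_plane as HO.
  apply (Cn2_comp2 n swapped_half_plane half_plane Lambda0 (fun _ c => c) (fun s _ => s));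
    auto using open_half_plane, Cn2_fst, Cn2_snd. apply Lambda0_smooth.
Qed.

Lemma Lambda0_swap_pos s c : 0 < c -> 0 < pd2 0 (fun s c => Lambda0 c s) s c.
Proof.
  intros Hc. change (0 < Derive (Lambda0 c) s).
  rewrite (is_derive_unique _ _ _ (Lambda0_derive c Hc s)). apply speed_pos, Hc.
Qed.

Lemma arc_of_height_smooth : smooth2 reached arc_of_height.
Proof.
  apply (implicit_smooth swapped_half_plane reached (fun s c => Lambda0 c s) arc_of_height).
  - apply open_swapped_half_plane.
  - apply reached_open.
  - apply Lambda0_swap_smooth.
  - intros x y Hy. apply Lambda0_swap_pos, Hy.
  - intros x1 x2 x y H _ _. exact H.
  - intros u v H. split; [apply H|apply arc_of_height_spec, H].
Qed.

Lemma arc_of_height_derive_c v c : reached (v, c) ->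
  is_derive (fun c => arc_of_height v c) c
    (- Lambda0_a c (arc_of_height v c) / speed c (arc_of_height v c)).
Proof.
  intros H. assert (Hc : 0 < c) by apply H.
  pose proof (speed_pos c Hc (arc_of_height v c)).
  pose proof (implicit_derive_along swapped_half_plane reached (fun s c => Lambda0 c s) arc_of_height
    open_swapped_half_plane reached_open Lambda0_swap_smooth (fun x y Hy => Lambda0_swap_pos x y Hy)
    (fun x1 x2 x y H1 _ _ => H1) (fun u w Hu => conj (proj1 Hu) (arc_of_height_spec u w Hu))
    (fun _ => v) (fun c => c) c 0 1) as D.
  eapply is_derive_eq.
  - apply D; [apply (is_derive_const (K := R_AbsRing) (V := R_NormedModule))
             |apply (is_derive_id (K := R_AbsRing))|exact H].
  - change (pd2 1 (fun s c0 => Lambda0 c0 s) (arc_of_height v c) c)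
      with (Lambda0_a c (arc_of_height v c)).
    change (pd2 0 (fun s c0 => Lambda0 c0 s) (arc_of_height v c) c)
      with (Derive (Lambda0 c) (arc_of_height v c)).
    rewrite (is_derive_unique _ _ _ (Lambda0_derive c Hc (arc_of_height v c))).
    field. lra.
Qed.

(** The distance to the axis of the catenary [c] at height [v]. *)
Definition dist_at (c v : R) : R := y0 c (arc_of_height v c).

(** At a fixed height the leaves move away from the axis as [c] grows, where [e0] is
    positive. *)
Lemma dist_at_derive_c c v : reached (v, c) ->
  is_derive (fun c => dist_at c v) c
    (e0 c (arc_of_height v c) / (cosh (dist_at c v) * speed c (arc_of_height v c))).
Proof.
  intros H. assert (Hc : 0 < c) by apply H. set (s := arc_of_height v c).
  pose proof (speed_pos c Hc s). pose proof (cosh_pos_1 (y0 c s)).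
  apply is_derive_eq with (pd2 0 y0 c s * 1 + pd2 1 y0 c s * (- Lambda0_a c s / speed c s)).
  - apply (is_derive_comp2 half_plane y0 (fun c => c) (fun c => arc_of_height v c)).
    + apply open_half_plane.
    + apply y0_smooth.
    + exact Hc.
    + apply (is_derive_id (K := R_AbsRing)).
    + apply arc_of_height_derive_c, H.
  - change (pd2 1 y0 c s) with (Derive (y0 c) s).
    change (pd2 0 y0 c s) with (Derive (fun b => y0 b s) c).
    rewrite (is_derive_unique (fun b : R => y0 b s) c _ (y0_derive_a c Hc s)).
    rewrite (is_derive_unique _ _ _ (y0_derive c Hc s)).
    unfold dist_at. fold s. rewrite (e0_expr c Hc). field. lra.
Qed.

Section Chart.

Variable A : R -> Prop.
Hypothesis A_pos : forall c, A c -> 0 < c.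
Hypothesis A_stable : forall c, A c -> E0 c < 0.
Hypothesis A_conv : forall x y c, A x -> A y -> x <= c <= y -> A c.

Lemma leaves_disjoint a b p : A a -> A b ->
  on_curve catenary a p -> on_curve catenary b p -> a = b.
Proof.
  intros Aa Ab. apply stable_disjoint; auto. intros c Hc. apply A_stable.
  destruct (Rle_dec a b).
  - rewrite Rmin_left, Rmax_right in Hc by lra. apply A_conv with a b; auto.
  - rewrite Rmin_right, Rmax_left in Hc by lra. apply A_conv with b a; auto.
Qed.

Variables (a0 s0 d : R).
Hypothesis Aa0 : A a0.
Hypothesis Hd : 0 < d.

Definition box (r : R) (p : R * R) : Prop := Rabs (fst p - a0) < r /\ Rabs (snd p - Lambda0 a0 s0) < r.

Hypothesis Hbox : forall p, box (2 * d) p -> A (fst p) /\ reached (snd p, fst p).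

Lemma box_open r : open (box r).
Proof.
  apply locally_2d_open. intros x y [Hx Hy]. simpl in Hx, Hy.
  assert (H : 0 < Rmin (r - Rabs (x - a0)) (r - Rabs (y - Lambda0 a0 s0))) by (apply Rmin_pos; lra).
  exists (mkposreal _ H). simpl. intros u v Hu Hv.
  pose proof (Rmin_l (r - Rabs (x - a0)) (r - Rabs (y - Lambda0 a0 s0))).
  pose proof (Rmin_r (r - Rabs (x - a0)) (r - Rabs (y - Lambda0 a0 s0))).
  pose proof (Rabs_triang (u - x) (x - a0)). pose proof (Rabs_triang (v - y) (y - Lambda0 a0 s0)).
  replace (u - x + (x - a0)) with (u - a0) in H2 by ring.
  replace (v - y + (y - Lambda0 a0 s0)) with (v - Lambda0 a0 s0) in H3 by ring.
  split; simpl; lra.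
Qed.

Lemma dist_at_smooth : smooth2 (box (2 * d)) dist_at.
Proof.
  intros n. pose proof (box_open (2 * d)) as HO. unfold dist_at.
  apply (Cn2_comp2 n (box (2 * d)) half_plane y0 (fun c _ => c) (fun c v => arc_of_height v c));
    auto using open_half_plane, Cn2_fst.
  - intros x y Hxy. apply A_pos. apply (Hbox _ Hxy).
  - apply y0_smooth.
  - apply (Cn2_comp2 n (box (2 * d)) reached arc_of_height (fun _ v => v) (fun c _ => c));
      auto using reached_open, Cn2_fst, Cn2_snd.
    + intros x y Hxy. apply (Hbox _ Hxy).
    + apply arc_of_height_smooth.
Qed.

Lemma dist_at_pos_derive x y : box (2 * d) (x, y) -> 0 < pd2 0 dist_at x y.
Proof.
  intros Hxy. destruct (Hbox _ Hxy) as [HA HR]. simpl in HA, HR.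
  unfold pd2. rewrite (is_derive_unique (fun t : R => dist_at t y) x _ (dist_at_derive_c x y HR)).
  pose proof (e0_pos_stable x (A_pos x HA) (A_stable x HA) (arc_of_height y x)).
  pose proof (cosh_pos_1 (dist_at x y)). pose proof (speed_pos x (A_pos x HA) (arc_of_height y x)).
  pos.
Qed.

Lemma box_convex x1 x2 x y : box (2 * d) (x1, y) -> box (2 * d) (x2, y) -> x1 <= x <= x2 ->
  box (2 * d) (x, y).
Proof.
  intros [H1 Hy] [H2 _] Hx. simpl in *. apply Rabs_lt_between in H1, H2.
  split; simpl; [|exact Hy]. apply Rabs_lt_between. lra.
Qed.

Lemma dist_at_incr x1 x2 y : box (2 * d) (x1, y) -> box (2 * d) (x2, y) -> x1 < x2 ->
  dist_at x1 y < dist_at x2 y.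
Proof.
  apply (implicit_incr (box (2 * d)) dist_at (box_open _) dist_at_smooth dist_at_pos_derive box_convex).
Qed.

(** The chart: the point [(u, v)] has coordinates [v] and the parameter of the leaf through it,
    rescaled to the unit box. *)
Definition chart_dom (p : R * R) : Prop :=
  Rabs (snd p - Lambda0 a0 s0) < d /\
  dist_at (a0 - d) (snd p) < fst p < dist_at (a0 + d) (snd p).

Definition leaf_at (u v : R) : R :=
  epsilon (inhabits 0) (fun c => a0 - d < c < a0 + d /\ dist_at c v = u).

Lemma in_box c v : Rabs (c - a0) <= d -> Rabs (v - Lambda0 a0 s0) < d -> box (2 * d) (c, v).
Proof. intros H1 H2. split; simpl; lra. Qed.

Lemma edge_in_box v : Rabs (v - Lambda0 a0 s0) < d ->
  box (2 * d) (a0 - d, v) /\ box (2 * d) (a0 + d, v).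
Proof.
  intros Hv. split; apply in_box; auto.
  - replace (a0 - d - a0) with (- d) by ring. rewrite Rabs_Ropp, Rabs_right; lra.
  - replace (a0 + d - a0) with d by ring. rewrite Rabs_right; lra.
Qed.

Lemma leaf_at_spec u v : chart_dom (u, v) ->
  a0 - d < leaf_at u v < a0 + d /\ dist_at (leaf_at u v) v = u.
Proof.
  intros [Hv Hu]. simpl in Hv, Hu.
  apply (epsilon_spec (inhabits 0) (fun c => a0 - d < c < a0 + d /\ dist_at c v = u)).
  destruct (edge_in_box v Hv) as [B1 B2].
  destruct (IVT_signed (fun c => dist_at c v - u) (a0 - d) (a0 + d)) as [c [Hc E]]; [lra| |nra|].
  - intros c Hc. apply continuity_pt_minus'; [|apply continuity_pt_cst'].
    apply (continuity_2d_pt_fst dist_at).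
    apply smooth2_continuity with (box (2 * d)); auto using box_open, dist_at_smooth.
    apply in_box; [|exact Hv]. apply Rabs_le_between. lra.
  - cbv beta in E. exists c. split; [|lra].
    destruct Hc as [[H1|H1] [H2|H2]]; subst; lra.
Qed.

Lemma leaf_box u v : chart_dom (u, v) -> box (2 * d) (leaf_at u v, v).
Proof.
  intros H. destruct (leaf_at_spec u v H) as [Hl _]. apply in_box; [|apply H].
  apply Rabs_le_between. lra.
Qed.

Lemma chart_dom_open : open chart_dom.
Proof.
  apply locally_2d_open. intros u v [Hv Hu]. simpl in Hv, Hu.
  destruct (edge_in_box v Hv) as [B1 B2].
  assert (C : forall c, box (2 * d) (c, v) -> continuity_pt (dist_at c) v).
  { intros c Bc. apply continuity_2d_pt_snd, smooth2_continuity with (box (2 * d));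
      auto using box_open, dist_at_smooth. }
  set (e := Rmin (u - dist_at (a0 - d) v) (dist_at (a0 + d) v - u) / 2).
  pose proof (Rmin_l (u - dist_at (a0 - d) v) (dist_at (a0 + d) v - u)).
  pose proof (Rmin_r (u - dist_at (a0 - d) v) (dist_at (a0 + d) v - u)).
  assert (He : 0 < e) by (unfold e; apply Rdiv_lt_0_compat; [apply Rmin_pos|]; lra).
  destruct (continuity_pt_locally _ _ e (C _ B1) He) as [d1 Hd1].
  destruct (continuity_pt_locally _ _ e (C _ B2) He) as [d2 Hd2].
  set (r := d - Rabs (v - Lambda0 a0 s0)).
  assert (Hr : 0 < Rmin (Rmin d1 d2) (Rmin e r)).
  { repeat apply Rmin_pos; try apply cond_pos; unfold r; lra. }
  exists (mkposreal _ Hr). simpl. intros u' v' Hu' Hv'.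
  pose proof (Rmin_l (Rmin d1 d2) (Rmin e r)). pose proof (Rmin_r (Rmin d1 d2) (Rmin e r)).
  pose proof (Rmin_l d1 d2). pose proof (Rmin_r d1 d2).
  pose proof (Rmin_l e r). pose proof (Rmin_r e r).
  specialize (Hd1 v' ltac:(lra)). specialize (Hd2 v' ltac:(lra)).
  assert (Hu2 : Rabs (u' - u) < e) by lra.
  pose proof (Rabs_triang (v' - v) (v - Lambda0 a0 s0)) as T.
  replace (v' - v + (v - Lambda0 a0 s0)) with (v' - Lambda0 a0 s0) in T by ring.
  apply Rabs_lt_between in Hd1, Hd2, Hu2.
  split; simpl; unfold e, r in *; lra.
Qed.

Lemma leaf_at_smooth : smooth2 chart_dom leaf_at.
Proof.
  apply (implicit_smooth (box (2 * d)) chart_dom dist_at leaf_at).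
  - apply box_open.
  - apply chart_dom_open.
  - apply dist_at_smooth.
  - apply dist_at_pos_derive.
  - apply box_convex.
  - intros u v H. split; [apply leaf_box, H|apply leaf_at_spec, H].
Qed.

Lemma leaf_at_dist c v : Rabs (c - a0) < d -> Rabs (v - Lambda0 a0 s0) < d ->
  chart_dom (dist_at c v, v) /\ leaf_at (dist_at c v) v = c.
Proof.
  intros Hc Hv. destruct (edge_in_box v Hv) as [B1 B2].
  assert (Bc : box (2 * d) (c, v)) by (apply in_box; lra).
  pose proof Hc as Hc'. apply Rabs_lt_between in Hc'.
  assert (Hdom : chart_dom (dist_at c v, v)).
  { split; simpl; [exact Hv|]. split; apply dist_at_incr; auto; lra. }
  split; [exact Hdom|].
  destruct (leaf_at_spec _ _ Hdom) as [Hl El]. pose proof (leaf_box _ _ Hdom) as Bl.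
  destruct (Rtotal_order (leaf_at (dist_at c v) v) c) as [L|[L|L]]; [|exact L|].
  - pose proof (dist_at_incr _ _ _ Bl Bc L). lra.
  - pose proof (dist_at_incr _ _ _ Bc Bl L). lra.
Qed.

(** A leaf meets the chart in the single plaque of its own parameter. *)
Lemma chart_leaf a u v : A a -> chart_dom (u, v) ->
  (on_curve catenary a (u, v) <-> leaf_at u v = a).
Proof.
  intros Aa H. destruct (leaf_at_spec u v H) as [Hl El]. pose proof (leaf_box u v H) as Bl.
  destruct (Hbox _ Bl) as [Al Rl]. simpl in Al, Rl.
  assert (Hon : on_curve catenary (leaf_at u v) (u, v)).
  { exists (arc_of_height v (leaf_at u v)). unfold catenary.
    rewrite arc_of_height_spec by exact Rl. unfold dist_at in El. rewrite El. reflexivity. }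
  split.
  - intros Ha. apply (leaves_disjoint _ _ (u, v)); assumption.
  - intros <-. exact Hon.
Qed.

Lemma chart_exists : exists (U : R * R -> Prop) (x y X Y : R -> R -> R),
  plane_chart U x y X Y /\ U (catenary a0 s0) /\
  (forall q, U q -> exists a, A a /\ on_curve catenary a q) /\
  forall a, A a -> exists T : R -> Prop,
    (forall q1 q2, U (q1, q2) -> (on_curve catenary a (q1, q2) <-> T (y q1 q2))) /\
    (forall t1 t2, t1 < t2 -> exists t, t1 < t < t2 /\ ~ T t).
Proof.
  exists chart_dom, (fun _ v => (v - Lambda0 a0 s0) / d), (fun u v => (leaf_at u v - a0) / d),
    (fun s t => dist_at (a0 + d * t) (Lambda0 a0 s0 + d * s)), (fun s _ => Lambda0 a0 s0 + d * s).
  assert (HOb : open unit_box).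
  { apply locally_2d_open. intros x y [Hx Hy]. simpl in Hx, Hy.
    set (r := Rmin (Rmin (x + 1) (1 - x)) (Rmin (y + 1) (1 - y))).
    assert (Hr : 0 < r) by (unfold r; repeat apply Rmin_pos; lra).
    assert (r <= x + 1 /\ r <= 1 - x /\ r <= y + 1 /\ r <= 1 - y).
    { unfold r, Rmin. repeat destruct Rle_dec; lra. }
    exists (mkposreal r Hr). simpl. intros u v Hu Hv. apply Rabs_lt_between in Hu, Hv.
    split; simpl; lra. }
  pose proof chart_dom_open as HOc.
  assert (Cc : forall n k U, open U -> Cn2 n U (fun _ _ => k)) by (intros; apply Cn2_const; auto).
  assert (Hsc : forall t, -1 < t < 1 -> Rabs (d * t) < d).
  { intros t Ht. rewrite Rabs_mult, (Rabs_right d) by lra.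
    assert (Rabs t < 1) by (apply Rabs_def1; lra). nra. }
  assert (Hdiv : forall x, Rabs x < d -> -1 < x / d < 1).
  { intros x Hx. apply Rabs_lt_between in Hx.
    split; apply Rmult_lt_reg_r with d; auto; unfold Rdiv; rewrite Rmult_assoc, Rinv_l; lra. }
  split; [|split; [|split]].
  - split; [exact HOc|]. repeat split.
    + intros n. apply Cn2_div; auto; [intros; lra|].
      apply Cn2_minus; auto using Cn2_snd.
    + intros n. apply Cn2_div; auto; [intros; lra|].
      apply Cn2_minus; auto. apply leaf_at_smooth.
    + intros n. apply (Cn2_comp2 n unit_box (box (2 * d)) dist_at (fun _ t => a0 + d * t)
        (fun s _ => Lambda0 a0 s0 + d * s)); auto using box_open.
      * intros s t [H1 H2]. simpl in H1, H2. apply in_box.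
        -- replace (a0 + d * t - a0) with (d * t) by ring. specialize (Hsc t H2). lra.
        -- replace (Lambda0 a0 s0 + d * s - Lambda0 a0 s0) with (d * s) by ring. auto.
      * apply dist_at_smooth.
      * apply Cn2_plus; auto. apply Cn2_mult; auto using Cn2_snd.
      * apply Cn2_plus; auto. apply Cn2_mult; auto using Cn2_fst.
    + intros n. apply Cn2_plus; auto. apply Cn2_mult; auto using Cn2_fst.
    + simpl. apply Hdiv. apply H.
    + simpl. apply Hdiv. apply H.
    + simpl. apply Hdiv. destruct (leaf_at_spec _ _ H). apply Rabs_def1; lra.
    + simpl. apply Hdiv. destruct (leaf_at_spec _ _ H). apply Rabs_def1; lra.
    + destruct (leaf_at_spec _ _ H) as [_ E].
      replace (a0 + d * ((leaf_at p q - a0) / d)) with (leaf_at p q) by (field; lra).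
      replace (Lambda0 a0 s0 + d * ((q - Lambda0 a0 s0) / d)) with q by (field; lra). exact E.
    + field. lra.
    + destruct H as [H1 H2]. simpl in H1, H2.
      apply (leaf_at_dist (a0 + d * t) (Lambda0 a0 s0 + d * s)).
      * replace (a0 + d * t - a0) with (d * t) by ring. auto.
      * replace (Lambda0 a0 s0 + d * s - Lambda0 a0 s0) with (d * s) by ring. auto.
    + destruct H as [H1 H2]. simpl in H1, H2.
      apply (leaf_at_dist (a0 + d * t) (Lambda0 a0 s0 + d * s)).
      * replace (a0 + d * t - a0) with (d * t) by ring. auto.
      * replace (Lambda0 a0 s0 + d * s - Lambda0 a0 s0) with (d * s) by ring. auto.
    + destruct H as [H1 H2]. simpl in H1, H2.
      apply (leaf_at_dist (a0 + d * t) (Lambda0 a0 s0 + d * s)).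
      * replace (a0 + d * t - a0) with (d * t) by ring. auto.
      * replace (Lambda0 a0 s0 + d * s - Lambda0 a0 s0) with (d * s) by ring. auto.
    + field. lra.
    + destruct H as [H1 H2]. simpl in H1, H2.
      destruct (leaf_at_dist (a0 + d * t) (Lambda0 a0 s0 + d * s)) as [_ ->].
      * replace (a0 + d * t - a0) with (d * t) by ring. auto.
      * replace (Lambda0 a0 s0 + d * s - Lambda0 a0 s0) with (d * s) by ring. auto.
      * field. lra.
  - assert (E : catenary a0 s0 = (dist_at a0 (Lambda0 a0 s0), Lambda0 a0 s0)).
    { unfold catenary, dist_at. rewrite arc_of_height_Lambda0 by auto. reflexivity. }
    rewrite E. apply leaf_at_dist; rewrite Rminus_eq_0, Rabs_R0; exact Hd.
  - intros [u v] H. exists (leaf_at u v). destruct (Hbox _ (leaf_box u v H)) as [Al _].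
    split; [exact Al|]. apply chart_leaf; auto.
  - intros a Aa. exists (fun t => t = (a - a0) / d). split.
    + intros u v H. rewrite (chart_leaf a u v Aa H). split.
      * intros ->. reflexivity.
      * intros E. assert (leaf_at u v - a0 = a - a0); [|lra].
        apply Rmult_eq_reg_r with (/ d); [exact E|]. apply Rinv_neq_0_compat. lra.
    + intros t1 t2 Ht.
      destruct (Req_dec ((t1 + t2) / 2) ((a - a0) / d)) as [E|E].
      * exists ((t1 + (t1 + t2) / 2) / 2). split; lra.
      * exists ((t1 + t2) / 2). split; [lra|exact E].
Qed.

End Chart.

Lemma catenaries_locally_foliate (A : R -> Prop) :
  (forall c, A c -> 0 < c) -> (forall c, A c -> E0 c < 0) ->
  (forall c, A c -> exists d : posreal, forall x, Rabs (x - c) < d -> A x) ->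
  (forall x y c, A x -> A y -> x <= c <= y -> A c) ->
  locally_foliate A catenary.
Proof.
  intros A_pos A_stable A_open A_conv.
  exists (fun p => exists a, A a /\ on_curve catenary a p).
  assert (Hchart : forall p, (exists a, A a /\ on_curve catenary a p) ->
     exists (U : R * R -> Prop) (x y X Y : R -> R -> R),
       plane_chart U x y X Y /\ U p /\
       (forall q, U q -> exists a, A a /\ on_curve catenary a q) /\
       forall a, A a -> exists T : R -> Prop,
           (forall q1 q2, U (q1, q2) -> (on_curve catenary a (q1, q2) <-> T (y q1 q2))) /\
           (forall t1 t2, t1 < t2 -> exists t, t1 < t < t2 /\ ~ T t)).
  { intros p [a0 [Aa0 [s0 <-]]].
    assert (R0 : reached (Lambda0 a0 s0, a0)) by (split; [apply A_pos, Aa0|exists s0; reflexivity]).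
    destruct (open_locally_2d _ _ _ reached_open R0) as [d1 Hd1].
    destruct (A_open a0 Aa0) as [d2 Hd2].
    set (d := Rmin d1 d2 / 2).
    assert (Hd : 0 < d) by (apply Rdiv_lt_0_compat; [apply Rmin_pos; apply cond_pos|lra]).
    pose proof (Rmin_l d1 d2). pose proof (Rmin_r d1 d2).
    assert (E : 2 * d = Rmin d1 d2) by (unfold d; field).
    apply (chart_exists A A_pos A_stable A_conv a0 s0 d Aa0 Hd).
    intros [c v] [Hc Hv]. simpl in *. split; [apply Hd2; lra|apply Hd1; lra]. }
  split; [|split; [|split; [|split]]].
  - intros p Hp. destruct (Hchart p Hp) as [U [x [y [X [Y [HU [Up [HUW _]]]]]]]].
    destruct HU as [HO _]. apply filter_imp with (2 := HO p Up). exact HUW.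
  - intros a s Aa. 
    assert (C1 : continuity_pt (y0 a) s) by (eapply is_derive_cont, y0_derive, A_pos, Aa).
    assert (C2 : continuity_pt (Lambda0 a) s) by (eapply is_derive_cont, Lambda0_derive, A_pos, Aa).
    intros P [eps HP].
    destruct (continuity_pt_locally _ _ eps C1 (cond_pos eps)) as [d1 H1].
    destruct (continuity_pt_locally _ _ eps C2 (cond_pos eps)) as [d2 H2].
    assert (Hd : 0 < Rmin d1 d2) by (apply Rmin_pos; apply cond_pos).
    exists (mkposreal _ Hd). simpl. intros t Ht. change (Rabs (t - s) < Rmin d1 d2) in Ht.
    pose proof (Rmin_l d1 d2). pose proof (Rmin_r d1 d2).
    apply HP. split; [apply H1|apply H2]; lra.
  - intros p. tauto.
  - intros a b p Aa Ab. apply (leaves_disjoint A A_pos A_stable A_conv); assumption.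
  - exact Hchart.
Qed.

(** * Intervals of parameters *)

Section Intervals.

Variables l r : Rbar.
Hypothesis Hl : Rbar_le 0 l.

Lemma interval_pos c : Rbar_open_interval l r c -> 0 < c.
Proof. intros [H _]. exact (Rbar_le_lt_trans _ _ _ Hl H). Qed.

Lemma interval_open c : Rbar_open_interval l r c ->
  exists d : posreal, forall x, Rabs (x - c) < d -> Rbar_open_interval l r x.
Proof.
  intros [H1 H2].
  destruct (open_Rbar_gt l c H1) as [d1 Hd1]. destruct (open_Rbar_lt r c H2) as [d2 Hd2].
  assert (Hd : 0 < Rmin d1 d2) by (apply Rmin_pos; apply cond_pos).
  exists (mkposreal _ Hd). simpl. intros x Hx.
  pose proof (Rmin_l d1 d2). pose proof (Rmin_r d1 d2).
  split; [apply Hd1|apply Hd2]; [change (Rabs (x - c) < d1)|change (Rabs (x - c) < d2)]; lra.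
Qed.

Lemma interval_convex x y c : Rbar_open_interval l r x -> Rbar_open_interval l r y ->
  x <= c <= y -> Rbar_open_interval l r c.
Proof.
  intros [H1 _] [_ H2] Hc. split.
  - apply Rbar_lt_le_trans with (1 := H1). exact (proj1 Hc).
  - apply Rbar_le_lt_trans with (2 := H2). exact (proj2 Hc).
Qed.

Lemma interval_nonempty : Rbar_lt l r -> exists c, Rbar_open_interval l r c.
Proof.
  intros H. destruct l as [x| |]; try contradiction.
  - destruct r as [y| |]; try contradiction.
    + exists ((x + y) / 2). simpl in H. split; simpl; lra.
    + exists (x + 1). split; simpl; [lra|exact I].
Qed.

End Intervals.

Theorem proposition7p8 :
  (forall l r : Rbar, Rbar_le 0 l -> Rbar_lt l r ->
     (forall a, Rbar_open_interval l r a -> E0 a < 0) ->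
     (forall a, Rbar_open_interval l r a ->
        stable (catenoid a) (surface (catenoid a))) /\
     locally_foliate (Rbar_open_interval l r) catenary)
  /\
  (forall l r : Rbar, Rbar_le 0 l -> Rbar_lt l r ->
     (forall a, Rbar_open_interval l r a -> 0 < E0 a) ->
     (forall a, Rbar_open_interval l r a ->
        has_index (catenoid a) (surface (catenoid a)) 1) /\
     (forall a b, Rbar_open_interval l r a -> Rbar_open_interval l r b -> a <> b ->
        exists p q : R * R, p <> q /\
          forall x, (on_curve catenary a x /\ on_curve catenary b x) <->
                    (x = p \/ x = q)) /\
     (exists p, envelope (Rbar_open_interval l r) catenary p) /\
     (forall a, Rbar_open_interval l r a ->
        exists z : R,
          unique (fun s => 0 < s /\ e0 a s = 0) z /\
          maximal_weakly_stable (catenoid a) (catenoid_domain a z) /\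
          (forall s, characteristic catenary a s <-> (s = z \/ s = - z)) /\
          (forall p, touches_envelope (Rbar_open_interval l r) catenary a p <->
                     (p = catenary a z \/ p = catenary a (- z))) /\
          (forall p, boundary_in_surface (catenoid a) (catenoid_domain a z) p <->
                     exists s theta, (s = z \/ s = - z) /\ catenoid a s theta = p))).
Proof.
  split.
  - intros l r Hl Hlr HE. split.
    + intros a Aa. apply catenoid_stable; [apply (interval_pos l r Hl), Aa|apply HE, Aa].
    + apply catenaries_locally_foliate.
      * apply (interval_pos l r Hl).
      * exact HE.
      * apply interval_open.
      * apply interval_convex.
  - intros l r Hl Hlr HE. split; [|split; [|split]].
    + intros a Aa. pose proof (interval_pos l r Hl a Aa) as Ha.
      destruct (e0_zero a Ha (HE a Aa)) as [z [Hz [E [Hin _]]]].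
      apply (catenoid_index_one a Ha z); assumption.
    + intros a b Aa Ab Hab. apply two_points; [apply (interval_pos l r Hl), Aa
        |apply (interval_pos l r Hl), Ab|exact Hab|].
      intros c Hc. apply HE. destruct (Rle_dec a b).
      * rewrite Rmin_left, Rmax_right in Hc by lra. apply interval_convex with a b; assumption.
      * rewrite Rmin_right, Rmax_left in Hc by lra. apply interval_convex with b a; assumption.
    + destruct (interval_nonempty l r Hl Hlr) as [a Aa].
      pose proof (interval_pos l r Hl a Aa) as Ha.
      destruct (e0_zero a Ha (HE a Aa)) as [z [Hz [E _]]].
      exists (catenary a z), a, z. split; [exact Aa|split; [|reflexivity]].
      apply characteristic_iff; assumption.
    + intros a Aa. pose proof (interval_pos l r Hl a Aa) as Ha.
      destruct (e0_zero a Ha (HE a Aa)) as [z [Hz [E [Hin Hout]]]].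
      assert (Hzero : forall s, e0 a s = 0 <-> (s = z \/ s = - z)).
      { intros s. split.
        - intros Es. destruct (Rtotal_order (Rabs s) z) as [L|[L|L]].
          + specialize (Hin s L). lra.
          + unfold Rabs in L. destruct Rcase_abs; lra.
          + specialize (Hout s L). lra.
        - intros [-> | ->]; [|rewrite (e0_even a Ha)]; exact E. }
      assert (Hchar : forall s, characteristic catenary a s <-> (s = z \/ s = - z)).
      { intros s. rewrite characteristic_iff by exact Ha. apply Hzero. }
      exists z. split; [|split; [|split; [|split]]].
      * split; [split; assumption|]. intros s [Hs Es]. apply Hzero in Es. lra.
      * apply domain_maximal; assumption.
      * exact Hchar.
      * intros p. apply touches_envelope_iff; [apply (interval_pos l r Hl)|exact Aa|exact Hchar].
      * intros p. apply catenoid_boundary; assumption.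
Qed.
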